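(* Let $\gamma(y)=1$ for $y\in\Omega\setminus D$ and $\gamma(y)=1+h(y)$ for $y\in D$, where $h\in L^\infty(D)$ is real valued, satisfies $\operatorname{ess\,inf}_{y\in D}(1+h(y))>0$, and satisfies the global jump condition: there is a positive constant $C$ such that either $h(y)\ge C$ for a.e. $y\in D$, or $-h(y)\ge C$ for a.e. $y\in D$. Then a point $x\in\Omega$ belongs to $\Omega\setminus\overline D$ if and only if there exist a needle $\sigma$ with tip at $x$ and a needle sequence $\xi=\{v_n\}$ for $(x,\sigma)$ (with $k=0$) such that the sequence $\{I(x,\sigma,\xi)_n\}$ given by $$I(x,\sigma,\xi)_n=\int_{\partial\Omega}\{(\Lambda_\gamma-\Lambda_1)f_n\}f_n\,dS,\qquad f_n(y)=v_n(y),\ y\in\partial\Omega,$$ is bounded. Moreover, given $x\in\Omega$ and a needle $\sigma$ with tip at $x$ we have: (i) if $x\in\Omega\setminus\overline D$ and $\sigma(]0,1])\cap\overline D=\emptyset$, then for any needle sequence $\xi=\{v_n\}$ for $(x,\sigma)$ the sequence $\{I(x,\sigma,\xi)_n\}$ is convergent; (ii) if $x\in\Omega\setminus\overline D$ and $\sigma(]0,1])\cap D\neq\emptyset$, then for any needle sequence $\xi=\{v_n\}$ for $(x,\sigma)$ we have $\lim_{n\to\infty}|I(x,\sigma,\xi)_n|=\infty$; (iii) if $x\in\overline D$, then for any needle sequence $\xi=\{v_n\}$ for $(x,\sigma)$ we have $\lim_{n\to\infty}|I(x,\sigma,\xi)_n|=\infty$.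
   Context: Setting. $m\in\{2,3\}$, $\Omega\subset\mathbb{R}^m$ is a bounded domain with Lipschitz boundary, $D$ is an open subset of $\Omega$ with Lipschitz boundary such that $\overline D\subset\Omega$ and $\Omega\setminus\overline D$ is connected. Functions here are real valued. Dirichlet-to-Neumann map. For $f\in H^{1/2}(\partial\Omega)$ let $u\in H^1(\Omega)$ be the weak solution of $\nabla\cdot\gamma\nabla u=0$ in $\Omega$, $u=f$ on $\partial\Omega$; $\Lambda_\gamma f=\gamma\frac{\partial u}{\partial\nu}|_{\partial\Omega}\in H^{-1/2}(\partial\Omega)$, where $\nu$ is the unit outward normal to $\partial\Omega$. $\Lambda_1$ is $\Lambda_\gamma$ for $\gamma\equiv1$. Integrals over $\partial\Omega$ involving these maps are understood as the $H^{-1/2}$–$H^{1/2}$ duality pairing. $G_0$ is the standard fundamental solution of the Laplace equation: $G_0(y)=\frac{1}{4\pi|y|}$ if $m=3$, $G_0(y)=\frac{1}{2\pi}\log\frac{1}{|y|}$ if $m=2$. Needle: given $x\in\Omega$, a needle with tip at $x$ is a (continuous) piecewise linear curve $\sigma:[0,1]\to\overline\Omega$ that is injective and satisfies $\sigma(0)\in\partial\Omega$, $\sigma(1)=x$ and $\sigma(t)\in\Omega$ for all $t\in\,]0,1[$. Needle sequence (case $k=0$): a sequence $\xi=\{v_n\}$ of (real valued) $H^1(\Omega)$ solutions of $\Delta v_n=0$ in $\Omega$ is a needle sequence for $(x,\sigma)$ if for each compact set $K\subset\mathbb{R}^m$ with $K\subset\Omega\setminus\sigma([0,1])$, $$\lim_{n\to\infty}\bigl(\|v_n(\cdot)-G_0(\cdot-x)\|_{L^2(K)}+\|\nabla\{v_n(\cdot)-G_0(\cdot-x)\}\|_{L^2(K)}\bigr)=0.$$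 It is a known fact that a needle sequence exists for every $x\in\Omega$ and every needle $\sigma$ with tip at $x$. *)

(* Defs.v *)
From HB Require Import structures.
From mathcomp Require Import all_boot all_order all_algebra.
From mathcomp Require Import all_classical all_reals all_analysis ess_sup_inf.

Set Implicit Arguments.
Unset Strict Implicit.
Unset Printing Implicit Defensive.
Import Order.TTheory GRing.Theory Num.Theory.
Import numFieldNormedType.Exports.
Local Open Scope classical_set_scope.
Local Open Scope ring_scope.

Fact rV_display : measure_display.
Proof. exact: default_measure_display. Qed.

Section measurable_rV.
Context {R : realType}.
Variable n : nat.

Let coords : 'I_n -> 'rV[R]_n -> R := fun i x => x ord0 i.

Let rV_set0 : g_sigma_preimage coords set0.
Proof. exact: sigma_algebra0. Qed.

Let rV_setC A : g_sigma_preimage coords A -> g_sigma_preimage coords (~` A).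
Proof. exact: sigma_algebraC. Qed.

Let rV_bigcup (F : _^nat) : (forall i, g_sigma_preimage coords (F i)) ->
  g_sigma_preimage coords (\bigcup_i (F i)).
Proof. exact: sigma_algebra_bigcup. Qed.

HB.instance Definition _ := @isMeasurable.Build
  rV_display 'rV[R]_n (g_sigma_preimage coords) rV_set0 rV_setC rV_bigcup.

End measurable_rV.

Section lebesgue_rV.
Context {R : realType}.

Lemma measurable_coord n (i : 'I_n) :
  measurable_fun [set: 'rV[R]_n] (fun x => x ord0 i).
Proof.
move=> _ Y mY; rewrite setTI; apply: sub_sigma_algebra => /=.
rewrite -bigcup_seq/=; exists i => /=; first by rewrite mem_index_enum.
by exists Y => //; rewrite setTI.
Qed.

Lemma measurable_fun_rV d (T : measurableType d) n (f : T -> 'rV[R]_n) :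
  (forall i, measurable_fun [set: T] (fun t => f t ord0 i)) ->
  measurable_fun [set: T] f.
Proof.
move=> mf.
have sub : g_sigma_preimage (fun i t => f t ord0 i) `<=` measurable.
  apply: smallest_sub; first exact: sigma_algebra_measurable.
  rewrite -bigcup_seq/=; apply: bigcup_sub => i _ A [B mB <-].
  exact: mf.
move=> _ A mA; apply: sub.
have -> : (fun i t => f t ord0 i) =
          (fun i => (fun x : 'rV[R]_n => x ord0 i) \o f) by [].
by rewrite g_sigma_preimage_comp; exists A.
Qed.

Definition cons_rV n (p : R * 'rV[R]_n) : 'rV[R]_n.+1 :=
  row_mx (\row_(_ < 1) p.1) p.2.

Definition uncons_rV n (x : 'rV[R]_n.+1) : R * 'rV[R]_n :=
  (x ord0 ord0, \row_i x ord0 (lift ord0 i)).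

Lemma cons_rV0 n (p : R * 'rV[R]_n) : cons_rV p ord0 ord0 = p.1.
Proof.
rewrite /cons_rV mxE; case: splitP => j /= ej; last by [].
by rewrite mxE.
Qed.

Lemma cons_rVS n (p : R * 'rV[R]_n) i :
  cons_rV p ord0 (lift ord0 i) = p.2 ord0 i.
Proof.
rewrite /cons_rV mxE; case: splitP => j /= ej.
  by have := ltn_ord j; rewrite -ej.
by congr (p.2 _ _); apply: val_inj; move: ej; rewrite /bump /= !add1n => -[].
Qed.

Lemma cons_rVK n : cancel (@cons_rV n) (@uncons_rV n).
Proof.
case=> a v; rewrite /uncons_rV cons_rV0; congr pair.
by apply/rowP => i; rewrite mxE cons_rVS.
Qed.

Lemma measurable_cons_rV n : measurable_fun [set: R * 'rV[R]_n] (@cons_rV n).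
Proof.
apply: measurable_fun_rV => i; have [j ->|->] := unliftP ord0 i.
  under eq_fun do rewrite cons_rVS.
  exact: (measurableT_comp (measurable_coord j) measurable_snd).
by under eq_fun do rewrite cons_rV0; exact: measurable_fst.
Qed.

Lemma measurable_uncons_rV n : measurable_fun [set: 'rV[R]_n.+1] (@uncons_rV n).
Proof.
apply/measurable_fun_pairP; split; first exact: measurable_coord.
apply: measurable_fun_rV => i; under eq_fun do rewrite /= mxE.
exact: measurable_coord.
Qed.

Section lebesgue_cons.
Variables (n : nat) (mu : {sigma_finite_measure set 'rV[R]_n -> \bar R}).
Local Open Scope ereal_scope.

Definition lebesgue_cons : set 'rV[R]_n.+1 -> \bar R :=
  pushforward (lebesgue_measure \x mu) (@cons_rV n).

Let mcons A : measurable A -> measurable (@cons_rV n @^-1` A).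
Proof.
by move=> mA; rewrite -[X in measurable X]setTI; exact: measurable_cons_rV.
Qed.

Let lebesgue_cons0 : lebesgue_cons set0 = 0.
Proof. by rewrite /lebesgue_cons /pushforward preimage_set0 measure0. Qed.

Let lebesgue_cons_ge0 A : 0 <= lebesgue_cons A.
Proof. by rewrite /lebesgue_cons /pushforward; exact: measure_ge0. Qed.

Let lebesgue_cons_sigma_additive : semi_sigma_additive lebesgue_cons.
Proof.
move=> F mF tF mUF; rewrite /lebesgue_cons /pushforward preimage_bigcup.
apply: measure_semi_sigma_additive.
- by move=> k; exact: mcons.
- apply/trivIsetP => /= i j _ _ ij; rewrite -preimage_setI.
  by move/trivIsetP : tF => /(_ _ _ _ _ ij) ->//; rewrite preimage_set0.
- by rewrite -preimage_bigcup; exact: mcons.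
Qed.

HB.instance Definition _ := isMeasure.Build _ _ _ lebesgue_cons
  lebesgue_cons0 lebesgue_cons_ge0 lebesgue_cons_sigma_additive.

Let lebesgue_cons_sigma_finite : sigma_finite setT lebesgue_cons.
Proof.
have /sigma_finiteP[F [FT ndF Foo]] := sigma_finiteT (@lebesgue_measure R).
have /sigma_finiteP[G [GT ndG Goo]] := sigma_finiteT mu.
exists (fun k => @uncons_rV n @^-1` (F k `*` G k)).
  rewrite -preimage_bigcup (_ : \bigcup_k _ = setT) ?preimage_setT//.
  apply/seteqP; split => // -[a v] _.
  have [i _ Fa] : (\bigcup_k F k) a by rewrite -FT.
  have [j _ Gv] : (\bigcup_k G k) v by rewrite -GT.
  exists (maxn i j) => //; split => /=.
    by move: a Fa; exact/subsetPset/ndF/leq_maxl.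
  by move: v Gv; exact/subsetPset/ndG/leq_maxr.
move=> k; have [mF Fk] := Foo k; have [mG Gk] := Goo k.
have mFG := measurableX mF mG.
split; first by rewrite -[X in measurable X]setTI; exact: measurable_uncons_rV.
rewrite /lebesgue_cons /pushforward (_ : _ @^-1` _ = F k `*` G k).
  by rewrite product_measure1E// lte_mul_pinfty// ge0_fin_numE.
by apply/seteqP; split => p; rewrite /preimage /mkset cons_rVK.
Qed.

HB.instance Definition _ := Measure_isSigmaFinite.Build _ _ _ lebesgue_cons
  lebesgue_cons_sigma_finite.

End lebesgue_cons.

(* R^0 is a point of mass 1, and R^n.+1 = R x R^n carries the product measure. *)
Fixpoint lebesgue_rV n : {sigma_finite_measure set 'rV[R]_n -> \bar R} :=
  match n with
  | 0 => \d_(0 : 'rV[R]_0)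
  | n'.+1 => lebesgue_cons (lebesgue_rV n')
  end.

End lebesgue_rV.

Notation leb := (lebesgue_rV _).

(* The library norm `|x| on 'rV_m is the sup norm.  It defines the same open, *)
(* closed, bounded and compact sets and the same Lipschitz functions as the   *)
(* Euclidean norm [enorm], which is used wherever the value matters.          *)

Section calculus.
Context {R : realType} {m : nat}.
Implicit Types (U : set 'rV[R]_m) (f : 'rV[R]_m -> R) (x y : 'rV[R]_m).

Definition dot x y : R := \sum_(i < m) x ord0 i * y ord0 i.

Definition enorm x : R := Num.sqrt (dot x x).

Definition partial f (i : 'I_m) x : R := 'D_(delta_mx ord0 i) f x.

Definition grad f x : 'rV[R]_m := \row_i partial f i x.

Fixpoint Ck (k : nat) f : Prop :=
  continuous f /\
  match k with
  | 0 => True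
  | k'.+1 => forall i, (forall x, derivable f x (delta_mx ord0 i)) /\
                       Ck k' (partial f i)
  end.

(* C_c^oo(U), as functions on R^m that vanish outside U *)
Definition test_function U f : Prop :=
  [/\ forall k, Ck k f, compact (closure [set x | f x != 0])
    & closure [set x | f x != 0] `<=` U].

Definition bdry U : set 'rV[R]_m := closure U `\` interior U.

(* Near each boundary point, U is the part of a ball lying above the graph of *)
(* a Lipschitz function over the hyperplane orthogonal to a unit vector e;    *)
(* the values of phi off that hyperplane are irrelevant.                      *)
Definition Lipschitz_boundary U : Prop :=
  forall p, bdry U p -> exists (r : R) (e : 'rV[R]_m) (phi : 'rV[R]_m -> R),
    [/\ 0 < r, dot e e = 1, exists k, k.-lipschitz phi
      & forall x, enorm (x - p) < r ->
          (U x <-> phi (x - dot x e *: e) < dot x e)].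

(* The fundamental solution of the Laplace equation; only m = 2, 3 are used. *)
Definition G0 y : R :=
  if m == 2%N then (2 * pi)^-1 * ln (enorm y)^-1
  else (4 * pi * enorm y)^-1.

End calculus.

Section sobolev.
Context {R : realType} {m : nat}.
Implicit Types (U D K : set 'rV[R]_m) (u v w phi gamma : 'rV[R]_m -> R).
Implicit Type F : 'rV[R]_m -> 'rV[R]_m.

(* u \in L^p(U); the values of u outside U are irrelevant *)
Definition memL (p : \bar R) U u : Prop := u \_ U \in Lfun leb p.

Definition L2norm U u : \bar R := ('N[leb]_2%:E[EFin \o (u \_ U)])%E.

Definition weak_gradient U u F : Prop :=
  (forall i, memL 2%:E U (fun x => F x ord0 i)) /\
  forall phi, test_function U phi -> forall i,
    \int[leb]_(x in U) (u x * partial phi i x) =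
    - \int[leb]_(x in U) (F x ord0 i * phi x).

Definition H1 U u : Prop := memL 2%:E U u /\ exists F, weak_gradient U u F.

(* The weak gradient of u \in H^1(U), determined a.e. on U. *)
Definition nabla U u : 'rV[R]_m -> 'rV[R]_m :=
  xget (fun=> 0) [set F | weak_gradient U u F].

(* ||u||_{L^2(K)} + || |F| ||_{L^2(K)}, where F is meant to be the gradient of u *)
Definition H1norm K u F : \bar R := (L2norm K u + L2norm K (enorm \o F))%E.

(* H^1_0(U): the closure of C_c^oo(U) in H^1(U) *)
Definition H10 U w : Prop :=
  H1 U w /\ exists phi : ('rV[R]_m -> R)^nat,
    (forall k, test_function U (phi k)) /\
    H1norm U (w \- phi k) (nabla U (w \- phi k)) @[k --> \oo] --> 0%E.

(* For a bounded Lipschitz domain U the trace operator H^1(U) -> H^{1/2}(bU)  *)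
(* is onto with kernel H^1_0(U).  H^{1/2}(bU) is taken to be the quotient     *)
(* H^1(U) / H^1_0(U), whose elements are the classes [trace U u].             *)
Definition trace U u : set ('rV[R]_m -> R) :=
  [set w | H1 U w /\ H10 U (w \- u)].

(* u \in H^1(U) and div (gamma grad u) = 0 in U, in the weak sense *)
Definition weak_solution U gamma u : Prop :=
  H1 U u /\ forall phi, test_function U phi ->
    \int[leb]_(x in U) (gamma x * dot (nabla U u x) (grad phi x)) = 0.

Definition Dirichlet_solution U gamma (f : set ('rV[R]_m -> R)) :
    'rV[R]_m -> R :=
  xget (fun=> 0) [set u | weak_solution U gamma u /\ trace U u = f].

(* For f \in H^{1/2}(bU), Lambda U gamma f \in H^{-1/2}(bU) is the weak       *)
(* conormal derivative gamma du/dnu of the Dirichlet solution u: its value at *)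
(* g is the integral of gamma (grad u . grad w), w being any element of       *)
(* H^1(U) with trace g.                                                       *)
Definition Lambda U gamma (f g : set ('rV[R]_m -> R)) : R :=
  let u := Dirichlet_solution U gamma f in
  let w := xget (fun=> 0) [set w | H1 U w /\ trace U w = g] in
  \int[leb]_(x in U) (gamma x * dot (nabla U u x) (nabla U w x)).

Definition conductivity D (h : 'rV[R]_m -> R) : 'rV[R]_m -> R :=
  patch (fun=> 1) D (fun y => 1 + h y).

(* ess inf of u over D: the value +oo outside D does not affect it *)
Definition ess_inf_on D u : \bar R :=
  ess_inf leb (patch (fun=> +oo%E) D (EFin \o u)).

(* the H^{-1/2}-H^{1/2} pairing of (Lambda_gamma - Lambda_1) f_n with f_n,    *)
(* where f_n is the trace of v_n                                              *)
Definition indicator U gamma (v : ('rV[R]_m -> R)^nat) : R^nat :=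
  fun n => Lambda U gamma (trace U (v n)) (trace U (v n))
         - Lambda U (fun=> 1) (trace U (v n)) (trace U (v n)).

End sobolev.

Section needles.
Context {R : realType} {m : nat}.
Implicit Types (Omega K : set 'rV[R]_m) (x : 'rV[R]_m) (sigma : R -> 'rV[R]_m).

(* sigma is affine on each interval of a subdivision 0 < s_1 < ... < s_k = 1 *)
Definition piecewise_linear sigma : Prop :=
  exists s : seq R, [/\ path <%R 0 s, last 0 s = 1
    & forall i, (i < size s)%N -> exists a b : 'rV[R]_m,
        {in `[nth 0 (0 :: s) i, nth 0 (0 :: s) i.+1],
          forall t, sigma t = a + t *: b}].

Definition needle Omega x sigma : Prop :=
  [/\ {within `[0, 1], continuous sigma} /\ piecewise_linear sigma,
      {in `[0, 1], forall t, closure Omega (sigma t)},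
      {in `[0, 1] &, injective sigma},
      bdry Omega (sigma 0) /\ sigma 1 = x
    & {in `]0, 1[, forall t, Omega (sigma t)}].

Definition needle_sequence Omega x sigma (v : ('rV[R]_m -> R)^nat) : Prop :=
  (forall n, weak_solution Omega (fun=> 1) (v n)) /\
  forall K, compact K -> K `<=` Omega `\` sigma @` `[0, 1] ->
    H1norm K (fun y => v n y - G0 (y - x))
             (fun y => nabla Omega (v n) y - grad G0 (y - x))
      @[n --> \oo] --> 0%E.

End needles.

(* Main.v *)
(* Let v be harmonic, u the solution of div (gamma grad u) = 0 with the same
   boundary values and r = u - v, an element of H^1_0.  Then
     <(Lambda_gamma - Lambda_1) f, f> = int_D h |grad v|^2 - int gamma |grad r|^2,
   and the jump condition bounds this from below, in absolute value, by a multiple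
   of int_D |grad v|^2; it is moreover continuous in grad v on L^2(D).  So only
   the energies int_D |grad v_n|^2 matter.

   In (i) they converge because closure D misses the needle.  In (iii) a cone with
   vertex x lies in D and, after shrinking, misses the needle; it contains
   infinitely many disjoint similar balls shrinking to x, and on each of them the
   energy of G_0(. - x) is bounded below since m >= 2.  In (ii) take a cutoff eta
   equal to 1 near a final piece of the needle, such that grad eta meets the needle
   only inside D.  The integral of grad eta . grad v_n vanishes, while that of
   grad eta . grad G_0(. - x) is a nonzero flux; hence the missing flux is carried
   by arbitrarily thin neighbourhoods of the needle inside D, and Cauchy-Schwarz
   forces the energy there to infinity.

   For the converse in the equivalence a needle inside the connected open set
   Omega \ closure D is needed; a polygonal path is made injective by leaving it
   at its first meeting point with each new segment.  A needle sequence for a given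
   needle is built from point sources outside closure Omega by moving the pole
   along the needle in small steps, each step being a Newton extrapolation of the
   analytic function t |-> G_0(y - c - t e). *)
Require Import Defs.
From HB Require Import structures.
From mathcomp Require Import all_boot all_order all_algebra.
From mathcomp Require Import all_classical all_reals all_analysis measurable_realfun ess_sup_inf.
From mathcomp Require Import ring lra.

Set Implicit Arguments.
Unset Strict Implicit.
Unset Printing Implicit Defensive.
Import Order.TTheory GRing.Theory Num.Theory.
Import numFieldNormedType.Exports.
Local Open Scope classical_set_scope.
Local Open Scope ring_scope.

(** * Lebesgue measure on R^n *)

(** Energy estimates are kept free of square roots: Cauchy-Schwarz is used as
    [2 |Q(F, G)| <= s Q(F) + Q(G) / s] with a free [s > 0], and limits are taken after [s] has been
    fixed. The weight gamma - 1 has no sign, so a pairing with it is estimated by writing it as a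
    difference of two nonnegative weights. Gradients, solutions and representatives of traces are
    choices; computations with them rest on facts that do not depend on the choice, namely equality
    almost everywhere and orthogonality to H^1_0. In (i) the limit is not identified: the indicator
    is shown to be Cauchy. The Lipschitz hypotheses enter through cones only: the inner cone of D in
    (iii), the outer cone of Omega for the first poles, the inner cone of Omega for the first piece
    of a needle. A pole is moved by at most one eighth of its distance to the compact set. The
    Taylor coefficients then decay like 2^-n, and the extrapolation error depends on the order only,
    so the nodes may be taken as close to the old pole as desired. *)

Section lebesgue_rV_theory.
Context {R : realType}.

Lemma rV_ballP n (c x : 'rV[R]_n) r :
  ball c r x <-> 0 < r /\ forall i, `|c ord0 i - x ord0 i| < r.
Proof.
split.
  by move=> [r0 H]; split=> // i; exact: (H ord0 i).
by move=> [r0 H]; split=> // i j; rewrite ord1; exact: H.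
Qed.

Lemma measurable_rV_ball n (c : 'rV[R]_n) r : measurable (ball c r).
Proof.
have [r0|r0] := ltP 0 r; last first.
  rewrite (_ : ball c r = set0)//; apply/seteqP; split=> // x.
  by case/rV_ballP => /lt_le_trans/(_ r0); rewrite ltxx.
rewrite (_ : ball c r = \bigcap_(i in [set: 'I_n])
    ((fun x : 'rV[R]_n => x ord0 i) @^-1` ball (c ord0 i) r)).
  apply: fin_bigcap_measurable => // i _.
  rewrite -[X in measurable X]setTI; apply: measurable_coord => //.
  by rewrite ball_itv; exact: measurable_itv.
apply/seteqP; split=> x; first by case/rV_ballP => _ H i _; exact: H.
by move=> H; apply/rV_ballP; split=> // i; exact: H.
Qed.

(** The sigma-algebra is generated by the coordinates, so an open set is written as the union of the
    balls it contains among those with rational centre and radius 1/(k+1), a countable family. *)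
Lemma open_measurable_rV n (A : set 'rV[R]_n) : open A -> measurable A.
Proof.
move=> oA.
pose F (p : 'rV[rat]_n * nat) : set 'rV[R]_n :=
  if `[< ball (\row_i ratr (p.1 ord0 i) : 'rV[R]_n) p.2.+1%:R^-1 `<=` A >]
  then ball (\row_i ratr (p.1 ord0 i) : 'rV[R]_n) p.2.+1%:R^-1 else set0.
have -> : A = \bigcup_p F p; last first.
  apply: countable_bigcupT_measurable => [|p]; last first.
    by rewrite /F; case: ifP => // _; exact: measurable_rV_ball.
  exact: countableP.
apply/seteqP; split => [x Ax|x [p _]]; last first.
  by rewrite /F; case: ifPn => // /asboolP; exact.
have /nbhs_ballP[e/= e0 eA] := open_nbhs_nbhs (conj oA Ax).
(* A rational centre within [d] of [x] gives a ball that contains [x] and, because 2d < e, stays in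
   [ball x e]. *)
pose k := Num.truncn (2 / e); pose d : R := k.+1%:R^-1.
have d0 : 0 < d by rewrite invr_gt0.
have de : d < e / 2.
  rewrite -[e / 2]invrK ltf_pV2 ?posrE ?invr_gt0 ?divr_gt0//.
  by rewrite invf_div /k; exact: truncnS_gt.
have /choice[q Hq] : forall i, exists q : rat, `|ratr q - x ord0 i| < d.
  move=> i; have /(@rat_in_itvoo R)[q] : x ord0 i < x ord0 i + d by rewrite ltrDl.
  rewrite in_itv/= => /andP[q1 q2]; exists q.
  by rewrite ltr_norml; apply/andP; split; lra.
exists (\row_i q i, k) => //=; rewrite /F /=; case: asboolP => [_|].
  by apply/rV_ballP; split => // i; rewrite !mxE.
case=> y /rV_ballP[_ xy]; apply: eA; apply/rV_ballP; split => // i.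
have := xy i; have := Hq i; rewrite !mxE -/d.
rewrite !ltr_norml => /andP[a b] /andP[a' b']; apply/andP; split; lra.
Qed.

Lemma closed_measurable_rV n (A : set 'rV[R]_n) : closed A -> measurable A.
Proof.
move=> cA; rewrite -(setCK A); apply: measurableC; apply: open_measurable_rV.
exact: closed_openC.
Qed.

Lemma compact_measurable_rV n (A : set 'rV[R]_n) : compact A -> measurable A.
Proof.
move=> cA; apply: closed_measurable_rV; apply: compact_closed => //.
Qed.

Lemma continuous_measurable_rV n (U : set 'rV[R]_n) (f : 'rV[R]_n -> R) :
  measurable U -> continuous f -> measurable_fun U f.
Proof.
move=> mU cf; apply: measurable_funTS.
apply: (measurability _ (RGenOpens.measurableE R)) => _ [B [a [b ->]] <-].
rewrite setTI; apply: open_measurable_rV.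
by move/continuousP : cf; apply; exact: interval_open.
Qed.

Definition rect n (B : 'I_n -> set R) : set 'rV[R]_n :=
  [set x | forall i, B i (x ord0 i)].

Lemma measurable_rect n (B : 'I_n -> set R) :
  (forall i, measurable (B i)) -> measurable (rect B).
Proof.
move=> mB; rewrite (_ : rect B = \bigcap_(i in [set: 'I_n])
    ((fun x : 'rV[R]_n => x ord0 i) @^-1` B i)).
  apply: fin_bigcap_measurable => // i _.
  by rewrite -[X in measurable X]setTI; apply: measurable_coord.
by apply/seteqP; split=> x H => [i _|i]; exact: H.
Qed.

Lemma leb_rect n (B : 'I_n -> set R) : (forall i, measurable (B i)) ->
  leb (rect B) = (\prod_(i < n) lebesgue_measure (B i))%E.
Proof.
elim: n B => [B _|n ih B mB].
  by rewrite big_ord0 /= /dirac/= indicE mem_set// => -[].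
rewrite big_ord_recl/= /lebesgue_cons /pushforward.
rewrite -ih; last by move=> i; exact: mB.
rewrite (_ : _ @^-1` _ = B ord0 `*` rect (fun i => B (lift ord0 i))).
  rewrite product_measure1E; [by []|exact: mB|by apply: measurable_rect => i; exact: mB].
apply/seteqP; split=> -[a v] /=.
  move=> H; split => [|i]; first by have := H ord0; rewrite cons_rV0.
  by have := H (lift ord0 i); rewrite cons_rVS.
by move=> [Ba Bv] i; have [j ->|->] := unliftP ord0 i;
  rewrite ?cons_rV0 ?cons_rVS//; exact: Bv.
Qed.

Lemma leb_cube n (c : 'I_n -> R) (r : R) : 0 <= r ->
  leb (rect (fun i => `[c i - r, c i + r]%classic)) = ((r *+ 2) ^+ n)%:E.
Proof.
move=> r0; rewrite leb_rect//.
rewrite (eq_bigr (fun=> (r *+ 2)%:E)) => [|i _].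
  rewrite big_const_ord; elim: n {c} => [//|n ih].
  by rewrite iterS ih exprS EFinM.
rewrite lebesgue_measure_itv/= lte_fin; case: ltP => [_|].
  by rewrite -EFinB; congr EFin; ring.
by move=> ?; congr EFin; lra.
Qed.

Definition rects n := [set A : set 'rV[R]_n |
  exists2 B : 'I_n -> set R, (forall i, measurable (B i)) & A = rect B].

Lemma rects_setI n : setI_closed (@rects n).
Proof.
move=> _ _ [B mB ->] [C mC ->]; exists (fun i => B i `&` C i).
  by move=> i; exact: measurableI.
by apply/seteqP; split=> x => [[H1 H2] i|H]; [|split=> i; have [] := H i].
Qed.

Lemma measurable_rects n : measurable = <<s @rects n >>.
Proof.
apply/seteqP; split; last first.
  apply: smallest_sub; first exact: sigma_algebra_measurable.
  by move=> _ [B mB ->]; exact: measurable_rect.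
apply: smallest_sub; first exact: smallest_sigma_algebra.
rewrite -bigcup_seq/=; apply: bigcup_sub => i _ A [B mB <-].
apply: sub_sigma_algebra; exists (fun j => if j == i then B else setT).
  by move=> j; case: ifP.
apply/seteqP; split=> x /=.
  by move=> [_ Bx] j; case: eqP => // ->.
by move=> /(_ i); rewrite eqxx => H; split.
Qed.

(** Rectangles form a pi-system that generates the measurable sets and contains the cubes [-k, k]^n,
    which have finite measure and exhaust the space. It is applied to the image of the measure under
    a translation. *)
Lemma leb_unique n (m' : {measure set 'rV[R]_n -> \bar R}) :
  (forall B, (forall i, measurable (B i)) ->
     m' (rect B) = (\prod_(i < n) lebesgue_measure (B i))%E) ->
  forall A, measurable A -> leb A = m' A.
Proof.
move=> mB A; apply: (measure_unique (@rects n)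
  (fun k => rect (fun=> `[0 - k%:R, 0 + k%:R]%classic))).
- exact: measurable_rects.
- exact: rects_setI.
- by move=> k; exists (fun=> `[0 - k%:R, 0 + k%:R]%classic).
- apply/seteqP; split=> // x _.
  exists (Num.truncn `|x|).+1 => //= i /=.
  have : `|x ord0 i| < (Num.truncn `|x|).+1%:R.
    apply: le_lt_trans (truncnS_gt _); rewrite [leRHS]/Num.norm/= mx_normrE.
    by apply/bigmax_geP; right => /=; exists (ord0, i).
  by rewrite in_itv/= sub0r add0r => /ltW; rewrite ler_norml.
- by move=> _ [B mB' ->]; rewrite [RHS](mB _ mB'); exact: leb_rect.
- move=> k; exact: (eq_ind_r (fun z => z < +oo)%E (ltry _)
    (leb_cube (fun=> 0) (ler0n R k))).
Qed.

Let shift1 (a t : R) : R := t + a.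

Let measurable_shift1 a : measurable_fun setT (shift1 a).
Proof. exact: measurable_funD. Qed.

HB.instance Definition _ a := isMeasurableFun.Build _ _ _ _
  (shift1 a) (@measurable_shift1 a).

Let lebesgue_measure_shift1 (a : R) (B : set R) : measurable B ->
  lebesgue_measure (shift1 a @^-1` B) = lebesgue_measure B.
Proof.
move=> mB; symmetry.
apply: (@lebesgue_measure_unique R (pushforward lebesgue_measure
  (shift1 a : _ -> measurableTypeR R))) => //.
  exact: measurable_shift1.
move=> mf _ [[b c]] _ <- /=.
change (lebesgue_measure `]b, c]%classic =
  lebesgue_measure (shift1 a @^-1` `]b, c]%classic)).
rewrite (_ : _ @^-1` _ = `]b - a, c - a]%classic).
  rewrite !lebesgue_measure_itv/= !lte_fin ltrD2r -!EFinB.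
  by case: ifP => // _; congr EFin; ring.
by apply/seteqP; split=> x /=; rewrite !in_itv/= ltrBlDr lerBrDr.
Qed.

Definition translation n (a x : 'rV[R]_n) := x + a.

Lemma measurable_translation n (a : 'rV[R]_n) :
  measurable_fun setT (translation a).
Proof.
apply: measurable_fun_rV => i; under eq_fun do rewrite mxE.
by apply: measurable_funD => //; exact: measurable_coord.
Qed.

HB.instance Definition _ n (a : 'rV[R]_n) := isMeasurableFun.Build _ _ _ _
  (translation a) (@measurable_translation n a).

Lemma leb_translation n (a : 'rV[R]_n) (A : set 'rV[R]_n) : measurable A ->
  leb (translation a @^-1` A) = leb A.
Proof.
move=> mA; symmetry.
apply: (leb_unique (m' := pushforward leb (translation a))) => //.
move=> B mB.
change (leb (translation a @^-1` rect B) =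
  (\prod_(i < n) lebesgue_measure (B i))%E).
rewrite (_ : _ @^-1` _ = rect (fun i => shift1 (a ord0 i) @^-1` B i)).
  rewrite (leb_rect (B := fun i => shift1 (a ord0 i) @^-1` B i)).
    by apply: eq_bigr => i _; rewrite lebesgue_measure_shift1.
  by move=> i; exact: measurable_funPTI.
by apply/seteqP; split=> x H i; have := H i; rewrite /= mxE.
Qed.

Lemma integral_translation n (a : 'rV[R]_n) (f : 'rV[R]_n -> \bar R) :
  measurable_fun setT f ->
  leb.-integrable setT (fun x => f (x + a)) ->
  (\int[leb]_x f (x + a)%R = \int[leb]_x f x)%E.
Proof.
move=> mf intf.
have E : (\int[pushforward leb (translation a)]_x f x = \int[leb]_x f x)%E.
  by apply: eq_measure_integral => A mA _; exact: leb_translation.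
by rewrite -E integral_pushforward ?preimage_setT//; exact: measurable_translation.
Qed.

Lemma leb_bounded n (A : set 'rV[R]_n) : measurable A -> bounded_set A ->
  (leb A < +oo)%E.
Proof.
move=> mA [M [Mr HM]]; pose r := `|M| + 1.
have H (x : 'rV[R]_n) : A x -> rect (fun i : 'I_n => `[0 - r, 0 + r]%classic) x.
  move=> Ax i /=; rewrite in_itv/= sub0r add0r -ler_norml.
  have Mr' : M < r by rewrite (le_lt_trans (ler_norm M)) ?ltrDl.
  apply: le_trans (HM r Mr' x Ax); rewrite [leRHS]/Num.norm/= mx_normrE.
  by apply/bigmax_geP; right => /=; exists (ord0, i).
have r0 : 0 <= r by rewrite addr_ge0.
apply: (@le_lt_trans _ _ (leb (rect (fun i : 'I_n => `[0 - r, 0 + r]%classic)))).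
  by apply: le_measure; rewrite ?inE//; exact: measurable_rect.
by rewrite (leb_cube (fun=> 0) r0) ltry.
Qed.


(* Infinitely many disjoint translates of A fit in a bounded set. *)
Lemma leb_disjoint_translates n (A : set 'rV[R]_n) (e : 'rV[R]_n) :
  measurable A -> bounded_set A ->
  (forall x y t, A x -> A y -> x = y + t *: e -> t = 0) -> leb A = 0%E.
Proof.
move=> mA bA dis; pose F k := translation (k.+1%:R^-1 *: e) @^-1` A.
have mF k : measurable (F k) by exact: measurable_funPTI.
have tF : trivIset setT F.
  apply/trivIsetP => i j _ _ ij; apply/seteqP; split=> // x [/= Fi Fj].
  have := dis _ _ (i.+1%:R^-1 - j.+1%:R^-1) Fi Fj; rewrite /translation.
  rewrite scalerBl addrA addrAC addrK addrC => /(_ erefl)/subr0_eq/invr_inj/eqP.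
  by rewrite eqr_nat eqSS (negbTE ij).
have [M [Mr HM]] := bA.
have bF : bounded_set (\bigcup_k F k).
  exists (`|M| + 1 + `|e|); split; first by rewrite num_real.
  move=> r Mr' x [k _ /= Fx].
  rewrite -[x](addrK (k.+1%:R^-1 *: e)).
  apply: le_trans (ler_normB _ _) _; apply/ltW/(le_lt_trans _ Mr'); rewrite lerD//.
    apply: HM Fx; by rewrite (le_lt_trans (ler_norm M)) ?ltrDl.
  rewrite normrZ normrV ?unitfE// normr_nat ler_piMl// invf_le1//.
  by rewrite ler1n.
have := leb_bounded (bigcupT_measurable F mF) bF.
rewrite measure_bigcup//.
rewrite (eq_eseriesr (g := fun=> leb A)) => [|k _]; last first.
  by rewrite -(@leb_translation _ (k.+1%:R^-1 *: e)).
set L := (X in (X < _)%E) => Loo.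
have lfin : leb A \is a fin_num by rewrite ge0_fin_numE ?leb_bounded.
have LN N : (N%:R * fine (leb A) <= fine L)%R.
  have NL : (\sum_(0 <= i < N | i \in [set: nat]) leb A <= L)%E.
    exact: (nneseries_lim_ge (u_ := fun=> leb A)).
  have L0 : (0 <= L)%E by apply: nneseries_ge0.
  rewrite -lee_fin fineK ?ge0_fin_numE//; apply: le_trans NL.
  rewrite (eq_bigl xpredT) => [|i]; last by rewrite in_setT.
  rewrite big_mkord big_const_ord -[X in iter _ (fun y => X + y)%E](fineK lfin).
  elim: N => [|N ih]; first by rewrite mul0r.
  by rewrite iterS -natr1 addrC mulrDl mul1r EFinD leeD2l.
apply/eqP; rewrite eq_le measure_ge0 andbT leNgt; apply/negP => A0.
have c0 : 0 < fine (leb A) by rewrite fine_gt0// A0 -ge0_fin_numE.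
have := LN (Num.truncn (fine L / fine (leb A))).+1.
by rewrite leNgt -ltr_pdivrMr// truncnS_gt.
Qed.

Lemma compact_segment n (a b : 'rV[R]_n) :
  compact [set a + t *: b | t in `[0, 1]%classic].
Proof.
apply: continuous_compact; last exact: segment_compact.
apply: continuous_subspaceT => t.
apply: cvgD; first exact: cvg_cst.
by apply: cvgZr_tmp; exact: cvg_id.
Qed.

(** In dimension at least 2 there is an axis [i] other than an axis [j] with b_j != 0. Equality of
    the [j]-th coordinates of two points of the segment forces equal parameters, so the translates
    along axis [i] are disjoint. *)
Lemma leb_segment n (a b : 'rV[R]_n.+2) : b != 0 ->
  leb [set a + t *: b | t in `[0, 1]%classic] = 0%E.
Proof.
move=> b0; have [j bj] : exists j, b ord0 j != 0.
  by apply/existsP; apply: contraNT b0 => /existsPn H; apply/eqP/rowP => j;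
    rewrite mxE; apply/eqP; have := H j; rewrite negbK.
have [i ij] : exists i : 'I_n.+2, i != j.
  by exists (if j == ord0 then ord_max else ord0); case: ifPn => [/eqP->|];
    rewrite // eq_sym.
apply: (@leb_disjoint_translates _ _ (delta_mx ord0 i)).
- by apply: compact_measurable_rV; exact: compact_segment.
- by apply: compact_bounded; exact: compact_segment.
move=> _ _ t [u _ <-] [v _ <-] H.
have /eqP := congr1 (fun x : 'rV_n.+2 => x ord0 j) H.
rewrite !mxE eqxx [j == i]eq_sym (negbTE ij) mulr0 addr0 => /eqP/addrI/(mulIf bj) uv.
have /eqP := congr1 (fun x : 'rV_n.+2 => x ord0 i) H.
by rewrite uv !mxE !eqxx mulr1 -subr_eq0 opprD addrA subrr sub0r oppr_eq0 => /eqP.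
Qed.

End lebesgue_rV_theory.

(** * Smooth functions and cutoffs *)

Section smooth_theory.
Context {R : realType}.

Section directional.
Context {V : normedModType R}.
Implicit Types (x v : V) (f g : V -> R).

(** Turns a directional derivative into the derivative at 0 of a function of one real variable,
    where the chain rule and the mean value theorem apply. *)
Lemma is_derive_line f x v (df : R) :
  is_derive x v f df <-> is_derive (0 : R) 1 (fun t : R => f (x + t *: v)) df.
Proof.
have E : (fun h : R => h^-1 *: (f (h *: v + x) - f x)) =
  (fun h : R => h^-1 *: (f (x + (h *: (1 : R) + 0) *: v) - f (x + (0 : R) *: v))).
  by apply/funext => h; rewrite scale0r addr0 addr0 [x + _]addrC [h *: 1]mulr1.
have D : derivable f x v = derivable (fun t : R => f (x + t *: v)) 0 1.
  by rewrite /derivable /= E.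
have D' : 'D_v f x = 'D_1 (fun t : R => f (x + t *: v)) 0 by rewrite /derive E.
split=> -[H1 H2]; split.
- by rewrite -D.
- by rewrite -D'.
- by rewrite D.
- by rewrite D'.
Qed.

Lemma is_derive_comp1 (phi : R -> R) f x v (df dphi : R) :
  is_derive x v f df -> is_derive (f x) 1 phi dphi ->
  is_derive x v (fun y => phi (f y)) (dphi * df).
Proof.
move=> /is_derive_line Hf Hphi; apply/is_derive_line.
apply: (@is_derive1_comp _ phi (fun t : R => f (x + t *: v))).
by rewrite scale0r addr0.
Qed.

Lemma is_derive_add f g x v (df dg : R) : is_derive x v f df ->
  is_derive x v g dg -> is_derive x v (fun y => f y + g y) (df + dg).
Proof. exact: is_deriveD. Qed.

Lemma is_derive_mul f g x v (df dg : R) : is_derive x v f df ->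
  is_derive x v g dg -> is_derive x v (fun y => f y * g y) (df * g x + f x * dg).
Proof.
move=> Hf Hg; have := is_deriveM Hf Hg; rewrite addrC [g x *: df]mulrC; exact.
Qed.

Lemma is_derive_inv f x v (df : R) : f x != 0 -> is_derive x v f df ->
  is_derive x v (fun y => (f y)^-1) (- df * (f x)^-1 * (f x)^-1).
Proof.
move=> fx [Hf <-]; split; first exact: derivableV.
rewrite deriveV// scaleNr [LHS]/= !mulNr; congr (- _).
by rewrite -mulrA -invfM -expr2 mulrC.
Qed.

End directional.

Section Ck.
Context {m : nat}.
Implicit Types (x y c : 'rV[R]_m) (f g : 'rV[R]_m -> R).

Lemma partialE f i x (df : R) :
  is_derive x (delta_mx ord0 i) f df -> partial f i x = df.
Proof. by case. Qed.

Lemma Ck_continuous k f : Ck k f -> continuous f.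
Proof. by case: k => [|k] []. Qed.

Lemma Ck_derivable k f i x : Ck k.+1 f -> derivable f x (delta_mx ord0 i).
Proof. by move=> [_ /(_ i)[]]. Qed.

Lemma Ck_partial k f i : Ck k.+1 f -> Ck k (partial f i).
Proof. by move=> [_ /(_ i)[]]. Qed.

Lemma Ck_is_derive k f i x : Ck k.+1 f ->
  is_derive x (delta_mx ord0 i) f (partial f i x).
Proof. by move=> cf; split => //; exact: Ck_derivable cf. Qed.

Lemma CkS k f : Ck k.+1 f -> Ck k f.
Proof.
elim: k f => [|k ih] f [cf Hf]; split => // i; have [df Hi] := Hf i.
by split => //; exact: ih.
Qed.

(** Works from explicit formulas for the partial derivatives, which makes the closure properties
    below inductions on [k]. *)
Lemma Ck_intro k f (g : 'I_m -> 'rV[R]_m -> R) : continuous f ->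
  (forall i x, is_derive x (delta_mx ord0 i) f (g i x)) ->
  (forall i, Ck k (g i)) -> Ck k.+1 f.
Proof.
move=> cf fg Hg; split => // i; split; first by move=> x; case: (fg i x).
by rewrite (_ : partial f i = g i)//; apply/funext => x; exact: partialE.
Qed.

Lemma Ck_cst k (a : R) : Ck k ((fun=> a) : 'rV[R]_m -> R).
Proof.
elim: k a => [|k ih] a; first by split => // x; exact: cst_continuous.
apply: (@Ck_intro _ _ (fun _ _ => 0)) => //; first by move=> x; exact: cst_continuous.
Qed.

Lemma is_derive_coord i j x :
  is_derive x (delta_mx ord0 i) (fun y => y ord0 j : R) (j == i)%:R.
Proof.
apply/is_derive_line.
have -> : (fun t : R => (x + t *: delta_mx ord0 i) ord0 j) =
  (fun t : R => x ord0 j + (j == i)%:R * t).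
  by apply/funext => t; rewrite !mxE eqxx/= mulrC.
by apply: is_derive_eq; rewrite add0r mul1r [_ *: _]mulr1.
Qed.

Lemma Ck_coord k j : Ck k (fun x => x ord0 j).
Proof.
have cc : continuous (fun x : 'rV[R]_m => x ord0 j) by exact: coord_continuous.
case: k => [//|k].
apply: (@Ck_intro _ _ (fun i _ => (j == i)%:R)) => //.
  by move=> i x; exact: is_derive_coord.
by move=> i; exact: Ck_cst.
Qed.

Lemma Ck_add k f g : Ck k f -> Ck k g -> Ck k (fun x => f x + g x).
Proof.
elim: k f g => [|k ih] f g Hf Hg.
  by split => // x; apply: continuousD; [exact: (Ck_continuous Hf)|exact: (Ck_continuous Hg)].
apply: (@Ck_intro _ _ (fun i x => partial f i x + partial g i x)).
- by move=> x; apply: continuousD; [exact: (Ck_continuous Hf)|exact: (Ck_continuous Hg)].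
- by move=> i x; exact: (is_derive_add (Ck_is_derive i x Hf) (Ck_is_derive i x Hg)).
- by move=> i; apply: ih; exact: Ck_partial.
Qed.

Lemma Ck_mul k f g : Ck k f -> Ck k g -> Ck k (fun x => f x * g x).
Proof.
elim: k f g => [|k ih] f g Hf Hg.
  by split => // x; apply: continuousM; [exact: (Ck_continuous Hf)|exact: (Ck_continuous Hg)].
apply: (@Ck_intro _ _ (fun i x => partial f i x * g x + f x * partial g i x)).
- by move=> x; apply: continuousM; [exact: (Ck_continuous Hf)|exact: (Ck_continuous Hg)].
- by move=> i x; exact: (is_derive_mul (Ck_is_derive i x Hf) (Ck_is_derive i x Hg)).
- by move=> i; apply: Ck_add; apply: ih; (exact: Ck_partial || exact: CkS).
Qed.

Lemma Ck_opp k f : Ck k f -> Ck k (fun x => - f x).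
Proof.
move=> Hf; have := Ck_mul (Ck_cst k (-1)) Hf.
by congr Ck; apply/funext => x; rewrite mulN1r.
Qed.

Lemma Ck_sub k f g : Ck k f -> Ck k g -> Ck k (fun x => f x - g x).
Proof. by move=> Hf Hg; apply: Ck_add => //; exact: Ck_opp. Qed.

Lemma Ck_inv k f : (forall x, f x != 0) -> Ck k f -> Ck k (fun x => (f x)^-1).
Proof.
move=> f0; elim: k => [|k ih] Hf.
  by split => // x; apply: continuousV; [exact: f0|exact: (Ck_continuous Hf)].
apply: (@Ck_intro _ _ (fun i x => - partial f i x * (f x)^-1 * (f x)^-1)).
- by move=> x; apply: continuousV; [exact: f0|exact: (Ck_continuous Hf)].
- by move=> i x; exact: (is_derive_inv (f0 x) (Ck_is_derive i x Hf)).
- move=> i; have IH := ih (CkS Hf); apply: Ck_mul => //; apply: Ck_mul => //.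
  by apply: Ck_opp; exact: Ck_partial.
Qed.

Lemma Ck_exp k f n : Ck k f -> Ck k (fun x => f x ^+ n).
Proof.
move=> Hf; elim: n => [|n ih]; first exact: Ck_cst.
by under eq_fun do rewrite exprS; exact: Ck_mul.
Qed.

Lemma Ck_sum k (I : Type) (r : seq I) (F : I -> 'rV[R]_m -> R) :
  (forall i, Ck k (F i)) -> Ck k (fun x => \sum_(i <- r) F i x).
Proof.
move=> HF; elim: r => [|a r ih].
  by under eq_fun do rewrite big_nil; exact: Ck_cst.
by under eq_fun do rewrite big_cons; exact: Ck_add.
Qed.

End Ck.

(* t^-n exp(-1/t), extended by 0: the derivatives of exp(-1/t) are            *)
(* combinations of these functions.                                           *)
Definition flat (n : nat) (t : R) : R := if 0 < t then t^-1 ^+ n * expR (- t^-1) else 0.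

Lemma flat_ge0 n t : 0 <= flat n t.
Proof.
rewrite /flat; case: ifP => // t0.
by rewrite mulr_ge0 ?expR_ge0// exprn_ge0// invr_ge0 ltW.
Qed.

Lemma flat_gt0 n t : 0 < t -> 0 < flat n t.
Proof.
by rewrite /flat => /[dup] t0 ->; rewrite mulr_gt0 ?expR_gt0// exprn_gt0// invr_gt0.
Qed.

Lemma flat_le0 n t : t <= 0 -> flat n t = 0.
Proof. by rewrite /flat ltNge => ->. Qed.

(** With N = n + 2, exp(s) = exp(s/N)^N >= (s/N)^N at s = 1/t gives exp(-1/t) <= (N t)^N. The two
    spare powers of [t] yield a zero derivative at the origin. *)
Lemma flat_bound n t : 0 < t -> flat n t <= n.+2%:R ^+ n.+2 * t ^+ 2.
Proof.
move=> t0; rewrite /flat t0 expRN; set N := n.+2.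
have H : (t^-1 / N%:R) ^+ N <= expR t^-1.
  have -> : expR t^-1 = expR (t^-1 / N%:R) ^+ N.
    by rewrite -expRM_natl mulrC divfK// pnatr_eq0.
  rewrite lerXn2r ?nnegrE ?expR_ge0 ?divr_ge0 ?invr_ge0 ?ltW//.
  by apply: lt_le_trans (expR_ge1Dx _); rewrite ltrDr.
have : (expR t^-1)^-1 <= (t * N%:R) ^+ N.
  rewrite -[leRHS]invrK lef_pV2 ?posrE ?expR_gt0 ?invr_gt0 ?exprn_gt0 ?mulr_gt0//.
  by rewrite -exprVn invfM.
move/(ler_wpM2l (exprn_ge0 n (ltW (_ : 0 < t^-1)))) => /(_ _)/le_trans -> //.
  by rewrite invr_gt0.
rewrite exprMn [_ ^+ N * _]mulrC mulrCA -[X in _ * (_ * X)](_ : t ^+ n * t ^+ 2 = _).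
  by rewrite (mulrA (t^-1 ^+ n)) -exprMn mulVf ?gt_eqF// expr1n mul1r.
by rewrite -exprD addn2.
Qed.

Lemma is_derive_flat n (t : R) :
  is_derive t (1 : R) (flat n) (flat n.+2 t - n%:R * flat n.+1 t).
Proof.
have [t0|t0|->] := ltrgt0P t.
- pose g (s : R) : R := s^-1 ^+ n * expR (- s^-1).
  have tV : t != 0 by rewrite gt_eqF.
  have H1 : is_derive t (1 : R) (fun s : R => s^-1) (- 1 * t^-1 * t^-1).
    exact: (is_derive_inv tV (is_derive_id _ _)).
  have H2 : is_derive t (1 : R) (fun s : R => (s^-1) ^+ n)
     (n%:R * t^-1 ^+ n.-1 * (- 1 * t^-1 * t^-1)).
    apply: (is_derive_comp1 (phi := fun s => s ^+ n) H1).
    have := is_deriveX n (is_derive_id (t^-1) (1 : R)).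
    rewrite [_ *: _]mulr1 (_ : id ^+ n = (fun s : R => s ^+ n))//.
    by apply/funext => s; rewrite exprfctE.
  have H3 : is_derive t (1 : R) (fun s : R => expR (- s^-1))
     (expR (- t^-1) * - (- 1 * t^-1 * t^-1)).
    exact: (is_derive_comp1 (phi := expR)).
  have H4 := is_derive_mul H2 H3.
  apply: (@near_eq_is_derive _ _ _ g).
    near=> s; rewrite /flat /g ifT//; near: s.
    exact: lt_nbhsr.
  apply: is_derive_eq H4 _.
  rewrite /flat t0; case: n {g H2} => [|n]; rewrite /= ?exprS; ring.
- apply: (@near_eq_is_derive _ _ _ (fun=> 0)).
    near=> s; rewrite flat_le0//; apply/ltW; near: s.
    exact: lt_nbhsl.
  by rewrite !flat_le0 ?ltW// mulr0 subr0; exact: is_derive_cst.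
(* At 0 the difference quotient is at most [M * h] for positive [h], by [flat_bound], and zero for
   negative [h]. *)
- rewrite !flat_le0// mulr0 subr0; set M : R := n.+2%:R ^+ n.+2.
  have cv : (fun h : R => h^-1 *: (flat n (h *: (1 : R) + 0) - flat n 0)) h @[h --> 0^'] --> (0 : R).
    apply/cvgr0Pnorm_lt => e e0.
    have M0 : 0 < M by rewrite exprn_gt0.
    near=> h.
    rewrite addr0 [h *: 1]mulr1 (flat_le0 n (lexx 0)) subr0.
    have h0 : h != 0 by near: h; exact: nbhs_dnbhs_neq.
    have [hp|hn] := ltP 0 h; last by rewrite flat_le0// scaler0 normr0.
    rewrite normrM ger0_norm ?invr_ge0 ?ltW// ger0_norm ?flat_ge0//.
    apply: le_lt_trans (ler_wpM2l _ (flat_bound n hp)) _.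
      by rewrite invr_ge0 ltW.
    rewrite -/M (_ : h^-1 * (M * h ^+ 2) = M * h); last by field.
    rewrite -ltr_pdivlMl//.
    apply: le_lt_trans (ler_norm h) _; near: h.
    apply: dnbhs0_lt; by rewrite mulr_gt0 ?invr_gt0.
  split; first by apply/cvg_ex; exists 0; exact: cv.
  by apply/cvg_lim => //; exact: cv.
Unshelve. all: by end_near. Qed.

Lemma continuous_flat n : continuous (flat n).
Proof.
move=> t; apply: differentiable_continuous; apply/derivable1_diffP.
by case: (is_derive_flat n t).
Qed.

Section Ck2.
Context {m : nat}.
Implicit Types (x y c : 'rV[R]_m) (f g : 'rV[R]_m -> R).

Definition smooth f := forall k, Ck k f.

Lemma Ck_flat k n f : smooth f -> Ck k (fun x => flat n (f x)).
Proof.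
move=> sf; elim: k n => [|k ih] n.
  split => // x; apply: continuous_comp; last exact: continuous_flat.
  exact: (Ck_continuous (sf 0%N)).
apply: (@Ck_intro _ _ _ (fun i x => (flat n.+2 (f x) - n%:R * flat n.+1 (f x)) *
  partial f i x)).
- move=> x; apply: continuous_comp; last exact: continuous_flat.
  exact: (Ck_continuous (sf 0%N)).
- move=> i x; apply: (is_derive_comp1 (phi := flat n)); last exact: is_derive_flat.
  exact: (Ck_is_derive i x (sf 1%N)).
- move=> i; apply: Ck_mul; last exact: Ck_partial.
  by apply: Ck_sub => //; apply: Ck_mul => //; exact: Ck_cst.
Qed.

Lemma Ck_partial_smooth f i : smooth f -> smooth (partial f i).
Proof. by move=> sf k; exact: Ck_partial. Qed.

(** The squared distance is a polynomial, so functions of it are smooth at the centre as well. Radii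
    that are compared with it are squared radii. *)
Definition qdist c x : R := dot (x - c) (x - c).

Lemma qdistE c x : qdist c x = \sum_(i < m) (x ord0 i - c ord0 i) ^+ 2.
Proof. by apply: eq_bigr => i _; rewrite !mxE expr2. Qed.

Lemma qdist_ge0 c x : 0 <= qdist c x.
Proof. by rewrite qdistE sumr_ge0// => i _; exact: sqr_ge0. Qed.

Lemma Ck_qdist k c : Ck k (qdist c).
Proof.
rewrite (_ : qdist c = fun x => \sum_(i < m) (x ord0 i - c ord0 i) ^+ 2).
  apply: Ck_sum => i; apply: Ck_exp.
  by apply: Ck_sub; [exact: Ck_coord|exact: Ck_cst].
by apply/funext => x; rewrite qdistE.
Qed.

Lemma partial_qdist c i x : partial (qdist c) i x = 2 * (x ord0 i - c ord0 i).
Proof.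
apply: partialE; rewrite (_ : qdist c = fun x => \sum_(i < m) (x ord0 i - c ord0 i) ^+ 2).
  apply/is_derive_line.
  have -> : (fun t : R => \sum_(j < m) ((x + t *: delta_mx ord0 i) ord0 j - c ord0 j) ^+ 2) =
    (fun t : R => qdist c x + t * (2 * (x ord0 i - c ord0 i)) + t ^+ 2).
    apply/funext => t; rewrite qdistE (bigD1 i)//= [in RHS](bigD1 i)//=.
    rewrite (eq_bigr (fun j => (x ord0 j - c ord0 j) ^+ 2)) => [|j /negbTE ji].
      by rewrite !mxE !eqxx /=; ring.
    by rewrite !mxE ji andbF mulr0 addr0.
  by apply: is_derive_eq; rewrite /GRing.scale/=; ring.
by apply/funext => y; rewrite qdistE.
Qed.

Lemma norm_coord x i : `|x ord0 i| <= `|x|.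
Proof.
rewrite [leRHS]/Num.norm/= mx_normrE.
by apply/bigmax_geP; right => /=; exists (ord0, i).
Qed.

Lemma norm_le_coord x r : 0 <= r -> (forall i, `|x ord0 i| <= r) -> `|x| <= r.
Proof.
move=> r0 H; rewrite [leLHS]/Num.norm/= mx_normrE.
by apply/bigmax_leP; split=> // -[j i] _; rewrite ord1; exact: H.
Qed.

Lemma qdist_norm c x : qdist c x <= m%:R * `|x - c| ^+ 2.
Proof.
rewrite qdistE; apply: le_trans (_ : _ <= \sum_(i < m) `|x - c| ^+ 2) _.
  apply: ler_sum => i _; rewrite -real_normK ?num_real//.
  rewrite lerXn2r ?nnegrE//; have := norm_coord (x - c) i.
  by rewrite !mxE.
by rewrite sumr_const card_ord mulr_natl.
Qed.

Lemma norm_qdist c x : `|x - c| ^+ 2 <= qdist c x.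
Proof.
have [r0 H] : 0 <= Num.sqrt (qdist c x) /\ forall i,
    `|(x - c) ord0 i| <= Num.sqrt (qdist c x).
  split=> [|i]; first exact: sqrtr_ge0.
  rewrite -sqrtr_sqr ler_wsqrtr// qdistE (bigD1 i)//= !mxE lerDl.
  by rewrite sumr_ge0// => j _; exact: sqr_ge0.
rewrite -[leRHS]sqr_sqrtr ?qdist_ge0//.
by rewrite lerXn2r ?nnegrE//; exact: norm_le_coord.
Qed.

(** The smooth transition from 1 on ]-oo, a] to 0 on [b, +oo[. For a < b one of b - t and t - a is
    positive, so the denominator never vanishes. *)
Definition step (a b t : R) : R := flat 0 (b - t) / (flat 0 (b - t) + flat 0 (t - a)).

Section step.
Variables (a b : R).
Hypothesis ab : a < b.

Lemma step_den_gt0 t : 0 < flat 0 (b - t) + flat 0 (t - a).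
Proof.
have [tb|bt] := ltP t b.
  by rewrite ltr_wpDr ?flat_ge0// flat_gt0// subr_gt0.
by rewrite ltr_wpDl ?flat_ge0// flat_gt0// subr_gt0 (lt_le_trans ab).
Qed.

Lemma step_ge0 t : 0 <= step a b t.
Proof. by rewrite divr_ge0 ?flat_ge0// ltW// step_den_gt0. Qed.

Lemma step_le1 t : step a b t <= 1.
Proof. by rewrite ler_pdivrMr ?step_den_gt0// mul1r lerDl flat_ge0. Qed.

Lemma step1 t : t <= a -> step a b t = 1.
Proof.
move=> ta; rewrite /step [flat 0 (t - a)]flat_le0 ?subr_le0// addr0 divff//.
by rewrite gt_eqF// flat_gt0// subr_gt0 (le_lt_trans ta).
Qed.

Lemma step0 t : b <= t -> step a b t = 0.
Proof. by move=> bt; rewrite /step flat_le0 ?subr_le0// mul0r. Qed.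

(** The derivative of [flat 0] is [flat 2]. This closed form shows the sign: nonpositive everywhere
    and negative in ]a, b[, which decides the sign of the flux in [flux_neq0]. *)
Definition dstep (t : R) : R :=
  - (flat 2 (b - t) * flat 0 (t - a) + flat 0 (b - t) * flat 2 (t - a)) /
  (flat 0 (b - t) + flat 0 (t - a)) ^+ 2.

Lemma is_derive_step t : is_derive t (1 : R) (step a b) (dstep t).
Proof.
have H1 : is_derive t (1 : R) (fun s => flat 0 (b - s)) (- flat 2 (b - t)).
  apply: is_derive_eq.
    apply: (is_derive_comp1 (phi := flat 0) (f := fun s => b - s)).
    exact: is_derive_flat.
  by ring.
have H2 : is_derive t (1 : R) (fun s => flat 0 (s - a)) (flat 2 (t - a)).
  apply: is_derive_eq.
    apply: (is_derive_comp1 (phi := flat 0) (f := fun s => s - a)).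
    exact: is_derive_flat.
  by ring.
have d0 := lt0r_neq0 (step_den_gt0 t).
have H3 := is_derive_mul H1
  (@is_derive_inv _ (fun s => flat 0 (b - s) + flat 0 (s - a)) _ _ _ d0 (is_derive_add H1 H2)).
by apply: is_derive_eq H3 _; rewrite /dstep; field.
Qed.

Lemma dstep_le0 t : dstep t <= 0.
Proof.
rewrite /dstep mulNr oppr_le0 divr_ge0 ?sqr_ge0//.
by rewrite addr_ge0// mulr_ge0// flat_ge0.
Qed.

Lemma dstep_lt0 t : a < t < b -> dstep t < 0.
Proof.
move=> /andP[a_t tb]; rewrite /dstep mulNr oppr_lt0 divr_gt0 ?exprn_gt0 ?step_den_gt0//.
by rewrite ltr_wpDr ?mulr_ge0 ?flat_ge0// mulr_gt0// flat_gt0// subr_gt0.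
Qed.

End step.

Definition plateau c (a b : R) x : R := step a b (qdist c x).

Lemma smooth_plateau c a b : a < b -> smooth (plateau c a b).
Proof.
move=> ab k; rewrite /plateau /step; apply: Ck_mul.
  by apply: Ck_flat => j; apply: Ck_sub; [exact: Ck_cst|exact: Ck_qdist].
apply: Ck_inv => [x|]; first by rewrite gt_eqF// step_den_gt0.
by apply: Ck_add; apply: Ck_flat => j; apply: Ck_sub;
  [exact: Ck_cst|exact: Ck_qdist|exact: Ck_qdist|exact: Ck_cst].
Qed.

Lemma plateau_ge0 c a b x : a < b -> 0 <= plateau c a b x.
Proof. by move=> ab; exact: step_ge0. Qed.

Lemma plateau_le1 c a b x : a < b -> plateau c a b x <= 1.
Proof. by move=> ab; exact: step_le1. Qed.

Lemma plateau1 c a b x : a < b -> qdist c x <= a -> plateau c a b x = 1.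
Proof. by move=> ab; exact: step1. Qed.

Lemma plateau0 c a b x : b <= qdist c x -> plateau c a b x = 0.
Proof. exact: step0. Qed.

Lemma smooth_continuous f : smooth f -> continuous f.
Proof. by move=> sf; exact: Ck_continuous (sf 0%N). Qed.

Lemma smooth_cst (a : R) : smooth (fun=> a).
Proof. by move=> k; exact: Ck_cst. Qed.

Lemma smooth_add f g : smooth f -> smooth g -> smooth (fun x => f x + g x).
Proof. by move=> sf sg k; exact: Ck_add. Qed.

Lemma smooth_sub f g : smooth f -> smooth g -> smooth (fun x => f x - g x).
Proof. by move=> sf sg k; exact: Ck_sub. Qed.

Lemma smooth_mul f g : smooth f -> smooth g -> smooth (fun x => f x * g x).
Proof. by move=> sf sg k; exact: Ck_mul. Qed.

Lemma smooth_is_derive f i x : smooth f ->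
  is_derive x (delta_mx ord0 i) f (partial f i x).
Proof. by move=> sf; exact: (Ck_is_derive i x (sf 1%N)). Qed.

Definition fsupp f := closure [set x | f x != 0].

Lemma fsuppPn f x : ~ fsupp f x -> f x = 0.
Proof.
by move=> Hx; apply/eqP/negPn/negP => fx; apply: Hx; exact: subset_closure.
Qed.

Lemma partial_fsupp f i x : ~ fsupp f x -> partial f i x = 0.
Proof.
move=> Hx; apply: partialE.
apply: (@near_eq_is_derive _ _ _ (fun=> 0)).
have oC : open (~` fsupp f) by apply: closed_openC; exact: closed_closure.
have : nbhs x (~` fsupp f) by exact: open_nbhs_nbhs.
by apply: filterS => y /fsuppPn.
Qed.

Lemma test_functionP (U : set 'rV[R]_m) f : test_function U f <->
  [/\ smooth f, compact (fsupp f) & fsupp f `<=` U].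
Proof. by []. Qed.

Lemma test_intro (U K : set 'rV[R]_m) f : smooth f -> compact K -> K `<=` U ->
  (forall x, ~ K x -> f x = 0) -> test_function U f.
Proof.
move=> sf cK KU Kf.
have sK : fsupp f `<=` K.
  have cl : closed K by apply: compact_closed.
  rewrite /fsupp closureE; apply: smallest_sub => // x /=.
  by apply: contraNP => /Kf ->.
split => //; last exact: subset_trans KU.
by apply: subclosed_compact cK sK; exact: closed_closure.
Qed.

Lemma test_mul (U : set 'rV[R]_m) f g : test_function U f -> smooth g ->
  test_function U (fun x => f x * g x).
Proof.
move=> /test_functionP[sf cf fU] sg; apply: (test_intro (smooth_mul sf sg) cf fU).
by move=> x /fsuppPn ->; rewrite mul0r.
Qed.

Lemma test_partial (U : set 'rV[R]_m) f i : test_function U f ->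
  test_function U (partial f i).
Proof.
move=> /test_functionP[sf cf fU]; apply: (test_intro (Ck_partial_smooth i sf) cf fU).
by move=> x /partial_fsupp.
Qed.

Lemma test_lin (U : set 'rV[R]_m) f g (a b : R) : test_function U f ->
  test_function U g -> test_function U (fun x => a * f x + b * g x).
Proof.
move=> /test_functionP[sf cf fU] /test_functionP[sg cg gU].
apply: (@test_intro _ (fsupp f `|` fsupp g)).
- by apply: smooth_add; apply: smooth_mul => //; exact: smooth_cst.
- exact: compactU.
- by move=> x [/fU|/gU].
- by move=> x /not_orP[/fsuppPn -> /fsuppPn ->]; rewrite !mulr0 addr0.
Qed.

Lemma partial_lin f g (a b : R) i x : smooth f -> smooth g ->
  partial (fun x => a * f x + b * g x) i x = a * partial f i x + b * partial g i x.
Proof.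
move=> sf sg; apply: partialE; apply: is_derive_eq.
  apply: is_derive_add; apply: is_derive_mul; (exact: smooth_is_derive || exact: is_derive_cst).
by rewrite !mul0r !add0r.
Qed.

Lemma closed_qdist_ball c (b : R) : closed [set x | qdist c x <= b].
Proof.
have := closed_comp (f := qdist c) (D := [set t | t <= b]).
apply; last exact: closed_le.
by move=> x _; apply: (smooth_continuous (f := qdist c)) => k; exact: Ck_qdist.
Qed.

Lemma compact_qdist_ball c (b : R) : compact [set x | qdist c x <= b].
Proof.
apply: bounded_closed_compact; last exact: closed_qdist_ball.
exists (`|c| + Num.sqrt `|b|); split; first by rewrite num_real.
move=> r Hr x /= Hx; rewrite -[x](subrK c) (le_trans (ler_normD _ _))//.
rewrite addrC; apply/ltW/(le_lt_trans _ Hr); rewrite lerD//.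
rewrite -(@ler_pXn2r _ 2)// ?nnegrE ?sqrtr_ge0// sqr_sqrtr//.
by rewrite (le_trans (norm_qdist _ _))// (le_trans Hx)// ler_norm.
Qed.

Lemma test_plateau (U : set 'rV[R]_m) c a b : a < b ->
  [set x | qdist c x <= b] `<=` U -> test_function U (plateau c a b).
Proof.
move=> ab bU; apply: (test_intro (smooth_plateau c ab) (@compact_qdist_ball c b) bU).
by move=> x /negP; rewrite -ltNge => /ltW; exact: plateau0.
Qed.

(** Finitely many balls whose concentric enlargements lie in U cover K. Their plateaus are combined
    by eta + theta (1 - eta), which stays in [0, 1] and is 1 wherever one of the two is. The open
    set V matters because the gradient of eta vanishes on it. *)
Lemma exists_cutoff (U K : set 'rV[R]_m) : open U -> compact K -> K `<=` U ->
  exists eta : 'rV[R]_m -> R, [/\ test_function U eta,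
    forall x, 0 <= eta x <= 1 &
    exists2 V, open V & K `<=` V /\ forall x, V x -> eta x = 1].
Proof.
move=> oU cK KU.
have /choice[r Hr] p : exists r : R, K p ->
    0 < r /\ [set x | qdist p x <= 2 * r] `<=` U.
  have [Kp|] := pselect (K p); last by exists 0.
  have /nbhs_ballP[e/= e0 eU] := open_nbhs_nbhs (conj oU (KU _ Kp)).
  (* A squared radius: the enlarged ball has Euclidean radius sqrt(2) e / 2 < e. *)
  exists ((e / 2) ^+ 2) => _; split; first by rewrite exprn_gt0// divr_gt0.
  move=> x /= Hx; apply: eU; rewrite -ball_normE /= distrC.
  rewrite -(@ltr_pXn2r _ 2)// ?nnegrE ?(ltW e0)//.
  apply: le_lt_trans (norm_qdist _ _) _; apply: le_lt_trans Hx _.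
  by rewrite expr_div_n; nra.
pose F (p : 'rV[R]_m) := [set x | qdist p x < r p].
have oF p : open (F p).
  apply: (@open_comp _ _ (qdist p) [set t | t < r p]) => [x _|]; last exact: open_lt.
  by apply: (smooth_continuous (f := qdist p)) => k; exact: Ck_qdist.
have Kcov : K `<=` cover K F.
  move=> p Kp; exists p => //; rewrite /F /= /qdist subrr /dot big1.
    by case: (Hr p Kp).
  by move=> i _; rewrite mxE mul0r.
move: (cK); rewrite compact_cover => /(_ _ K F (fun i _ => oF i) Kcov)[D' D'K KD'].
suff [eta [teta eta01 Heta]] : exists eta : 'rV[R]_m -> R, [/\ test_function U eta,
    forall x, 0 <= eta x <= 1 &
    forall p, p \in finmap.enum_fset D' -> forall x, F p x -> eta x = 1].
  exists eta; split => //; exists (\bigcup_(p in [set` finmap.enum_fset D']) F p).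
    by apply: bigcup_open => i _; exact: oF.
  by split=> // x [p pD' Fx]; exact: (Heta p).
have : forall p, p \in finmap.enum_fset D' -> K p by move=> p /D'K; rewrite inE.
move: (finmap.enum_fset D') => s0; elim: s0 => [_|p s ih Hs].
  exists (fun=> 0); split => //; last by move=> x; rewrite lexx ler01.
  by apply: (test_intro (K := set0)) => //; [exact: smooth_cst|exact: compact0].
have [|eta [teta eta01 Heta]] := ih.
  by move=> q qs; apply: Hs; rewrite inE qs orbT.
have [rp rU] := Hr _ (Hs p (mem_head _ _)).
have rr : r p < 2 * r p by lra.
have tth : test_function U (plateau p (r p) (2 * r p)) by exact: test_plateau.
have seta : smooth eta by case: teta.
exists (fun x => 1 * eta x + 1 * (plateau p (r p) (2 * r p) x * (1 - eta x))); split.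
- apply: test_lin => //; apply: test_mul => //.
  by apply: smooth_sub => //; exact: smooth_cst.
- move=> x; have /andP[h1 h2] := eta01 x.
  have := plateau_ge0 p x rr; have := plateau_le1 p x rr.
  by move: (plateau _ _ _ _) => u; nra.
- move=> q; rewrite inE => /predU1P[->|qs] x Fx.
    by rewrite plateau1 ?(ltW Fx)//; ring.
  by rewrite (Heta q qs)//; ring.
Qed.

(** A compact exhaustion of U. With U the complement of a needle it also separates the region close
    to the needle from the region where needle sequences converge. *)
Definition inner (U : set 'rV[R]_m) (n : nat) : set 'rV[R]_m :=
  [set x | `|x| <= n%:R /\ forall y, ~ U y -> n.+1%:R^-1 <= `|x - y|].

Lemma inner_sub U n : inner U n `<=` U.
Proof.
move=> x [_ H]; apply: contrapT => /H.
by rewrite subrr normr0 leNgt invr_gt0 ltr0n.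
Qed.

Lemma compact_inner U n : compact (inner U n).
Proof.
apply: bounded_closed_compact.
  by exists n%:R; split => // M nM x [xn _]; exact: (le_trans xn (ltW nM)).
rewrite (_ : inner U n = [set x | `|x| <= n%:R] `&`
   \bigcap_(y in ~` U) [set x | n.+1%:R^-1 <= `|x - y|]).
  apply: closedI.
    have := @closed_comp _ _ (@Num.norm _ 'rV[R]_m) [set t | t <= n%:R].
    by apply=> [x _|]; [exact: norm_continuous|exact: closed_le].
  apply: closed_bigI => y _.
  have := @closed_comp _ _ (fun x : 'rV[R]_m => `|x - y|) [set t | n.+1%:R^-1 <= t].
  apply=> [x _|]; last exact: closed_ge.
  apply: continuous_comp; last exact: norm_continuous.
  by apply: continuousB; [by move=> ?|exact: cst_continuous].
by apply/seteqP; split=> x [H1 H2]; split => // y; exact: H2.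
Qed.

Lemma inner_cover U K : open U -> compact K -> K `<=` U ->
  exists n, K `<=` inner U n.
Proof.
move=> oU cK KU.
have inner_mono n k : (n <= k)%N -> inner U n `<=` inner U k.
  move=> nk x [H1 H2]; split => [|y /H2]; first by rewrite (le_trans H1)// ler_nat.
  by apply: le_trans; rewrite lef_pV2 ?posrE// ler_nat.
have cov : K `<=` cover setT (fun n => (inner U n)^°).
  move=> x Kx; have /nbhs_ballP[e/= e0 eU] := open_nbhs_nbhs (conj oU (KU _ Kx)).
  (* The first entry bounds the norm on the unit ball around [x]; the second keeps the ball of
     radius e / 2 at distance 1/(N+1) from the complement of U. *)
  pose N := maxn (Num.truncn (`|x| + 1)).+1 (Num.truncn (2 / e)).+1.
  exists N => //; apply/nbhs_ballP; exists (Num.min 1 (e / 2)) => /=.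
    by rewrite lt_min ltr01 divr_gt0.
  move=> y; rewrite -ball_normE /= lt_min => /andP[y1 ye]; split.
    rewrite -[y](subrK x) (le_trans (ler_normD _ _))// distrC addrC.
    apply: (@le_trans _ _ (`|x| + 1)); first by rewrite lerD2l ltW.
    rewrite (le_trans (ltW (truncnS_gt _)))// ler_nat /N.
    by rewrite leq_max leqnn.
  move=> z Uz; have xz : e <= `|x - z|.
    by rewrite leNgt; apply/negP => H; apply/Uz/eU; rewrite -ball_normE.
  have : N.+1%:R^-1 <= e / 2.
    rewrite -[leRHS]invrK lef_pV2 ?posrE ?invr_gt0 ?divr_gt0//.
    rewrite invf_div (le_trans (ltW (truncnS_gt _)))// ler_nat /N.
    by rewrite leqW// leq_max leqnn orbT.
  move/le_trans; apply; rewrite -(lerD2r (`|x - y|)).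
  have : `|x - z| <= `|y - z| + `|x - y| by rewrite [leRHS]addrC; exact: ler_distD.
  by move=> H; apply: le_trans H; apply: le_trans xz; lra.
move: cK; rewrite compact_cover => /(_ _ _ _ (fun i _ => open_interior (inner U i)) cov).
move=> [D' _ KD']; exists (\max_(i <- finmap.enum_fset D') i)%N => x /KD'[n /= nD].
move=> /interior_subset; apply: inner_mono.
by rewrite (big_rem n)//= leq_maxl.
Qed.

Lemma partial_plateau c a b i x : a < b ->
  partial (plateau c a b) i x = dstep a b (qdist c x) * (2 * (x ord0 i - c ord0 i)).
Proof.
move=> ab; apply: partialE; rewrite -partial_qdist.
apply: (is_derive_comp1 (phi := step a b)); last exact: is_derive_step.
exact: (Ck_is_derive i x (Ck_qdist 1 c)).
Qed.

End Ck2.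

End smooth_theory.

(** * Integration by parts and the fundamental lemma *)

Section real_integrable.
Context d (T : measurableType d) {R : realType} (mu : {measure set T -> \bar R}).
Variables (D : set T) (mD : measurable D).
Implicit Types f g : T -> R.

Lemma rintegrableD f g : mu.-integrable D (EFin \o f) ->
  mu.-integrable D (EFin \o g) -> mu.-integrable D (EFin \o (fun x => f x + g x)).
Proof. by move=> fi gi; exact: (integrableD mD fi gi). Qed.

Lemma rintegrableB f g : mu.-integrable D (EFin \o f) ->
  mu.-integrable D (EFin \o g) -> mu.-integrable D (EFin \o (fun x => f x - g x)).
Proof. by move=> fi gi; exact: (integrableB mD fi gi). Qed.

Lemma rintegrableZ (a : R) f : mu.-integrable D (EFin \o f) ->
  mu.-integrable D (EFin \o (fun x => a * f x)).
Proof. by move=> fi; exact: (integrableZl mD a fi). Qed.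

Lemma rintegrable_sum (I : Type) (s : seq I) (F : I -> T -> R) :
  (forall i, mu.-integrable D (EFin \o F i)) ->
  mu.-integrable D (EFin \o (fun x => \sum_(i <- s) F i x)).
Proof.
move=> H; elim: s => [|a s ih].
  rewrite (_ : _ \o _ = cst 0%E); first exact: integrable0.
  by apply/funext => x /=; rewrite big_nil.
rewrite (_ : (fun x => _) = (fun x => F a x + \sum_(i <- s) F i x)).
  exact: rintegrableD.
by apply/funext => x; rewrite big_cons.
Qed.

Lemma rintegrable_le f g : measurable_fun D f ->
  (forall x, D x -> `|f x| <= g x) -> mu.-integrable D (EFin \o g) ->
  mu.-integrable D (EFin \o f).
Proof.
move=> mf fg; apply: le_integrable => //; first exact/measurable_EFinP.
by move=> x Dx /=; rewrite lee_fin (le_trans (fg x Dx))// ler_norm.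
Qed.

Lemma Rintegral_sum (I : Type) (s : seq I) (F : I -> T -> R) :
  (forall i, mu.-integrable D (EFin \o F i)) ->
  \int[mu]_(x in D) (\sum_(i <- s) F i x) = \sum_(i <- s) \int[mu]_(x in D) F i x.
Proof.
move=> H; elim: s => [|a s ih].
  rewrite big_nil; under eq_Rintegral do rewrite big_nil.
  by rewrite Rintegral_cst// mul0r.
under eq_Rintegral do rewrite big_cons.
by rewrite RintegralD// ?ih ?big_cons//; exact: rintegrable_sum.
Qed.

Lemma EFin_Rintegral f : mu.-integrable D (EFin \o f) ->
  ((\int[mu]_(x in D) f x)%:E = \int[mu]_(x in D) (f x)%:E)%E.
Proof. by move=> fi; rewrite /Rintegral fineK//; exact: integrable_fin_num. Qed.

End real_integrable.

Section calculus_integral.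
Context {R : realType} {m : nat}.
Implicit Types (U K : set 'rV[R]_m) (f g : 'rV[R]_m -> R).

Lemma compact_leb_fin K : compact K -> (leb K < +oo)%E.
Proof.
move=> cK; apply: leb_bounded; first exact: compact_measurable_rV.
exact: compact_bounded.
Qed.

Lemma continuous_compact_bound K f : compact K -> continuous f ->
  exists2 M, 0 < M & forall x, K x -> `|f x| <= M.
Proof.
move=> cK cf; have /compact_bounded[M [_ HM]] : compact (f @` K).
  by apply: continuous_compact => //; exact: continuous_subspaceT.
exists (`|M| + 1); first by rewrite ltr_wpDl.
move=> x Kx; apply: HM; last by exists x.
by rewrite (le_lt_trans (ler_norm M)) ?ltrDl.
Qed.

Lemma bounded_compact_integrable K f (M : R) : compact K -> measurable_fun K f ->
  (forall x, K x -> `|f x| <= M) -> leb.-integrable K (EFin \o f).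
Proof.
move=> cK mf fM; apply: measurable_bounded_integrable => //.
- exact: compact_measurable_rV.
- exact: compact_leb_fin.
- by exists M; split => [|r Mr x Kx]; rewrite ?num_real//= (le_trans (fM x Kx))// ltW.
Qed.

Lemma supp_integrable K f : compact K -> continuous f ->
  (forall x, ~ K x -> f x = 0) -> leb.-integrable setT (EFin \o f).
Proof.
move=> cK cf f0; have mK := compact_measurable_rV cK.
have [M M0 HM] := continuous_compact_bound cK cf.
have := bounded_compact_integrable cK (continuous_measurable_rV mK cf) HM.
move/(integrable_mkcond _ mK); apply: eq_integrable => // x _.
rewrite patchE; case: ifPn => // /negP xK; rewrite /= f0// => Kx.
by apply: xK; rewrite inE.
Qed.

Lemma Rintegral_translation (a : 'rV[R]_m) f : measurable_fun setT f ->
  leb.-integrable setT (fun x => (f (x + a))%:E) ->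
  \int[leb]_x f (x + a) = \int[leb]_x f x.
Proof.
move=> mf fi; congr fine; apply: (@integral_translation _ _ a (EFin \o f)) => //.
exact/measurable_EFinP.
Qed.

(* The integral of every difference quotient vanishes by translation          *)
(* invariance. *)
Lemma integral_derive0 K g g' i : compact K -> continuous g -> continuous g' ->
  (forall x, is_derive x (delta_mx ord0 i) g (g' x)) ->
  (forall x, ~ K x -> g x = 0) -> \int[leb]_x g' x = 0.
Proof.
move=> cK cg cg' dg g0; set e : 'rV[R]_m := delta_mx ord0 i.
have ne : `|e| <= 1.
  apply: norm_le_coord => // j; rewrite mxE eqxx/=.
  by case: eqP => _; rewrite ?normr0 ?normr1.
have [M0 [_ HM0]] := compact_bounded cK.
pose r := `|M0| + 1.
have Kr x : K x -> `|x| <= r.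
  by move=> Kx; apply: HM0 => //; rewrite (le_lt_trans (ler_norm M0)) ?ltrDl.
(* Every step [h k] and the norm of [e] are at most 1, so all difference quotients vanish outside
   the single ball [B]. *)
pose B := [set x : 'rV[R]_m | `|x| <= r + 1].
have cB : compact B.
  apply: bounded_closed_compact.
    by exists (r + 1); split; rewrite ?num_real// => s rs x /= Bx; rewrite (le_trans Bx)// ltW.
  have := @closed_comp _ _ (@Num.norm _ 'rV[R]_m) [set t | t <= r + 1].
  by apply=> [x _|]; [exact: norm_continuous|exact: closed_le].
have mB := compact_measurable_rV cB.
have [M M_gt0 HM] := continuous_compact_bound cB cg'.
have g0' x : ~ K x -> g' x = 0.
  have cl : closed K by apply: compact_closed.
  move=> Kx; have [_ <-] := dg x.
  have [_ <-] : is_derive x (delta_mx ord0 i) g 0; last by [].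
  apply: (@near_eq_is_derive _ _ _ (fun=> 0)).
  have : nbhs x (~` K) by apply: open_nbhs_nbhs; split=> //; exact: closed_openC.
  by apply: filterS => y /g0.
have HM' x : `|g' x| <= M.
  have [Kx|Kx] := pselect (K x); last by rewrite g0'// normr0 ltW.
  by apply: HM; rewrite /B /= (le_trans (Kr _ Kx))// lerDl.
pose h (k : nat) : R := k.+1%:R^-1.
have h0 k : 0 < h k by rewrite invr_gt0.
have h1 k : h k <= 1 by rewrite invf_le1// ler1n.
pose q k (x : 'rV[R]_m) : R := (h k)^-1 * (g (x + h k *: e) - g x).
have cgt k : continuous (fun x : 'rV[R]_m => g (x + h k *: e)).
  move=> x; apply: (@continuous_comp _ _ _ (fun x : 'rV[R]_m => x + h k *: e) g).
    by apply: continuousD; [by move=> ?|exact: cst_continuous].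
  exact: cg.
have cq k : continuous (q k).
  rewrite /q => x; apply: (@continuousM _ _ (fun=> (h k)^-1)
    (fun x : 'rV[R]_m => g (x + h k *: e) - g x)); first exact: cst_continuous.
  by apply: continuousB; [exact: cgt|exact: cg].
have gT k x : ~ B x -> g (x + h k *: e) = 0.
  move=> Bx; apply: g0 => /Kr; apply/negP; rewrite -ltNge.
  move/negP : Bx; rewrite -ltNge => Bx.
  have : `|x| <= `|x + h k *: e| + 1.
    rewrite -[X in `|X| <= _](addrK (h k *: e)) (le_trans (ler_normB _ _))// lerD2l.
    by rewrite normrZ gtr0_norm// mulr_ile1// ltW.
  by lra.
have gB x : ~ B x -> g x = 0.
  by move=> Bx; apply: g0 => Kx; apply: Bx; rewrite /B/= (le_trans (Kr _ Kx))// lerDl.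
have qi k : \int[leb]_x q k x = 0.
  have ig1 := supp_integrable cB (cgt k) (gT k).
  have ig := supp_integrable cB cg gB.
  rewrite RintegralZl//; last exact: rintegrableB.
  by rewrite RintegralB// Rintegral_translation ?subrr ?mulr0//;
    exact: continuous_measurable_rV.
(* The mean value theorem on the segment from x to x + h e gives one bound for all [k], as dominated
   convergence requires. *)
have qM k x : `|q k x| <= M.
  have dl (t : R) : is_derive t (1 : R) (fun s : R => g (x + s *: e)) (g' (x + t *: e)).
    have /is_derive_line H := dg (x + t *: e).
    apply/is_derive_line; move: H; congr (is_derive _ _ _ _).
    by apply/funext => s; rewrite [s *: 1]mulr1 scalerDl addrA.
  have [|c _] := @MVT_segment _ (fun s : R => g (x + s *: e)) (fun s => g' (x + s *: e)) 0 (h k) (ltW (h0 k)) (fun t _ => dl t).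
    apply: continuous_subspaceT => t.
    by apply: differentiable_continuous; apply/derivable1_diffP; case: (dl t).
  rewrite scale0r addr0 subr0 /q => ->.
  by rewrite mulrCA mulVf ?gt_eqF// mulr1.
have qg x : q k x @[k --> \oo] --> g' x.
  have [dgx <-] := dg x.
  have : (fun u : R => u^-1 *: ((g \o shift x) (u *: e) - g x)) u @[u --> 0^']
    --> 'D_e g x by exact: dgx.
  move=> /cvgr_dnbhsP/(_ h); rewrite /q.
  have -> : (fun k => (h k)^-1 * (g (x + h k *: e) - g x)) =
    (fun k => (h k)^-1 *: ((g \o shift x) (h k *: e) - g x)).
    by apply/funext => k; rewrite /= [x + _]addrC.
  apply; split; first by move=> k; rewrite gt_eqF.
  exact: cvg_harmonic.
have qi' k : (\int[leb]_x (q k x)%:E = 0)%E.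
  rewrite -EFin_Rintegral ?qi//; apply: (supp_integrable cB (cq k)) => x Bx.
  by rewrite /q gT// gB// subrr mulr0.
have [||||| _ _ H] := @dominated_convergence _ _ _ leb setT measurableT
  (fun k => EFin \o q k) (EFin \o g') (EFin \o (fun x => M * (\1_B x))).
- by move=> k; apply/measurable_EFinP; exact: continuous_measurable_rV.
- by apply/measurable_EFinP; exact: continuous_measurable_rV.
- by apply: aeW => x _; apply: cvg_EFin; [exact: nearW|exact: qg].
- apply: rintegrableZ => //; rewrite (_ : _ \o _ = EFin \o \1_B)//.
  apply/integrableP; split; first exact/measurable_EFinP.
  under eq_integral do rewrite /= ger0_norm//.
  by rewrite integral_indic// setIT; exact: compact_leb_fin.
- apply: aeW => x k _ /=; rewrite lee_fin indicE.
  have [Bx|Bx] := boolP (x \in B); first by rewrite mulr1.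
  have {}Bx : ~ B x by move=> H; rewrite mem_set in Bx.
  by rewrite /q gT// gB// subrr mulr0 normr0 mulr0.
rewrite /Rintegral; have /cvg_lim <- // := H.
rewrite (_ : [sequence _]_n = fun=> 0%E); first by rewrite lim_cst.
by apply/funext => k /=; exact: qi'.
Qed.

(* 1 - (1 - c)^k with c = b^2 / (1 + b^2) increases to the indicator of      *)
(* [b != 0], and such sets form a pi-system generating the Borel sets. *)
Definition nonzero_sets := [set A : set 'rV[R]_m |
  exists2 b : 'rV[R]_m -> R, smooth b & A = [set x | b x != 0]].

Lemma nonzero_sets_setI : setI_closed nonzero_sets.
Proof.
move=> _ _ [b sb ->] [c sc ->]; exists (fun x => b x * c x).
  exact: smooth_mul.
by apply/seteqP; split=> x /=; rewrite mulf_eq0 negb_or => /andP.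
Qed.

Lemma measurable_nonzero_sets : measurable = <<s nonzero_sets >>.
Proof.
apply/seteqP; split; last first.
  apply: smallest_sub; first exact: sigma_algebra_measurable.
  move=> _ [b sb ->]; rewrite -[X in measurable X]setTI.
  have := continuous_measurable_rV measurableT (smooth_continuous sb).
  move=> /(_ measurableT (~` [set 0]) (measurableC (measurable_set1 0))).
  rewrite (_ : b @^-1` _ = [set x | b x != 0])//.
  by apply/seteqP; split=> x /= => [/eqP//|/eqP].
apply: smallest_sub; first exact: smallest_sigma_algebra.
rewrite -bigcup_seq/=; apply: bigcup_sub => i _ A [B mB <-].
rewrite setTI.
have HB : <<s @RGenOInfty.G R >> B.
  by change ((@RGenOInfty.G R).-sigma.-measurable B); rewrite -RGenOInfty.measurableE.
have : (<<s nonzero_sets >>) ((fun x : 'rV[R]_m => x ord0 i) @^-1` B).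
  move: B HB {mB}; apply: smallest_sub.
    split.
    - by rewrite /= preimage_set0; exact: sigma_algebra0.
    - move=> B HB /=; rewrite setTD preimage_setC -setTD.
      exact: sigma_algebraCD.
    - move=> F HF /=; rewrite preimage_bigcup; exact: sigma_algebra_bigcup.
  move=> _ [a ->] /=; apply: sub_sigma_algebra.
  exists (fun x => flat 0 (x ord0 i - a)).
    move=> k; apply: Ck_flat => j; apply: Ck_sub; [exact: Ck_coord|exact: Ck_cst].
  apply/seteqP; split=> x /=; rewrite in_itv/= andbT.
    by move=> ax; rewrite gt_eqF// flat_gt0// subr_gt0.
  by move=> H; rewrite ltNge; apply/negP => xa; move: H; rewrite flat_le0 ?eqxx// subr_le0.
exact.
Qed.

(** The test function [th] supplies integrability and compact support, so [g * th] may be paired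
    with any smooth function. Pairing with 1 - (1 - c)^k and dominated convergence give integral
    zero over the sets [b != 0]; Dynkin induction extends this to all measurable sets. *)
Lemma weak_integral_eq0_loc U g th : open U -> measurable_fun U g ->
  (forall phi, test_function U phi ->
    leb.-integrable U (EFin \o (fun x => g x * phi x)) /\
    \int[leb]_(x in U) (g x * phi x) = 0) ->
  test_function U th -> {ae leb, forall x, U x -> g x * th x = 0}.
Proof.
move=> oU mg Hg tth; have mU := open_measurable_rV oU.
set f := fun x => g x * th x.
have [fi _] := Hg _ tth.
have f0 b : smooth b -> \int[leb]_(x in U `&` [set x | b x != 0]) f x = 0.
  move=> sb.
  pose c x := b x * b x / (1 + b x * b x).
  have b2 x : 0 <= b x * b x by rewrite -expr2 sqr_ge0.
  have b20 x : 1 + b x * b x != 0 by rewrite gt_eqF// ltr_pwDl.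
  have sc : smooth c.
    apply: smooth_mul; first exact: smooth_mul.
    move=> k; apply: Ck_inv => //; apply: Ck_add; first exact: Ck_cst.
    exact: Ck_mul.
  pose psi (k : nat) x := 1 - (1 - c x) ^+ k.
  have spsi k : smooth (psi k).
    apply: smooth_sub; first exact: smooth_cst.
    move=> j; apply: Ck_exp; apply: Ck_sub; [exact: Ck_cst|exact: sc].
  have c01 x : 0 <= 1 - c x <= 1.
    have d0 : 0 < 1 + b x * b x by rewrite ltr_pwDl.
    by rewrite subr_ge0 gerBl ler_pdivrMr// mul1r lerDr ler01 divr_ge0// ltW.
  have H k : \int[leb]_(x in U) (f x * psi k x) = 0.
    have [_ <-] := Hg _ (test_mul tth (spsi k)).
    by apply: eq_Rintegral => x _; rewrite mulrA.
  have Hi k : leb.-integrable U (EFin \o (fun x => f x * psi k x)).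
    have [+ _] := Hg _ (test_mul tth (spsi k)); apply: eq_integrable => // x _.
    by rewrite /= mulrA.
  have [||||| _ _ L] := @dominated_convergence _ _ _ leb U mU
    (fun k => EFin \o (fun x => f x * psi k x))
    (EFin \o (fun x => f x * (\1_[set x | b x != 0] x))) (EFin \o (fun x => `|f x|)).
  - by move=> k; apply: measurable_int (Hi k).
  - apply/measurable_EFinP; apply: measurable_funM.
      by apply/measurable_EFinP; exact: measurable_int fi.
    apply: measurable_indic; rewrite measurable_nonzero_sets.
    by apply: sub_sigma_algebra; exists b.
  - apply: aeW => x _; apply: cvg_EFin; first exact: nearW.
    apply: cvgM; first exact: cvg_cst.
    rewrite indicE; have [/set_mem /= bx|bx] := boolP (x \in _).
      rewrite -[X in _ --> X]subr0; apply: cvgB; first exact: cvg_cst.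
      apply: cvg_expr; rewrite ger0_norm; last by case/andP: (c01 x).
      by rewrite ltrBlDr ltrDl divr_gt0// ?ltr_pwDl// lt_neqAle b2 eq_sym mulf_neq0.
    have bx0 : b x = 0.
      by apply/eqP/negPn/negP => H'; move/negP: bx; apply; rewrite inE.
    rewrite /psi /c bx0 mulr0 mul0r subr0 (_ : (fun k => _) = fun=> 0); first exact: cvg_cst.
    by apply/funext => k; rewrite expr1n subrr.
  - exact: integrable_norm fi.
  - apply: aeW => x k _ /=; rewrite lee_fin normrM ler_piMr//.
    have /andP[c0 c1] := c01 x.
    have := exprn_ge0 k c0; have := exprn_ile1 k c0 c1.
    by rewrite /psi ler_norml => h1 h2; apply/andP; split; lra.
  rewrite Rintegral_mkcondr /Rintegral.
  rewrite (_ : [sequence _]_n = fun=> 0%E) in L; last first.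
    by apply/funext => k /=; rewrite -EFin_Rintegral// H.
  have E := cvg_unique _ L (cvg_cst 0%E).
  rewrite -[RHS]/(fine 0%E) -E//; congr fine; apply: eq_integral => x _.
  rewrite /= patchE indicE; case: ifP => _; by rewrite ?mulr1 ?mulr0.
have fE E : measurable E -> \int[leb]_(x in U `&` E) f x = 0.
  move=> mE; have := @dynkin_induction _ _ nonzero_sets
    (fun E => \int[leb]_(x in U `&` E) f x = 0) measurable_nonzero_sets
    nonzero_sets_setI.
  have fS S : measurable S -> leb.-integrable (U `&` S) (EFin \o f).
    by move=> mS; apply: integrableS fi => //; exact: measurableI.
  have U0 : \int[leb]_(x in U) f x = 0.
    rewrite -[U]setIT -(f0 (fun=> 1)); last exact: smooth_cst.
    by congr (Rintegral _ (_ `&` _) _); apply/seteqP; split => // x _ /=; rewrite oner_neq0.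
  apply; last by rewrite -measurable_nonzero_sets.
  - by rewrite setIT.
  - by move=> _ [b sb ->]; exact: f0.
  - move=> S mS fS0; have UE : U = (U `&` S) `|` (U `&` ~` S).
      by rewrite -setIUr setUv setIT.
    have mUS := measurableI _ _ mU mS.
    have mUC := measurableI _ _ mU (measurableC mS).
    have := U0; rewrite {1}UE Rintegral_setU// -?UE//.
      by rewrite fS0 add0r.
    by apply/disj_set2P; rewrite setIACA setICr setI0.
  - move=> F mF tF F0; rewrite setI_bigcupr /Rintegral integral_bigcup.
    + rewrite eseries0// => k _ _; rewrite -EFin_Rintegral ?F0//; first exact: measurableI.
      exact: fS.
    + apply/trivIsetP => i j _ _ ij; rewrite setIACA setIid.
      by move/trivIsetP : tF => ->//; rewrite setI0.
    + by move=> k; exact: measurableI.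
    + by rewrite -setI_bigcupr; apply: fS; exact: bigcupT_measurable.
have : ae_eq leb U (EFin \o f) (cst 0%E).
  apply: integral_ae_eq => //.
  move=> E EU mE; rewrite integral0.
  rewrite -[E in integral _ E](setIidr EU).
  rewrite -EFin_Rintegral ?fE//; first exact: measurableI.
  by apply: integrableS fi => //; exact: measurableI.
by apply: filterS => x /= H /H [].
Qed.

(** Cutoffs that equal 1 on the sets of the compact exhaustion reduce the claim to countably many
    applications of the local version. *)
Lemma weak_integral_eq0 U g : open U -> measurable_fun U g ->
  (forall phi, test_function U phi ->
    leb.-integrable U (EFin \o (fun x => g x * phi x)) /\
    \int[leb]_(x in U) (g x * phi x) = 0) ->
  {ae leb, forall x, U x -> g x = 0}.
Proof.
move=> oU mg Hg.
have /choice[eta Heta] n : exists eta : 'rV[R]_m -> R, test_function U eta /\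
    forall x, inner U n x -> eta x = 1.
  have [eta [te _ [V _ [KV V1]]]] := exists_cutoff oU (@compact_inner _ _ U n) (@inner_sub _ _ U n).
  by exists eta; split => // x /KV/V1.
have : {ae leb, forall x n, U x -> g x * eta n x = 0}.
  apply/ae_foralln => n; have [te _] := Heta n.
  exact: weak_integral_eq0_loc.
apply: filterS => x Hx Ux.
have [n Hn] : exists n, [set x] `<=` inner U n.
  by apply: inner_cover => // [|_ ->//]; exact: compact_set1.
by have := Hx n Ux; have [_ ->] := Heta n; rewrite ?mulr1//; apply: Hn.
Qed.

End calculus_integral.

(** * Square integrable functions *)

Section L2.
Context d (T : measurableType d) {R : realType} (mu : {measure set T -> \bar R}).
Implicit Types (U V : set T) (f g : T -> R).

(** Refers to [U] only, whereas [memL] extends by zero to the whole space; [memL2P] identifies the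
    two for measurable [U]. *)
Definition L2 U f := measurable_fun U f /\
  mu.-integrable U (EFin \o (fun x => f x ^+ 2)).

Variables (U : set T) (mU : measurable U).

Lemma L2_mul f g : L2 U f -> L2 U g ->
  mu.-integrable U (EFin \o (fun x => f x * g x)).
Proof.
move=> [mf f2] [mg g2].
have fg : mu.-integrable U (EFin \o (fun x => f x ^+ 2 + g x ^+ 2)).
  exact: rintegrableD.
apply: (rintegrable_le mU _ _ fg); first exact: measurable_funM.
move=> x _; rewrite normrM -[f x ^+ 2]real_normK ?num_real//.
by rewrite -[g x ^+ 2]real_normK ?num_real//; nra.
Qed.

Lemma L2_lin (a b : R) f g : L2 U f -> L2 U g -> L2 U (fun x => a * f x + b * g x).
Proof.
move=> Lf Lg; have [mf f2] := Lf; have [mg g2] := Lg; split.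
  by apply: measurable_funD; apply: measurable_funM.
rewrite (_ : (fun x => _) = (fun x => (a ^+ 2) * f x ^+ 2 + ((2 * a * b) * (f x * g x) +
  b ^+ 2 * g x ^+ 2))); last by apply/funext => x; ring.
apply: rintegrableD => //; first exact: rintegrableZ.
apply: rintegrableD => //; first by apply: rintegrableZ => //; exact: L2_mul.
exact: rintegrableZ.
Qed.

Lemma L2_ext f g : (forall x, U x -> f x = g x) -> L2 U f -> L2 U g.
Proof.
move=> fg [mf f2]; have fg' x : x \in U -> f x = g x by rewrite inE => /fg.
split; first exact: (eq_measurable_fun f).
by apply: eq_integrable f2 => // x /fg' /= ->.
Qed.

Lemma L2D f g : L2 U f -> L2 U g -> L2 U (fun x => f x + g x).
Proof.
by move=> Lf Lg; apply: L2_ext (L2_lin 1 1 Lf Lg) => x _; rewrite !mul1r.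
Qed.

Lemma L2B f g : L2 U f -> L2 U g -> L2 U (fun x => f x - g x).
Proof.
by move=> Lf Lg; apply: L2_ext (L2_lin 1 (-1) Lf Lg) => x _; rewrite mul1r mulN1r.
Qed.

Lemma L2_bounded_mul (w : T -> R) M f : measurable_fun U w ->
  (forall x, U x -> `|w x| <= M) -> L2 U f -> L2 U (fun x => w x * f x).
Proof.
move=> mw wM [mf f2]; split; first exact: measurable_funM.
have H : mu.-integrable U (EFin \o (fun x => (M ^+ 2) * f x ^+ 2)).
  exact: rintegrableZ.
apply: (rintegrable_le mU _ _ H).
  by apply: measurable_funX; exact: measurable_funM.
move=> x Ux; rewrite ger0_norm ?sqr_ge0// exprMn ler_wpM2r ?sqr_ge0//.
rewrite -real_normK ?num_real// lerXn2r ?nnegrE ?wM//.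
exact: le_trans (wM _ Ux).
Qed.

Lemma L2_bounded f M : (mu U < +oo)%E -> measurable_fun U f ->
  (forall x, U x -> `|f x| <= M) -> L2 U f.
Proof.
move=> Uoo mf fM; split => //; apply: measurable_bounded_integrable => //.
  exact: measurable_funX.
exists (M ^+ 2); split => [|r Mr x Ux]; rewrite ?num_real//=.
rewrite ger0_norm ?sqr_ge0// (le_trans _ (ltW Mr))//.
rewrite -real_normK ?num_real// lerXn2r ?nnegrE ?fM//.
exact: le_trans (fM _ Ux).
Qed.

Lemma L2_sub V f : measurable V -> V `<=` U -> L2 U f -> L2 V f.
Proof.
move=> mV VU [mf f2]; split; first exact: measurable_funS mf.
exact: integrableS f2.
Qed.

Lemma Rintegral_ae_eq f g : measurable_fun U f -> measurable_fun U g ->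
  {ae mu, forall x, U x -> f x = g x} ->
  \int[mu]_(x in U) f x = \int[mu]_(x in U) g x.
Proof.
move=> mf mg fg; congr fine; apply: ae_eq_integral => //.
- exact/measurable_EFinP.
- exact/measurable_EFinP.
- by apply: filterS fg => x H Ux; rewrite H.
Qed.

(** Replacing [f] by the minimum of [f] and [g], which equals [f] almost everywhere, turns the
    inequality into one that holds everywhere. *)
Lemma ae_le_Rintegral f g : mu.-integrable U (EFin \o f) ->
  mu.-integrable U (EFin \o g) -> {ae mu, forall x, U x -> f x <= g x} ->
  \int[mu]_(x in U) f x <= \int[mu]_(x in U) g x.
Proof.
move=> fi gi fg.
have mf : measurable_fun U f by apply/measurable_EFinP; exact: measurable_int fi.
have mg : measurable_fun U g by apply/measurable_EFinP; exact: measurable_int gi.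
pose f' x := Num.min (f x) (g x).
have mf' : measurable_fun U f' by exact: measurable_minr.
have f'i : mu.-integrable U (EFin \o f').
  have := rintegrableD mU (integrable_norm fi) (integrable_norm gi).
  apply: rintegrable_le => // x _; rewrite /f' minEle; case: ifP => _ /=.
    by rewrite lerDl.
  by rewrite lerDr.
rewrite (@Rintegral_ae_eq f f')//.
  by apply: le_Rintegral => // x _; rewrite /f' ge_min lexx orbT.
by apply: filterS fg => x H Ux; rewrite /f' min_l// H.
Qed.

Lemma le_Rintegral_sub V f : measurable V -> V `<=` U ->
  mu.-integrable U (EFin \o f) -> (forall x, U x -> 0 <= f x) ->
  \int[mu]_(x in V) f x <= \int[mu]_(x in U) f x.
Proof.
move=> mV VU fi f0; have fiV := integrableS mU mV VU fi.
rewrite -lee_fin !EFin_Rintegral//; apply: ge0_subset_integral => //.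
exact: measurable_int fi.
Qed.

End L2.

(** * Completeness of L^2 *)

Section L2_complete.
Context d (T : measurableType d) {R : realType} (mu : {measure set T -> \bar R}).
Variables (U : set T) (mU : measurable U).
Implicit Types (f g : T -> R).

Let nrm f := \int[mu]_(x in U) f x ^+ 2.

(* A subsequence with \int (g_(k+1) - g_k)^2 <= 8^-k converges a.e., since    *)
(* \sum_k 4^k (g_(k+1) - g_k)^2 is integrable. *)
Let fast_cvg (g : nat -> T -> R) : (forall k, L2 mu U (g k)) ->
  (forall k, nrm (fun x => g k.+1 x - g k x) <= (8^-1) ^+ k) ->
  {ae mu, forall x, U x -> cvgn (fun k => g k x)}.
Proof.
move=> Lg Hg.
pose D k x := 4 ^+ k * (g k.+1 x - g k x) ^+ 2.
have Ld k := L2B mU (Lg k.+1) (Lg k).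
have D0 k x : 0 <= D k x by rewrite mulr_ge0 ?sqr_ge0 ?exprn_ge0.
have mD k : measurable_fun U (D k).
  by apply: measurable_funM => //; apply: measurable_funX; case: (Ld k).
have iD k : (\int[mu]_(x in U) (D k x)%:E <= ((2^-1) ^+ k)%:E)%E.
  rewrite -EFin_Rintegral//; last by apply: rintegrableZ => //; case: (Ld k).
  rewrite lee_fin RintegralZl//; last by case: (Ld k).
  rewrite (_ : 2^-1 ^+ k = 4 ^+ k * 8^-1 ^+ k).
    by rewrite ler_wpM2l ?exprn_ge0// Hg.
  by rewrite -exprMn; congr (_ ^+ _); lra.
have intS : (\int[mu]_(x in U) (\sum_(k <oo) (D k x)%:E) < +oo)%E.
  rewrite integral_nneseries//; last 2 first.
    by move=> k; exact/measurable_EFinP.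
    by move=> k x _; rewrite lee_fin.
  apply: (@le_lt_trans _ _ (\sum_(k <oo) ((2^-1) ^+ k : R)%:E)%E).
    apply: lee_nneseries => [k _ _|k _]; last exact: iD.
    by apply: integral_ge0 => x _; rewrite lee_fin.
  apply: (@le_lt_trans _ _ (2%:E : \bar R)); last exact: ltry.
  apply: lime_le; first by apply: is_cvg_nneseries => k _ _; rewrite lee_fin exprn_ge0.
  apply: nearW => n; rewrite sumEFin lee_fin.
  have -> : \sum_(0 <= i < n) (2^-1 : R) ^+ i = 2 - 2 * 2^-1 ^+ n.
    elim: n => [|n ih]; first by rewrite big_geq// expr0; lra.
    by rewrite big_nat_recr//= ih exprS; lra.
  by rewrite gerBl mulr_ge0 ?exprn_ge0.
have mS : measurable_fun U (fun x => \sum_(k <oo) (D k x)%:E)%E.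
  apply: ge0_emeasurable_sum => [k x _ _|k _]; first by rewrite lee_fin.
  exact/measurable_EFinP.
have : mu.-integrable U (fun x => \sum_(k <oo) (D k x)%:E)%E.
  apply/integrableP; split => //.
  rewrite (eq_integral (fun x => \sum_(k <oo) (D k x)%:E)%E)//= => x _.
  by rewrite gee0_abs// nneseries_ge0// => k _ _; rewrite lee_fin.
move=> /(integrable_ae mU); apply: filterS => x /[apply] Sfin.
pose S := (\sum_(k <oo) (D k x)%:E)%E.
have DS k : D k x <= fine S.
  rewrite -lee_fin fineK//.
  have := nneseries_lim_ge (u_ := fun k => (D k x)%:E) (m := 0%N) (P := xpredT) k.+1.
  move=> /(_ (fun n _ _ => D0 n x))/(le_trans _); apply.
  rewrite big_nat_recr//= leeDr// sume_ge0// => i _; by rewrite lee_fin.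
(* Each term 4^k d_k^2 is at most the finite sum, so d_k is dominated by a geometric sequence and
   the telescoping series converges. *)
have dS k : `|g k.+1 x - g k x| <= Num.sqrt (fine S) * 2^-1 ^+ k.
  rewrite -(@ler_pXn2r _ 2)// ?nnegrE ?mulr_ge0 ?sqrtr_ge0 ?exprn_ge0//.
  rewrite exprMn sqr_sqrtr ?(le_trans (D0 0%N x))// real_normK ?num_real//.
  rewrite -exprM mulnC exprM (_ : 2^-1 ^+ 2 = 4^-1); last by lra.
  by rewrite exprVn ler_pdivlMr ?exprn_gt0// mulrC DS.
pose d_ := fun k => g k.+1 x - g k x.
have cd : cvgn (series d_).
  apply: normed_cvg; apply: (@series_le_cvg _ _ (geometric (Num.sqrt (fine S)) 2^-1)).
  - by move=> n /=.
  - by move=> n /=; rewrite mulr_ge0 ?sqrtr_ge0 ?exprn_ge0.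
  - by move=> n; exact: dS.
  - apply: is_cvg_geometric_series; rewrite ger0_norm//; lra.
have -> : (fun k => g k x) = (fun k => g 0%N x + series d_ k).
  by apply/funext => k; rewrite /series /= telescope_sumr// addrC subrK.
by apply: is_cvgD => //; exact: is_cvg_cst.
Qed.

(** Riesz-Fischer: the limit is found almost everywhere along a fast subsequence, and Fatou's lemma
    carries the Cauchy bound for f_j - g_i over to f_j - G, for every large j and not only along the
    subsequence. *)
Theorem L2_complete (f : nat -> T -> R) : (forall k, L2 mu U (f k)) ->
  (forall e, 0 < e -> exists N, forall j k, (N <= j)%N -> (N <= k)%N ->
     nrm (fun x => f j x - f k x) <= e) ->
  exists2 g, L2 mu U g & nrm (fun x => f k x - g x) @[k --> \oo] --> 0.
Proof.
move=> Lf Cf.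
have /choice[N HN] k : exists N, forall i j, (N <= i)%N -> (N <= j)%N ->
    nrm (fun x => f i x - f j x) <= 8^-1 ^+ k.
  by apply: Cf; rewrite exprn_gt0// invr_gt0.
(* Partial sums make the indices nondecreasing while keeping them at least [N k]. *)
pose n k := (\sum_(i < k.+1) N i)%N.
have nS k : (n k <= n k.+1)%N by rewrite /n [leqRHS]big_ord_recr/= leq_addr.
have Nn k : (N k <= n k)%N by rewrite /n big_ord_recr/= leq_addl.
pose g k := f (n k).
have g_cv : {ae mu, forall x, U x -> cvgn (fun k => g k x)}.
  apply: fast_cvg => [k|k]; first exact: Lf.
  by apply: HN => //; exact: leq_trans (Nn k) (nS k).
(* The upper limit is measurable and defined everywhere; [fine] makes it real on the null set where
   the subsequence diverges. *)
pose G x := fine (limn_esup (fun k => (g k x)%:E)).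
have mG : measurable_fun U G.
  apply: (measurableT_comp (f := fine)) => //.
  apply: measurable_fun_limn_esup => k; apply/measurable_EFinP.
  by case: (Lf (n k)).
have gG : {ae mu, forall x, U x -> g k x @[k --> \oo] --> G x}.
  apply: filterS g_cv => x /[apply] /cvg_ex[l gl].
  have E : (fun k => (g k x)%:E) @ \oo --> l%:E by apply: cvg_EFin => //; exact: nearW.
  rewrite /G is_cvg_limn_esupE; last by apply/cvg_ex; exists l%:E.
  by rewrite (cvg_lim _ E).
have mono k j : (k <= j)%N -> (n k <= n j)%N.
  elim: j => [|j ih]; first by rewrite leqn0 => /eqP->.
  by rewrite leq_eqVlt => /predU1P[->//|/ih/leq_trans]; apply.
have key j k : (N k <= j)%N -> (\int[mu]_(x in U) ((f j x - G x) ^+ 2)%:E <= (8^-1 ^+ k)%:E)%E.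
  move=> Nj.
  have Ld i := L2B mU (Lf j) (Lf (n i)).
  have mF i : measurable_fun U (fun x => ((f j x - g i x) ^+ 2)%:E).
    by apply/measurable_EFinP; apply: measurable_funX; case: (Ld i).
  have F0 i x : U x -> (0 <= ((f j x - g i x) ^+ 2)%:E)%E by rewrite lee_fin sqr_ge0.
  have := fatou mu mU mF F0.
  have -> : (\int[mu]_(x in U) limn_einf ((fun i => (fun x => ((f j x - g i x) ^+ 2)%:E))^~ x) =
             \int[mu]_(x in U) ((f j x - G x) ^+ 2)%:E)%E.
    apply: ae_eq_integral => //.
    - rewrite (_ : (fun x => _) =
          (fun x => - limn_esup (fun i => - ((f j x - g i x) ^+ 2)%:E))%E).
        apply: measurableT_comp => //; apply: measurable_fun_limn_esup => i.
        exact: measurableT_comp.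
      by apply/funext => x /=; rewrite -limn_einfN; congr limn_einf; apply/funext => i /=; rewrite opprK.
    - apply/measurable_EFinP; apply: measurable_funX; apply: measurable_funB => //.
      by case: (Lf j).
    - apply: filterS gG => x /[apply] H.
      have E : (fun i => ((f j x - g i x) ^+ 2)%:E) @ \oo --> ((f j x - G x) ^+ 2)%:E.
        apply: cvg_EFin; first exact: nearW.
        by apply: cvgM; (apply: cvgB; [exact: cvg_cst|exact: H]).
      rewrite is_cvg_limn_einfE; last by apply/cvg_ex; eexists; exact: E.
      exact: (cvg_lim _ E).
  move=> /le_trans; apply.
  rewrite limn_einf_lim; apply: lime_le; first exact: is_cvg_einfs.
  near=> i.
  apply: (@le_trans _ _ (\int[mu]_(x in U) ((f j x - g i x) ^+ 2)%:E)%E).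
    by apply: ereal_inf_lbound; exists i => /=.
  rewrite -EFin_Rintegral//; last by case: (Ld i).
  rewrite lee_fin; apply: HN => //; apply: leq_trans (Nn k) _; apply: mono.
  by near: i; exact: nbhs_infty_ge.
have LdG j : L2 mu U (fun x => f (N j) x - G x).
  split; first by apply: measurable_funB => //; case: (Lf (N j)).
  apply/integrableP; split.
    apply/measurable_EFinP; apply: measurable_funX; apply: measurable_funB => //.
    by case: (Lf (N j)).
  under eq_integral do rewrite /= ger0_norm ?sqr_ge0//.
  by apply: le_lt_trans (key _ _ (leqnn (N j))) _; rewrite ltry.
have LG : L2 mu U G.
  by apply: L2_ext (L2B mU (Lf (N 0%N)) (LdG 0%N)) => // x _; rewrite opprB addrC subrK.
exists G => //; apply/cvgr0Pnorm_le => e e0.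
have [k _ Hk] : exists2 k : nat, True & 8^-1 ^+ k <= e.
  have : (8^-1 : R) ^+ k @[k --> \oo] --> 0 by apply: cvg_expr; rewrite ger0_norm; lra.
  move=> /cvgr0Pnorm_le/(_ e e0)[k _ Hk]; exists k => //.
  by have := Hk k (leqnn k); rewrite ger0_norm ?exprn_ge0.
exists (N k) => //= j Nj; rewrite ger0_norm; last first.
  by apply: Rintegral_ge0 => x _; exact: sqr_ge0.
apply: le_trans Hk; rewrite -lee_fin /nrm EFin_Rintegral//; first exact: key.
by case: (L2B mU (Lf j) LG).
Unshelve. all: by end_near. Qed.

End L2_complete.

Section memL.
Context {R : realType} {m : nat}.
Implicit Types (U : set 'rV[R]_m) (f : 'rV[R]_m -> R).

Lemma L2normE U f : measurable U -> L2 leb U f ->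
  L2norm U f = (Num.sqrt (\int[leb]_(x in U) f x ^+ 2))%:E.
Proof.
move=> mU Lf; rewrite /L2norm Lnorm.unlock.
have -> : (\int[leb]_x (`|(EFin \o (f \_ U)) x| `^ 2) =
    \int[leb]_(x in U) (f x ^+ 2)%:E)%E.
  rewrite [RHS]integral_mkcond; apply: eq_integral => x _ /=.
  rewrite !patchE; case: ifP => _ /=; last by rewrite normr0 powR0 ?pnatr_eq0.
  by rewrite powR_mulrn// real_normK ?num_real.
rewrite -EFin_Rintegral//; last by case: Lf.
by rewrite poweR_EFin powR12_sqrt// Rintegral_ge0// => x _; exact: sqr_ge0.
Qed.

Lemma memL2P U f : measurable U -> memL 2%:E U f <-> L2 leb U f.
Proof.
move=> mU; split.
  move=> Hf; have Hi := Lfun2_integrable_sqr Hf.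
  have mf : measurable_fun U f.
    move: Hf; rewrite /memL inE => /andP[]; rewrite inE /= => + _.
    by move/(measurable_restrictT f mU).
  split => //; apply/(integrable_mkcond _ mU).
  apply: eq_integrable Hi => // x _ /=; rewrite !patchE.
  by case: ifP => //= _; rewrite expr0n.
move=> Lf; have [mf f2] := Lf; rewrite /memL inE; apply/andP; split; rewrite inE/=.
  exact/(measurable_restrictT f mU).
rewrite /finite_norm -/(L2norm U f).
by rewrite (L2normE mU Lf) ltry.
Qed.

End memL.

(** * Weak gradients *)

Section weak_gradient_theory.
Context {R : realType} {m : nat}.
Implicit Types (U K : set 'rV[R]_m) (u v w phi : 'rV[R]_m -> R).
Implicit Types (F G H : 'rV[R]_m -> 'rV[R]_m).

Definition L2v U F := forall i, L2 leb U (fun x => F x ord0 i).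

Lemma L2v_lin U (a b : R) F G : measurable U -> L2v U F -> L2v U G ->
  L2v U (fun x => a *: F x + b *: G x).
Proof.
move=> mU LF LG i; apply: L2_ext (L2_lin mU a b (LF i) (LG i)) => // x _.
by rewrite !mxE.
Qed.

Lemma L2v_ext U F G : measurable U -> (forall x, U x -> F x = G x) -> L2v U F -> L2v U G.
Proof. by move=> mU FG LF i; apply: L2_ext (LF i) => // x /FG ->. Qed.

Lemma L2v_sub U V F : measurable U -> measurable V -> V `<=` U -> L2v U F -> L2v V F.
Proof. by move=> mU mV VU LF i; exact: L2_sub (LF i). Qed.

(* weighted inner product *)
Definition wip U (g : 'rV[R]_m -> R) F G : R :=
  \int[leb]_(x in U) (g x * dot (F x) (G x)).

(** No sign is required, because gamma - 1 also serves as a weight; positivity is a separate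
    hypothesis where it is used. *)
Definition weight U (g : 'rV[R]_m -> R) :=
  measurable_fun U g /\ exists M, forall x, U x -> `|g x| <= M.

Lemma weight1 U : weight U (fun=> 1).
Proof. by split; [exact: measurable_cst|exists 1 => x _; rewrite normr1]. Qed.

Lemma dotC (x y : 'rV[R]_m) : dot x y = dot y x.
Proof. by apply: eq_bigr => i _; rewrite mulrC. Qed.

Lemma dot_lin (a b : R) (x y z : 'rV[R]_m) :
  dot (a *: x + b *: y) z = a * dot x z + b * dot y z.
Proof.
rewrite /dot !mulr_sumr -big_split/=; apply: eq_bigr => i _.
by rewrite !mxE mulrDl !mulrA.
Qed.

Lemma dot_ge0 (x : 'rV[R]_m) : 0 <= dot x x.
Proof. by apply: sumr_ge0 => i _; rewrite -expr2 sqr_ge0. Qed.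

Lemma enorm_sqr (x : 'rV[R]_m) : enorm x ^+ 2 = dot x x.
Proof. by rewrite /enorm sqr_sqrtr// dot_ge0. Qed.

Lemma wip_integrable U g F G : measurable U -> weight U g -> L2v U F -> L2v U G ->
  leb.-integrable U (EFin \o (fun x => g x * dot (F x) (G x))).
Proof.
move=> mU [mg [M gM]] LF LG; rewrite /dot.
rewrite (_ : (fun x => _) = (fun x => \sum_(i < m) (g x * F x ord0 i * G x ord0 i))).
  apply: rintegrable_sum => // i; apply: L2_mul => //.
  exact: L2_bounded_mul gM _.
by apply/funext => x; rewrite mulr_sumr; apply: eq_bigr => i _; rewrite mulrA.
Qed.

Lemma wip_measurable U (g : 'rV[R]_m -> R) F G : measurable U -> measurable_fun U g ->
  L2v U F -> L2v U G -> measurable_fun U (fun x => g x * dot (F x) (G x)).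
Proof.
move=> mU mg LF LG; apply: measurable_funM => //; rewrite /dot.
apply: measurable_sum => i; apply: measurable_funM.
  by case: (LF i).
by case: (LG i).
Qed.

Lemma wipC U g F G : wip U g F G = wip U g G F.
Proof. by apply: eq_Rintegral => x _; rewrite dotC. Qed.

Lemma wip_lin U g (a b : R) F G H (K : 'rV[R]_m -> 'rV[R]_m) : measurable U -> weight U g ->
  L2v U F -> L2v U G -> L2v U H -> L2v U K ->
  {ae leb, forall x, U x -> F x = a *: G x + b *: H x} ->
  wip U g F K = a * wip U g G K + b * wip U g H K.
Proof.
move=> mU wg LF LG LH LK E; have [mg _] := wg.
have iG := wip_integrable mU wg LG LK; have iH := wip_integrable mU wg LH LK.
rewrite -!RintegralZl// -RintegralD//; [|exact: rintegrableZ..].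
apply: Rintegral_ae_eq => //.
- exact: wip_measurable.
- by apply: measurable_funD; apply: measurable_funM => //; exact: wip_measurable.
by apply: filterS E => x H' /H' ->; rewrite dot_lin mulrDr !(mulrCA (g x)).
Qed.

Lemma wip_ae U g g' F F' G : measurable U -> weight U g -> weight U g' ->
  L2v U F -> L2v U F' -> L2v U G ->
  {ae leb, forall x, U x -> g x = g' x} ->
  {ae leb, forall x, U x -> F x = F' x} -> wip U g F G = wip U g' F' G.
Proof.
move=> mU [mg _] [mg' _] LF LF' LG gg' FF'.
apply: Rintegral_ae_eq => //; [exact: wip_measurable..|].
by apply: filterS2 gg' FF' => x H1 H2 Ux; rewrite H1// H2.
Qed.

Lemma wip_le U g g' F : measurable U -> weight U g -> weight U g' -> L2v U F ->
  {ae leb, forall x, U x -> g x <= g' x} -> wip U g F F <= wip U g' F F.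
Proof.
move=> mU wg wg' LF gg'; apply: ae_le_Rintegral => //; [exact: wip_integrable..|].
by apply: filterS gg' => x H Ux; rewrite ler_wpM2r ?dot_ge0// H.
Qed.

Lemma wip1_ge0 U F : 0 <= wip U (fun=> 1) F F.
Proof. by apply: Rintegral_ge0 => x _; rewrite mul1r dot_ge0. Qed.

Lemma wip_cst U g (a : R) F G : measurable U -> weight U g -> L2v U F -> L2v U G ->
  wip U (fun x => a * g x) F G = a * wip U g F G.
Proof.
move=> mU wg LF LG; rewrite -RintegralZl//; last exact: wip_integrable.
by apply: eq_Rintegral => x _; rewrite mulrA.
Qed.

Lemma wip_ge0 U g F : measurable U -> weight U g -> L2v U F ->
  {ae leb, forall x, U x -> 0 <= g x} -> 0 <= wip U g F F.
Proof.
move=> mU wg LF g0; apply: le_trans (_ : _ <= wip U (fun x => 0 * 1) F F) _.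
  by apply: Rintegral_ge0 => x _; rewrite !mul0r.
apply: wip_le => //; last by apply: filterS g0 => x H /H; rewrite mul0r.
by split; [exact: measurable_cst|exists 0 => x _; rewrite mul0r normr0].
Qed.

(* Cauchy-Schwarz in the division-free form  2 |Q(F, G)| <= s Q(F) + Q(G) / s *)
Lemma wip_young U g (s : R) F G : measurable U -> weight U g -> L2v U F -> L2v U G ->
  {ae leb, forall x, U x -> 0 <= g x} -> 0 < s ->
  2 * `|wip U g F G| <= s * wip U g F F + s^-1 * wip U g G G.
Proof.
move=> mU wg LF LG g0 s0.
have H (e : R) : e ^+ 2 = 1 -> - (2 * e * wip U g F G) <=
    s * wip U g F F + s^-1 * wip U g G G.
  move=> e2; pose K x := s *: F x + e *: G x.
  have LK : L2v U K by exact: L2v_lin.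
  have K0 := wip_ge0 mU wg LK g0.
  have E1 L : L2v U L -> wip U g K L = s * wip U g F L + e * wip U g G L.
    by move=> LL; apply: wip_lin => //; exact: aeW.
  rewrite E1// ![wip U g _ K]wipC !E1// [wip U g G F]wipC in K0.
  have sV : 0 < s^-1 by rewrite invr_gt0.
  have := mulr_ge0 (ltW sV) K0.
  move: (wip U g F F) (wip U g G G) (wip U g F G) => a b c.
  have -> : s^-1 * (s * (s * a + e * c) + e * (s * c + e * b)) =
     s * a + 2 * e * c + s^-1 * (e ^+ 2 * b) by field; rewrite gt_eqF.
  by rewrite e2 mul1r; lra.
have [h|h] := ger0P (wip U g F G).
  by have := H (-1); rewrite sqrrN expr1n => /(_ erefl); lra.
by have := H 1; rewrite expr1n => /(_ erefl); lra.
Qed.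

Lemma weight_sub U V g : measurable U -> measurable V -> V `<=` U -> weight U g -> weight V g.
Proof.
move=> mU mV VU [mg [M gM]]; split; first exact: measurable_funS mg.
by exists M => x /VU/gM.
Qed.

(** The product vanishes near every point outside the support of [phi], so [f] may be singular off
    U, as the fundamental solution is at its pole. *)
Lemma continuous_test_mul U (f : 'rV[R]_m -> R) phi : (forall x, U x -> {for x, continuous f}) ->
  test_function U phi -> continuous (fun x => f x * phi x).
Proof.
move=> cf /test_functionP[sp cp pU] x; have [Sx|Sx] := pselect (fsupp phi x).
  apply: (@continuousM _ _ f phi); first exact: cf (pU _ Sx).
  exact: smooth_continuous.
have N : \forall y \near x, f y * phi y = 0.
  have : nbhs x (~` fsupp phi).
    by apply: open_nbhs_nbhs; split=> //; apply: closed_openC; exact: closed_closure.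
  by apply: filterS => y /fsuppPn ->; rewrite mulr0.
rewrite /continuous_at (nbhs_singleton N) => A A0.
by move: N; apply: filterS => y /= ->; exact: nbhs_singleton.
Qed.

Lemma test_supp_integral U phi (f : 'rV[R]_m -> R) : measurable U ->
  test_function U phi -> (forall x, phi x = 0 -> f x = 0) ->
  \int[leb]_(x in U) f x = \int[leb]_x f x.
Proof.
move=> mU /test_functionP[_ _ pU] f0; rewrite Rintegral_mkcond.
apply: eq_Rintegral => x _; rewrite patchE; case: ifPn => // /negP H.
by rewrite f0//; apply: fsuppPn => /pU Ux; apply: H; rewrite inE.
Qed.

(** The product u phi has compact support and a continuous partial derivative on the whole space, so
    the integral of that derivative vanishes by [integral_derive0]. *)
Lemma ibp_test U u (g : 'rV[R]_m -> R) phi i : open U ->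
  (forall x, U x -> {for x, continuous u}) ->
  (forall x, U x -> {for x, continuous g}) ->
  (forall x, U x -> is_derive x (delta_mx ord0 i) u (g x)) ->
  test_function U phi ->
  \int[leb]_(x in U) (u x * partial phi i x) = - \int[leb]_(x in U) (g x * phi x).
Proof.
move=> oU cu cg dg tp; have mU := open_measurable_rV oU.
have [sp cp pU] := (iffLR (test_functionP U phi) tp).
have tp' := test_partial i tp.
have c1 := continuous_test_mul cu tp'.
have c2 := continuous_test_mul cg tp.
have c3 := continuous_test_mul cu tp.
have i1 : leb.-integrable setT (EFin \o (fun x => u x * partial phi i x)).
  by apply: (supp_integrable cp c1) => x /(partial_fsupp i) ->; rewrite mulr0.
have i2 : leb.-integrable setT (EFin \o (fun x => g x * phi x)).
  by apply: (supp_integrable cp c2) => x /fsuppPn ->; rewrite mulr0.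
rewrite (test_supp_integral mU tp'); last by move=> x ->; rewrite mulr0.
rewrite (test_supp_integral mU tp); last by move=> x ->; rewrite mulr0.
apply/eqP; rewrite -subr_eq0 opprK -RintegralD//; apply/eqP.
rewrite -[RHS](@integral_derive0 _ _ (fsupp phi) (fun x => u x * phi x)
  (fun x => g x * phi x + u x * partial phi i x) i cp c3).
- by apply: eq_Rintegral => x _; rewrite addrC.
- by move=> x; exact: (@continuousD _ _ _ (fun x => g x * phi x)
    (fun x => u x * partial phi i x) x (c2 x) (c1 x)).
- move=> x; have [Sx|Sx] := pselect (fsupp phi x).
    apply: is_derive_mul; first exact: dg (pU _ Sx).
    exact: smooth_is_derive.
  rewrite (fsuppPn Sx) (partial_fsupp i Sx) !mulr0 addr0.
  apply: (@near_eq_is_derive _ _ _ (fun=> 0)).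
  have : nbhs x (~` fsupp phi).
    by apply: open_nbhs_nbhs; split=> //; apply: closed_openC; exact: closed_closure.
  by apply: filterS => y /fsuppPn ->; rewrite mulr0.
- by move=> x /fsuppPn ->; rewrite mulr0.
Qed.

Lemma test_L2 U phi : measurable U -> test_function U phi -> L2 leb U phi.
Proof.
move=> mU /test_functionP[sp cp pU]; split.
  by apply: continuous_measurable_rV => //; exact: smooth_continuous.
apply: (@integrableS _ _ _ _ setT) => //.
apply: (supp_integrable cp); last by move=> x /fsuppPn ->; rewrite expr0n.
by apply: smooth_continuous => k; apply: Ck_exp; exact: sp.
Qed.

Lemma test_grad_L2v U phi : measurable U -> test_function U phi -> L2v U (grad phi).
Proof.
move=> mU tp i; apply: L2_ext (test_L2 mU (test_partial i tp)) => // x _.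
by rewrite mxE.
Qed.

Lemma weak_gradientP U u F : measurable U -> weak_gradient U u F <-> (L2v U F /\
  forall phi, test_function U phi -> forall i,
    \int[leb]_(x in U) (u x * partial phi i x) =
    - \int[leb]_(x in U) (F x ord0 i * phi x)).
Proof.
by move=> mU; split=> -[H1 H2]; split=> // i; have := H1 i => /memL2P; apply.
Qed.

Lemma weak_gradient_C1 U u F : open U -> (leb U < +oo)%E ->
  (forall x, U x -> {for x, continuous u}) ->
  (forall i x, U x -> {for x, continuous (fun y => F y ord0 i)}) ->
  (forall i x, U x -> is_derive x (delta_mx ord0 i) u (F x ord0 i)) ->
  L2v U F -> weak_gradient U u F.
Proof.
move=> oU Uoo cu cF dF LF; have mU := open_measurable_rV oU.
apply/weak_gradientP => //; split=> // phi tp i.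
by apply: (ibp_test oU cu (cF i) (dF i) tp).
Qed.

Lemma weak_gradient_test U phi : open U -> test_function U phi ->
  weak_gradient U phi (grad phi).
Proof.
move=> oU tp; have mU := open_measurable_rV oU.
have [sp cp pU] := (iffLR (test_functionP U phi) tp).
apply/weak_gradientP => //; split; first exact: test_grad_L2v.
move=> psi tpsi i; rewrite (@ibp_test U phi (partial phi i) psi i oU _ _ _ tpsi).
- by congr (- _); apply: eq_Rintegral => x _; rewrite mxE.
- by move=> x _; exact: smooth_continuous.
- by move=> x _; apply: smooth_continuous; exact: Ck_partial_smooth.
- by move=> x _; exact: smooth_is_derive.
Qed.

(** Each coordinate of F - G is orthogonal to all test functions. This is what lets the chosen
    gradient [nabla] be replaced by any explicit one under integrals. *)
Lemma weak_gradient_unique U u F G : open U -> weak_gradient U u F ->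
  weak_gradient U u G -> {ae leb, forall x, U x -> F x = G x}.
Proof.
move=> oU; have mU := open_measurable_rV oU.
move=> /(weak_gradientP _ _ mU)[LF HF] /(weak_gradientP _ _ mU)[LG HG].
have : {ae leb, forall x (i : 'I_m), U x -> F x ord0 i - G x ord0 i = 0}.
  apply: filter_forall => i; apply: weak_integral_eq0 => //.
    by apply: measurable_funB; [case: (LF i)|case: (LG i)].
  move=> phi tp; have Lp := test_L2 mU tp; split.
    by apply: L2_mul => //; exact: L2B.
  have H1 := L2_mul mU (LF i) Lp; have H2 := L2_mul mU (LG i) Lp.
  have := HF _ tp i; rewrite HG// => /oppr_inj E.
  under eq_Rintegral do rewrite mulrBl.
  by rewrite RintegralB// E subrr.
apply: filterS => x H Ux; apply/rowP => i; apply/eqP.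
by rewrite -subr_eq0 H.
Qed.

Lemma weak_gradient_lin U u v F G (a b : R) : open U -> L2 leb U u -> L2 leb U v ->
  weak_gradient U u F -> weak_gradient U v G ->
  weak_gradient U (fun x => a * u x + b * v x) (fun x => a *: F x + b *: G x).
Proof.
move=> oU Lu Lv; have mU := open_measurable_rV oU.
move=> /(weak_gradientP _ _ mU)[LF HF] /(weak_gradientP _ _ mU)[LG HG].
apply/weak_gradientP => //; split; first exact: L2v_lin.
move=> phi tp i; have Lp := test_L2 mU tp; have Lp' := test_L2 mU (test_partial i tp).
have E1 : \int[leb]_(x in U) ((a * u x + b * v x) * partial phi i x) =
    a * \int[leb]_(x in U) (u x * partial phi i x) +
    b * \int[leb]_(x in U) (v x * partial phi i x).
  rewrite -!RintegralZl// ?(L2_mul _ _ Lp')// -RintegralD//.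
  - by apply: eq_Rintegral => x _; rewrite mulrDl !mulrA.
  - by apply: rintegrableZ => //; exact: L2_mul.
  - by apply: rintegrableZ => //; exact: L2_mul.
have E2 : \int[leb]_(x in U) ((a *: F x + b *: G x) ord0 i * phi x) =
    a * \int[leb]_(x in U) (F x ord0 i * phi x) +
    b * \int[leb]_(x in U) (G x ord0 i * phi x).
  have H1 := L2_mul mU (LF i) Lp; have H2 := L2_mul mU (LG i) Lp.
  rewrite -!RintegralZl// -RintegralD//.
  - by apply: eq_Rintegral => x _; rewrite !mxE mulrDl !mulrA.
  - exact: rintegrableZ.
  - exact: rintegrableZ.
by rewrite E1 E2 HF// HG// !mulrN opprD.
Qed.

Lemma H1_L2 U u : measurable U -> H1 U u -> L2 leb U u.
Proof. by move=> mU [/(memL2P _ mU)]. Qed.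

Lemma nablaP U u : H1 U u -> weak_gradient U u (nabla U u).
Proof. by move=> [_ [F HF]]; exact: (@xgetPex _ (fun=> 0) [set F | weak_gradient U u F] (ex_intro _ F HF)). Qed.

Lemma nabla_L2v U u : measurable U -> H1 U u -> L2v U (nabla U u).
Proof. by move=> mU /nablaP/(weak_gradientP _ _ mU)[]. Qed.

Lemma H1_intro U u F : measurable U -> L2 leb U u -> weak_gradient U u F -> H1 U u.
Proof. by move=> mU Lu HF; split; [exact/memL2P|exists F]. Qed.

Lemma nabla_ae U u F : open U -> H1 U u -> weak_gradient U u F ->
  {ae leb, forall x, U x -> nabla U u x = F x}.
Proof. by move=> oU /nablaP; exact: weak_gradient_unique. Qed.

Lemma H1_lin U u v (a b : R) : open U -> H1 U u -> H1 U v ->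
  H1 U (fun x => a * u x + b * v x).
Proof.
move=> oU Hu Hv; have mU := open_measurable_rV oU.
have Lu := H1_L2 mU Hu; have Lv := H1_L2 mU Hv.
apply: H1_intro (weak_gradient_lin a b oU Lu Lv (nablaP Hu) (nablaP Hv)) => //.
exact: L2_lin.
Qed.

Lemma nabla_lin U u v (a b : R) : open U -> H1 U u -> H1 U v ->
  {ae leb, forall x, U x -> nabla U (fun x => a * u x + b * v x) x =
    a *: nabla U u x + b *: nabla U v x}.
Proof.
move=> oU Hu Hv; have mU := open_measurable_rV oU.
have Lu := H1_L2 mU Hu; have Lv := H1_L2 mU Hv.
apply: nabla_ae => //; first exact: H1_lin.
exact: (weak_gradient_lin a b oU Lu Lv (nablaP Hu) (nablaP Hv)).
Qed.

Lemma H1_test U phi : open U -> test_function U phi -> H1 U phi.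
Proof.
move=> oU tp; have mU := open_measurable_rV oU.
exact: H1_intro (test_L2 mU tp) (weak_gradient_test oU tp).
Qed.

Lemma nabla_test U phi : open U -> test_function U phi ->
  {ae leb, forall x, U x -> nabla U phi x = grad phi x}.
Proof.
move=> oU tp; apply: nabla_ae => //; first exact: H1_test.
exact: weak_gradient_test.
Qed.

Lemma L2_enorm U F : measurable U -> L2v U F -> L2 leb U (enorm \o F).
Proof.
move=> mU LF.
have E : (fun x => (enorm \o F) x ^+ 2) = (fun x => 1 * dot (F x) (F x)).
  by apply/funext => x; rewrite /= enorm_sqr mul1r.
have [w1 _] := weight1 U; split; last by rewrite E; exact: (wip_integrable mU (weight1 U) LF LF).
have := wip_measurable mU w1 LF LF.
rewrite (_ : enorm \o F = Num.sqrt \o (fun x => 1 * dot (F x) (F x))).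
  by move=> H; apply: measurableT_comp H; apply: continuous_measurable_fun; exact: sqrt_continuous.
by apply/funext => x /=; rewrite mul1r.
Qed.

(** Passes from the extended real norm to two real sequences of squared norms, the form in which the
    estimates below are made. *)
Lemma H1norm_cvg0 K (u : nat -> 'rV[R]_m -> R) (F : nat -> 'rV[R]_m -> 'rV[R]_m) :
  measurable K -> (forall k, L2 leb K (u k)) -> (forall k, L2v K (F k)) ->
  (H1norm K (u k) (F k) @[k --> \oo] --> 0%E) <->
  (\int[leb]_(x in K) u k x ^+ 2 @[k --> \oo] --> 0 /\
   wip K (fun=> 1) (F k) (F k) @[k --> \oo] --> 0).
Proof.
move=> mK Lu LF.
pose a k := \int[leb]_(x in K) u k x ^+ 2; pose b k := wip K (fun=> 1) (F k) (F k).
have a0 k : 0 <= a k by apply: Rintegral_ge0 => x _; exact: sqr_ge0.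
have b0 k : 0 <= b k by exact: wip1_ge0.
have E k : H1norm K (u k) (F k) = (Num.sqrt (a k) + Num.sqrt (b k))%:E.
  rewrite /H1norm (L2normE mK (Lu k)) (L2normE mK (L2_enorm mK (LF k))) -EFinD.
  congr (_ + Num.sqrt _)%:E; apply: eq_Rintegral => x _.
  by rewrite /= enorm_sqr mul1r.
rewrite (eq_fun E); split.
  move=> /fine_cvgP[_ H].
  have H1 : Num.sqrt (a k) @[k --> \oo] --> 0.
    apply: (squeeze_cvgr _ (cvg_cst 0) H); apply: nearW => k /=.
    by rewrite sqrtr_ge0 lerDl sqrtr_ge0.
  have H2 : Num.sqrt (b k) @[k --> \oo] --> 0.
    apply: (squeeze_cvgr _ (cvg_cst 0) H); apply: nearW => k /=.
    by rewrite sqrtr_ge0 lerDr sqrtr_ge0.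
  split.
    have := cvgM H1 H1; rewrite mulr0 (_ : _ \* _ = a); first by apply.
    by apply/funext => k /=; rewrite -expr2 sqr_sqrtr.
  have := cvgM H2 H2; rewrite mulr0 (_ : _ \* _ = b); first by apply.
  by apply/funext => k /=; rewrite -expr2 sqr_sqrtr.
move=> [H1 H2]; apply: cvg_EFin; first exact: nearW.
rewrite -[X in _ --> X](addr0 0) -{1}(sqrtr0 R) -[X in _ --> _ + X](sqrtr0 R).
apply: cvgD; apply: (continuous_cvg _ _ _) => //; exact: sqrt_continuous.
Qed.

End weak_gradient_theory.

(** * H^1_0 and traces *)

Section dirichlet.
Context {R : realType} {m : nat}.
Implicit Types (U K : set 'rV[R]_m) (u v w phi g : 'rV[R]_m -> R).
Implicit Types (F G H : 'rV[R]_m -> 'rV[R]_m).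

Lemma funB u v : u \- v = (fun x => 1 * u x + (-1) * v x).
Proof. by apply/funext => x /=; rewrite mul1r mulN1r. Qed.

Lemma H1B U u v : open U -> H1 U u -> H1 U v -> H1 U (u \- v).
Proof. by move=> oU Hu Hv; rewrite funB; exact: H1_lin. Qed.

Lemma nablaB U u v : open U -> H1 U u -> H1 U v ->
  {ae leb, forall x, U x -> nabla U (u \- v) x = 1 *: nabla U u x + (-1) *: nabla U v x}.
Proof. by move=> oU Hu Hv; rewrite funB; exact: nabla_lin. Qed.

Lemma grad_lin phi psi (a b : R) x : smooth phi -> smooth psi ->
  grad (fun x => a * phi x + b * psi x) x = a *: grad phi x + b *: grad psi x.
Proof. by move=> sp sq; apply/rowP => i; rewrite !mxE partial_lin. Qed.

Lemma L2vB U F G : measurable U -> L2v U F -> L2v U G -> L2v U (fun x => F x - G x).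
Proof.
move=> mU LF LG i; apply: L2_ext (L2B mU (LF i) (LG i)) => // x _.
by rewrite !mxE.
Qed.

Lemma wip_sqr_lin U g (a b : R) F G H : measurable U -> weight U g ->
  L2v U F -> L2v U G -> L2v U H ->
  {ae leb, forall x, U x -> F x = a *: G x + b *: H x} ->
  wip U g F F = a ^+ 2 * wip U g G G + 2 * a * b * wip U g G H + b ^+ 2 * wip U g H H.
Proof.
move=> mU wg LF LG LH E.
rewrite (wip_lin mU wg LF LG LH LF E) ![wip U g _ F]wipC.
rewrite (wip_lin mU wg LF LG LH LG E) (wip_lin mU wg LF LG LH LH E).
by rewrite [wip U g H G]wipC; ring.
Qed.

(** The parallelogram identity: the energies of aG + bH and aG - bH add up to the right-hand side,
    and the second one is nonnegative. *)
Lemma wip_lin_le U g (a b : R) F G H : measurable U -> weight U g ->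
  {ae leb, forall x, U x -> 0 <= g x} ->
  L2v U F -> L2v U G -> L2v U H ->
  {ae leb, forall x, U x -> F x = a *: G x + b *: H x} ->
  wip U g F F <= (2 * a ^+ 2) * wip U g G G + (2 * b ^+ 2) * wip U g H H.
Proof.
move=> mU wg g0 LF LG LH E; rewrite (wip_sqr_lin mU wg LF LG LH E).
have LK : L2v U (fun x => a *: G x + (- b) *: H x) by exact: L2v_lin.
have := wip_ge0 mU wg LK g0.
rewrite (wip_sqr_lin (a := a) (b := - b) mU wg LK LG LH); last exact: aeW.
by rewrite sqrrN; lra.
Qed.

(** Fix [s] so large that B / s is at most half the tolerance, then let [k] grow. With e_k a squared
    distance this is the convergence of pairings that Cauchy-Schwarz gives. *)
Lemma cvg0_young (a e : nat -> R) (B : R) : e k @[k --> \oo] --> 0 ->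
  (forall k s, 0 < s -> `|a k| <= s * e k + B / s) -> a k @[k --> \oo] --> 0.
Proof.
move=> He Ha; apply/cvgr0Pnorm_le => d d0.
pose s := 2 * (`|B| + 1) / d.
have s0 : 0 < s by rewrite divr_gt0// mulr_gt0// ltr_wpDl.
have Bs : B / s <= d / 2.
  rewrite ler_pdivrMr// /s (le_trans (ler_norm B))//.
  rewrite (_ : d / 2 * _ = `|B| + 1); first by rewrite lerDl.
  by field; rewrite gt_eqF.
have : d / 2 / s > 0 by rewrite divr_gt0// divr_gt0.
move: He => /cvgr0Pnorm_le He /He[N _ HN]; exists N => // k Nk.
have := Ha k s s0; have := HN k Nk => /=.
rewrite ler_pdivlMr// => h1 h2.
have := ler_norm (e k); nra.
Qed.

Lemma cvg0Z (c : R) (f : nat -> R) : f k @[k --> \oo] --> 0 ->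
  c * f k @[k --> \oo] --> 0.
Proof. by move=> H; rewrite -(mulr0 c); exact: cvgMl_tmp. Qed.

Lemma cvg0D (f g : nat -> R) : f k @[k --> \oo] --> 0 ->
  g k @[k --> \oo] --> 0 -> f k + g k @[k --> \oo] --> 0.
Proof. by move=> H1 H2; rewrite -(addr0 0); exact: cvgD. Qed.

Lemma L2_cvg_mul U (f : nat -> 'rV[R]_m -> R) (l psi : 'rV[R]_m -> R) :
  measurable U -> (forall k, L2 leb U (f k)) -> L2 leb U l -> L2 leb U psi ->
  \int[leb]_(x in U) (f k x - l x) ^+ 2 @[k --> \oo] --> 0 ->
  \int[leb]_(x in U) (f k x * psi x) @[k --> \oo] --> \int[leb]_(x in U) (l x * psi x).
Proof.
move=> mU Lf Ll Lp H; apply/subr_cvg0.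
apply: (cvg0_young (B := \int[leb]_(x in U) psi x ^+ 2) H) => k s s0.
have LB := L2B mU (Lf k) Ll.
rewrite -RintegralB//; [|exact: L2_mul..].
under eq_Rintegral do rewrite -mulrBl.
have i1 := L2_mul mU LB Lp.
apply: le_trans (le_normr_Rintegral mU i1) _.
have i2 : leb.-integrable U (EFin \o (fun x => (f k x - l x) ^+ 2)) by case: LB.
have i3 : leb.-integrable U (EFin \o (fun x => psi x ^+ 2)) by case: Lp.
rewrite mulrC -RintegralZr// -RintegralZr// -RintegralD//; last 2 first.
- by under eq_fun do rewrite mulrC; exact: rintegrableZ.
- by under eq_fun do rewrite mulrC; exact: rintegrableZ.
apply: le_Rintegral => //.
- exact: integrable_norm i1.
- by apply: rintegrableD => //; under eq_fun do rewrite mulrC; exact: rintegrableZ.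
move=> x _; set a := f k x - l x; set b := psi x.
have h0 : 0 <= s * (`|a| - `|b| / s) ^+ 2 by rewrite mulr_ge0 ?sqr_ge0// ltW.
have h1 : a ^+ 2 * s + b ^+ 2 / s = s * (`|a| - `|b| / s) ^+ 2 + 2 * `|a * b|.
  rewrite normrM -[a ^+ 2]real_normK ?num_real// -[b ^+ 2]real_normK ?num_real//.
  by field; rewrite gt_eqF.
by rewrite h1; have := normr_ge0 (a * b); lra.
Qed.

Lemma wip_cvg U g (F : nat -> 'rV[R]_m -> 'rV[R]_m) L G : measurable U ->
  weight U g -> {ae leb, forall x, U x -> 0 <= g x} ->
  (forall k, L2v U (F k)) -> L2v U L -> L2v U G ->
  wip U g (fun x => F k x - L x) (fun x => F k x - L x) @[k --> \oo] --> 0 ->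
  wip U g (F k) G @[k --> \oo] --> wip U g L G.
Proof.
move=> mU wg g0 LF LL LG H.
have LD k := L2vB mU (LF k) LL.
apply/subr_cvg0; apply: (cvg0_young (B := wip U g G G) H) => k s s0.
have E : wip U g (fun x => F k x - L x) G = 1 * wip U g (F k) G + (-1) * wip U g L G.
  by apply: wip_lin => //; apply: aeW => x _; rewrite scale1r scaleN1r.
have -> : wip U g (F k) G - wip U g L G = wip U g (fun x => F k x - L x) G by rewrite E; ring.
have := wip_young mU wg (LD k) LG g0 s0; rewrite [s^-1 * _]mulrC.
have := normr_ge0 (wip U g (fun x => F k x - L x) G); lra.
Qed.

(** One coordinate suffices. Integrating phi^2 = phi^2 d_i(x_i) by parts gives -2 int x_i phi d_i
    phi, and |x_i| <= L on U; Young's inequality bounds this by half of int phi^2, which is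
    absorbed, plus 2 L^2 int (d_i phi)^2. Hence the constant 4 L^2. *)
Lemma poincare U (i : 'I_m) : open U -> bounded_set U ->
  exists2 C, 0 < C & forall phi, test_function U phi ->
    \int[leb]_(x in U) phi x ^+ 2 <= C * wip U (fun=> 1) (grad phi) (grad phi).
Proof.
move=> oU [M [_ HM]]; have mU := open_measurable_rV oU.
pose L := `|M| + 1; have L0 : 0 < L by rewrite ltr_wpDl.
have UL x : U x -> `|x ord0 i| <= L.
  move=> Ux; apply: le_trans (norm_coord x i) _.
  by apply: HM => //; rewrite (le_lt_trans (ler_norm M)) ?ltrDl.
exists (4 * L ^+ 2) => [|phi tp]; first by rewrite mulr_gt0// exprn_gt0.
have Lp := test_L2 mU tp; have Lp' := test_L2 mU (test_partial i tp).
have [sp cp pU] := (iffLR (test_functionP U phi) tp).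
have sc : smooth (fun x : 'rV[R]_m => x ord0 i) by move=> k; exact: Ck_coord.
have Lx : L2 leb U (fun x => x ord0 i * phi x).
  apply: (L2_bounded_mul mU _ UL Lp).
  by apply: continuous_measurable_rV => //; exact: smooth_continuous.
have E : \int[leb]_(x in U) (phi x * x ord0 i * partial phi i x) =
   - \int[leb]_(x in U) ((partial phi i x * x ord0 i + phi x * 1) * phi x).
  apply: (ibp_test oU) => //.
  - by move=> x _; apply: smooth_continuous; exact: smooth_mul.
  - move=> x _; apply: smooth_continuous; apply: smooth_add.
      by apply: smooth_mul => //; exact: Ck_partial_smooth.
    by apply: smooth_mul => //; exact: smooth_cst.
  - move=> x _; apply: is_derive_mul; first exact: smooth_is_derive.
    by have := is_derive_coord i i x; rewrite eqxx.
have i1 := L2_mul mU Lx Lp'.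
have i2 : leb.-integrable U (EFin \o (fun x => phi x ^+ 2)) by case: Lp.
have i3 : leb.-integrable U (EFin \o (fun x => partial phi i x ^+ 2)) by case: Lp'.
have E2 : \int[leb]_(x in U) phi x ^+ 2 =
    - 2 * \int[leb]_(x in U) (x ord0 i * phi x * partial phi i x).
  move: E; rewrite (_ : \int[leb]_(x in U) (phi x * _ * _) =
    \int[leb]_(x in U) (x ord0 i * phi x * partial phi i x)); last first.
    by apply: eq_Rintegral => x _; rewrite [phi x * _]mulrC.
  rewrite (_ : \int[leb]_(x in U) ((_ + _) * _) =
    \int[leb]_(x in U) (x ord0 i * phi x * partial phi i x + phi x ^+ 2)); last first.
    by apply: eq_Rintegral => x _; ring.
  by rewrite RintegralD//; lra.
have E3 : \int[leb]_(x in U) (- 2 * (x ord0 i * phi x * partial phi i x)) <=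
   \int[leb]_(x in U) (2^-1 * phi x ^+ 2 + (2 * L ^+ 2) * partial phi i x ^+ 2).
  apply: le_Rintegral => //; first exact: rintegrableZ.
    by apply: rintegrableD => //; exact: rintegrableZ.
  move=> x Ux; have := UL x Ux; rewrite ler_norml => /andP[h1 h2].
  have h3 : x ord0 i ^+ 2 <= L ^+ 2.
    by rewrite -real_normK ?num_real// lerXn2r ?nnegrE ?UL// ltW.
  have h4 := mulr_ge0 (sqr_ge0 (partial phi i x)) (_ : 0 <= L ^+ 2 - x ord0 i ^+ 2).
  move: h4; rewrite subr_ge0 => /(_ h3) h4.
  have := sqr_ge0 (phi x + 2 * x ord0 i * partial phi i x); nra.
rewrite RintegralZl// in E3; rewrite -E2 RintegralD// ?RintegralZl// in E3;
  try exact: rintegrableZ.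
have E4 : \int[leb]_(x in U) partial phi i x ^+ 2 <=
    wip U (fun=> 1) (grad phi) (grad phi).
  apply: le_Rintegral => //.
    apply: wip_integrable => //; [exact: weight1|exact: test_grad_L2v..].
  move=> x _; rewrite mul1r /dot (bigD1 i)//= !mxE -expr2 lerDl sumr_ge0// => j _.
  by rewrite -expr2 sqr_ge0.
by have := exprn_gt0 2 L0; nra.
Qed.

Lemma H10_H1 U w : H10 U w -> H1 U w. Proof. by case. Qed.

(** Replaces the chosen gradient of each w - phi_k by nabla w - grad phi_k, which equals it almost
    everywhere, and separates the two squared norms. *)
Lemma H10P U w : open U -> H1 U w -> (H10 U w <->
  exists phi : ('rV[R]_m -> R)^nat, [/\ forall k, test_function U (phi k),
    \int[leb]_(x in U) (w x - phi k x) ^+ 2 @[k --> \oo] --> 0 &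
    wip U (fun=> 1) (fun x => nabla U w x - grad (phi k) x)
      (fun x => nabla U w x - grad (phi k) x) @[k --> \oo] --> 0]).
Proof.
move=> oU Hw; have mU := open_measurable_rV oU.
have key (phi : nat -> 'rV[R]_m -> R) : (forall k, test_function U (phi k)) ->
  (H1norm U (w \- phi k) (nabla U (w \- phi k)) @[k --> \oo] --> 0%E) <->
  (\int[leb]_(x in U) (w x - phi k x) ^+ 2 @[k --> \oo] --> 0 /\
    wip U (fun=> 1) (fun x => nabla U w x - grad (phi k) x)
      (fun x => nabla U w x - grad (phi k) x) @[k --> \oo] --> 0).
  move=> tp; have Hp k := H1_test oU (tp k).
  have HB k := H1B oU Hw (Hp k).
  have := @H1norm_cvg0 _ _ U (fun k => w \- phi k) (fun k => nabla U (w \- phi k)) mU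
    (fun k => H1_L2 mU (HB k)) (fun k => nabla_L2v mU (HB k)).
  have LG k := L2vB mU (nabla_L2v mU Hw) (test_grad_L2v mU (tp k)).
  rewrite (_ : (fun k => wip U (fun=> 1) (nabla U (w \- phi k)) (nabla U (w \- phi k))) =
    (fun k => wip U (fun=> 1) (fun x => nabla U w x - grad (phi k) x)
      (fun x => nabla U w x - grad (phi k) x)))//.
  apply/funext => k.
  have E : {ae leb, forall x, U x -> nabla U (w \- phi k) x = nabla U w x - grad (phi k) x}.
    apply: filterS2 (nablaB oU Hw (Hp k)) (nabla_test oU (tp k)) => x H1 H2 Ux.
    by rewrite H1// H2// scale1r scaleN1r.
  have LB := nabla_L2v mU (HB k); have w1 := weight1 U.
  have A1 : {ae leb, forall x : 'rV[R]_m, U x -> (1 : R) = 1} by exact: aeW.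
  rewrite (wip_ae mU w1 w1 LB (LG k) LB A1 E) wipC.
  by rewrite (wip_ae mU w1 w1 LB (LG k) (LG k) A1 E).
split=> [[_ [phi [tp H]]]|[phi [tp H1 H2]]].
  by exists phi; have [H1 H2] := iffLR (key phi tp) H.
by split=> //; exists phi; split=> //; apply: (iffRL (key phi tp)).
Qed.

Lemma H10_0 U : open U -> H10 U (fun=> 0).
Proof.
move=> oU; have mU := open_measurable_rV oU.
have t0 : test_function U (fun=> 0 : R).
  by apply: (test_intro (K := set0)) => //; [exact: smooth_cst|exact: compact0].
have H0 := H1_test oU t0; apply/(H10P oU H0); exists (fun=> fun=> 0); split => //.
  rewrite (_ : (fun k : nat => _) = (fun=> 0)); first exact: cvg_cst.
  apply/funext => k; rewrite (@eq_Rintegral _ _ _ _ _ (fun=> 0)).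
    by rewrite Rintegral_cst// mul0r.
  by move=> x _; rewrite subrr expr0n.
rewrite (_ : (fun k : nat => _) = (fun=> 0)); first exact: cvg_cst.
apply/funext => k; rewrite /wip.
rewrite (@Rintegral_ae_eq _ _ _ leb U mU _ (fun=> 0)).
- by rewrite Rintegral_cst// mul0r.
- have [w1 _] := weight1 U; apply: (wip_measurable mU w1).
    by apply: L2vB => //; [exact: nabla_L2v|exact: test_grad_L2v].
  by apply: L2vB => //; [exact: nabla_L2v|exact: test_grad_L2v].
- exact: measurable_cst.
apply: filterS (nabla_test oU t0) => x H Ux; rewrite H// subrr.
by rewrite /dot mul1r big1// => i _; rewrite mxE mul0r.
Qed.

Lemma H10_lin U u v (a b : R) : open U -> H10 U u -> H10 U v ->
  H10 U (fun x => a * u x + b * v x).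
Proof.
move=> oU Hu Hv; have mU := open_measurable_rV oU.
have Hu1 := H10_H1 Hu; have Hv1 := H10_H1 Hv.
have Hw := H1_lin a b oU Hu1 Hv1.
move: Hu => /(H10P oU Hu1)[p [tp p1 p2]]; move: Hv => /(H10P oU Hv1)[q [tq q1 q2]].
apply/(H10P oU Hw); exists (fun k x => a * p k x + b * q k x); split.
- by move=> k; exact: test_lin.
- have Lp k := test_L2 mU (tp k); have Lq k := test_L2 mU (tq k).
  have Lu := H1_L2 mU Hu1; have Lv := H1_L2 mU Hv1.
  have LA k := L2B mU Lu (Lp k); have LB k := L2B mU Lv (Lq k).
  have I1 k : leb.-integrable U (EFin \o (fun x => (u x - p k x) ^+ 2)) by case: (LA k).
  have I2 k : leb.-integrable U (EFin \o (fun x => (v x - q k x) ^+ 2)) by case: (LB k).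
  have H : (2 * a ^+ 2) * (\int[leb]_(x in U) (u x - p k x) ^+ 2) +
     (2 * b ^+ 2) * (\int[leb]_(x in U) (v x - q k x) ^+ 2) @[k --> \oo] --> (0 : R).
    exact: (cvg0D (cvg0Z _ p1) (cvg0Z _ q1)).
  apply: (squeeze_cvgr _ (cvg_cst 0) H); apply: nearW => k.
  rewrite Rintegral_ge0; last by move=> x _; exact: sqr_ge0.
  rewrite /= -!RintegralZl// -RintegralD//; [|exact: rintegrableZ..].
  apply: le_Rintegral => //.
  - have := L2_lin mU a b (LA k) (LB k) => -[_]; apply: eq_integrable => // x _ /=.
    by congr (_ ^+ 2)%:E; ring.
  - by apply: rintegrableD => //; exact: rintegrableZ.
  - move=> x _; rewrite (_ : _ - _ = a * (u x - p k x) + b * (v x - q k x)); last by ring.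
    set A := u x - _; set B := v x - _; have := sqr_ge0 (a * A - b * B); nra.
- have w1 := weight1 U.
  have Lp k := test_grad_L2v mU (tp k); have Lq k := test_grad_L2v mU (tq k).
  have Lu := nabla_L2v mU Hu1; have Lv := nabla_L2v mU Hv1.
  have LA k := L2vB mU Lu (Lp k); have LB k := L2vB mU Lv (Lq k).
  apply: (squeeze_cvgr _ (cvg_cst 0) (cvg0D (cvg0Z (2 * a ^+ 2) p2) (cvg0Z (2 * b ^+ 2) q2))).
  apply: nearW => k; rewrite wip1_ge0/=.
  apply: wip_lin_le (LA k) (LB k) _ => //; first by apply: aeW => x _; exact: ler01.
    by apply: L2vB => //; [exact: nabla_L2v|apply: test_grad_L2v => //; exact: test_lin].
  apply: filterS (nabla_lin a b oU Hu1 Hv1) => x H3 Ux; rewrite H3// grad_lin.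
  + by rewrite !scalerBr opprD addrACA.
  + by case: (tp k).
  + by case: (tq k).
Qed.

Lemma H10B U u v : open U -> H10 U u -> H10 U v -> H10 U (u \- v).
Proof. by move=> oU Hu Hv; rewrite funB; exact: H10_lin. Qed.

Lemma trace_eqP U u v : open U -> H1 U u -> H1 U v ->
  (trace U u = trace U v) <-> H10 U (u \- v).
Proof.
move=> oU Hu Hv; split=> [E|Huv].
  have : trace U u u.
    split; first exact: Hu.
    have -> : u \- u = (fun=> 0) by apply/funext => x /=; rewrite subrr.
    exact: H10_0.
  by rewrite E => -[].
apply/seteqP; split=> w [Hw Hwu]; (split; first exact: Hw).
  have := H10_lin 1 1 oU Hwu Huv; congr (H10 U _); apply/funext => x /=; ring.
have := H10_lin 1 (-1) oU Hwu Huv; congr (H10 U _); apply/funext => x /=; ring.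
Qed.

(** Since g is bounded, the pairings converge along the approximating test functions, so the weak
    equation passes from test functions to H^1_0. *)
Lemma weak_solution_H10 U g u w : open U -> weight U g ->
  {ae leb, forall x, U x -> 0 <= g x} ->
  weak_solution U g u -> H10 U w -> wip U g (nabla U u) (nabla U w) = 0.
Proof.
move=> oU wg g0 [Hu su] Hw; have mU := open_measurable_rV oU.
have Hw1 := H10_H1 Hw; move: Hw => /(H10P oU Hw1)[phi [tp _ H]].
have Lu := nabla_L2v mU Hu; have Lw := nabla_L2v mU Hw1.
have Lp k := test_grad_L2v mU (tp k).
have [_ [M gM]] := wg.
have Hg : wip U g (fun x => grad (phi k) x - nabla U w x)
   (fun x => grad (phi k) x - nabla U w x) @[k --> \oo] --> 0.
  have H' : (`|M| * wip U (fun=> 1) (fun x => nabla U w x - grad (phi k) x)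
    (fun x => nabla U w x - grad (phi k) x)) @[k --> \oo] --> (0 : R).
    exact: (cvg0Z _ H).
  apply: (squeeze_cvgr _ (cvg_cst 0) H'); apply: nearW => k.
  rewrite wip_ge0//=; last exact: L2vB.
  have L1 := L2vB mU Lw (Lp k); have L2 := L2vB mU (Lp k) Lw.
  rewrite -wip_cst//; last exact: weight1.
  have E : wip U (fun=> `|M| * 1) (fun x => nabla U w x - grad (phi k) x)
    (fun x => nabla U w x - grad (phi k) x) =
    wip U (fun=> `|M| * 1) (fun x => grad (phi k) x - nabla U w x)
    (fun x => grad (phi k) x - nabla U w x).
    apply: eq_Rintegral => x _; congr (_ * _); rewrite /dot.
    by apply: eq_bigr => i _; rewrite !mxE; ring.
  rewrite E; apply: wip_le => //.
    by split; [exact: measurable_cst|exists `|M| => x _; rewrite mulr1 normr_id].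
  by apply: aeW => x Ux; rewrite mulr1 (le_trans (ler_norm _))// (le_trans (gM x Ux))// ler_norm.
have := wip_cvg mU wg g0 Lp Lw Lu Hg.
rewrite (_ : (fun k => _) = fun=> 0) => [C|].
  by rewrite wipC; apply/esym; apply: (cvg_unique _ (cvg_cst 0) C).
by apply/funext => k; rewrite wipC; exact: su.
Qed.

End dirichlet.

(** * The Dirichlet problem and the energy gap *)

Section energy.
Context {R : realType} {m : nat}.
Implicit Types (U K D : set 'rV[R]_m) (u v w phi psi g : 'rV[R]_m -> R).
Implicit Types (F G H : 'rV[R]_m -> 'rV[R]_m).

Lemma cauchy_bound (a : nat -> nat -> R) (B : R) : 0 <= B ->
  (forall j k, a j k <= B * (j.+1%:R^-1 + k.+1%:R^-1)) ->
  forall e, 0 < e -> exists N, forall j k, (N <= j)%N -> (N <= k)%N -> a j k <= e.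
Proof.
move=> B0 H e e0; have B1 : 0 < 2 * (B + 1) by lra.
exists (Num.truncn (2 * (B + 1) / e)) => j k Nj Nk.
have key i : (Num.truncn (2 * (B + 1) / e) <= i)%N -> i.+1%:R^-1 <= e / (2 * (B + 1)).
  move=> Ni; rewrite -[leRHS]invrK lef_pV2 ?posrE ?invr_gt0 ?divr_gt0// invf_div.
  apply/ltW/(lt_le_trans (truncnS_gt _)); by rewrite ler_nat.
apply: le_trans (H j k) _.
apply: le_trans (ler_wpM2l B0 (lerD (key j Nj) (key k Nk))) _.
have -> : B * (e / (2 * (B + 1)) + e / (2 * (B + 1))) = e * (B / (B + 1)).
  by field; rewrite gt_eqF//; lra.
by rewrite ler_piMr ?(ltW e0)// ler_pdivrMr ?mul1r; lra.
Qed.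

(** Arithmetic of a minimizing sequence: i is the infimum, a and b are the energies of two members
    that exceed it by at most ej and ek, x is their cross term, q the unweighted energy of the
    difference. The first hypothesis compares i with the energy of the midpoint. *)
Lemma parallelogram_bound (c q a b x i ej ek : R) :
  i <= 2^-1 ^+ 2 * a + 2 * 2^-1 * 2^-1 * x + 2^-1 ^+ 2 * b ->
  c * q <= 1 ^+ 2 * a + 2 * 1 * -1 * x + (-1) ^+ 2 * b ->
  a <= i + ej -> b <= i + ek -> q * c <= 2 * (ej + ek).
Proof. by rewrite sqrrN expr1n; lra. Qed.

(** Here a is the energy of a member within e of the infimum i, x its cross term with a test
    function of energy q, and t the size of the variation. *)
Lemma first_variation_bound (i e a x q t : R) :
  i <= 1 ^+ 2 * a + 2 * 1 * t * x + t ^+ 2 * q -> a <= i + e ->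
  0 <= e + 2 * t * x + t ^+ 2 * q.
Proof. by rewrite expr1n; lra. Qed.

Lemma wip1_sum U F : measurable U -> L2v U F ->
  wip U (fun=> 1) F F = \sum_(i < m) \int[leb]_(x in U) (F x ord0 i) ^+ 2.
Proof.
move=> mU LF; rewrite -Rintegral_sum//; last by move=> i; case: (LF i).
by apply: eq_Rintegral => x _; rewrite mul1r; apply: eq_bigr => i _; rewrite expr2.
Qed.

Lemma cvg0_sum (I : Type) (s : seq I) (f : I -> nat -> R) :
  (forall i, f i k @[k --> \oo] --> 0) ->
  \sum_(i <- s) f i k @[k --> \oo] --> 0.
Proof.
move=> H; elim: s => [|a s ih].
  by under eq_fun do rewrite big_nil; exact: cvg_cst.
by under eq_fun do rewrite big_cons; exact: cvg0D.
Qed.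

Lemma wip_subC U g F G : wip U g (fun x => F x - G x) (fun x => F x - G x) =
  wip U g (fun x => G x - F x) (fun x => G x - F x).
Proof.
apply: eq_Rintegral => x _; congr (_ * _); apply: eq_bigr => i _.
by rewrite !mxE; ring.
Qed.

Lemma L2vD U F G : measurable U -> L2v U F -> L2v U G -> L2v U (fun x => F x + G x).
Proof.
move=> mU LF LG i; apply: L2_ext (L2D mU (LF i) (LG i)) => // x _.
by rewrite !mxE.
Qed.

Lemma wip_weight_bound U g F M : measurable U -> weight U g ->
  (forall x, U x -> `|g x| <= M) -> L2v U F ->
  wip U g F F <= M * wip U (fun=> 1) F F.
Proof.
move=> mU wg gM LF; rewrite -wip_cst//; last exact: weight1.
apply: wip_le => //.
  by split; [exact: measurable_cst|exists `|M| => x _; rewrite mulr1].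
by apply: aeW => x Ux; rewrite mulr1 (le_trans (ler_norm _))// gM.
Qed.

Lemma wip_coercive U g F (c : R) : measurable U -> weight U g ->
  {ae leb, forall x, U x -> c <= g x} -> L2v U F ->
  c * wip U (fun=> 1) F F <= wip U g F F.
Proof.
move=> mU wg cg LF; rewrite -wip_cst//; last exact: weight1.
apply: wip_le => //.
  by split; [exact: measurable_cst|exists `|c| => x _; rewrite mulr1].
by apply: filterS cg => x H Ux; rewrite mulr1 H.
Qed.

Lemma ae_ge_ge0 U g (c : R) : 0 < c -> {ae leb, forall x, U x -> c <= g x} ->
  {ae leb, forall x, U x -> 0 <= g x}.
Proof. by move=> c0; apply: filterS => x H Ux; rewrite (le_trans _ (H Ux))// ltW. Qed.

(* Minimization of the energy over v + C_c^oo(U): a minimizing sequence is    *)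
(* Cauchy by the parallelogram identity and Poincare's inequality. *)
Lemma dirichlet_exists U g v (c : R) (i0 : 'I_m) : open U -> bounded_set U ->
  weight U g -> 0 < c -> {ae leb, forall x, U x -> c <= g x} -> H1 U v ->
  exists2 u, weak_solution U g u & H10 U (u \- v).
Proof.
move=> oU bU wg c0 cg Hv; have mU := open_measurable_rV oU.
have g0 := ae_ge_ge0 c0 cg; have w1 := weight1 U.
have Lv := nabla_L2v mU Hv.
pose V phi (x : 'rV[R]_m) : 'rV[R]_m := nabla U v x + grad phi x.
have LV phi : test_function U phi -> L2v U (V phi).
  by move=> tp; apply: L2vD => //; exact: test_grad_L2v.
pose J := [set t | exists2 phi, test_function U phi & t = wip U g (V phi) (V phi)].
have t0 : test_function U (fun=> 0 : R).
  by apply: (test_intro (K := set0)) => //; [exact: smooth_cst|exact: compact0].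
have J0 : lbound J 0 by move=> _ [phi tp ->]; apply: wip_ge0 => //; exact: LV.
have hJ : has_inf J.
  split; first by exists (wip U g (V (fun=> 0)) (V (fun=> 0))); exists (fun=> 0).
  by exists 0.
have infJ phi : test_function U phi -> inf J <= wip U g (V phi) (V phi).
  by move=> tp; apply: ge_inf; [case: hJ|exists phi].
have /choice[phi Hphi] k : exists phi, test_function U phi /\
    wip U g (V phi) (V phi) <= inf J + k.+1%:R^-1.
  have k0 : 0 < k.+1%:R^-1 :> R by rewrite invr_gt0.
  have [_ [phi tp ->] H] := inf_adherent k0 hJ.
  by exists phi; split => //; exact: ltW.
have tp k : test_function U (phi k) by case: (Hphi k).
have sp k : smooth (phi k) by case: (tp k).
have Jp k : wip U g (V (phi k)) (V (phi k)) <= inf J + k.+1%:R^-1 by case: (Hphi k).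
have QW j k : wip U (fun=> 1) (fun x => grad (phi j) x - grad (phi k) x)
    (fun x => grad (phi j) x - grad (phi k) x) <= 2 / c * (j.+1%:R^-1 + k.+1%:R^-1).
  have LW := L2vB mU (test_grad_L2v mU (tp j)) (test_grad_L2v mU (tp k)).
  have E1 := wip_sqr_lin (a := 1) (b := -1) mU wg LW (LV _ (tp j)) (LV _ (tp k)).
  have tm := test_lin (2^-1) (2^-1) (tp j) (tp k).
  have E2 := wip_sqr_lin (a := 2^-1) (b := 2^-1) mU wg (LV _ tm) (LV _ (tp j)) (LV _ (tp k)).
  have := infJ _ tm; rewrite E2; last first.
    apply: aeW => x _; rewrite /V grad_lin// !scalerDr addrACA -scalerDl.
    by rewrite -div1r -splitr scale1r.
  have := wip_coercive mU wg cg LW; rewrite E1; last first.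
    by apply: aeW => x _; rewrite /V scale1r scaleN1r opprD addrACA subrr add0r.
  by move=> h3 h4; rewrite mulrAC ler_pdivlMr//; exact: parallelogram_bound h4 h3 (Jp j) (Jp k).
have QV j k (i : 'I_m) : \int[leb]_(x in U) (partial (phi j) i x - partial (phi k) i x) ^+ 2 <=
    2 / c * (j.+1%:R^-1 + k.+1%:R^-1).
  apply: le_trans (QW j k).
  have LW := L2vB mU (test_grad_L2v mU (tp j)) (test_grad_L2v mU (tp k)).
  rewrite wip1_sum// (bigD1 i)//= [leLHS](_ : _ = \int[leb]_(x in U)
    ((grad (phi j) x - grad (phi k) x) ord0 i) ^+ 2).
    by rewrite lerDl sumr_ge0// => l _; apply: Rintegral_ge0 => x _; exact: sqr_ge0.
  by apply: eq_Rintegral => x _; rewrite !mxE.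
have c20 : 0 <= 2 / c by rewrite divr_ge0// ltW.
have [C C0 HC] := poincare i0 oU bU.
have [w Lw Hw] : exists2 w, L2 leb U w &
    \int[leb]_(x in U) (phi k x - w x) ^+ 2 @[k --> \oo] --> 0.
  apply: L2_complete => // [k|]; first exact: test_L2.
  apply: (@cauchy_bound _ (C * (2 / c))) => [|j k]; first by rewrite mulr_ge0// ltW.
  have := HC _ (test_lin 1 (-1) (tp j) (tp k)) => H.
  rewrite [leLHS](_ : _ = \int[leb]_(x in U) (1 * phi j x + -1 * phi k x) ^+ 2); last first.
    by apply: eq_Rintegral => x _; congr (_ ^+ 2); ring.
  apply: le_trans H _; rewrite -mulrA ler_wpM2l ?(ltW C0)//.
  apply: le_trans (QW j k); rewrite le_eqVlt; apply/orP; left; apply/eqP.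
  by apply: eq_Rintegral => x _; rewrite grad_lin// scale1r scaleN1r.
have /choice[f Hf] (i : 'I_m) : exists f, L2 leb U f /\
    \int[leb]_(x in U) (partial (phi k) i x - f x) ^+ 2 @[k --> \oo] --> 0.
  have [f Lf Hf] : exists2 f, L2 leb U f &
    \int[leb]_(x in U) (partial (phi k) i x - f x) ^+ 2 @[k --> \oo] --> 0.
    apply: (@L2_complete _ _ _ leb U mU (fun k => partial (phi k) i)) => // [k|].
      by apply: test_L2 => //; exact: test_partial.
    exact: (cauchy_bound c20 (fun j k => QV j k i)).
  by exists f.
pose F (x : 'rV[R]_m) : 'rV[R]_m := \row_i f i x.
have LF : L2v U F.
  by move=> i; apply: L2_ext (proj1 (Hf i)) => // x _; rewrite mxE.
have GF : wip U (fun=> 1) (fun x => F x - grad (phi k) x) (fun x => F x - grad (phi k) x)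
    @[k --> \oo] --> 0.
  have E k : wip U (fun=> 1) (fun x => F x - grad (phi k) x) (fun x => F x - grad (phi k) x)
      = \sum_(i < m) \int[leb]_(x in U) (partial (phi k) i x - f i x) ^+ 2.
    rewrite wip1_sum//; last by apply: L2vB => //; exact: test_grad_L2v.
    by apply: eq_bigr => i _; apply: eq_Rintegral => x _; rewrite !mxE -sqrrN opprB.
  rewrite (eq_fun E); apply: cvg0_sum => i; exact: (proj2 (Hf i)).
have WF : weak_gradient U w F.
  apply/weak_gradientP => //; split=> // psi tpsi i.
  have tpi := test_partial i tpsi.
  have C1 := L2_cvg_mul mU (fun k => test_L2 mU (tp k)) Lw (test_L2 mU tpi) Hw.
  have C2 := L2_cvg_mul mU (fun k => test_L2 mU (test_partial i (tp k))) (proj1 (Hf i))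
    (test_L2 mU tpsi) (proj2 (Hf i)).
  have -> : \int[leb]_(x in U) (F x ord0 i * psi x) = \int[leb]_(x in U) (f i x * psi x).
    by apply: eq_Rintegral => x _; rewrite mxE.
  have E k : \int[leb]_(x in U) (phi k x * partial psi i x) =
      - \int[leb]_(x in U) (partial (phi k) i x * psi x).
    have [_ ->] := iffLR (weak_gradientP _ _ mU) (weak_gradient_test oU (tp k)) => //.
    by congr (- _); apply: eq_Rintegral => x _; rewrite mxE.
  rewrite (eq_fun E) in C1; exact: (cvg_unique _ C1 (cvgN C2)).
have Hw1 : H1 U w by exact: H1_intro Lw WF.
have nw := nabla_ae oU Hw1 WF.
have H10w : H10 U w.
  apply/(H10P oU Hw1); exists phi; split; first exact: tp.
    rewrite (_ : (fun k => _) = (fun k => \int[leb]_(x in U) (phi k x - w x) ^+ 2))//.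
    by apply/funext => k; apply: eq_Rintegral => x _; rewrite -sqrrN opprB.
  rewrite (_ : (fun k => _) = (fun k => wip U (fun=> 1) (fun x => F x - grad (phi k) x)
    (fun x => F x - grad (phi k) x)))//.
  apply/funext => k; have Lp := test_grad_L2v mU (tp k).
  have LA := L2vB mU (nabla_L2v mU Hw1) Lp; have LB := L2vB mU LF Lp.
  have A1 : {ae leb, forall x : 'rV[R]_m, U x -> (1 : R) = 1} by exact: aeW.
  have E : {ae leb, forall x, U x -> nabla U w x - grad (phi k) x = F x - grad (phi k) x}.
    by apply: filterS nw => x H Ux; rewrite H.
  by rewrite (wip_ae mU w1 w1 LA LB LA A1 E) wipC (wip_ae mU w1 w1 LA LB LB A1 E).
have Hu := H1_lin 1 1 oU Hv Hw1.
exists (fun x => 1 * v x + 1 * w x); last first.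
  by move: H10w; congr (H10 U _); apply/funext => x /=; ring.
split=> // psi tpsi; have Lpsi := test_grad_L2v mU tpsi.
pose L (x : 'rV[R]_m) : 'rV[R]_m := nabla U v x + F x.
have LL : L2v U L by exact: L2vD.
have [_ [M gM]] := wg.
have bk : wip U g (V (phi k)) (grad psi) @[k --> \oo] --> wip U g L (grad psi).
  apply: (wip_cvg mU wg g0 (fun k => LV _ (tp k)) LL Lpsi).
  have E k : wip U g (fun x => V (phi k) x - L x) (fun x => V (phi k) x - L x) =
     wip U g (fun x => F x - grad (phi k) x) (fun x => F x - grad (phi k) x).
    rewrite [RHS]wip_subC; apply: eq_Rintegral => x _.
    by rewrite /V /L opprD addrACA subrr add0r.
  rewrite (eq_fun E); apply: (squeeze_cvgr _ (cvg_cst 0) (cvg0Z M GF)); apply: nearW => k.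
  have LA := L2vB mU LF (test_grad_L2v mU (tp k)).
  by rewrite wip_ge0//=; exact: wip_weight_bound.
set b := wip U g L (grad psi) in bk.
set q := wip U g (grad psi) (grad psi).
have q0 : 0 <= q by exact: wip_ge0.
(* The variation is taken at [phi k], a competitor within 1/(k+1) of the infimum, and then [k] tends
   to infinity; the limit [w] is in general not a test function. *)
have H t : 0 <= 2 * t * b + t ^+ 2 * q.
  have Ck : k.+1%:R^-1 + 2 * t * wip U g (V (phi k)) (grad psi) + t ^+ 2 * q @[k --> \oo]
      --> 0 + 2 * t * b + t ^+ 2 * q.
    apply: cvgD; last exact: cvg_cst.
    by apply: cvgD; [exact: cvg_harmonic|exact: cvgMl_tmp].
  rewrite -(add0r (2 * t * b)); apply: (cvgr_to_ge Ck); apply: nearW => k.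
  have tt := test_lin 1 t (tp k) tpsi.
  have := infJ _ tt; rewrite (wip_sqr_lin (a := 1) (b := t) (G := V (phi k)) (H := grad psi) mU wg (LV _ tt) (LV _ (tp k)) Lpsi).
    by move=> H; exact: (first_variation_bound H (Jp k)).
  apply: aeW => x _; rewrite /V grad_lin//; last by case: tpsi.
  by rewrite !scale1r addrA.
have b0 : b = 0.
  have := H (- b / (q + 1)); rewrite (_ : _ + _ = - (b ^+ 2 * (q + 2) / (q + 1) ^+ 2)); last first.
    by field; rewrite gt_eqF// ltr_wpDl.
  rewrite oppr_ge0 pmulr_lle0 ?invr_gt0 ?exprn_gt0 ?ltr_wpDl//.
  rewrite pmulr_lle0 ?ltr_wpDl// => b2; apply/eqP.
  by rewrite -sqrf_eq0 eq_le b2 sqr_ge0.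
rewrite -[RHS]b0 /b; apply: (wip_ae mU wg wg) => //; first exact: nabla_L2v.
  exact: aeW.
apply: filterS2 nw (nabla_lin 1 1 oU Hv Hw1) => x h1 h2 Ux.
by rewrite h2// h1// !scale1r.
Qed.

Lemma wip_weightB U g g' F G : measurable U -> weight U g -> weight U g' ->
  L2v U F -> L2v U G ->
  wip U (fun x => g x - g' x) F G = wip U g F G - wip U g' F G.
Proof.
move=> mU wg wg' LF LG; rewrite -RintegralB//; [|exact: wip_integrable..].
by apply: eq_Rintegral => x _; rewrite mulrBl.
Qed.

Lemma weightB U g g' : weight U g -> weight U g' -> weight U (fun x => g x - g' x).
Proof.
move=> [mg [M HM]] [mg' [M' HM']]; split; first exact: measurable_funB.
exists (M + M') => x Ux; apply: le_trans (ler_normB _ _) _.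
by rewrite lerD ?HM ?HM'.
Qed.

Section one_conductivity.
Variables (U : set 'rV[R]_m) (g : 'rV[R]_m -> R) (c : R) (i0 : 'I_m).
Hypotheses (oU : open U) (bU : bounded_set U) (wg : weight U g) (c0 : 0 < c).
Hypothesis cg : {ae leb, forall x, U x -> c <= g x}.
Variable v : 'rV[R]_m -> R.
Hypothesis Hv : H1 U v.

Let u := Dirichlet_solution U g (trace U v).

Lemma Dirichlet_solutionP : weak_solution U g u /\ H10 U (u \- v).
Proof.
have [u0 su0 Hu0] := dirichlet_exists i0 oU bU wg c0 cg Hv.
have E : exists u, weak_solution U g u /\ trace U u = trace U v.
  by exists u0; split; [exact: su0|exact/(trace_eqP oU (proj1 su0) Hv)].
have [su] := @xgetPex _ (fun=> 0) [set u | weak_solution U g u /\ trace U u = trace U v] E.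
by move=> /(trace_eqP oU (proj1 su) Hv) H; split; [exact: su|exact: H].
Qed.

(** The representative [w] chosen in [Lambda] differs from [u] by an element of H^1_0, whose
    gradient is orthogonal to that of [u] for the weight [g]. *)
Lemma LambdaE : Lambda U g (trace U v) (trace U v) = wip U g (nabla U u) (nabla U u).
Proof.
have mU := open_measurable_rV oU; have [su Hu] := Dirichlet_solutionP.
have g0 := ae_ge_ge0 c0 cg.
rewrite /Lambda -/u; set w := xget _ _.
have [Hw Hwv0] : H1 U w /\ trace U w = trace U v.
  by apply: (@xgetPex _ (fun=> 0) [set w | H1 U w /\ trace U w = trace U v]); exists v.
have Hwv := iffLR (trace_eqP oU Hw Hv) Hwv0.
have Hwu : H10 U (w \- u).
  have := H10_lin 1 (-1) oU Hwv Hu; congr (H10 U _); apply/funext => x /=; ring.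
have Hu1 : H1 U u by case: su.
have Lu := nabla_L2v mU Hu1; have Lw := nabla_L2v mU Hw.
have := weak_solution_H10 oU wg g0 su Hwu.
rewrite wipC (wip_lin mU wg (nabla_L2v mU (H10_H1 Hwu)) Lw Lu Lu (nablaB oU Hw Hu1)).
rewrite mul1r mulN1r => /subr0_eq <-; rewrite wipC; exact.
Qed.

End one_conductivity.

(* [r] is u - v, where u is the Dirichlet solution with the trace of v *)
Lemma Lambda_difference U g v (c : R) (i0 : 'I_m) : open U -> bounded_set U ->
  weight U g -> 0 < c -> {ae leb, forall x, U x -> c <= g x} ->
  weak_solution U (fun=> 1) v ->
  exists2 r, H10 U r & [/\
    forall w, H10 U w -> wip U (fun=> 1) (nabla U v) (nabla U w) = 0,
    forall w, H10 U w -> wip U g (nabla U r) (nabla U w) =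
      - wip U (fun x => g x - 1) (nabla U v) (nabla U w) &
    Lambda U g (trace U v) (trace U v) - Lambda U (fun=> 1) (trace U v) (trace U v) =
      wip U (fun x => g x - 1) (nabla U v) (nabla U v) -
      wip U g (nabla U r) (nabla U r)].
Proof.
move=> oU bU wg c0 cg sv; have mU := open_measurable_rV oU.
have Hv : H1 U v by case: sv.
have w1 := weight1 U.
have c1 : {ae leb, forall x : 'rV[R]_m, U x -> (1 : R) <= 1} by exact: aeW.
have g0 := ae_ge_ge0 c0 cg; have g01 := ae_ge_ge0 ltr01 c1.
have [su Hu] := Dirichlet_solutionP i0 oU bU wg c0 cg Hv.
have [su1 Hu1] := Dirichlet_solutionP i0 oU bU w1 ltr01 c1 Hv.
rewrite (LambdaE i0 oU bU wg c0 cg Hv) (LambdaE i0 oU bU w1 ltr01 c1 Hv).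
move: (Dirichlet_solution U g (trace U v)) su Hu => u su Hu.
move: (Dirichlet_solution U (fun=> 1) (trace U v)) su1 Hu1 => u1 su1 Hu1.
have Huu : H1 U u by case: su.
have Huu1 : H1 U u1 by case: su1.
have Lv := nabla_L2v mU Hv; have Lu := nabla_L2v mU Huu; have Lu1 := nabla_L2v mU Huu1.
have Hr := H10_H1 Hu; have Lr := nabla_L2v mU Hr.
have Hr1 := H10_H1 Hu1; have Lr1 := nabla_L2v mU Hr1.
have orth w : H10 U w -> wip U (fun=> 1) (nabla U v) (nabla U w) = 0.
  exact: weak_solution_H10.
have rw w : H10 U w -> wip U g (nabla U (u \- v)) (nabla U w) =
      - wip U (fun x => g x - 1) (nabla U v) (nabla U w).
  move=> Hw; have Lw := nabla_L2v mU (H10_H1 Hw).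
  rewrite (wip_lin mU wg Lr Lu Lv Lw (nablaB oU Huu Hv)).
  by rewrite (weak_solution_H10 oU wg g0 su Hw) (wip_weightB mU wg w1 Lv Lw) (orth w Hw); ring.
exists (u \- v); first exact: Hu.
split; [exact: orth|exact: rw|].
(* [u1] is the harmonic function chosen in [Lambda]. Its gradient and that of [v] are both
   orthogonal to the gradient of u1 - v, so their energies agree. *)
have E1 : wip U (fun=> 1) (nabla U u1) (nabla U u1) = wip U (fun=> 1) (nabla U v) (nabla U v).
  have := orth _ Hu1; rewrite wipC (wip_lin mU w1 Lr1 Lu1 Lv Lv (nablaB oU Huu1 Hv)).
  have := weak_solution_H10 oU w1 g01 su1 Hu1.
  rewrite wipC (wip_lin mU w1 Lr1 Lu1 Lv Lu1 (nablaB oU Huu1 Hv)) [wip _ _ (nabla U v) (nabla U u1)]wipC.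
  move: (wip _ _ (nabla U u1) (nabla U u1)) (wip _ _ (nabla U u1) (nabla U v)).
  by move: (wip _ _ (nabla U v) (nabla U v)) => a b d; clear; lra.
rewrite E1 (wip_weightB mU wg w1 Lv Lv).
have := weak_solution_H10 oU wg g0 su Hu; rewrite wipC (wip_lin mU wg Lr Lu Lv Lu (nablaB oU Huu Hv)).
rewrite (wip_sqr_lin mU wg Lr Lu Lv (nablaB oU Huu Hv)) [wip _ _ (nabla U v) (nabla U u)]wipC.
rewrite sqrrN expr1n.
move: (wip U g (nabla U u) (nabla U u)) (wip U g (nabla U u) (nabla U v)).
by move: (wip U g (nabla U v) (nabla U v)) (wip _ _ _ _) => a b d e; clear; lra.
Qed.

Lemma wip_patch U D g F G : measurable U -> D `<=` U ->
  (forall x, U x -> ~ D x -> g x = 0) ->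
  wip U g F G = wip D g F G.
Proof.
move=> mU DU g0; rewrite /wip Rintegral_mkcond [RHS]Rintegral_mkcond.
apply: eq_Rintegral => x _; rewrite !patchE.
have [Dx|Dx] := boolP (x \in D).
  by rewrite ifT// inE; apply: DU; rewrite inE in Dx.
by case: ifP => // xU; rewrite g0 ?mul0r//; [rewrite inE in xU|move=> Dx'; rewrite mem_set in Dx].
Qed.

(* controls the energy of v in D. *)
Lemma energy_gap U D g v (c C : R) (i0 : 'I_m) : open U -> bounded_set U -> open D ->
  D `<=` U -> weight U g -> 0 < c -> {ae leb, forall x, U x -> c <= g x} ->
  (forall x, U x -> ~ D x -> g x = 1) -> 0 < C ->
  {ae leb, forall x, D x -> C <= g x - 1} \/ {ae leb, forall x, D x -> C <= - (g x - 1)} ->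
  weak_solution U (fun=> 1) v ->
  Num.min C 1 / 2 * wip D (fun=> 1) (nabla U v) (nabla U v) <=
  `|Lambda U g (trace U v) (trace U v) - Lambda U (fun=> 1) (trace U v) (trace U v)|.
Proof.
move=> oU bU oD DU wg c0 cg g1 C0 hC sv; have mU := open_measurable_rV oU.
have mD := open_measurable_rV oD; have Hv : H1 U v by case: sv.
have w1 := weight1 U; have wB := weightB wg w1; have wBD := weight_sub mU mD DU wB.
have Lv := nabla_L2v mU Hv; have LvD := L2v_sub mU mD DU Lv.
have [r Hr [orth rw ->]] := Lambda_difference i0 oU bU wg c0 cg sv.
have Lr := nabla_L2v mU (H10_H1 Hr); have LrD := L2v_sub mU mD DU Lr.
have patch F G : wip U (fun x => g x - 1) F G = wip D (fun x => g x - 1) F G.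
  by apply: wip_patch => // x Ux Dx; rewrite g1// subrr.
have nD := wip1_ge0 D (nabla U v).
have mC : Num.min C 1 <= C by rewrite ge_min lexx.
have mC1 : Num.min C 1 <= 1 by rewrite ge_min lexx orbT.
have mC0 : 0 < Num.min C 1 by rewrite lt_min C0 ltr01.
have g0 := ae_ge_ge0 c0 cg.
case: hC => hC.
(* Positive jump: [L] is the gradient of the solution u = v + r. The difference equals int_D (g - 1)
   |L|^2 + int_U |grad r|^2, a sum of nonnegative terms, and |grad v|^2 <= 2 |L|^2 + 2 |grad r|^2
   gives the constant min(C, 1) / 2. *)
- pose L (x : 'rV[R]_m) : 'rV[R]_m := 1 *: nabla U v x + 1 *: nabla U r x.
  have LL : L2v U L by exact: L2v_lin.
  have LLD := L2v_sub mU mD DU LL.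
  have EL : {ae leb, forall x, D x -> nabla U v x = 1 *: L x + (-1) *: nabla U r x}.
    by apply: aeW => x _; rewrite /L !scale1r scaleN1r addrK.
  have H1 : C * wip D (fun=> 1) L L <= wip D (fun x => g x - 1) L L.
    exact: wip_coercive.
  have D1 : {ae leb, forall x : 'rV[R]_m, D x -> (0 : R) <= 1} by apply: aeW.
  have H2 := wip_lin_le mD (weight1 D) D1 LvD LLD LrD EL.
  have H3 : wip D (fun=> 1) (nabla U r) (nabla U r) <= wip U (fun=> 1) (nabla U r) (nabla U r).
    apply: le_Rintegral_sub => //; first exact: wip_integrable.
    by move=> x _; rewrite mul1r dot_ge0.
  have := wip1_ge0 D L; have := wip1_ge0 U (nabla U r).
  have E : wip U (fun x => g x - 1) (nabla U v) (nabla U v) - wip U g (nabla U r) (nabla U r) =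
    wip D (fun x => g x - 1) L L + wip U (fun=> 1) (nabla U r) (nabla U r).
    rewrite -patch (wip_sqr_lin (a := 1) (b := 1) mU wB LL Lv Lr (aeW _ (fun _ _ => erefl))).
    have := rw r Hr; rewrite (wip_weightB mU wg w1 Lv Lr) (orth r Hr) => E1.
    rewrite (wip_weightB mU wg w1 Lr Lr); move: E1.
    move: (wip U g (nabla U r) _) (wip U g (nabla U v) _) (wip U (fun x => g x - 1) _ _).
    by move: (wip U (fun=> 1) _ _) => a b d e; clear; lra.
  rewrite E => r0 L0.
  apply: le_trans (ler_norm _).
  move: H1 H2 H3 r0 L0 mC mC1 mC0; rewrite sqrrN expr1n.
  move: (wip U _ _ _) (wip D _ (nabla U v) _) (wip D _ (nabla U r) _) (wip D _ L L) (wip D _ L L) => a b d e f.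
  move: (Num.min C 1) => k; clear; nra.
(* Negative jump: both terms of the difference are nonpositive, so the first alone gives the
   bound. *)
- have H1 : C * wip D (fun=> 1) (nabla U v) (nabla U v) <=
    wip D (fun x => - (g x - 1)) (nabla U v) (nabla U v).
    apply: wip_coercive => //; split; first by apply: measurable_funN; case: wBD.
    by case: wBD => _ [M HM]; exists M => x Dx; rewrite normrN HM.
  have H2 : wip D (fun x => - (g x - 1)) (nabla U v) (nabla U v) =
    - wip D (fun x => g x - 1) (nabla U v) (nabla U v).
    have := wip_cst (-1) mD wBD LvD LvD; rewrite mulN1r => <-.
    by apply: eq_Rintegral => x _; rewrite mulN1r.
  have H3 := wip_ge0 mU wg Lr g0.
  rewrite patch -normrN; apply: le_trans (ler_norm _).
  rewrite H2 in H1; move: H1 H3 nD mC mC0.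
  move: (wip U _ _ _) (wip D _ _ _) (wip D _ _ _) (Num.min C 1) => a b d k; clear; nra.
Qed.

End energy.

(** * Convergence of the indicator *)

Section energy_gap_convergence.
Context {R : realType} {m : nat}.
Implicit Types (U K D : set 'rV[R]_m) (u v w phi psi g : 'rV[R]_m -> R).
Implicit Types (F G H : 'rV[R]_m -> 'rV[R]_m).

(** Fixing [s] with K2 / s half the tolerance leaves a term that tends to 0 with [del]. The bound is
    demanded only for [del] at most 1, where the energies involved are bounded. *)
Lemma cauchy_young (a del : nat -> R) (K1 K2 : R) : 0 < K1 -> 0 < K2 ->
  del k @[k --> \oo] --> 0 ->
  (forall j k s, 0 < s -> del j <= 1 -> del k <= 1 ->
     `|a j - a k| <= s * K1 * (del j + del k) + K2 / s) -> cvgn a.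
Proof.
move=> K10 K20 Hd Ha; apply: cauchy_cvg; apply/cauchy_exP => e e0.
pose s := 2 * K2 / e; have s0 : 0 < s by rewrite divr_gt0// mulr_gt0.
pose d := Num.min 1 (e / (8 * s * K1)).
have d0 : 0 < d by rewrite lt_min; apply/andP; split=> //; apply: divr_gt0 => //; apply: mulr_gt0 => //; exact: mulr_gt0.
move: Hd => /cvgr0Pnorm_le/(_ d d0)[N _ HN].
exists (a N); exists N => // k Nk; rewrite /ball/=.
have key i : (N <= i)%N -> del i <= 1 /\ del i <= e / (8 * s * K1).
  move=> Ni; have := le_trans (ler_norm _) (HN i Ni).
  by rewrite le_min => /andP[].
have [h1 h2] := key N (leqnn N); have [h3 h4] := key k Nk.
apply: le_lt_trans (Ha N k s s0 h1 h3) _.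
have E : K2 / s = e / 2 by rewrite /s; field; rewrite !gt_eqF.
rewrite E; have : s * K1 * (del N + del k) <= e / 4.
  rewrite (_ : e / 4 = s * K1 * (e / (8 * s * K1) + e / (8 * s * K1))); last first.
    by field; rewrite !gt_eqF.
  by apply: ler_wpM2l; [rewrite mulr_ge0 ?ltW|exact: lerD].
by lra.
Qed.

(** A weight without sign is the difference M - (M - g) of two nonnegative weights, bounded by M and
    2M; hence the factor 3. *)
Lemma wip_young_signed U g M (s : R) F G : measurable U -> weight U g ->
  0 <= M -> (forall x, U x -> `|g x| <= M) -> L2v U F -> L2v U G -> 0 < s ->
  2 * `|wip U g F G| <=
  3 * M * (s * wip U (fun=> 1) F F + s^-1 * wip U (fun=> 1) G G).
Proof.
move=> mU wg M0 gM LF LG s0; have w1 := weight1 U.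
have wM : weight U (fun=> M * 1).
  by split; [exact: measurable_cst|exists `|M| => x _; rewrite mulr1].
have wMg : weight U (fun x => M * 1 - g x) by exact: weightB.
have g0 : {ae leb, forall x, U x -> 0 <= M * 1 - g x}.
  by apply: aeW => x Ux; rewrite mulr1 subr_ge0 (le_trans (ler_norm _))// gM.
have gM2 x : U x -> `|M * 1 - g x| <= 2 * M.
  by move=> /gM; rewrite mulr1 ler_norml => /andP[h1 h2]; rewrite ler_norml; apply/andP; split; lra.
have M0' : {ae leb, forall x : 'rV[R]_m, U x -> 0 <= M * 1} by apply: aeW => x _; rewrite mulr1.
have H1 := wip_young mU wMg LF LG g0 s0.
have H2 := wip_young mU wM LF LG M0' s0.
have E := wip_weightB mU wM wg LF LG.
have B1 := wip_weight_bound mU wMg gM2 LF; have B2 := wip_weight_bound mU wMg gM2 LG.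
rewrite E in H1; rewrite (wip_cst M mU w1 LF LF) (wip_cst M mU w1 LG LG) in H2.
have sV : 0 < s^-1 by rewrite invr_gt0.
have B1' := ler_wpM2l (ltW s0) B1; have B2' := ler_wpM2l (ltW sV) B2.
move: H1 H2 B1' B2'; clear E B1 B2.
move: (wip U _ _ _) (wip U _ _ _) (wip U _ _ _) (wip U _ _ _) (wip U _ _ _) (wip U _ _ _) => a b d e f h.
move=> H1 H2 B1 B2.
have : `|f| <= `|h| + `|h - f| by rewrite -[X in `|X| <= _](subKr h) ler_normB.
by move: H1 H2 B1 B2; clear; lra.
Qed.

(* Testing Q_g(N, N) = - int_D (g - 1) V.N against itself. *)
Lemma wip_self_bound U D g c M N V : measurable U -> measurable D -> D `<=` U ->
  weight U g -> 0 < c -> {ae leb, forall x, U x -> c <= g x} -> 0 < M ->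
  (forall x, U x -> `|g x - 1| <= M) ->
  L2v U N -> L2v U V -> wip U g N N = - wip D (fun x => g x - 1) V N ->
  wip U g N N <= 9 * M ^+ 2 / c * wip D (fun=> 1) V V.
Proof.
move=> mU mD DU wg c0 cg M0 gM LN LV E.
have LND := L2v_sub mU mD DU LN; have LVD := L2v_sub mU mD DU LV.
have wB := weight_sub mU mD DU (weightB wg (weight1 U)).
(* With this parameter the term in [N] is at most Q_g(N, N) and is absorbed on the left. *)
have s0 : 0 < 3 * M / c by rewrite divr_gt0// mulr_gt0.
have := wip_young_signed mD wB (ltW M0) (fun x Dx => gM x (DU x Dx)) LVD LND s0.
have H3 : wip D (fun=> 1) N N <= wip U (fun=> 1) N N.
  apply: (le_Rintegral_sub mU mD DU); first exact: (wip_integrable mU (weight1 U) LN LN).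
  by move=> x _; rewrite mul1r dot_ge0.
have H4 := wip_coercive mU wg cg LN.
have H5 := ler_norm (- wip D (fun x => g x - 1) V N); rewrite normrN -E in H5.
move: H3 H4 H5; clear E.
move: (wip U g N N) (wip U _ N N) (wip D _ N N) (wip D _ V V) `|_| => a b d e f.
move=> H3 H4 H5; rewrite invf_div => H.
have : 3 * M * (c / (3 * M) * d) <= a.
  rewrite (_ : 3 * M * _ = c * d); last by field; rewrite gt_eqF.
  exact: le_trans (ler_wpM2l (ltW c0) H3) H4.
have : 3 * M * (3 * M / c * e) = 9 * M ^+ 2 / c * e by field; rewrite gt_eqF.
by move: H H5; clear; lra.
Qed.

Let weighted_sum_le (k q x y : R) : 0 < k -> x <= 1 -> y <= 1 ->
  k * (2 * x + 2 * q) + k * (2 * y + 2 * q) <= k * (4 + 4 * q).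
Proof. by move=> k0 x1 y1; rewrite -mulrDr (ler_wpM2l (ltW k0))//; lra. Qed.

Let normB4_le (x y z t : R) : `|x - y - (z - t)| <= `|x - z| + `|y - t|.
Proof. by rewrite (_ : x - y - _ = (x - z) - (y - t)) ?ler_normB//; ring. Qed.

Let cauchy_constants (M K s q x y : R) : 0 < M -> 0 < K -> 0 < s -> x <= 1 -> y <= 1 ->
  3 / 2 * M * (s * (2 * (x + y)) + s^-1 * (4 * (x + y) + 8 * q)) +
  2^-1 * (s * (K * (2 * (x + y))) + s^-1 * (K * (8 + 8 * q))) <=
  s * (3 * M + K) * (x + y) +
  (3 / 2 * M * (8 + 8 * q) + 2^-1 * (K * (8 + 8 * q))) / s.
Proof.
move=> M0 K0 s0 x1 y1; have sV0 : 0 < s^-1 by rewrite invr_gt0.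
have : M * (s^-1 * (4 * (x + y) + 8 * q)) <= M * (s^-1 * (8 + 8 * q)).
  by rewrite (ler_wpM2l (ltW M0))// (ler_wpM2l (ltW sV0))//; lra.
by move: (s^-1) => t; lra.
Qed.

(** The indicator is a_n - b_n with two quadratic quantities, so each increment is the pairing of a
    difference with a sum: the difference is small, the sum bounded. For b_n this uses that r
    depends linearly on v, so r_j - r_k is controlled by the gradient of v_j - v_k on D. *)
Lemma energy_gap_cvg U D g (v : nat -> 'rV[R]_m -> R) (c : R) (i0 : 'I_m)
    (G : 'rV[R]_m -> 'rV[R]_m) : open U ->
  bounded_set U -> open D -> D `<=` U -> weight U g -> 0 < c ->
  {ae leb, forall x, U x -> c <= g x} -> (forall x, U x -> ~ D x -> g x = 1) ->
  (forall n, weak_solution U (fun=> 1) (v n)) -> L2v D G ->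
  wip D (fun=> 1) (fun x => nabla U (v n) x - G x) (fun x => nabla U (v n) x - G x)
    @[n --> \oo] --> 0 ->
  cvgn (fun n => Lambda U g (trace U (v n)) (trace U (v n)) -
    Lambda U (fun=> 1) (trace U (v n)) (trace U (v n))).
Proof.
move=> oU bU oD DU wg c0 cg g1 sv LG HG; have mU := open_measurable_rV oU.
have mD := open_measurable_rV oD; have w1 := weight1 U; have w1D := weight1 D.
have wB := weightB wg w1; have wBD := weight_sub mU mD DU wB.
have g0 := ae_ge_ge0 c0 cg.
have Hv n : H1 U (v n) by case: (sv n).
have Lv n := nabla_L2v mU (Hv n); have LvD n := L2v_sub mU mD DU (Lv n).
have patch F H : wip U (fun x => g x - 1) F H = wip D (fun x => g x - 1) F H.
  by apply: wip_patch => // x Ux Dx; rewrite g1// subrr.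
have [M M0 gM] : exists2 M, 0 < M & forall x, U x -> `|g x - 1| <= M.
  have [_ [M HM]] := wB; exists (`|M| + 1); first by rewrite ltr_wpDl.
  by move=> x /HM/le_trans; apply; rewrite (le_trans (ler_norm M))// lerDl.
have gMD x (Dx : D x) := gM x (DU x Dx).
pose K := 9 * M ^+ 2 / c.
have K0 : 0 < K by rewrite divr_gt0// mulr_gt0// exprn_gt0.
have Hn n := Lambda_difference i0 oU bU wg c0 cg (sv n).
have /choice[r Hr0] : forall n, exists r, _ /\ _ :=
  fun n => let: ex_intro2 r h1 h2 := Hn n in ex_intro _ r (conj h1 h2).
have Hr n : H10 U (r n) by case: (Hr0 n).
have Hr1 n := H10_H1 (Hr n); have Lr n := nabla_L2v mU (Hr1 n).
have rw n w : H10 U w -> wip U g (nabla U (r n)) (nabla U w) =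
    - wip D (fun x => g x - 1) (nabla U (v n)) (nabla U w).
  by move=> Hw; rewrite -patch; have [_ [_ H _]] := Hr0 n; exact: H.
pose a n := wip D (fun x => g x - 1) (nabla U (v n)) (nabla U (v n)).
pose b n := wip U g (nabla U (r n)) (nabla U (r n)).
have E n : Lambda U g (trace U (v n)) (trace U (v n)) -
    Lambda U (fun=> 1) (trace U (v n)) (trace U (v n)) = a n - b n.
  by have [_ [_ _ H]] := Hr0 n; apply: (etrans H); congr (_ - _); exact: patch.
rewrite (eq_fun E).
pose del n := wip D (fun=> 1) (fun x => nabla U (v n) x - G x) (fun x => nabla U (v n) x - G x).
pose q := wip D (fun=> 1) G G.
have q0 : 0 <= q by exact: wip1_ge0.
have D1 : {ae leb, forall x : 'rV[R]_m, D x -> (0 : R) <= 1} by apply: aeW.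
have LdG n := L2vB mD (LvD n) LG.
have Vq n : wip D (fun=> 1) (nabla U (v n)) (nabla U (v n)) <= 2 * del n + 2 * q.
  have := wip_lin_le (a := 1) (b := 1) mD w1D D1 (LvD n) (LdG n) LG.
  rewrite expr1n !mulr1; apply; apply: aeW => x _.
  by rewrite !scale1r subrK.
pose dV j k (x : 'rV[R]_m) : 'rV[R]_m := nabla U (v j) x - nabla U (v k) x.
pose sV j k (x : 'rV[R]_m) : 'rV[R]_m := nabla U (v j) x + nabla U (v k) x.
have LdV j k : L2v U (dV j k) by exact: L2vB.
have LsV j k : L2v U (sV j k) by exact: L2vD.
have LdVD j k := L2v_sub mU mD DU (LdV j k); have LsVD j k := L2v_sub mU mD DU (LsV j k).
have dVq j k : wip D (fun=> 1) (dV j k) (dV j k) <= 2 * (del j + del k).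
  have := wip_lin_le (a := 1) (b := -1) mD w1D D1 (LdVD j k) (LdG j) (LdG k).
  rewrite sqrrN expr1n !mulr1 mulrDr; apply; apply: aeW => x _.
  by rewrite scale1r scaleN1r opprB addrA subrK.
have sVq j k : wip D (fun=> 1) (sV j k) (sV j k) <= 4 * (del j + del k) + 8 * q.
  have := wip_lin_le (a := 1) (b := 1) mD w1D D1 (LsVD j k) (LvD j) (LvD k).
  rewrite expr1n !mulr1 => /(_ _) H; apply: le_trans (H _) _.
    by apply: aeW => x _; rewrite !scale1r.
  have A := Vq j; have B := Vq k; clear - A B.
  move: A B; set y := wip D _ _ _; set z := wip D _ _ _; clearbody y z del q; lra.
have bq n : b n <= K * (2 * del n + 2 * q).
  apply: le_trans (ler_wpM2l (ltW K0) (Vq n)).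
  exact: (wip_self_bound mU mD DU wg c0 cg M0 gM (Lr n) (Lv n) (rw n _ (Hr n))).
have abound j k s : 0 < s -> `|a j - a k| <=
    3 / 2 * M * (s * (2 * (del j + del k)) + s^-1 * (4 * (del j + del k) + 8 * q)).
  move=> s0; have -> : a j - a k = wip D (fun x => g x - 1) (dV j k) (sV j k).
    have e1 : {ae leb, forall x, D x -> dV j k x = 1 *: nabla U (v j) x + (-1) *: nabla U (v k) x}.
      by apply: aeW => x _; rewrite scale1r scaleN1r.
    have e2 : {ae leb, forall x, D x -> sV j k x = 1 *: nabla U (v j) x + 1 *: nabla U (v k) x}.
      by apply: aeW => x _; rewrite !scale1r.
    rewrite (wip_lin mD wBD (LdVD j k) (LvD j) (LvD k) (LsVD j k) e1).
    rewrite ![wip _ _ _ (sV j k)]wipC.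
    rewrite (wip_lin mD wBD (LsVD j k) (LvD j) (LvD k) (LvD j) e2).
    rewrite (wip_lin mD wBD (LsVD j k) (LvD j) (LvD k) (LvD k) e2).
    rewrite [wip _ _ (nabla U (v k)) (nabla U (v j))]wipC /a.
    by move: (wip _ _ _ _) (wip _ _ _ _) (wip _ _ _ _) => y z t; clear; ring.
  have sV0 : 0 < s^-1 by rewrite invr_gt0.
  have := wip_young_signed mD wBD (ltW M0) gMD (LdVD j k) (LsVD j k) s0.
  have h1 := ler_wpM2l (ltW s0) (dVq j k); have h2 := ler_wpM2l (ltW sV0) (sVq j k).
  have h3 := ler_wpM2l (ltW M0) (lerD h1 h2).
  move: h3; clear.
  move: (wip _ _ (dV j k) (dV j k)) (wip _ _ (sV j k) (sV j k)) `|_| (del j + del k) => y z t dd; lra.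
have bbound j k s : 0 < s -> del j <= 1 -> del k <= 1 -> `|b j - b k| <=
    2^-1 * (s * (K * (2 * (del j + del k))) + s^-1 * (K * (8 + 8 * q))).
  move=> s0 dj dk; pose N := nabla U (r j \- r k).
  have HN : H10 U (r j \- r k) by exact: H10B.
  have LN : L2v U N by exact: nabla_L2v (H10_H1 HN).
  have eN : {ae leb, forall x, U x -> N x = 1 *: nabla U (r j) x + -1 *: nabla U (r k) x}.
    exact: nablaB.
  have ND : wip U g N N <= K * wip D (fun=> 1) (dV j k) (dV j k).
    apply: (wip_self_bound mU mD DU wg c0 cg M0 gM LN (LdV j k)).
    rewrite {1}(wip_lin mU wg LN (Lr j) (Lr k) LN eN) !rw//.
    have e1 : {ae leb, forall x, D x -> dV j k x = 1 *: nabla U (v j) x + (-1) *: nabla U (v k) x}.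
      by apply: aeW => x _; rewrite scale1r scaleN1r.
    rewrite (wip_lin mD wBD (LdVD j k) (LvD j) (LvD k) (L2v_sub mU mD DU LN) e1) /N.
    by move: (wip _ _ _ _) (wip _ _ _ _) => y z; clear; ring.
  pose S (x : 'rV[R]_m) : 'rV[R]_m := 1 *: nabla U (r j) x + 1 *: nabla U (r k) x.
  have LS : L2v U S by exact: L2v_lin.
  have eS : {ae leb, forall x, U x -> S x = 1 *: nabla U (r j) x + 1 *: nabla U (r k) x}.
    exact: aeW.
  have -> : b j - b k = wip U g N S.
    rewrite (wip_lin mU wg LN (Lr j) (Lr k) LS eN) ![wip _ _ _ S]wipC.
    rewrite (wip_lin mU wg LS (Lr j) (Lr k) (Lr j) eS) (wip_lin mU wg LS (Lr j) (Lr k) (Lr k) eS).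
    rewrite [wip _ _ (nabla U (r k)) (nabla U (r j))]wipC /b.
    by move: (wip _ _ _ _) (wip _ _ _ _) (wip _ _ _ _) => y z t; clear; ring.
  have SS := wip_lin_le mU wg g0 LS (Lr j) (Lr k) eS.
  have := wip_young mU wg LN LS g0 s0.
  have sV0 : 0 < s^-1 by rewrite invr_gt0.
  have h1 := ler_wpM2l (ltW s0) (le_trans ND (ler_wpM2l (ltW K0) (dVq j k))).
  have h2 : wip U g S S <= K * (8 + 8 * q).
    have b1 := bq j; have b2 := bq k.
    have h3 := weighted_sum_le q K0 dj dk.
    move: SS; rewrite expr1n -/(b j) -/(b k); move: b1 b2 h3; clear.
    by move: (wip U g S S) (b j) (b k) (del j) (del k) K q => w p r' d e k' q'; clear; lra.
  have h3 := ler_wpM2l (ltW sV0) h2.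
  move: h1 h3; clear.
  move: (wip _ _ N N) (wip _ _ S S) `|_| (del j + del k) => y z t dd; lra.
apply: (@cauchy_young _ del (3 * M + K) (3 / 2 * M * (8 + 8 * q) + 2^-1 * (K * (8 + 8 * q)))) => //.
- by rewrite addr_gt0// mulr_gt0.
- have q8 : 0 < 8 + 8 * q by rewrite ltr_wpDr ?mulr_ge0.
  have h32 : 0 < (3 / 2 : R) by exact: divr_gt0.
  apply: addr_gt0; first exact: mulr_gt0 (mulr_gt0 h32 M0) q8.
  apply: mulr_gt0; [by rewrite invr_gt0|exact: mulr_gt0].
move=> j k s s0 dj dk.
apply: le_trans (normB4_le _ _ _ _) _.
apply: le_trans (lerD (abound j k s s0) (bbound j k s s0 dj dk)) _.
exact: cauchy_constants.
Qed.

End energy_gap_convergence.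

(** * The fundamental solution *)

Section continuous_on.
Context {R : realType} {m : nat}.
Implicit Types (U V K : set 'rV[R]_m) (f g : 'rV[R]_m -> R).

Lemma open_continuous_measurable U f : open U ->
  (forall x, U x -> {for x, continuous f}) -> measurable_fun U f.
Proof.
move=> oU cf; apply: (measurability _ (RGenOpens.measurableE R)) => _ [B [a [b ->]] <-].
apply: open_measurable_rV; rewrite openE => x [Ux fx].
rewrite /interior; apply: filterI; first exact: open_nbhs_nbhs.
by apply: (cf x Ux); apply: open_nbhs_nbhs; split=> //; exact: interval_open.
Qed.

Lemma compact_continuous_bound K f : compact K ->
  (forall x, K x -> {for x, continuous f}) ->
  exists2 M, 0 < M & forall x, K x -> `|f x| <= M.
Proof.
move=> cK cf; have : compact (f @` K).
  apply: continuous_compact => //; apply: continuous_in_subspaceT => x /set_mem; exact: cf.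
move=> /compact_bounded[M [_ HM]]; exists (`|M| + 1); first by rewrite ltr_wpDl.
move=> x Kx; apply: HM; last by exists x.
by rewrite (le_lt_trans (ler_norm M))// ltrDl.
Qed.

Lemma L2_continuous U K f : open U -> compact K -> K `<=` U ->
  (forall x, U x -> {for x, continuous f}) -> L2 leb K f.
Proof.
move=> oU cK KU cf; have mK := compact_measurable_rV cK.
have [M _ HM] := compact_continuous_bound cK (fun x Kx => cf x (KU x Kx)).
apply: (L2_bounded mK (compact_leb_fin cK)) HM.
apply: measurable_funS (open_measurable_rV oU) KU _.
exact: open_continuous_measurable.
Qed.

Lemma open_punctured (z : 'rV[R]_m) : open (~` [set z]).
Proof. by apply: closed_openC; apply: compact_closed => //; exact: compact_set1. Qed.

Lemma is_derive_shift f (z x v : 'rV[R]_m) (df : R) :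
  is_derive (x - z) v f df -> is_derive x v (fun y => f (y - z)) df.
Proof.
move=> /is_derive_line H; apply/is_derive_line.
by under eq_fun do rewrite addrAC.
Qed.

Lemma continuous_at_shift f (z x : 'rV[R]_m) : {for x - z, continuous f} ->
  {for x, continuous (fun y : 'rV[R]_m => f (y - z))}.
Proof.
move=> cf; have cz : {for x, continuous (fun y : 'rV[R]_m => y - z)}.
  by apply: (@continuousB _ _ _ id (fun=> z)); [rewrite /prop_for /continuous_at; exact: cvg_id|exact: cst_continuous].
exact: (@continuous_comp _ _ _ _ f x cz cf).
Qed.

Lemma continuous_at_sum x (I : Type) (r : seq I) (F : I -> 'rV[R]_m -> R) :
  (forall i, {for x, continuous (F i)}) ->
  {for x, continuous (fun y => \sum_(i <- r) F i y)}.
Proof.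
move=> cF; elim: r => [|i r IH].
  rewrite (_ : (fun y => _) = cst 0); first exact: cst_continuous.
  by apply/funext => y; rewrite big_nil.
rewrite (_ : (fun y => _) = (fun y => F i y + \sum_(j <- r) F j y)).
  exact: (@continuousD _ _ _ (F i) (fun y => \sum_(j <- r) F j y)).
by apply/funext => y; rewrite big_cons.
Qed.

Lemma is_derive_mulc (a : R) f (x v : 'rV[R]_m) (df : R) :
  is_derive x v f df -> is_derive x v (fun y => a * f y) (a * df).
Proof.
move=> D; have := is_derive_mul (is_derive_cst a x v) D.
by rewrite mul0r add0r.
Qed.

End continuous_on.

Section fundamental_solution.
Context {R : realType} {m : nat}.
Implicit Types (U V K : set 'rV[R]_m) (f g : 'rV[R]_m -> R) (x y z : 'rV[R]_m).

Lemma dot_gt0 y : y != 0 -> 0 < dot y y.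
Proof.
move=> y0; have : 0 < `|y| ^+ 2 by rewrite exprn_gt0// normr_gt0.
move=> /lt_le_trans; apply; have := norm_qdist 0 y.
by rewrite /qdist !subr0.
Qed.

Lemma enorm_gt0 y : y != 0 -> 0 < enorm y.
Proof. by move=> /dot_gt0; rewrite sqrtr_gt0. Qed.

Lemma enorm_ge0 y : 0 <= enorm y. Proof. exact: sqrtr_ge0. Qed.

Lemma norm_le_enorm y : `|y| <= enorm y.
Proof.
rewrite -(ler_pXn2r (_ : 0 < 2)%N) ?nnegrE ?enorm_ge0// enorm_sqr.
by have := norm_qdist 0 y; rewrite /qdist !subr0.
Qed.

Lemma enorm_le_norm y : enorm y <= m%:R * `|y|.
Proof.
rewrite -(ler_pXn2r (_ : 0 < 2)%N) ?nnegrE ?enorm_ge0 ?mulr_ge0// enorm_sqr.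
have := qdist_norm 0 y; rewrite /qdist !subr0 => /le_trans; apply.
rewrite exprMn ler_wpM2r ?exprn_ge0// -natrX ler_nat.
by case: (m) => // n; rewrite leq_pmulr.
Qed.

Definition rinv y : R := (enorm y)^-1.

Lemma is_derive_rinv i y : y != 0 ->
  is_derive y (delta_mx ord0 i) rinv (- (y ord0 i * rinv y ^+ 3)).
Proof.
move=> y0; have r0 := enorm_gt0 y0; have d0 := dot_gt0 y0.
have E : (fun y : 'rV[R]_m => dot y y) = qdist 0 by apply/funext => x; rewrite /qdist subr0.
have D1 : is_derive y (delta_mx ord0 i) (fun y : 'rV[R]_m => dot y y) (2 * y ord0 i).
  have := smooth_is_derive i y (fun k => Ck_qdist k (0 : 'rV[R]_m)).
  by rewrite partial_qdist mxE subr0 E.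
have D2 := is_derive_comp1 D1 (is_derive1_sqrt d0).
have rn0 : enorm y != 0 by rewrite gt_eqF.
have D3 : is_derive y (delta_mx ord0 i) rinv _ := is_derive_inv rn0 D2.
suff -> : - (y ord0 i * rinv y ^+ 3) =
  - ((2 * Num.sqrt (dot y y))^-1 * (2 * y ord0 i)) / enorm y / enorm y by exact: D3.
by rewrite -/(enorm y) /rinv; field.
Qed.

Lemma continuous_rinv y : y != 0 -> {for y, continuous rinv}.
Proof.
move=> y0; apply: (@continuousV _ _ (@enorm R m)); first by rewrite gt_eqF// enorm_gt0.
apply: (@continuous_comp _ _ _ (fun y : 'rV[R]_m => dot y y) Num.sqrt); last exact: sqrt_continuous.
have -> : (fun y : 'rV[R]_m => dot y y) = qdist 0 by apply/funext => x; rewrite /qdist subr0.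
by move: y {y0}; exact: (Ck_continuous (Ck_qdist 0 (0 : 'rV[R]_m))).
Qed.

Lemma is_derive_rinvX i n y : y != 0 ->
  is_derive y (delta_mx ord0 i) (fun y => rinv y ^+ n)
    (- (n%:R * y ord0 i * rinv y ^+ n.+2)).
Proof.
move=> y0; elim: n => [|n IH].
  by under eq_fun do rewrite expr0; rewrite !mul0r oppr0; exact: is_derive_cst.
under eq_fun do rewrite exprS.
apply: is_derive_eq; first exact: (is_derive_mul (is_derive_rinv i y0) IH).
by rewrite -natr1 !exprS; ring.
Qed.

Definition dG0_const : R := if m == 2%N then (2 * pi)^-1 else (4 * pi)^-1.
Notation kappa := dG0_const.

Lemma dG0_const_gt0 : 0 < kappa.
Proof. by rewrite /kappa; case: ifP => _; rewrite invr_gt0 mulr_gt0// pi_gt0. Qed.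

(** One formula, -kappa y / |y|^m, for the gradient of the fundamental solution in both
    dimensions. *)
Definition dG0 y : 'rV[R]_m := - (kappa * rinv y ^+ m) *: y.

Definition ddG0 i y : R :=
  - kappa * (rinv y ^+ m - m%:R * y ord0 i ^+ 2 * rinv y ^+ m.+2).

Lemma is_derive_dG0 i y : y != 0 ->
  is_derive y (delta_mx ord0 i) (fun y => dG0 y ord0 i) (ddG0 i y).
Proof.
move=> y0; under eq_fun do rewrite mxE.
have D := is_derive_mul (is_derive_mulc (- kappa) (is_derive_rinvX i m y0)) (is_derive_coord i i y).
rewrite (_ : (fun y => _) = (fun y : 'rV[R]_m => - kappa * rinv y ^+ m * y ord0 i)); last first.
  by apply/funext => x; rewrite -mulNr.
suff -> : ddG0 i y = - kappa * - (m%:R * y ord0 i * rinv y ^+ m.+2) * y ord0 i +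
  - kappa * rinv y ^+ m * (i == i)%:R by exact: D.
have -> : (i == i)%:R = 1 :> R by rewrite eqxx.
by rewrite /ddG0; ring.
Qed.

Lemma laplacian_G0 y : y != 0 -> \sum_i ddG0 i y = 0.
Proof.
move=> y0; rewrite -mulr_sumr big_split/= sumrN sumr_const card_ord.
have -> : \sum_(i < m) m%:R * y ord0 i ^+ 2 * rinv y ^+ m.+2 = m%:R * rinv y ^+ m.
  rewrite -mulr_suml -mulr_sumr.
  have -> : \sum_(i < m) y ord0 i ^+ 2 = enorm y ^+ 2.
    by rewrite enorm_sqr; apply: eq_bigr => i _; rewrite expr2.
  have r0 : enorm y != 0 by rewrite gt_eqF ?enorm_gt0.
  by rewrite /rinv !exprS; field.
by rewrite -(mulr_natl (rinv y ^+ m)) subrr mulr0.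
Qed.

Lemma continuous_rinvX n y : y != 0 -> {for y, continuous (fun y => rinv y ^+ n)}.
Proof.
move=> y0; elim: n => [|n IH].
  by rewrite (_ : (fun y => _) = cst 1); [exact: cst_continuous|apply/funext => x; rewrite expr0].
rewrite (_ : (fun y => _) = (fun y => rinv y * rinv y ^+ n)); last first.
  by apply/funext => x; rewrite exprS.
by apply: (@continuousM _ _ rinv (fun y => rinv y ^+ n)) => //; exact: continuous_rinv.
Qed.

Lemma continuous_coord i y : {for y, continuous (fun y => y ord0 i : R)}.
Proof. exact: (Ck_continuous (Ck_coord 0 i)). Qed.

Lemma continuous_dG0 i y : y != 0 -> {for y, continuous (fun y => dG0 y ord0 i)}.
Proof.
move=> y0; rewrite (_ : (fun y => _) = (fun y => - (kappa * rinv y ^+ m) * y ord0 i)); last first.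
  by apply/funext => x; rewrite mxE.
apply: (@continuousM _ _ (fun y => - (kappa * rinv y ^+ m)) (fun y => y ord0 i)); last exact: continuous_coord.
apply: (@continuousN _ _ _ (fun y => kappa * rinv y ^+ m)).
by apply: (@continuousM _ _ (fun=> kappa) (fun y => rinv y ^+ m)); [exact: cst_continuous|exact: continuous_rinvX].
Qed.

Lemma continuous_ddG0 i y : y != 0 -> {for y, continuous (ddG0 i)}.
Proof.
move=> y0; apply: (@continuousM _ _ (fun=> - kappa)
  (fun y => rinv y ^+ m - m%:R * y ord0 i ^+ 2 * rinv y ^+ m.+2)); first exact: cst_continuous.
apply: (@continuousB _ _ _ (fun y => rinv y ^+ m)); first exact: continuous_rinvX.
apply: (@continuousM _ _ (fun y => m%:R * y ord0 i ^+ 2) (fun y => rinv y ^+ m.+2)); last exact: continuous_rinvX.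
exact: (Ck_continuous (Ck_mul (Ck_cst 0 m%:R) (Ck_exp 2 (Ck_coord 0 i)))).
Qed.

Hypothesis m23 : m = 2%N \/ m = 3%N.

Lemma is_derive_G0 i y : y != 0 ->
  is_derive y (delta_mx ord0 i) (@G0 R m) (dG0 y ord0 i).
Proof.
move=> y0; have r0 : 0 < rinv y by rewrite invr_gt0 enorm_gt0.
have D1 := is_derive_rinv i y0.
case: m23 => m2.
- rewrite (_ : @G0 R m = fun y => kappa * ln (rinv y)); last first.
    by apply/funext => x; rewrite /G0 /dG0_const; rewrite (introT eqP m2).
  apply: is_derive_eq.
    exact: is_derive_mulc (is_derive_comp1 D1 (is_derive1_ln r0)).
  rewrite mxE; have -> : rinv y ^+ m = rinv y ^+ 2 by congr (_ ^+ _).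
  rewrite !exprS.
  by field; rewrite gt_eqF.
- rewrite (_ : @G0 R m = fun y => kappa * rinv y); last first.
    by apply/funext => x; rewrite /G0 /dG0_const; rewrite (_ : (m == 2%N) = false) ?invfM//; rewrite m2.
  suff -> : dG0 y ord0 i = kappa * - (y ord0 i * rinv y ^+ 3) by exact: is_derive_mulc D1.
  by rewrite mxE; have -> : rinv y ^+ m = rinv y ^+ 3; [congr (_ ^+ _)|ring].
Qed.

Lemma continuous_G0 y : y != 0 -> {for y, continuous (@G0 R m)}.
Proof.
move=> y0; have r0 : 0 < rinv y by rewrite invr_gt0 enorm_gt0.
case: m23 => m2.
- rewrite (_ : @G0 R m = fun y => kappa * ln (rinv y)); last first.
    by apply/funext => x; rewrite /G0 /dG0_const; rewrite (introT eqP m2).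
  apply: (@continuousM _ _ (fun=> kappa) (fun y => ln (rinv y))); first exact: cst_continuous.
  apply: (@continuous_comp _ _ _ rinv (@ln R)); first exact: continuous_rinv.
  exact: continuous_ln.
- rewrite (_ : @G0 R m = fun y => kappa * rinv y); last first.
    by apply/funext => x; rewrite /G0 /dG0_const; rewrite (_ : (m == 2%N) = false) ?invfM//; rewrite m2.
  by apply: (@continuousM _ _ (fun=> kappa) rinv); [exact: cst_continuous|exact: continuous_rinv].
Qed.

Lemma grad_G0 y : y != 0 -> grad (@G0 R m) y = dG0 y.
Proof.
move=> y0; apply/rowP => i; rewrite mxE.
exact: partialE (is_derive_G0 i y0).
Qed.

Lemma dot_dG0 y : y != 0 -> dot (dG0 y) (dG0 y) = kappa ^+ 2 * rinv y ^+ (2 * m.-1).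
Proof.
move=> y0; rewrite /dot; under eq_bigr do rewrite !mxE mulrACA.
rewrite -mulr_sumr -/(dot y y) -enorm_sqr.
have r0 : enorm y != 0 by rewrite gt_eqF ?enorm_gt0.
have : rinv y * enorm y = 1 by rewrite mulVf.
have : (0 < m)%N by case: m23 => ->.
move: (rinv y) (enorm y) {r0} => p r; clear -p r; case: (m) => // n _ pr.
rewrite -pred_Sn mulnC exprM exprS; have -> : r ^+ 2 = r * r by [].
by transitivity ((p * r) ^+ 2 * (kappa ^+ 2 * p ^+ n ^+ 2)); [ring|rewrite pr expr1n mul1r].
Qed.

(** Integration by parts in each coordinate and harmonicity off the pole. The pole may lie on the
    boundary of U, because the lemma is also applied to a domain from which the pole has been
    removed. *)
Lemma dG0_test_orth U z psi : open U -> ~ U z -> test_function U psi ->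
  wip U (fun=> 1) (fun y => dG0 (y - z)) (grad psi) = 0.
Proof.
move=> oU Uz tp.
have yz y : U y -> y - z != 0 by move=> Uy; apply/eqP => /subr0_eq yz; apply: Uz; rewrite -yz.
have cd i y : U y -> {for y, continuous (fun y => dG0 (y - z) ord0 i)}.
  by move=> /yz ?; apply: (@continuous_at_shift _ _ (fun y => dG0 y ord0 i)); exact: continuous_dG0.
have cdd i y : U y -> {for y, continuous (fun y => ddG0 i (y - z))}.
  by move=> /yz ?; apply: continuous_at_shift; exact: continuous_ddG0.
have mU := open_measurable_rV oU; have /test_functionP[sp cp pU] := tp.
have int (f : 'rV[R]_m -> R) psi' : test_function U psi' -> (forall y, U y -> {for y, continuous f}) ->
    leb.-integrable U (EFin \o (fun y => f y * psi' y)).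
  move=> tp' cf; apply: (@integrableS _ _ _ _ setT) => //.
  have /test_functionP[sp' cp' _] := tp'.
  apply: (supp_integrable cp'); first exact: (continuous_test_mul cf tp').
  by move=> x /fsuppPn ->; rewrite mulr0.
rewrite /wip; under eq_Rintegral.
  move=> y _; rewrite mul1r /dot; under eq_bigr do rewrite [grad _ _ _ _]mxE.
  over.
rewrite Rintegral_sum//; last first.
  by move=> i; apply: int => //; [exact: test_partial|exact: cd].
transitivity (\sum_(i < m) - \int[leb]_(y in U) (ddG0 i (y - z) * psi y)).
  apply: eq_bigr => i _; apply: (ibp_test oU (cd i) (cdd i)) => // y /yz y0.
  by apply: (@is_derive_shift _ _ (fun y => dG0 y ord0 i)); exact: is_derive_dG0.
rewrite sumrN -Rintegral_sum//; last by move=> i; apply: int => //; exact: cdd.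
rewrite (_ : \int[leb]_(y in U) _ = \int[leb]_(y in U) 0).
  by rewrite Rintegral_cst// mul0r oppr0.
by apply: eq_Rintegral => y /set_mem /yz y0; rewrite -mulr_suml laplacian_G0// mul0r.
Qed.

End fundamental_solution.

(** * Finite superpositions of point sources *)

Section singular_solutions.
Context {R : realType} {m : nat}.
Implicit Types (U V K : set 'rV[R]_m) (f g : 'rV[R]_m -> R) (x y z : 'rV[R]_m).
Hypothesis m23 : m = 2%N \/ m = 3%N.

Definition combo (s : seq (R * 'rV[R]_m)) y : R := \sum_(p <- s) p.1 * G0 (y - p.2).
Definition dcombo (s : seq (R * 'rV[R]_m)) y : 'rV[R]_m := \sum_(p <- s) p.1 *: dG0 (y - p.2).

Lemma compact_closure_bounded U : bounded_set U -> compact (closure U).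
Proof.
move=> [M [Mr HM]]; apply: bounded_closed_compact; last exact: closed_closure.
exists M; split=> // r Mr' x Ux; have : closed [set y : 'rV[R]_m | `|y| <= r].
  by apply: (@closed_comp _ _ (fun y : 'rV[R]_m => `|y|) [set t | t <= r]);
    [move=> y _; exact: norm_continuous|exact: closed_le].
move=> /closure_id; rewrite -[X in _ -> X]/([set y : 'rV[R]_m | `|y| <= r] x) => ->.
by apply: (closure_subset _ Ux) => y Uy /=; exact: HM Uy.
Qed.

Lemma G0_L2 K z : compact K -> ~ K z -> L2 leb K (fun y => G0 (y - z)).
Proof.
move=> cK Kz; apply: (@L2_continuous _ _ (~` [set z])) => //; [exact: open_punctured|move=> y Ky yz|move=> y /eqP yz].
  by apply: Kz; rewrite -yz.
by apply: continuous_at_shift; apply: continuous_G0 => //; rewrite subr_eq0.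
Qed.

Lemma dG0_L2v K z : compact K -> ~ K z -> L2v K (fun y => dG0 (y - z)).
Proof.
move=> cK Kz i; apply: (@L2_continuous _ _ (~` [set z])) => //; [exact: open_punctured|move=> y Ky yz|move=> y /eqP yz].
  by apply: Kz; rewrite -yz.
apply: (@continuous_at_shift _ _ (fun y => dG0 y ord0 i)).
by apply: continuous_dG0 => //; rewrite subr_eq0.
Qed.

Lemma weak_gradient_G0 U z : open U -> bounded_set U -> ~ closure U z ->
  weak_gradient U (fun y => G0 (y - z)) (fun y => dG0 (y - z)).
Proof.
move=> oU bU Uz; have cU := compact_closure_bounded bU.
have mU := open_measurable_rV oU; have mcU := compact_measurable_rV cU.
have yz y : U y -> y - z != 0.
  by move=> Uy; apply/eqP => /subr0_eq yz; apply: Uz; rewrite -yz; exact: subset_closure.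
apply: (weak_gradient_C1 oU (leb_bounded mU bU)).
- by move=> y /yz ?; apply: continuous_at_shift; exact: continuous_G0.
- move=> i y /yz ?; apply: (@continuous_at_shift _ _ (fun y => dG0 y ord0 i)).
  exact: continuous_dG0.
- by move=> i y /yz ?; apply: is_derive_shift; exact: is_derive_G0.
exact: L2v_sub mcU mU (@subset_closure _ U) (dG0_L2v cU Uz).
Qed.

Lemma combo_weak_solution U s : open U -> bounded_set U ->
  (forall p, p \in s -> ~ closure U p.2) ->
  weak_gradient U (combo s) (dcombo s) /\ weak_solution U (fun=> 1) (combo s).
Proof.
move=> oU bU Hs; have mU := open_measurable_rV oU; have cU := compact_closure_bounded bU.
have mcU := compact_measurable_rV cU.
suff [L W O] : [/\ L2 leb U (combo s), weak_gradient U (combo s) (dcombo s) &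
    forall phi, test_function U phi -> wip U (fun=> 1) (dcombo s) (grad phi) = 0].
  have H := H1_intro mU L W; split=> //; split=> // phi tp.
  rewrite -(O phi tp); apply: (wip_ae mU (weight1 U) (weight1 U)).
  - exact: nabla_L2v.
  - by case/weak_gradientP : W.
  - exact: test_grad_L2v.
  - exact: aeW.
  - exact: nabla_ae.
elim: s Hs => [_|p s IH Hs].
  have -> : combo [::] = (fun y => 0 * 0 + 0 * 0 : R) :> ('rV[R]_m -> R).
    by apply/funext => y; rewrite /combo big_nil mul0r addr0.
  have -> : dcombo [::] = (fun y => 0 *: 0 + 0 *: 0) :> ('rV[R]_m -> 'rV[R]_m).
    by apply/funext => y; rewrite /dcombo big_nil scale0r addr0.
  have t0 : test_function U ((fun=> 0) : 'rV[R]_m -> R).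
    by apply: (@test_intro _ _ _ set0) => //; [exact: smooth_cst|exact: compact0].
  have L0 := test_L2 mU t0; have W0 := weak_gradient_test oU t0.
  have g0 : grad ((fun=> 0) : 'rV[R]_m -> R) = fun=> 0.
    by apply/funext => y; apply/rowP => i; rewrite !mxE; exact: partialE (is_derive_cst _ _ _).
  rewrite g0 in W0; split.
  - exact: L2_lin.
  - exact: weak_gradient_lin.
  - move=> phi tp; rewrite /wip (_ : \int[leb]_(x in U) _ = \int[leb]_(x in U) 0).
      by rewrite Rintegral_cst// mul0r.
    by apply: eq_Rintegral => y _; rewrite dot_lin !mul0r addr0 mulr0.
have [L W O] := IH (fun q qs => Hs q (mem_behead (s := p :: s) qs)).
have pz := Hs p (mem_head _ _).
have Lp : L2 leb U (fun y => G0 (y - p.2)).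
  have sU := @subset_closure _ U; have LG := G0_L2 cU pz.
  exact: L2_sub LG.
have Wp := weak_gradient_G0 oU bU pz.
have -> : combo (p :: s) = fun y => p.1 * G0 (y - p.2) + 1 * combo s y.
  by apply/funext => y; rewrite /combo big_cons mul1r.
have -> : dcombo (p :: s) = fun y => p.1 *: dG0 (y - p.2) + 1 *: dcombo s y.
  by apply/funext => y; rewrite /dcombo big_cons scale1r.
have [LvW _] := (weak_gradientP _ _ mU).1 W; have [LvWp _] := (weak_gradientP _ _ mU).1 Wp.
split.
- exact: L2_lin.
- exact: weak_gradient_lin.
- move=> phi tp.
  rewrite (wip_lin mU (weight1 U) _ LvWp LvW (test_grad_L2v mU tp) (aeW _ (fun _ _ => erefl))); last exact: L2v_lin.
  rewrite (O phi tp) dG0_test_orth// ?mulr0 ?addr0// => Uz.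
  by apply: pz; exact: subset_closure.
Qed.

End singular_solutions.

(** * Flux of the fundamental solution through a cutoff *)

Section flux.
Context {R : realType} {m : nat}.
Implicit Types (U V K : set 'rV[R]_m) (f g : 'rV[R]_m -> R) (x y z : 'rV[R]_m).
Lemma open_cube V x : open V -> V x ->
  exists2 r, 0 < r & forall y, `|y - x| <= r -> V y.
Proof.
move=> oV Vx; have : nbhs x V by exact: open_nbhs_nbhs.
move=> /nbhs_ballP[r /= r0 Hr]; exists (r / 2); first by rewrite divr_gt0.
move=> y yx; apply: Hr; rewrite -ball_normE /= distrC (le_lt_trans yx)//.
by rewrite ltr_pdivrMr// ltr_pMr// ltr1n.
Qed.

Lemma leb_ball x r : 0 <= r -> leb [set y | `|y - x| <= r] = ((r *+ 2) ^+ m)%:E.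
Proof.
move=> r0; rewrite -(leb_cube (fun i => x ord0 i) r0); congr (leb _).
apply/seteqP; split=> y /=.
  move=> yx i; rewrite /= in_itv /=; have := le_trans (norm_coord (y - x) i) yx.
  by rewrite !mxE ler_norml => /andP[h1 h2]; apply/andP; split; lra.
move=> H; apply: norm_le_coord => // i; have := H i; rewrite /= in_itv /= => /andP[h1 h2].
by rewrite !mxE ler_norml; apply/andP; split; lra.
Qed.

Lemma compact_norm_ball x r : compact [set y : 'rV[R]_m | `|y - x| <= r].
Proof.
apply: bounded_closed_compact.
  exists (`|x| + r); split; first by rewrite num_real.
  move=> s sr y /= yx; apply: le_trans (ltW sr).
  by rewrite -[y](subrK x) (le_trans (ler_normD _ _))// addrC lerD2l.
apply: (@closed_comp _ _ (fun y : 'rV[R]_m => `|y - x|) [set t | t <= r]); last exact: closed_le.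
move=> y _; apply: (@continuous_comp _ _ _ (fun y : 'rV[R]_m => y - x) (fun z : 'rV[R]_m => `|z|)); last exact: norm_continuous.
by apply: (@continuousB _ _ _ id (fun=> x)); [rewrite /continuous_at; exact: cvg_id|exact: cst_continuous].
Qed.

Lemma mid_between (a b : R) : a < b -> a < (a + b) / 2 < b.
Proof. by move=> ab; apply/andP; split; lra. Qed.

Hypothesis m23 : m = 2%N \/ m = 3%N.

(* eta minus a radial plateau is supported off the pole, so the flux of the
   fundamental solution can be computed with the plateau, whose gradient is radial. *)
Lemma flux_neq0 U V x eta : open U -> test_function U eta -> open V -> V x -> V `<=` U ->
  (forall y, V y -> eta y = 1) ->
  wip U (fun=> 1) (fun y => dG0 (y - x)) (grad eta) != 0.
Proof.
move=> oU te oV Vx VU e1; have [r r0 Hr] := open_cube oV Vx.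
have mU := open_measurable_rV oU.
(* Squared radii: qdist x y <= r^2 implies that the sup-norm distance is at most r, hence [V y]. *)
pose b := r ^+ 2; pose a := b / 2; have b0 : 0 < b by rewrite exprn_gt0.
have ab : a < b by rewrite /a ltr_pdivrMr// ltr_pMr// ltr1n.
have a0 : 0 < a by rewrite divr_gt0.
have Vb y : qdist x y <= b -> V y.
  move=> yb; apply: Hr; rewrite -(ler_pXn2r (_ : 0 < 2)%N) ?nnegrE ?(ltW r0)//.
  exact: le_trans (norm_qdist _ _) yb.
pose th := plateau x a b.
have st : smooth th by exact: smooth_plateau.
have tt : test_function U th by apply: test_plateau => // y /Vb /VU.
have [se ce eU] := (test_functionP _ _).1 te.
(* eta - th and the partial derivatives of th vanish near x, so they are test functions on the
   domain without the pole, where the fundamental solution is harmonic. *)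
pose U' := U `\ x.
have oU' : open U' by apply: openI => //; exact: open_punctured.
have NU' : ~ U' x by move=> [_]; apply.
have lt_open : open [set y | qdist x y < a].
  apply: (@open_comp _ _ (qdist x) [set t | t < a]); last exact: open_lt.
  by move=> y _; exact: (Ck_continuous (Ck_qdist 0 x)).
have near1 (f : 'rV[R]_m -> R) : smooth f -> test_function U f ->
    (forall y, qdist x y < a -> f y = 0) -> test_function U' f.
  move=> sf tf f0; have [_ cf fU] := (test_functionP _ _).1 tf.
  apply/test_functionP; split=> // y fy; split; first exact: fU.
  move=> yx; move: fy; rewrite /= yx => fx.
  have : nbhs x [set y | qdist x y < a].
    by apply: open_nbhs_nbhs; split=> //=; rewrite qdistE big1// => i _; rewrite subrr expr0n.
  by move=> /fx [z [/= fz /f0 fz0]]; move: fz; rewrite fz0 eqxx.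
have T1 : test_function U' (fun y => 1 * eta y + -1 * th y).
  apply: near1.
  - by apply: smooth_add; apply: smooth_mul => //; exact: smooth_cst.
  - exact: test_lin.
  - move=> y ya; rewrite e1; last by apply: Vb; rewrite ltW// (lt_trans ya).
    by rewrite /th plateau1// ?ltW// mulr1 mulN1r subrr.
have Ti i : test_function U' (partial th i).
  apply: near1; [exact: Ck_partial_smooth|exact: test_partial|].
  move=> y ya; rewrite partial_plateau// /dstep.
  by rewrite !(flat_le0 _ (_ : qdist x y - a <= 0)) ?subr_le0 ?ltW// !mulr0 addr0 oppr0 !mul0r.
pose f1 (y : 'rV[R]_m) : R := 1 * eta y + -1 * th y.
have s1 : smooth f1 by case/test_functionP : T1.
have cd i y : U' y -> {for y, continuous (fun y => dG0 (y - x) ord0 i)}.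
  move=> [_ yx]; apply: (@continuous_at_shift _ _ (fun y => dG0 y ord0 i)).
  by apply: continuous_dG0; rewrite subr_eq0; apply/eqP.
pose w (y : 'rV[R]_m) : R := \sum_i dG0 (y - x) ord0 i * partial th i y.
pose w1 (y : 'rV[R]_m) : R := \sum_i dG0 (y - x) ord0 i * partial f1 i y.
have cw : continuous w.
  apply: (@Ck_continuous _ _ 0); apply: Ck_sum => i; split=> //.
  by apply: (continuous_test_mul (U := U')); [exact: cd|exact: Ti].
have cw1 : continuous w1.
  apply: (@Ck_continuous _ _ 0); apply: Ck_sum => i; split=> //.
  by apply: (continuous_test_mul (U := U')); [exact: cd|exact: test_partial].
have [_ cth thU] := (test_functionP _ _).1 tt.
have [_ cf1 f1U] := (test_functionP _ _).1 T1.
have iw : leb.-integrable setT (EFin \o w).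
  apply: (supp_integrable cth cw) => y Ny.
  by rewrite /w big1// => i _; rewrite partial_fsupp// mulr0.
have iw1 : leb.-integrable setT (EFin \o w1).
  apply: (supp_integrable cf1 cw1) => y Ny.
  by rewrite /w1 big1// => i _; rewrite partial_fsupp// mulr0.
have O1 : \int[leb]_y w1 y = 0.
  apply: etrans (dG0_test_orth oU' NU' T1); rewrite /wip [RHS]Rintegral_mkcond.
  apply: eq_Rintegral => y _; rewrite patchE; case: ifPn => [_|/negP Ny].
    by rewrite mul1r; apply: eq_bigr => i _; rewrite [grad _ _ _ _]mxE.
  rewrite /w1 big1// => i _; rewrite partial_fsupp ?mulr0// => /f1U.
  by move=> U'y; apply: Ny; rewrite inE.
have E : wip U (fun=> 1) (fun y => dG0 (y - x)) (grad eta) = \int[leb]_y w y.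
  rewrite -[RHS]add0r -O1 -RintegralD// /wip Rintegral_mkcond.
  apply: eq_Rintegral => y _.
  have P i : partial eta i y = partial f1 i y + partial th i y.
    rewrite /f1 partial_lin//; first by rewrite mul1r mulN1r subrK.
  rewrite patchE; case: ifPn => [_|/negP Ny].
    by rewrite mul1r -big_split; apply: eq_bigr => i _; rewrite [grad _ _ _ _]mxE P mulrDr.
  rewrite -big_split big1// => i _ /=; rewrite -mulrDr -P partial_fsupp ?mulr0// => /eU.
  by move=> Uy; apply: Ny; rewrite inE.
have wE y : w y = (- dstep a b (qdist x y)) * (2 * @dG0_const R m * rinv (y - x) ^+ m * qdist x y) :> R.
  rewrite /w /qdist /dot !mulr_sumr; apply: eq_bigr => i _.
  by rewrite partial_plateau// /dG0 !mxE /qdist /dot; ring.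
have w0 y : 0 <= w y.
  rewrite wE mulr_ge0 ?oppr_ge0 ?dstep_le0// mulr_ge0 ?qdist_ge0//.
  by rewrite !mulr_ge0 ?exprn_ge0 ?invr_ge0 ?sqrtr_ge0 ?ltW ?dG0_const_gt0.
have m0 : (0 < m)%N by case: m23 => ->.
(* The density [w] is nonnegative, and positive in the shell a < qdist x y < b; a small cube there
   bounds the flux from below. *)
have [B [y1 [oB By1 Bw]]] : exists B : set 'rV[R]_m, exists y1, [/\ open B, B y1 & forall y, B y -> 0 < w y].
  exists [set y | a < qdist x y < b], (x + Num.sqrt ((a + b) / 2) *: delta_mx ord0 (Ordinal m0)).
  have ab0 : 0 <= (a + b) / 2 by rewrite divr_ge0// ltW// addr_gt0.
  split.
  - rewrite (_ : [set y | _] = [set y | a < qdist x y] `&` [set y | qdist x y < b]); last first.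
      by apply/seteqP; split=> y /=; [move=> /andP[]|move=> [-> ->]].
    by apply: openI; [apply: (@open_comp _ _ (qdist x) [set t | a < t])|
      apply: (@open_comp _ _ (qdist x) [set t | t < b])];
      do ?[exact: open_gt|exact: open_lt|move=> y _; exact: (Ck_continuous (Ck_qdist 0 x))].
  - rewrite /= (_ : qdist _ _ = (a + b) / 2).
      exact: mid_between.
    rewrite qdistE (bigD1 (Ordinal m0))//= big1 => [|i /negPf ni].
      by rewrite !mxE !eqxx mulr1 addrAC subrr add0r sqr_sqrtr// addr0.
    by rewrite !mxE eqxx /= ni mulr0 addr0 subrr expr0n.
  - move=> y /= ayb; have q0 : 0 < qdist x y by case/andP : ayb => /(lt_trans a0).
    have y0 : y - x != 0.
      by apply/eqP => yx; move: q0; rewrite /qdist yx /dot big1 ?ltxx// => i _; rewrite mxE mul0r.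
    rewrite wE mulr_gt0 ?oppr_gt0 ?dstep_lt0// mulr_gt0// !mulr_gt0 ?exprn_gt0 ?dG0_const_gt0//.
    by rewrite invr_gt0 enorm_gt0.
have [s s0 Hs] := open_cube oB By1; have cC := @compact_norm_ball y1 s.
have [M M0 HM] : exists2 M, 0 < M & forall y, `|y - y1| <= s -> `|(w y)^-1| <= M.
  apply: (compact_continuous_bound cC) => y /= /Hs/Bw wy.
  by apply: continuousV; [rewrite gt_eqF|exact: cw].
rewrite E gt_eqF//; have mC := compact_measurable_rV cC.
apply: lt_le_trans (le_Rintegral_sub measurableT mC (@subsetT _ _) iw (fun y _ => w0 y)).
apply: (@lt_le_trans _ _ (\int[leb]_(y in [set y | `|y - y1| <= s]) M^-1)).
  rewrite Rintegral_cst// mulr_gt0 ?invr_gt0//.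
  have h : 0 < fine (leb [set y : 'rV[R]_m | `|y - y1| <= s]).
    by rewrite leb_ball ?ltW//= exprn_gt0// pmulrn_lgt0.
  exact: h.
apply: le_Rintegral => //; [exact: (bounded_compact_integrable (M := `|M^-1|))| | ].
  exact: (@integrableS _ _ _ _ setT).
move=> y Cy; have wy := Bw _ (Hs _ Cy).
rewrite -[leRHS]invrK lef_pV2 ?posrE ?invr_gt0//.
by apply: le_trans (HM y Cy); rewrite ger0_norm// invr_ge0 ltW.
Qed.

End flux.

(** * Blow-up of the energy in D *)

Section blow_up.
Context {R : realType} {m : nat}.
Implicit Types (U V K D T : set 'rV[R]_m) (f g : 'rV[R]_m -> R) (x y z : 'rV[R]_m).
Implicit Types v : nat -> 'rV[R]_m -> R.
Hypothesis m23 : m = 2%N \/ m = 3%N.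

(** What the blow-up uses of a needle sequence: gradients only, compared with the explicit [dG0],
    away from a set T that need not be given as a curve. *)
Definition sources_converge U T x v :=
  (forall n, weak_solution U (fun=> 1) (v n)) /\
  forall K, compact K -> K `<=` U `\` T ->
    wip K (fun=> 1) (fun y => nabla U (v n) y - dG0 (y - x))
      (fun y => nabla U (v n) y - dG0 (y - x)) @[n --> \oo] --> 0.

Lemma needle_sequence_sources U x sigma v : open U -> needle_sequence U x sigma v ->
  (sigma @` `[0, 1]) x -> sources_converge U (sigma @` `[0, 1]) x v.
Proof.
move=> oU [sv Hv] Tx; split=> // K cK KU; have mK := compact_measurable_rV cK.
have mU := open_measurable_rV oU.
have Kx : ~ K x by move=> /KU[].
have KsU : K `<=` U by move=> y /KU[].
have yx y : K y -> y - x != 0.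
  by move=> Ky; apply/eqP => /subr0_eq yx; apply: Kx; rewrite -yx.
have Lv n : L2 leb K (fun y => v n y - G0 (y - x)).
  apply: (L2B mK); last exact: G0_L2.
  have h := H1_L2 mU (sv n).1; exact: L2_sub h.
have LG := dG0_L2v cK Kx.
have Ln n : L2v K (fun y => nabla U (v n) y - dG0 (y - x)).
  apply: L2vB => //; exact: L2v_sub (nabla_L2v mU (sv n).1).
have e n y : K y -> nabla U (v n) y - dG0 (y - x) = nabla U (v n) y - grad G0 (y - x).
  by move=> /yx y0; rewrite grad_G0.
have Ln' n : L2v K (fun y => nabla U (v n) y - grad G0 (y - x)).
  exact: (L2v_ext mK (e n) (Ln n)).
have [_] := (H1norm_cvg0 mK Lv Ln').1 (Hv K cK KU).
apply: cvg_trans; apply: near_eq_cvg; apply: nearW => n.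
by apply: eq_Rintegral => y /set_mem Ky; rewrite e.
Qed.

Lemma inner_le U j k : (j <= k)%N -> inner U j `<=` inner U k.
Proof.
move=> jk y [y1 y2]; split; first by rewrite (le_trans y1)// ler_nat.
move=> z /y2; apply: le_trans; by rewrite lef_pV2 ?posrE// ler_nat ltnS.
Qed.

(** The sets S minus [inner] decrease, as [k] grows, to a subset of the null set T; continuity from
    above applies since S has finite measure. *)
Lemma leb_collar S T : compact S -> compact T -> leb T = 0%E -> forall e : R, 0 < e ->
  exists n, forall k, (n <= k)%N -> (leb (S `\` inner (~` T) k) <= e%:E)%E.
Proof.
move=> cS cT T0 e e0; have mS := compact_measurable_rV cS; have mT := compact_measurable_rV cT.
have oT : open (~` T) by apply: closed_openC; apply: compact_closed => //; exact: norm_hausdorff.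
pose E k := S `\` inner (~` T) k.
have mi k : measurable (inner (~` T) k) by apply: compact_measurable_rV; exact: compact_inner.
have mE k : measurable (E k) by apply: measurableD.
have Eoo : (leb (E 0%N) < +oo)%E.
  apply: le_lt_trans (compact_leb_fin cS).
  by apply: le_measure; rewrite ?inE//; exact: subDsetl.
have IE : \bigcap_k E k `<=` T.
  move=> y Ey; apply: contrapT => Ty.
  have yT : [set y] `<=` ~` T by move=> z ->.
  have [n Hn] := inner_cover oT (@compact_set1 _ y) yT.
  by have [_] := Ey n I; apply; exact: Hn.
have mI : measurable (\bigcap_k E k) by exact: bigcap_measurable.
have I0 : leb (\bigcap_k E k) = 0%E.
  apply/eqP; rewrite eq_le measure_ge0 andbT -T0.
  by apply: le_measure; rewrite ?inE.
have ndE : nonincreasing_seq E.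
  by move=> j k jk; apply/subsetPset => y [Sy ny]; split=> // /(inner_le jk).
have C : leb (E k) @[k --> \oo] --> 0%:E.
  have to0 (l : \bar R) : l = 0%:E -> leb (E k) @[k --> \oo] --> l ->
    leb (E k) @[k --> \oo] --> 0%:E by move=> ->.
  exact: (to0 _ I0 (nonincreasing_cvg_mu Eoo mE mI ndE)).
have [[N _ HN1] /cvgrPdist_le/(_ e e0)[M _ HM]] := (fine_cvgP _ _).1 C.
exists (maxn N M) => k; rewrite geq_max => /andP[Nk Mk].
have := HM k Mk; rewrite /= sub0r normrN => h.
rewrite -(@fineK _ (leb (E k))); last exact: HN1.
by rewrite lee_fin (le_trans (ler_norm _)).
Qed.

(** The flux of modulus c splits as GK + GE over a set K away from the needle and a thin set E
    around it; vK + vE = 0 is the same splitting for v_n. As GE is small and vK close to GK, vE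
    carries a fixed part of c. Young's inequality, with gg and vv the energies of eta and v_n on E,
    then makes vv at least c s = 2B. *)
Lemma blow_up_arith (c B s Me M'e vK GK vE GE gg vv w : R) : 0 < c -> 0 < B -> 0 <= Me -> s = 2 * B / c ->
  `|GE| <= M'e -> gg <= Me -> s * Me + M'e = c / 4 -> `|GK - vK| <= c / 4 ->
  0 = vK + vE -> c = `|GK + GE| -> 2 * `|vE| <= s * gg + s^-1 * vv -> vv <= w -> B <= w.
Proof.
move=> c0 B0 Me0 es h1 h2 e4 h3 h4 h5 h6 h7.
have s0 : 0 < s by rewrite es divr_gt0// mulr_gt0.
have k1 : c <= `|GK - vK| + `|GE| + `|vE|.
  rewrite {1}h5 (_ : GK + GE = (GK - vK) + GE + (- vE)); last by lra.
  by rewrite (le_trans (ler_normD _ _))// normrN lerD2r ler_normD.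
have k0 : 0 <= s * Me by rewrite mulr_ge0// ltW.
have k2 : s * gg <= s * Me by rewrite ler_wpM2l// ltW.
have k3 : c <= s^-1 * vv by lra.
have : c * s <= vv by rewrite -ler_pdivlMr// mulrC.
by rewrite es (_ : c * (2 * B / c) = 2 * B); [lra|field; rewrite gt_eqF].
Qed.

(** The last hypothesis says that, within the support of eta, T leaves V only inside D. Hence the
    part of the support of grad eta close to T lies in D, and on the rest the gradients converge. *)
Lemma blow_up_crossing U D T V x v eta : open U -> bounded_set U -> open D -> D `<=` U ->
  compact T -> leb T = 0%E -> T x -> sources_converge U T x v ->
  test_function U eta -> open V -> V x -> V `<=` U -> (forall y, V y -> eta y = 1) ->
  (forall y, fsupp eta y -> T y -> ~ V y -> D y) ->
  wip D (fun=> 1) (nabla U (v n)) (nabla U (v n)) @[n --> \oo] --> +oo.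
Proof.
move=> oU bU oD DU cT T0 Tx [sv Hv] te oV Vx VU e1 HD.
have mU := open_measurable_rV oU; have mD := open_measurable_rV oD.
have [se ce eU] := (test_functionP _ _).1 te.
have oT : open (~` T) by apply: closed_openC; apply: compact_closed => //; exact: norm_hausdorff.
(* [S] is compact and carries grad eta, since eta is 1 on V; it avoids the pole, which lies in V. *)
pose S := fsupp eta `\` V.
have cS : compact S by apply: compact_closedI => //; exact: open_closedC.
have SU : S `<=` U by move=> y [/eU].
have mS := compact_measurable_rV cS.
have Sx : ~ S x by move=> [].
have g0 y : ~ S y -> grad eta y = 0.
  move=> Sy; apply/rowP => i; rewrite !mxE.
  have [Vy|Vy] := pselect (V y); last first.
    by apply: partial_fsupp => fy; apply: Sy.
  have N : \forall z \near y, (fun=> 1) z = eta z.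
    have : nbhs y V by exact: open_nbhs_nbhs.
    by apply: filterS => z /e1.
  by apply: partialE; apply: (near_eq_is_derive N); exact: is_derive_cst.
have wS F : wip U (fun=> 1) F (grad eta) = wip S (fun=> 1) F (grad eta).
  rewrite /wip Rintegral_mkcond [RHS]Rintegral_mkcond; apply: eq_Rintegral => y _.
  rewrite !patchE; case: ifPn => Uy; case: ifPn => // Sy.
    by rewrite g0 ?/dot ?big1 ?mulr0// => [i _|Sy']; [rewrite mxE mulr0|rewrite notin_setE in Sy].
  by rewrite notin_setE in Uy; exfalso; apply: Uy; apply: SU; exact: set_mem Sy.
pose c0 := `|wip U (fun=> 1) (fun y => dG0 (y - x)) (grad eta)|.
have c00 : 0 < c0 by rewrite normr_gt0; exact: (flux_neq0 m23 oU te oV Vx VU e1).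
have Lg : L2v U (grad eta) by exact: test_grad_L2v.
have LgS := L2v_sub mU mS SU Lg.
have LG : L2v S (fun y => dG0 (y - x)) by exact: dG0_L2v.
have Lv n : L2v U (nabla U (v n)) by exact: nabla_L2v (sv n).1.
have LvS n := L2v_sub mU mS SU (Lv n).
have cg : continuous (fun y => dot (grad eta y) (grad eta y)).
  apply: (@Ck_continuous _ _ 0); apply: Ck_sum => i.
  have -> : (fun y => grad eta y ord0 i * grad eta y ord0 i) = (fun y => partial eta i y * partial eta i y).
    by apply/funext => y; rewrite !mxE.
  by apply: Ck_mul; exact: Ck_partial_smooth.
have [M M0 HM] := continuous_compact_bound cS cg.
have [M' M'0 HM'] : exists2 M', 0 < M' & forall y, S y -> `|dot (dG0 (y - x)) (grad eta y)| <= M'.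
  apply: (compact_continuous_bound cS) => y Sy; have yx : y - x != 0.
    by apply/eqP => /subr0_eq yx; apply: Sx; rewrite -yx.
  have : {for y, continuous (fun y => \sum_(i < m) dG0 (y - x) ord0 i * grad eta y ord0 i)}.
    apply: (@continuous_at_sum _ _ _ _ _ (fun i y => dG0 (y - x) ord0 i * grad eta y ord0 i)) => i.
    rewrite (_ : (fun y => _) = (fun y => dG0 (y - x) ord0 i * partial eta i y)); last first.
      by apply/funext => z; rewrite [grad _ _ _ _]mxE.
    apply: (@continuousM _ _ (fun y => dG0 (y - x) ord0 i) (partial eta i)).
      by apply: (@continuous_at_shift _ _ (fun y => dG0 y ord0 i)); exact: continuous_dG0.
    exact: (smooth_continuous (Ck_partial_smooth i se)).
  by [].
have splitK k F : L2v S F -> wip S (fun=> 1) F (grad eta) =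
    wip (S `&` inner (~` T) k) (fun=> 1) F (grad eta) +
    wip (S `\` inner (~` T) k) (fun=> 1) F (grad eta).
  move=> LF; have mi : measurable (inner (~` T) k) by apply: compact_measurable_rV; exact: compact_inner.
  rewrite /wip -[X in \int[leb]_(_ in X) _ = _](setUIDK S (inner (~` T) k)).
  rewrite Rintegral_setU//; [exact: measurableI|exact: measurableD| |].
    by rewrite setUIDK; exact: (wip_integrable mS (weight1 S) LF LgS).
  by apply/disj_setPS => y [[_ h] [_]].
apply/cvgryPge => A.
pose B := `|A| + 1; have B0 : 0 < B by rewrite ltr_wpDl.
pose s := 2 * B / c0; have s0 : 0 < s by rewrite divr_gt0// mulr_gt0.
(* The measure allowed for [E]: the flux of the fundamental solution over [E] and s times the energy
   of eta on [E] then add up to at most c0 / 4. *)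
pose e := c0 / (4 * (s * M + M')).
have sM0 : 0 < s * M + M' by rewrite addr_gt0// mulr_gt0.
have e0 : 0 < e by rewrite divr_gt0// mulr_gt0.
have [k1 Hk1] := leb_collar cS cT T0 e0.
(* [S] minus D is compact and disjoint from T, so it keeps a positive distance from T; this puts [E]
   inside D. *)
have [k2 Hk2] : exists k2, S `\` D `<=` inner (~` T) k2.
  apply: inner_cover => //; first by apply: compact_closedI => //; exact: open_closedC.
  by move=> y [[fy Vy] Dy] Ty; apply: Dy; exact: HD.
pose k := maxn k1 k2; pose K := S `&` inner (~` T) k; pose E := S `\` inner (~` T) k.
have ED : E `<=` D.
  move=> y [Sy iy]; apply: contrapT => Dy; apply: iy.
  by apply: (@inner_le _ k2 k); [rewrite leq_maxr|exact: Hk2].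
have cK : compact K by apply: compact_closedI => //; apply: compact_closed; [exact: norm_hausdorff|exact: compact_inner].
have mK := compact_measurable_rV cK.
have mE : measurable E.
  by apply: measurableD => //; apply: compact_measurable_rV; exact: compact_inner.
have ES : E `<=` S by exact: subDsetl.
have KS : K `<=` S by exact: subIsetl.
have Ee : (leb E <= e%:E)%E by apply: Hk1; rewrite leq_maxl.
have KU : K `<=` U `\` T by move=> y [Sy /inner_sub Ty]; split=> //; exact: SU.
have LgE := L2v_sub mS mE ES LgS; have LgK := L2v_sub mS mK KS LgS.
have C1 := wip_cvg mK (weight1 K) (aeW _ (fun _ _ => ler01)) (fun n => L2v_sub mS mK KS (LvS n))
  (L2v_sub mS mK KS LG) LgK (Hv K cK KU).
have Eoo : (leb E < +oo)%E by apply: le_lt_trans Ee _; rewrite ltry.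
have bE (f : 'rV[R]_m -> R) N : 0 <= N -> leb.-integrable E (EFin \o f) ->
    (forall y, S y -> `|f y| <= N) -> `|\int[leb]_(y in E) f y| <= N * e.
  move=> N0 fi fN; apply: le_trans (le_normr_Rintegral mE fi) _.
  apply: (@le_trans _ _ (\int[leb]_(y in E) N)).
    apply: le_Rintegral => //.
    - exact: integrable_norm.
    - apply: (integrableS mS mE ES).
      exact: (bounded_compact_integrable (M := `|N|) cS (measurable_cst _) (fun _ _ => lexx _)).
    - by move=> y /ES/fN.
  rewrite Rintegral_cst// ler_wpM2l//.
  by rewrite -lee_fin fineK// ge0_fin_numE.
have i1 := wip_integrable mE (weight1 E) (L2v_sub mS mE ES LG) LgE.
have i2 := wip_integrable mE (weight1 E) LgE LgE.
have h1 : `|wip E (fun=> 1) (fun y => dG0 (y - x)) (grad eta)| <= M' * e.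
  by apply: bE => //; [exact: ltW|move=> y Sy; rewrite mul1r HM'].
have h2 : wip E (fun=> 1) (grad eta) (grad eta) <= M * e.
  apply: le_trans (ler_norm _) _; apply: bE => //; first exact: ltW.
  by move=> y Sy; rewrite mul1r HM.
have e4 : s * (M * e) + M' * e = c0 / 4 by rewrite /e; field; rewrite gt_eqF.
move/cvgrPdist_le : C1 => /(_ (c0 / 4) (divr_gt0 c00 (ltr0Sn _ 3)))[N _ HN].
exists N => // n Nn; have h3 := HN n Nn.
have h4 : 0 = wip K (fun=> 1) (nabla U (v n)) (grad eta) + wip E (fun=> 1) (nabla U (v n)) (grad eta).
  by rewrite -splitK// -wS; case: (sv n) => _ /(_ _ te).
have h5 : c0 = `|wip K (fun=> 1) (fun y => dG0 (y - x)) (grad eta) +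
    wip E (fun=> 1) (fun y => dG0 (y - x)) (grad eta)|.
  by rewrite -splitK// -wS.
have h6 := wip_young mE (weight1 E) LgE (L2v_sub mS mE ES (LvS n)) (aeW _ (fun _ _ => ler01)) s0.
have h7 : wip E (fun=> 1) (nabla U (v n)) (nabla U (v n)) <= wip D (fun=> 1) (nabla U (v n)) (nabla U (v n)).
  apply: le_Rintegral_sub => //.
    apply: wip_integrable => //; [exact: weight1|exact: L2v_sub (Lv n)|exact: L2v_sub (Lv n)].
  by move=> y _; rewrite mul1r dot_ge0.
rewrite wipC in h6.
suff : B <= wip D (fun=> 1) (nabla U (v n)) (nabla U (v n)).
  by apply: le_trans; rewrite /B ler_wpDr// ler_norm.
exact: (blow_up_arith c00 B0 (mulr_ge0 (ltW M0) (ltW e0)) (erefl s) h1 h2 e4 h3 h4 h5 h6 h7).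
Qed.
(** A union of N of the sets is compact and off T, so the gradients converge on it, while the limit
    energy is at least N c. Since N is arbitrary, the energies in D are unbounded along every
    subsequence. *)
Lemma blow_up_union U D T x v (K : nat -> set 'rV[R]_m) (c : R) : open U -> open D -> D `<=` U ->
  T x -> sources_converge U T x v -> 0 < c ->
  (forall j, compact (K j)) -> (forall j, K j `<=` D `\` T) ->
  (forall j k y, K j y -> K k y -> j = k) ->
  (forall j, c <= wip (K j) (fun=> 1) (fun y => dG0 (y - x)) (fun y => dG0 (y - x))) ->
  wip D (fun=> 1) (nabla U (v n)) (nabla U (v n)) @[n --> \oo] --> +oo.
Proof.
move=> oU oD DU Tx [sv Hv] c0 cK KD dK HK.
have mU := open_measurable_rV oU; have mD := open_measurable_rV oD.
have cup N : exists B : set 'rV[R]_m, [/\ compact B, B `<=` D `\` T,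
    (forall y, B y -> exists2 j, (j < N)%N & K j y) &
    N%:R * c <= wip B (fun=> 1) (fun y => dG0 (y - x)) (fun y => dG0 (y - x))].
  elim: N => [|N [B [cB BD BK HB]]].
    by exists set0; split=> //; [exact: compact0|rewrite mul0r wip1_ge0].
  have cBK : compact (B `|` K N) by exact: compactU.
  exists (B `|` K N); split=> //.
  - by move=> y [/BD|/KD].
  - by move=> y [/BK[j jN Kj]|Ky]; [exists j => //; exact: ltnW|exists N].
  - have mB := compact_measurable_rV cB; have mN := compact_measurable_rV (cK N).
    rewrite -natr1 mulrDl mul1r; apply: le_trans (lerD HB (HK N)) _; rewrite /wip Rintegral_setU//.
    + have Bx : ~ (B `|` K N) x by move=> [/BD[]|/KD[]].
      have L := dG0_L2v cBK Bx.
      exact: (wip_integrable (compact_measurable_rV cBK) (weight1 _) L L).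
    + apply/disj_setPS => y [/BK[j jN Kj] Ky].
      by rewrite (dK _ _ _ Kj Ky) ltnn in jN.
apply/cvgryPge => A.
pose N := (Num.truncn ((2 * (`|A| + 1)) / c)).+1.
have hN : 2 * (`|A| + 1) <= N%:R * c by rewrite -ler_pdivrMr// ltW// truncnS_gt.
have [B [cB BD _ HB]] := cup N.
have mB := compact_measurable_rV cB.
have BU : B `<=` U `\` T by move=> y /BD[Dy Ty]; split=> //; exact: DU.
have Bx : ~ B x by move=> /BD[].
have BsU : B `<=` U by move=> y /BU[].
have BsD : B `<=` D by move=> y /BD[].
have := Hv B cB BU; move/cvgr0Pnorm_le => /(_ 1 ltr01)[M _ HM].
exists M => // n Mn; have h1 := le_trans (ler_norm _) (HM n Mn).
have Ln := nabla_L2v mU (sv n).1; have LnB := L2v_sub mU mB BsU Ln.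
have LG := dG0_L2v cB Bx; have LD := L2vB mB LnB LG.
have h2 : wip B (fun=> 1) (fun y => dG0 (y - x)) (fun y => dG0 (y - x)) <=
    2 * wip B (fun=> 1) (nabla U (v n)) (nabla U (v n)) +
    2 * wip B (fun=> 1) (fun y => nabla U (v n) y - dG0 (y - x)) (fun y => nabla U (v n) y - dG0 (y - x)).
  have := wip_lin_le (a := 1) (b := -1) mB (weight1 B) (aeW _ (fun _ _ => ler01)) LG LnB LD.
  rewrite sqrrN expr1n !mulr1; apply; apply: aeW => y _.
  by rewrite scale1r scaleN1r opprB [RHS]addrC subrK.
have h3 : wip B (fun=> 1) (nabla U (v n)) (nabla U (v n)) <= wip D (fun=> 1) (nabla U (v n)) (nabla U (v n)).
  apply: le_Rintegral_sub => //; last by move=> y _; rewrite mul1r dot_ge0.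
  by have LnD := L2v_sub mU mD DU Ln; apply: wip_integrable => //; exact: weight1.
have a0 := ler_norm A; move: h1 h2 h3 HB hN a0.
move: (wip _ _ _ _) (wip _ _ _ _) (wip _ _ _ _) (wip _ _ _ _) (N%:R * c) `|A| => p q r s t u.
by clear; lra.
Qed.

Lemma compact_affine_ball x d (k s : R) : 0 < s ->
  [set y | exists2 z, `|z - d| <= k & y = x + s *: z] = [set y | `|y - (x + s *: d)| <= s * k].
Proof.
move=> s0; apply/seteqP; split=> y /=.
  move=> [z zd ->]; rewrite opprD addrACA subrr add0r -scalerBr normrZ gtr0_norm//.
  by rewrite ler_pM2l.
move=> yd; exists (s^-1 *: (y - x)).
  rewrite -(ler_pM2l s0) -[X in X * `|_|](gtr0_norm s0) -normrZ scalerBr scalerA.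
  by rewrite divff ?gt_eqF// scale1r -addrA -opprD.
by rewrite scalerA divff ?gt_eqF// scale1r addrC subrK.
Qed.

(** Under scaling by s the energy density of the fundamental solution gains s^(-2(m-1)) and the
    volume s^m. As m <= 2(m-1), smaller balls do not carry less energy. *)
Lemma shell_arith (q k s kap : R) : 0 < q -> 0 < k -> 0 < s -> s <= 1 -> 0 < kap ->
  kap ^+ 2 * q ^+ (2 * m.-1) * (k *+ 2) ^+ m <=
  kap ^+ 2 * (q / s) ^+ (2 * m.-1) * ((s * k) *+ 2) ^+ m.
Proof.
move=> q0 k0 s0 s1 kap0; rewrite -mulrnAr !exprMn exprVn.
set a := q ^+ _; set b := (k *+ 2) ^+ m; set p := s ^+ (2 * _).
have ab : 0 <= kap ^+ 2 * a * b by rewrite !mulr_ge0 ?exprn_ge0 ?mulrn_wge0 ?ltW.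
rewrite (_ : kap ^+ 2 * (a / p) * (s ^+ m * b) = kap ^+ 2 * a * b * (s ^+ m / p)); last by ring.
rewrite ler_peMr// ler_pdivlMr ?exprn_gt0// mul1r ler_wiXn2l// ?(ltW s0)//.
by case: m23 => ->.
Qed.

(** The sets are balls at scales s1 2^-j along the direction d. Because 4k <= |d|, the ball of scale
    t lies between the distances 3/4 t |d| and 5/4 t |d| from x, and 5/8 < 3/4 makes balls of
    different scales disjoint. *)
Lemma blow_up_cone U D T x v d (k s0 : R) : open U -> open D -> D `<=` U ->
  T x -> sources_converge U T x v -> 0 < k -> 0 < s0 -> 4 * k <= `|d| ->
  (forall s z, 0 < s -> s <= s0 -> `|z - d| <= k -> (D `\` T) (x + s *: z)) ->
  wip D (fun=> 1) (nabla U (v n)) (nabla U (v n)) @[n --> \oo] --> +oo.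
Proof.
move=> oU oD DU Tx Hv k0 s00 kd HD.
pose s1 := Num.min s0 1; have s10 : 0 < s1 by rewrite lt_min s00 ltr01.
pose sc j : R := s1 * 2^-1 ^+ j.
have scp j : 0 < sc j by rewrite mulr_gt0// exprn_gt0// invr_gt0.
have sc1 j : sc j <= s1 by rewrite ger_pMr// exprn_ile1// ?invr_ge0// invf_le1// ler1n.
have scS j n : (j < n)%N -> sc n <= sc j / 2.
  move=> jn; rewrite /sc -mulrA ler_pM2l// -exprSr.
  by rewrite ler_wiXn2l// ?invr_ge0// invf_le1// ler1n.
pose K j := [set y | `|y - (x + sc j *: d)| <= sc j * k].
have KP j y : K j y -> exists2 z, `|z - d| <= k & y = x + sc j *: z.
  by rewrite /K -compact_affine_ball//.
have cK j : compact (K j) by exact: compact_norm_ball.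
have zb z : `|z - d| <= k -> 3 / 4 * `|d| <= `|z| /\ `|z| <= 5 / 4 * `|d|.
  move=> zd; have h1 : `|z| <= `|z - d| + `|d| by rewrite -{1}(subrK d z) ler_normD.
  have h2 : `|d| <= `|z - d| + `|z| by rewrite distrC -{1}(subrK z d) ler_normD.
  by move: h1 h2 zd kd; move: `|z| `|d| `|z - d| => p q r; clear; lra.
have d0 : 0 < `|d| by apply: lt_le_trans kd; rewrite mulr_gt0.
have KD j : K j `<=` D `\` T.
  by move=> y /KP[z zd ->]; apply: HD => //; rewrite (le_trans (sc1 j))// ge_min lexx.
have Kn j y : K j y -> sc j * (3 / 4 * `|d|) <= `|y - x| /\ `|y - x| <= sc j * (5 / 4 * `|d|).
  move=> /KP[z /zb[z1 z2] ->]; rewrite addrC addKr normrZ gtr0_norm//.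
  by rewrite !ler_pM2l.
have dis j n y : (j < n)%N -> K j y -> K n y -> False.
  move=> jn /Kn[h _] /Kn[_ h']; have := le_trans h h'.
  apply/negP; rewrite -ltNge.
  apply: (@le_lt_trans _ _ (sc j / 2 * (5 / 4 * `|d|))).
    by rewrite ler_wpM2r// ?scS// mulr_ge0// ltW.
  by rewrite -mulrA ltr_pM2l//; move: d0; move: `|d| => p; clear; lra.
pose q := (m%:R * (5 / 4 * `|d|))^-1.
have m0 : (0 < m)%N by case: m23 => ->.
have q0 : 0 < q by rewrite invr_gt0 !mulr_gt0 ?ltr0n// divr_gt0.
pose c := (@dG0_const R m) ^+ 2 * q ^+ (2 * m.-1) * (k *+ 2) ^+ m.
have c0 : 0 < c.
  by rewrite !mulr_gt0// ?exprn_gt0 ?dG0_const_gt0// pmulrn_lgt0.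
apply: (blow_up_union oU oD DU Tx Hv c0 cK KD).
  by move=> j n y Kj Kn'; case: (ltngtP j n) => // h; [case: (dis j n y h)|case: (dis n j y h)].
move=> j; have mK := compact_measurable_rV (cK j).
have Kx : ~ K j x by move=> /KD[].
have LG := dG0_L2v (cK j) Kx.
apply: (@le_trans _ _ (\int[leb]_(y in K j) ((@dG0_const R m) ^+ 2 * (q / sc j) ^+ (2 * m.-1)))).
  rewrite Rintegral_cst//.
  have -> : fine (leb (K j)) = ((sc j * k) *+ 2) ^+ m.
    by rewrite /K leb_ball// mulr_ge0// ltW.
  have scl : sc j <= 1 by rewrite (le_trans (sc1 j))// ge_min lexx orbT.
  exact: shell_arith q0 k0 (scp j) scl dG0_const_gt0.
apply: le_Rintegral => //.
- exact: (bounded_compact_integrable (M := `|_|) (cK j) (measurable_cst _) (fun _ _ => lexx _)).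
- exact: (wip_integrable mK (weight1 _) LG LG).
move=> y Ky; have y0 : y - x != 0 by apply/eqP => /subr0_eq yx; apply: Kx; rewrite -yx.
rewrite mul1r dot_dG0// ler_pM2l ?exprn_gt0 ?dG0_const_gt0//.
have [_ h] := Kn j y Ky; have e0 := enorm_gt0 y0.
have qs : q / sc j <= rinv (y - x).
  rewrite /q -invfM lef_pV2 ?posrE//; last by rewrite !mulr_gt0 ?ltr0n// divr_gt0.
  apply: (le_trans (enorm_le_norm _)); rewrite -[leRHS]mulrA ler_pM2l ?ltr0n//.
  by apply: (le_trans h); rewrite mulrC.
have qs0 : 0 <= q / sc j by rewrite divr_ge0// ltW.
by apply: lerXn2r => //; rewrite nnegrE (le_trans qs0).
Qed.

End blow_up.

(** * Lipschitz cones and needles *)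

Section cones.
Context {R : realType} {m : nat}.
Implicit Types (U V K D T : set 'rV[R]_m) (x y z p e d b : 'rV[R]_m).

Lemma lipschitz_continuous (f : 'rV[R]_m -> R) (C : R) :
  (forall x y, `|f x - f y| <= C * `|x - y|) -> continuous f.
Proof.
move=> Hf x A /nbhs_ballP[e /= e0 He].
pose C' := `|C| + 1; have C'0 : 0 < C' by rewrite ltr_wpDl.
apply/nbhs_ballP; exists (e / C'); first by rewrite /= divr_gt0.
move=> y; rewrite -ball_normE /= => xy; apply: He; rewrite -ball_normE /=.
apply: (le_lt_trans (Hf x y)); apply: (@le_lt_trans _ _ (C' * `|x - y|)).
  by rewrite ler_wpM2r// /C' (le_trans (ler_norm C))// lerDl.
by rewrite mulrC -ltr_pdivlMr.
Qed.

Lemma dot_le x y : `|dot x y| <= m%:R * (`|x| * `|y|).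
Proof.
apply: le_trans (ler_norm_sum _ _ _) _.
apply: le_trans (ler_sum _ (_ : forall i, true -> _ <= `|x| * `|y|)) _.
  by move=> i _; rewrite normrM ler_pM// norm_coord.
by rewrite sumr_const card_ord mulr_natl.
Qed.

Lemma dotDl x y z : dot (x + y) z = dot x z + dot y z.
Proof. by have := dot_lin 1 1 x y z; rewrite !scale1r !mul1r. Qed.

Lemma dotZl (a : R) x z : dot (a *: x) z = a * dot x z.
Proof. by have := dot_lin a 0 x 0 z; rewrite scale0r addr0 mul0r addr0. Qed.

Lemma dotBl x y z : dot (x - y) z = dot x z - dot y z.
Proof. by rewrite dotDl -scaleN1r dotZl mulN1r. Qed.

Lemma open_enorm_ball p (r : R) : open [set x | enorm (x - p) < r].
Proof.
apply: (@open_comp _ _ (fun x : 'rV[R]_m => enorm (x - p)) [set t | t < r]); last exact: open_lt.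
move=> x _; apply: (@continuous_comp _ _ _ (qdist p) Num.sqrt); last exact: sqrt_continuous.
exact: (Ck_continuous (Ck_qdist 0 p)).
Qed.

Let cone_arith (M K k : R) : 0 < k -> (K + 1) * (M + 1) * k = 2^-1 ->
  K * ((M + 1) * k) < 1 - M * k.
Proof. by lra. Qed.

(** Near p, U is the set where F(x) = x.e - phi(P x) is positive, and F(p) = 0. In directions close
    to e the first term of F changes faster than the Lipschitz term can compensate, so F has the
    sign of the displacement. *)
Lemma lipschitz_cone U p : Lipschitz_boundary U -> bdry U p ->
  exists e (k s0 : R), [/\ 0 < k, 0 < s0 & forall s z, 0 < s -> s <= s0 -> `|z - e| <= k ->
    U (p + s *: z) /\ ~ closure U (p - s *: z)].
Proof.
move=> LU bp; have [r [e [phi [r0 ee [C HC] HU]]]] := LU p bp.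
have e1 : `|e| <= 1.
  by rewrite (le_trans (norm_le_enorm e))// /enorm ee sqrtr1.
pose P x := x - dot x e *: e.
pose K := `|C| + 1; have K0 : 0 < K by rewrite ltr_wpDl.
have phiK x y : `|phi x - phi y| <= K * `|x - y|.
  apply: (le_trans (HC (x, y) (conj I I))).
  by rewrite ler_wpM2r// (le_trans (ler_norm C))// lerDl.
have PB x y : P x - P y = P (x - y) by apply/rowP => i; rewrite /P dotBl !mxE; ring.
have Pn x : `|P x| <= (m%:R + 1) * `|x|.
  apply: (le_trans (ler_normB _ _)); rewrite normrZ mulrDl mul1r addrC lerD2r.
  rewrite -[leRHS]mulr1 ler_pM//; apply: (le_trans (dot_le x e)).
  by rewrite ler_wpM2l// -[leRHS]mulr1 ler_wpM2l.
pose F x := dot x e - phi (P x).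
have cF : continuous F.
  apply: (@lipschitz_continuous _ (m%:R + K * (m%:R + 1))) => x y.
  rewrite /F (_ : _ - _ = dot (x - y) e - (phi (P x) - phi (P y))); last first.
    by rewrite dotBl; ring.
  apply: (le_trans (ler_normB _ _)); rewrite mulrDl lerD//.
    apply: (le_trans (dot_le _ _)); rewrite ler_wpM2l// -[leRHS]mulr1 ler_wpM2l//.
  by apply: (le_trans (phiK _ _)); rewrite PB -mulrA ler_wpM2l// ltW.
have UF x : enorm (x - p) < r -> (U x <-> 0 < F x) by move=> /HU; rewrite /F subr_gt0.
have oB : open [set x : 'rV[R]_m | enorm (x - p) < r] by exact: open_enorm_ball.
have Bp : enorm (p - p) < r by rewrite subrr /enorm /dot big1 ?sqrtr0// => i _; rewrite mxE mul0r.
have nbF (A : set R) x : open A -> A (F x) -> enorm (x - p) < r ->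
    nbhs x [set y | A (F y) /\ enorm (y - p) < r].
  move=> oA Ax Bx; apply: open_nbhs_nbhs; split=> //.
  by apply: openI => //; apply: open_comp => // y _; exact: cF.
(* A nonzero F(p) would keep its sign nearby, making p an interior or an exterior point. *)
have Fp : F p = 0.
  apply/eqP; rewrite eq_le; apply/andP; split; rewrite leNgt; apply/negP => Fp.
  - case: bp => _; apply; apply: (filterS _ (nbF [set t | 0 < t] p (@open_gt _ 0) Fp Bp)) => y [Fy By].
    exact: (UF y By).2 Fy.
  - case: bp => cp _; have [y [Uy [Fy By]]] := cp _ (nbF [set t | t < 0] p (@open_lt _ 0) Fp Bp).
    by have := lt_trans Fy ((UF y By).1 Uy); rewrite ltxx.
(* So small that |z - e| <= k implies K |P z| < z.e: the bounds are (m + 1) k for |P z| and 1 - m k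
   for z.e. *)
pose k := (2 * ((K + 1) * (m%:R + 1)))^-1.
have m1 : 0 < m%:R + 1 :> R by rewrite ltr_wpDl.
have K1 : 0 < K + 1 by rewrite addr_gt0.
have k0 : 0 < k by rewrite invr_gt0 !mulr_gt0.
have k1 : k <= 1.
  rewrite invf_le1 ?mulr_gt0//.
  have : 1 <= (K + 1) * (m%:R + 1) :> R by rewrite mulr_ege1// lerDr ?ler0n// ltW.
  by lra.
pose s0 := r / (2 * m%:R + 1).
have m2 : 0 < 2 * m%:R + 1 :> R by rewrite ltr_wpDl// mulr_ge0.
have s00 : 0 < s0 by rewrite divr_gt0.
have up z : `|z - e| <= k -> K * `|P z| < dot z e.
  move=> ze; have Pe : P e = 0 by rewrite /P ee scale1r subrr.
  have h1 : `|P z| <= (m%:R + 1) * k.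
    have := Pn (z - e); rewrite -PB Pe subr0 => /le_trans; apply.
    by rewrite ler_wpM2l// ltW.
  have h2 : 1 - m%:R * k <= dot z e.
    have := dot_le (z - e) e; rewrite dotBl ee => h.
    have h3 : m%:R * (`|z - e| * `|e|) <= m%:R * k.
      by rewrite ler_wpM2l// -[leRHS]mulr1 ler_pM.
    have := le_trans h h3; rewrite ler_norml => /andP[h4 _]; move: h4.
    by move: (dot z e) (m%:R * k) => u w; clear; lra.
  apply: lt_le_trans h2; apply: (le_lt_trans (ler_wpM2l (ltW K0) h1)).
  have : (K + 1) * (m%:R + 1) * k = 2^-1.
    by rewrite /k; field; rewrite !gt_eqF.
  exact: cone_arith k0.
have Bs s z : 0 < s -> s <= s0 -> `|z - e| <= k -> enorm (s *: z) < r.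
  move=> s_0 ss ze; apply: (le_lt_trans (enorm_le_norm _)).
  have z2 : `|z| <= 2.
    rewrite -(subrK e z) (le_trans (ler_normD _ _))// (_ : 2 = 1 + 1)// lerD//.
    exact: le_trans ze k1.
  rewrite normrZ gtr0_norm//; apply: (@le_lt_trans _ _ (m%:R * (s0 * 2))).
    by rewrite ler_wpM2l// ler_pM// ltW.
  rewrite (_ : m%:R * (s0 * 2) = r * (2 * m%:R) / (2 * m%:R + 1)); last by rewrite /s0; ring.
  by rewrite ltr_pdivrMr// ltr_pM2l// ltrDl.
exists e, k, s0; split=> // s z s_0 ss ze; have Pz := up z ze.
have PZ (t : R) : P (t *: z) = t *: P z by rewrite /P dotZl scalerBr scalerA.
have Fs (t : R) : `|F (p + t *: z) - t * dot z e| <= `|t| * (K * `|P z|).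
  rewrite /F dotDl dotZl.
  rewrite (_ : _ - _ - _ = F p + (phi (P p) - phi (P (p + t *: z)))); last by rewrite /F; ring.
  rewrite Fp add0r; apply: (le_trans (phiK _ _)).
  by rewrite PB opprD addrA subrr sub0r -scaleNr PZ normrZ normrN mulrCA.
have sP : s * (K * `|P z|) < s * dot z e by rewrite ltr_pM2l.
split.
- apply: (UF _ _).2; first by rewrite addrC addKr; exact: Bs.
  have := Fs s; rewrite (gtr0_norm s_0) ler_norml => /andP[h _]; move: h sP.
  by move: (F _) (s * dot _ _) (s * (K * _)) => u w t; clear; lra.
- have Bm : enorm (p - s *: z - p) < r.
    rewrite addrAC subrr sub0r /enorm (_ : dot _ _ = dot (s *: z) (s *: z)); first exact: Bs.
    by apply: eq_bigr => i _; rewrite !mxE mulrNN.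
  have Fm : F (p - s *: z) < 0.
    have := Fs (- s); rewrite normrN (gtr0_norm s_0) scaleNr mulNr ler_norml => /andP[_ h]; move: h sP.
    by move: (F _) (s * dot _ _) (s * (K * _)) => u w t; clear; lra.
  move=> cl; have [y [Uy [Fy By]]] := cl _ (nbF [set t | t < 0] _ (@open_lt _ 0) Fm Bm).
  by have := lt_trans Fy ((UF y By).1 Uy); rewrite ltxx.
Qed.

Lemma closure_cone D x : open D -> Lipschitz_boundary D -> closure D x ->
  exists e (k s0 : R), [/\ 0 < k, 0 < s0 & forall s z, 0 < s -> s <= s0 -> `|z - e| <= k ->
    D (x + s *: z)].
Proof.
move=> oD LD cx; have [Dx|Dx] := pselect (D x).
  have [r r0 Hr] := open_cube oD Dx.
  (* At an interior point the cone is a full ball: axis 0 and aperture 1. *)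
  exists 0, 1, r; split=> // s z s0 sr; rewrite subr0 => z1.
  apply: Hr; rewrite addrC addKr normrZ gtr0_norm//.
  by rewrite -[leRHS]mulr1 ler_pM// ltW.
have [|e [k [s0 [k0 s00 H]]]] := lipschitz_cone LD (_ : bdry D x).
  by split=> // /interior_subset.
by exists e, k, s0; split=> // s z ? ? ze; case: (H s z _ _ ze).
Qed.

(** A 2 by 2 minor of (z, b) with b_j != 0 is a linear form in z that vanishes on the line of b but
    not identically. A small shift of e makes it nonzero, and continuity keeps it nonzero nearby.
    The bound 4k' <= |d| is the one [blow_up_cone] asks for. *)
Lemma avoid_line e b (k : R) : (1 < m)%N -> b != 0 -> 0 < k ->
  exists d (k' : R), [/\ 0 < k', 4 * k' <= `|d|, forall z, `|z - d| <= k' -> `|z - e| <= k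
    & forall z t, `|z - d| <= k' -> z != t *: b].
Proof.
move=> m1 b0 k0; have [j bj] : exists j, b ord0 j != 0.
  apply: contrapT => H; move/negP : b0; apply; apply/eqP/rowP => j; rewrite mxE.
  by apply: contrapT => bj; apply: H; exists j; apply/eqP.
have [i ij] : exists i : 'I_m, i != j.
  have m0 : (0 < m)%N by exact: ltnW.
  have [->|j0] := eqVneq j (Ordinal m0); first by exists (Ordinal m1).
  by exists (Ordinal m0); rewrite eq_sym.
pose f (z : 'rV[R]_m) : R := z ord0 i * b ord0 j - z ord0 j * b ord0 i.
have fb t : f (t *: b) = 0 by rewrite /f !mxE; ring.
have cf : continuous f.
  by apply: (@Ck_continuous _ _ 0); apply: Ck_sub; apply: Ck_mul;
    [exact: Ck_coord|exact: Ck_cst|exact: Ck_coord|exact: Ck_cst].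
have [d de fd] : exists2 d, `|d - e| <= k / 2 & f d != 0.
  have [fe|fe] := eqVneq (f e) 0; last by exists e; rewrite // subrr normr0 divr_ge0// ltW.
  exists (e + (k / 2) *: delta_mx ord0 i).
    rewrite addrC addKr normrZ gtr0_norm ?divr_gt0//.
    rewrite -[leRHS]mulr1 ler_wpM2l ?divr_ge0 ?(ltW k0)//.
    apply: norm_le_coord => // l; rewrite mxE eqxx /=.
    by case: (l == i); rewrite ?normr1 ?normr0.
  have -> : f (e + (k / 2) *: delta_mx ord0 i) = f e + (k / 2) * b ord0 j.
    have ji : (j == i) = false by rewrite eq_sym (negPf ij).
    by rewrite /f !mxE !eqxx ji /=; ring.
  by rewrite fe add0r mulf_neq0// gt_eqF// divr_gt0.
have oN : open [set z | f z != 0].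
  apply: (@open_comp _ _ f [set t | t != 0]); first by move=> z _; exact: cf.
  exact: open_neq.
have [r r0 Hr] := open_cube oN fd.
have d0 : d != 0.
  by apply: contraNN fd => /eqP ->; rewrite -(scale0r b) fb.
pose k' := Num.min r (Num.min (k / 4) (`|d| / 4)).
have h1 : k' <= r by rewrite ge_min lexx.
have h2 : k' <= k / 4 by rewrite !ge_min lexx !orbT.
have h3 : k' <= `|d| / 4 by rewrite !ge_min lexx !orbT.
exists d, k'; split.
- by rewrite !lt_min r0 !divr_gt0// normr_gt0.
- by rewrite mulrC -ler_pdivlMr.
- move=> z zd; rewrite -(subrK d z) -addrA (le_trans (ler_normD _ _))//.
  by have := le_trans zd h2; move: de k0; move: `|_| `|_| => p q; clear; lra.
- move=> z t zd; apply/eqP => zb; have := Hr z (le_trans zd h1).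
  by rewrite /= zb fb eqxx.
Qed.

End cones.

(** * Measure and tip of a needle; blow-up along needle sequences *)

Section needle_geometry.
Context {R : realType} {m : nat}.
Implicit Types (U D T : set 'rV[R]_m) (x y z b : 'rV[R]_m) (sigma : R -> 'rV[R]_m).

Lemma leb_segment_gt1 n (a b : 'rV[R]_n) : (1 < n)%N -> b != 0 ->
  leb [set a + t *: b | t in `[0, 1]%classic] = 0%E.
Proof. by case: n a b => [|[|n]] a b // _; exact: leb_segment. Qed.

Lemma path_last_ge (a : R) s : path <%R a s -> a <= last a s.
Proof.
elim: s a => [|c s IH] a //= /andP[ac /IH]; exact: le_trans (ltW ac).
Qed.

Lemma path_interval (a t : R) s : path <%R a s -> (0 < size s)%N -> a <= t <= last a s ->
  exists2 i, (i < size s)%N & t \in `[nth 0 (a :: s) i, nth 0 (a :: s) i.+1].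
Proof.
elim: s a => [|c s IH] a //= /andP[ac ps] _ /andP[at_ tl].
have [tc|ct] := leP t c; first by exists 0%N; rewrite //= in_itv /= at_ tc.
have s0 : (0 < size s)%N by case: s ps tl {IH} => //= _; rewrite leNgt ct.
have ctl : c <= t <= last c s by rewrite (ltW ct) tl.
by have [i is_ Hi] := IH c ps s0 ctl; exists i.+1.
Qed.

Lemma needle_compact U x sigma (t0 t1 : R) : needle U x sigma -> 0 <= t0 -> t1 <= 1 ->
  compact (sigma @` `[t0, t1]).
Proof.
move=> [[cs _] _ _ _ _] t00 t11; apply: continuous_compact; last exact: segment_compact.
apply: continuous_subspaceW cs => t /=; rewrite !in_itv /= => /andP[h1 h2].
by rewrite (le_trans t00 h1) (le_trans h2 t11).
Qed.

Lemma needle_null U x sigma : (1 < m)%N -> needle U x sigma -> leb (sigma @` `[0, 1]) = 0%E.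
Proof.
move=> m1 nd; have cT := needle_compact nd (lexx _) (lexx _).
case: nd => -[_ [s [ps ls Hs]]] _ _ _ _.
have s0 : (0 < size s)%N by case: s ls {ps Hs} => //= /eqP; rewrite eq_sym oner_eq0.
have seg i : exists S : set 'rV[R]_m, leb.-negligible S /\ ((i < size s)%N ->
    sigma @` `[nth 0 (0 :: s) i, nth 0 (0 :: s) i.+1] `<=` S).
  have [is_|is_] := ltnP i (size s); last by exists set0; split=> //; exact: negligible_set0.
  have [a [b Hab]] := Hs i is_.
  set u := nth 0 (0 :: s) i in Hab *; set w := nth 0 (0 :: s) i.+1 in Hab *.
  pose i0 : 'I_m := Ordinal m1.
  (* A constant piece is put in a segment with an arbitrary nonzero direction, so that
     [leb_segment_gt1] covers it. *)
  pose b' := if (w - u) *: b == 0 then delta_mx ord0 i0 else (w - u) *: b.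
  have b'0 : b' != 0.
    rewrite /b'; case: ifPn => // _; apply/eqP => /rowP/(_ i0); rewrite !mxE !eqxx /=.
    by apply/eqP; exact: oner_neq0.
  exists [set (a + u *: b) + t *: b' | t in `[0, 1]%classic]; split.
    have cS : compact [set (a + u *: b) + t *: b' | t in `[0, 1]%classic] by exact: compact_segment.
    apply/negligibleP; first exact: compact_measurable_rV.
    exact: leb_segment_gt1.
  move=> _ _ [t /= tI <-]; rewrite Hab//; move: tI; rewrite in_itv /= => /andP[ut tw].
  rewrite /b'; case: ifPn => [/eqP wb|wb].
    exists 0; rewrite /= ?in_itv /= ?lexx ?ler01// scale0r addr0; congr (_ + _).
    have := wb => /eqP; rewrite scaler_eq0 subr_eq0 => /orP[/eqP wu|/eqP ->]; last by rewrite !scaler0.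
    by congr (_ *: _); apply/eqP; rewrite eq_le ut -wu tw.
  have uw : u < w.
    rewrite lt_neqAle (le_trans ut tw) andbT; apply: contraNN wb => /eqP ->.
    by rewrite subrr scale0r.
  have d0 : 0 < w - u by rewrite subr_gt0.
  exists ((t - u) / (w - u)).
    by rewrite /= in_itv /= divr_ge0 ?subr_ge0 ?(ltW uw)// ler_pdivrMr// mul1r lerD2r.
  by rewrite scalerA divfK ?gt_eqF// -addrA -scalerDl [u + _]addrC subrK.
have /choice[S HS] := seg.
apply/(negligibleP _ (compact_measurable_rV cT)).
apply: (negligibleS _ (negligible_bigcup (fun i => (HS i).1))) => _ [t /= tI <-].
have t01 : 0 <= t <= last 0 s by move: tI; rewrite in_itv /= ls.
have [i is_ ti] := path_interval ps s0 t01.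
by exists i => //; apply: (HS i).2 => //; exists t.
Qed.

(** The pieces before the last one form a compact set that misses x by injectivity; within their
    distance from x only the straight last piece is met. *)
Lemma needle_tip U x sigma : needle U x sigma ->
  exists b (r : R), [/\ b != 0, 0 < r & forall t, t \in `[0, 1] -> `|sigma t - x| < r ->
    exists tau : R, sigma t = x + tau *: b].
Proof.
move=> nd; have [[_ [s [ps ls Hs]]] _ inj [_ s1] _] := nd.
case/lastP : s ps ls Hs => [_ /= /eqP|s w]; first by rewrite eq_sym oner_eq0.
rewrite last_rcons => + w1; rewrite w1 rcons_path => /andP[ps ls1] Hs.
have [|a [b Hab]] := Hs (size s) _; first by rewrite size_rcons.
set t' := last 0 s in ls1; have t'0 : 0 <= t' by exact: path_last_ge.
have e1 : nth 0 (0 :: rcons s 1) (size s) = t'.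
  by rewrite -rcons_cons nth_rcons /= ltnS leqnn /t' (last_nth 0).
have e2 : nth 0 (0 :: rcons s 1) (size s).+1 = 1 by rewrite /= nth_rcons ltnn eqxx.
rewrite e1 e2 in Hab.
have xE : x = a + b by rewrite -s1 Hab ?scale1r// in_itv /= lexx ltW.
have b0 : b != 0.
  apply/eqP => b0; have : t' = 1.
    apply: inj; rewrite ?in_itv /= ?lexx ?ler01 ?t'0 ?(ltW ls1)//.
    by rewrite !Hab ?b0 ?scaler0// in_itv /= ?lexx ?(ltW ls1).
  by move=> t'1; rewrite t'1 ltxx in ls1.
have cT := needle_compact nd (lexx 0) (ltW ls1).
have oT : open (~` (sigma @` `[0, t'])) by apply: closed_openC; apply: compact_closed => //; exact: norm_hausdorff.
have xT : (~` (sigma @` `[0, t'])) x.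
  move=> [t /= tI tx]; have t1 : t = 1.
    move: tI; rewrite in_itv /= => /andP[h1 h2].
    by apply: inj; rewrite ?in_itv /= ?lexx ?ler01 ?h1 ?(le_trans h2 (ltW ls1)) ?tx ?s1.
  by move: tI; rewrite t1 in_itv /= => /andP[_]; rewrite leNgt ls1.
have [r r0 Hr] := open_cube oT xT.
exists b, r; split=> // t; rewrite in_itv /= => /andP[h1 h2] /ltW/Hr Tt.
have t't : t' <= t.
  by rewrite leNgt; apply/negP => tt'; apply: Tt; exists t => //=; rewrite in_itv /= h1 ltW.
exists (t - 1); rewrite Hab ?in_itv /= ?t't//.
by rewrite xE scalerBl scale1r -addrA; congr (a + _); rewrite addrC subrK.
Qed.

Hypothesis m23 : m = 2%N \/ m = 3%N.

Lemma blow_up_closure U D x sigma v : open U -> open D -> D `<=` U -> Lipschitz_boundary D ->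
  closure D x -> needle U x sigma -> needle_sequence U x sigma v ->
  wip D (fun=> 1) (nabla U (v n)) (nabla U (v n)) @[n --> \oo] --> +oo.
Proof.
move=> oU oD DU LD cx nd nv.
have m1 : (1 < m)%N by case: m23 => ->.
have [_ _ _ [_ s1] _] := nd.
have Tx : (sigma @` `[0, 1]) x by exists 1 => //=; rewrite in_itv /= lexx ler01.
have sc := needle_sequence_sources m23 oU nv Tx.
have [e [k [s0 [k0 s00 He]]]] := closure_cone oD LD cx.
have [b [r [b0 r0 Hr]]] := needle_tip nd.
have [d [k' [k'0 kd de db]]] := avoid_line e m1 b0 k0.
have d0 : 0 < `|d| by apply: lt_le_trans kd; rewrite mulr_gt0.
(* In the narrowed cone |z| <= 2 |d|, so s |z| < r and the needle could meet it only along the line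
   of its last piece. *)
pose s2 := Num.min s0 (r / (3 * `|d|)).
have s20 : 0 < s2 by rewrite lt_min s00 divr_gt0// mulr_gt0.
apply: (blow_up_cone m23 oU oD DU Tx sc k'0 s20 kd) => s z s_0 ss zd.
split; first by apply: He => //; [rewrite (le_trans ss)// ge_min lexx|exact: de].
move=> [t /= tI st]; have /Hr : t \in `[0, 1] by [].
rewrite st addrC addKr normrZ gtr0_norm// => /(_ _)[|tau].
  have z2 : `|z| <= 2 * `|d|.
    have : `|z| <= `|z - d| + `|d| by rewrite -{1}(subrK d z) ler_normD.
    by move: zd kd k'0; move: `|z - d| `|d| `|z| => p q w; clear; lra.
  apply: (@le_lt_trans _ _ (r / (3 * `|d|) * (2 * `|d|))).
    rewrite ler_pM// ?(ltW s_0)// (le_trans ss)// ge_min lexx orbT//.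
  rewrite (_ : _ * _ = r * (2 / 3)); last by field; rewrite gt_eqF.
  by rewrite gtr_pMr//; lra.
move=> /(@addrI _ x) sz; have /eqP := db z (tau / s) zd; apply.
by rewrite mulrC -scalerA -sz scalerA mulVf ?scale1r// gt_eqF.
Qed.

Lemma blow_up_through U D x sigma v : open U -> bounded_set U -> open D -> D `<=` U ->
  U x -> needle U x sigma -> needle_sequence U x sigma v ->
  (sigma @` `]0, 1]) `&` D !=set0 ->
  wip D (fun=> 1) (nabla U (v n)) (nabla U (v n)) @[n --> \oo] --> +oo.
Proof.
move=> oU bU oD DU Ux nd nv [_ [[t1 /= t1I <-] Dt1]].
have m1 : (1 < m)%N by case: m23 => ->.
have [_ _ inj [_ s1] ins] := nd.
have Tx : (sigma @` `[0, 1]) x by exists 1 => //=; rewrite in_itv /= lexx ler01.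
have sc := needle_sequence_sources m23 oU nv Tx.
move: t1I; rewrite in_itv /= => /andP[t10 t11].
have c1 := needle_compact nd (lexx 0) t11; have c2 := needle_compact nd (ltW t10) (lexx 1).
have cT := needle_compact nd (lexx 0) (lexx 1).
have cD : compact (sigma @` `[0, t1] `\` D) by apply: compact_closedI => //; exact: open_closedC.
(* The part of the needle up to [t1] that is outside D is removed, so off its final piece the needle
   meets the support of the cutoff only in D. Injectivity keeps the final piece itself inside
   [W]. *)
pose W := U `\` (sigma @` `[0, t1] `\` D).
have oW : open W.
  by apply: openI => //; apply: closed_openC; apply: compact_closed => //; exact: norm_hausdorff.
have TW : sigma @` `[t1, 1] `<=` W.
  move=> _ [t /= tI <-]; move: tI; rewrite in_itv /= => /andP[h1 h2]; split.
    have [->|tn1] := eqVneq t 1; first by rewrite s1.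
    by apply: ins; rewrite in_itv /= (lt_le_trans t10 h1) lt_neqAle tn1.
  move=> [[u /= uI ut] Dt]; move: uI; rewrite in_itv /= => /andP[u0 u1].
  have e : u = t by apply: inj; rewrite ?in_itv /= ?u0 ?h2 ?(le_trans u1)// (le_trans (ltW t10)).
  by apply: Dt; rewrite (_ : t = t1)//; apply/eqP; rewrite eq_le h1 -e u1.
have [eta [te _ [V oV [TV e1]]]] := exists_cutoff oW c2 TW.
have WU : W `<=` U by move=> y [].
have Vx : V x by apply: TV; exists 1; rewrite //= in_itv /= lexx t11.
apply: (@blow_up_crossing _ _ m23 U D (sigma @` `[0, 1]) (V `&` U) x v eta) => //.
- exact: needle_null nd.
- have [se ce eW] := (test_functionP _ _).1 te.
  by apply/test_functionP; split=> // y /eW/WU.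
- exact: openI.
- by move=> y [/e1].
- move=> y fy [t /= tI ty] NV; have [se ce eW] := (test_functionP _ _).1 te.
  have [Uy NT] := eW _ fy; apply: contrapT => Dy; apply: NT; split=> //.
  move: tI; rewrite in_itv /= => /andP[h1 h2].
  exists t => //=; rewrite in_itv /= h1 /= leNgt; apply/negP => t1t.
  by apply: NV; split=> //; apply: TV; exists t => //=; rewrite in_itv /= h2 ltW.
Qed.

End needle_geometry.

(** * Taylor coefficients of the fundamental solution along a segment *)

Section newton_extrapolation.
Context {R : realType}.

Definition dl (V : zmodType) (g : nat -> V) j : V := g j.+1 - g j.

(** Newton's forward formula, by induction on M: Pascal's rule splits the remainder of order N + 1
    at M + 1 into that of g at M and that of order N of its difference. *)
Lemma newton_remainder (N M : nat) (g : nat -> R) (B : R) :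
  (forall j, (j + N <= M)%N -> `|iter N (@dl R) g j| <= B) ->
  `|g M - \sum_(k < N) 'C(M, k)%:R * iter k (@dl R) g 0| <= 'C(M, N)%:R * B.
Proof.
elim: M N g => [|M IH] [|N] g H.
- by rewrite big_ord0 subr0 bin0 mul1r; exact: (H 0%N).
- rewrite big_ord_recl big1 => [|i _]; last by rewrite bin0n mul0r.
  by rewrite bin0 mul1r addr0 subrr normr0 bin0n mul0r.
- by rewrite big_ord0 subr0 bin0 mul1r; apply: (H M.+1); rewrite addn0.
have H1 : `|g M - \sum_(k < N.+1) 'C(M, k)%:R * iter k (@dl R) g 0| <= 'C(M, N.+1)%:R * B.
  by apply: IH => j jM; apply: H; rewrite leqW.
have H2 : `|dl g M - \sum_(k < N) 'C(M, k)%:R * iter k (@dl R) (dl g) 0| <= 'C(M, N)%:R * B.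
  by apply: IH => j jM; rewrite -iterSr; apply: H; rewrite addnS ltnS.
rewrite binS natrD mulrDl.
have -> : g M.+1 - \sum_(k < N.+1) 'C(M.+1, k)%:R * iter k (@dl R) g 0 =
    (g M - \sum_(k < N.+1) 'C(M, k)%:R * iter k (@dl R) g 0) +
    (dl g M - \sum_(k < N) 'C(M, k)%:R * iter k (@dl R) (dl g) 0).
  rewrite !big_ord_recl /= !bin0.
  under eq_bigr => i _ do rewrite /bump /= add1n binS natrD mulrDl.
  under [X in _ = _ - (_ + X) + _]eq_bigr => i _ do rewrite /bump /= add1n.
  under [X in _ = _ + (_ - X)]eq_bigr => i _ do rewrite -iterSr.
  by rewrite big_split /= /dl; ring.
by apply: (le_trans (ler_normD _ _)); rewrite lerD.
Qed.

Definition fwd (h : R) (f : R -> R) t := f (t + h) - f t.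

Lemma iter_fwd h (f : R -> R) N j :
  iter N (@dl R) (fun i => f (i%:R * h)) j = iter N (fwd h) f (j%:R * h).
Proof.
elim: N j => [|N IH] j //; rewrite !iterS /dl !IH /fwd.
by rewrite -natr1 mulrDl mul1r.
Qed.

Lemma is_derive_conv (f : R -> R) (t df df' : R) : is_derive t (1 : R) f df -> df = df' ->
  is_derive t (1 : R) f df'.
Proof. by move=> D <-. Qed.

Lemma is_derive_mulc1 (c : R) (f : R -> R) (t df : R) : is_derive t (1 : R) f df ->
  is_derive t (1 : R) (fun u => c * f u) (c * df).
Proof. exact: is_deriveZ. Qed.

(* F n t is the n-th Taylor coefficient of F 0 at t. *)
Definition taylor_family (F : nat -> R -> R) := forall (n : nat) (t : R), 0 <= t <= 1 ->
  is_derive t (1 : R) (F n) (n.+1%:R * F n.+1 t).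

Lemma is_derive_fwd (F : nat -> R -> R) h N n (t : R) : taylor_family F -> 0 <= h -> 0 <= t ->
  t + N%:R * h <= 1 ->
  is_derive t (1 : R) (iter N (fwd h) (F n)) (n.+1%:R * iter N (fwd h) (F n.+1) t).
Proof.
move=> HF h0; elim: N t => [|N IH] t t0 t1.
  by apply: HF; rewrite t0 /=; move: t1; rewrite mul0r addr0.
have t1' : t + h + N%:R * h <= 1 by move: t1; rewrite -natr1; lra.
have D1 := IH (t + h) (addr_ge0 t0 h0) t1'.
have D2 : is_derive t (1 : R) (iter N (fwd h) (F n)) (n.+1%:R * iter N (fwd h) (F n.+1) t).
  by apply: IH => //; move: t1; rewrite -natr1; lra.
have D3 : is_derive t (1 : R) (fun t => t + h) 1.
  have := is_derive_add (is_derive_id t (1 : R)) (is_derive_cst h t (1 : R)).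
  by rewrite addr0.
have D4 := is_derive_comp1 D3 D1.
have D5 := is_deriveB D4 D2.
suff -> : n.+1%:R * iter N.+1 (fwd h) (F n.+1) t =
  n.+1%:R * iter N (fwd h) (F n.+1) (t + h) * 1 - n.+1%:R * iter N (fwd h) (F n.+1) t by exact: D5.
by rewrite mulr1 -mulrBr.
Qed.

(** Each difference costs one application of the mean value theorem: a factor h, and the factor n +
    1 that differentiating a Taylor coefficient produces. The factors accumulate to a falling
    factorial. *)
Lemma fwd_bound (F : nat -> R -> R) h N n (t B : R) : taylor_family F -> 0 < h -> 0 <= t ->
  t + N%:R * h <= 1 -> (forall s, 0 <= s <= 1 -> `|F (n + N)%N s| <= B) ->
  `|iter N (fwd h) (F n) t| <= h ^+ N * ((n + N) ^_ N)%:R * B.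
Proof.
move=> HF h0; elim: N n t => [|N IH] n t t0 t1 HB.
  rewrite addn0 in HB *; rewrite expr0 ffactn0 !mul1r; apply: HB.
  by rewrite t0; move: t1; rewrite mul0r addr0.
have tS : t + h + N%:R * h <= 1 by move: t1; rewrite -natr1; lra.
have D s : t <= s <= t + h -> is_derive s (1 : R) (iter N (fwd h) (F n)) (n.+1%:R * iter N (fwd h) (F n.+1) s).
  by move=> /andP[s1 s2]; apply: is_derive_fwd => //; [exact: ltW|exact: le_trans s1|move: s2 tS; lra].
have [c cI] : exists2 c, c \in `[t, t + h] & iter N (fwd h) (F n) (t + h) - iter N (fwd h) (F n) t =
    n.+1%:R * iter N (fwd h) (F n.+1) c * (t + h - t).
  apply: MVT_segment; first by rewrite lerDl ltW.
    by move=> s; rewrite in_itv /= => /andP[s1 s2]; apply: D; rewrite !ltW.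
  apply: derivable_within_continuous => s; rewrite in_itv /= => /D Ds.
  exact: ex_derive.
rewrite iterS /fwd => ->; move: cI; rewrite in_itv /= => /andP[c1 c2].
rewrite addrC addKr !normrM (gtr0_norm h0) normr_nat.
have := IH n.+1 c (le_trans t0 c1) _ _.
move=> /(_ _ _)/(ler_wpM2l (ler0n R n.+1))/(ler_wpM2r (ltW h0)) H.
apply: le_trans (H _ _) _.
- by move: c2 tS; lra.
- by move=> s; rewrite addSnnS; exact: HB.
rewrite le_eqVlt; apply/orP; left; apply/eqP.
have -> : ((n + N.+1) ^_ N.+1 = n.+1 * (n.+1 + N) ^_ N)%N.
  by rewrite addnS addSn ffactnSr mulnC subSn ?leq_addl// addnK.
by rewrite natrM exprS; ring.
Qed.

(** The nodes are j/M with j < N. As binomial(M, N) N! M^-N <= 1, the error bound does not involve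
    M, so a large M brings all nodes close to 0 at no cost. *)
Lemma newton_extrapolation (F : nat -> R -> R) (N M : nat) (B : R) :
  taylor_family F -> (0 < M)%N -> 0 <= B -> (forall s, 0 <= s <= 1 -> `|F N s| <= B) ->
  `|F 0%N 1 - \sum_(k < N) 'C(M, k)%:R * iter k (@dl R) (fun j => F 0%N (j%:R * M%:R^-1)) 0| <= B.
Proof.
move=> HF M0 B0 HB; have MR : 0 < M%:R :> R by rewrite ltr0n.
have h0 : 0 < M%:R^-1 :> R by rewrite invr_gt0.
have := @newton_remainder N M (fun j => F 0%N (j%:R * M%:R^-1)) (M%:R^-1 ^+ N * (N`!)%:R * B).
rewrite mulfV ?gt_eqF// => H; apply: le_trans (H _) _.
  move=> j jM; rewrite iter_fwd -ffactnn -[X in (X ^_ _)%:R]add0n.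
  apply: (fwd_bound HF h0) => //.
  by rewrite -mulrDl ler_pdivrMr// mul1r -natrD ler_nat.
rewrite !mulrA ler_piMl// -mulrA mulrCA -natrM bin_ffact exprVn.
rewrite mulrC ler_pdivrMr ?exprn_gt0// mul1r -natrX ler_nat.
elim: N {HB H} => [|n IH]; first by rewrite ffactn0.
by rewrite ffactnSr expnSr leq_mul// leq_subr.
Qed.

End newton_extrapolation.

(** * Taylor coefficients of powers of a quadratic polynomial *)

Section power_family.
Context {R : realType}.
Variables (q q' : R -> R) (q2 s al : R) (f : R -> R).
Hypothesis q_gt0 : forall t : R, 0 <= t <= 1 -> 0 < q t.
Hypothesis dq : forall t : R, 0 <= t <= 1 -> is_derive t (1 : R) q (q' t).
Hypothesis dq' : forall t : R, 0 <= t <= 1 -> is_derive t (1 : R) q' (2 * q2).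
Hypothesis df : forall t : R, 0 <= t <= 1 -> is_derive t (1 : R) f (- al * q' t / q t * f t).

(** Two consecutive coefficients are carried along because the recurrence for the next one involves
    both. *)
Fixpoint pcoef2 (n : nat) : (R -> R) * (R -> R) :=
  match n with
  | 0 => (f, fun t => - al * q' t / q t * f t)
  | n'.+1 => let: (a, b) := pcoef2 n' in
      (b, fun t => - ((n'.+1%:R + al) * q' t * b t + (n'%:R + 2 * al) * q2 * a t) / (n'.+2%:R * q t))
  end.

(* The Taylor coefficients at t of f = q^-al for a quadratic polynomial q, read off q f' = - al q' f. *)
Definition pcoef n t := (pcoef2 n).1 t.

Lemma pcoef2E n : (pcoef2 n).2 = pcoef n.+1.
Proof. by rewrite /pcoef /=; case: (pcoef2 n). Qed.

Lemma pcoefSS n t : pcoef n.+2 t =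
  - ((n.+1%:R + al) * q' t * pcoef n.+1 t + (n%:R + 2 * al) * q2 * pcoef n t) / (n.+2%:R * q t).
Proof.
by rewrite -!pcoef2E /pcoef /=; case: (pcoef2 n) => a b /=.
Qed.

Lemma taylor_pcoef : taylor_family pcoef.
Proof.
suff H n : (forall t : R, 0 <= t <= 1 -> is_derive t (1 : R) (pcoef n) (n.+1%:R * pcoef n.+1 t)) /\
    (forall t : R, 0 <= t <= 1 -> is_derive t (1 : R) (pcoef n.+1) (n.+2%:R * pcoef n.+2 t)).
  by move=> n; case: (H n).
have dqV (t : R) : 0 <= t <= 1 -> is_derive t (1 : R) (fun t => (q t)^-1) (- q' t * (q t)^-1 * (q t)^-1).
  by move=> tI; apply: is_derive_inv (dq tI); rewrite gt_eqF ?q_gt0.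
elim: n => [|n [IH1 IH2]]; split=> //.
- by move=> t tI; have := df tI; rewrite mul1r.
- move=> t tI; have qt0 : q t != 0 by rewrite gt_eqF ?q_gt0.
  have D := is_derive_mul (is_derive_mul (is_derive_mulc1 (- al) (dq' tI)) (dqV t tI)) (df tI).
  rewrite pcoefSS; suff -> : 2 * (- ((1 + al) * q' t * pcoef 1 t + (0 + 2 * al) * q2 * pcoef 0 t) / (2 * q t)) =
    (- al * (2 * q2) * (q t)^-1 + - al * q' t * (- q' t * (q t)^-1 * (q t)^-1)) * f t +
    - al * q' t * (q t)^-1 * (- al * q' t / q t * f t) by exact: D.
  by rewrite /pcoef /=; field.
move=> t tI; have qt0 : q t != 0 by rewrite gt_eqF ?q_gt0.
have n0 (k : nat) : k.+1%:R != 0 :> R by rewrite pnatr_eq0.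
have -> : pcoef n.+2 = fun t => - n.+2%:R^-1 * (((n.+1%:R + al) * q' t) * pcoef n.+1 t + (n%:R + 2 * al) * q2 * pcoef n t) * (q t)^-1.
  by apply/funext => u; rewrite pcoefSS invfM mulrA mulNr [in RHS]mulNr [_ * n.+2%:R^-1]mulrC.
have D := is_derive_mul (is_derive_mulc1 (- n.+2%:R^-1) (is_derive_add
  (is_derive_mul (is_derive_mulc1 (n.+1%:R + al) (dq' tI)) (IH2 t tI))
  (is_derive_mulc1 ((n%:R + 2 * al) * q2) (IH1 t tI)))) (dqV t tI).
rewrite (pcoefSS n.+1); apply: (is_derive_conv D).
rewrite (pcoefSS n).
move: (pcoef n t) (pcoef n.+1 t) (q' t) (q t) qt0 (n0 n.+1) (n0 n.+2) => A B C Q; clear.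
rewrite -!(natr1 n.+2) -!(natr1 n.+1) -!(natr1 n).
move: (n%:R : R) => N Q0 N1 N2.
by field; rewrite Q0 N1 N2.
Qed.

Hypothesis al0 : 0 <= al.
Hypothesis al3 : al <= 3 / 2.
Hypothesis s_ge0 : 0 <= s.
Hypothesis q2_ge0 : 0 <= q2.
Hypothesis q'_le : forall t : R, 0 <= t <= 1 -> `|q' t| <= 2 * s * q t.
Hypothesis q2_le : forall t : R, 0 <= t <= 1 -> q2 <= s ^+ 2 * q t.

(** Insert rate 4s into the recurrence, using |q'| <= 2 s q, q2 <= s^2 q and al <= 3/2. What has to
    hold is 8 (k + 5/2) + (k + 3) <= 16 (k + 2), and the difference of the two sides is 7k + 9. *)
Lemma pcoef_bound n t : 0 <= t <= 1 -> `|pcoef n t| <= `|f t| * (4 * s) ^+ n.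
Proof.
move=> tI; have qt := q_gt0 tI; have s4 : 0 <= 4 * s by rewrite mulr_ge0.
suff H k : `|pcoef k t| <= `|f t| * (4 * s) ^+ k /\ `|pcoef k.+1 t| <= `|f t| * (4 * s) ^+ k.+1.
  by case: (H n).
elim: k => [|k [IH1 IH2]]; split=> //.
- by rewrite mulr1.
- rewrite /pcoef /= expr1 normrM mulrC ler_wpM2l//.
  rewrite !normrM normrN normfV (gtr0_norm qt) (ger0_norm al0) ler_pdivrMr//.
  have h := q'_le tI; apply: (@le_trans _ _ (3 / 2 * (2 * s * q t))); first by rewrite ler_pM.
  have : 0 <= s * q t by rewrite mulr_ge0// ltW.
  by lra.
rewrite pcoefSS normrM normrN normfV normrM normr_nat (gtr0_norm qt).
have n2 : 0 < k.+2%:R * q t by rewrite mulr_gt0// ltr0n.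
rewrite ler_pdivrMr//; apply: (le_trans (ler_normD _ _)).
set X := `|f t| * (4 * s) ^+ k in IH1 *.
have X0 : 0 <= X by rewrite mulr_ge0 ?exprn_ge0.
have h1 : `|(k.+1%:R + al) * q' t * pcoef k.+1 t| <= (k.+1%:R + 3 / 2) * (2 * s * q t) * (X * (4 * s)).
  rewrite !normrM ler_pM//.
    by rewrite ler_pM// ?q'_le// ger0_norm ?lerD2l// addr_ge0.
  by rewrite /X -mulrA -exprSr.
have h2 : `|(k%:R + 2 * al) * q2 * pcoef k t| <= (k%:R + 3) * (s ^+ 2 * q t) * X.
  rewrite !normrM ler_pM//; rewrite ler_pM//.
    have k3 : 0 <= k%:R + 2 * al by rewrite addr_ge0 ?mulr_ge0.
    by rewrite (ger0_norm k3) lerD2l; have := al3; lra.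
  by rewrite ger0_norm// q2_le.
apply: (le_trans (lerD h1 h2)).
have -> : `|f t| * (4 * s) ^+ k.+2 = X * (4 * s) ^+ 2 by rewrite /X -mulrA -exprD addn2.
have P : 0 <= s ^+ 2 * q t * X by rewrite !mulr_ge0 ?exprn_ge0 ?(ltW qt).
rewrite -!(natr1 k.+1) -!(natr1 k).
have K0 : 0 <= k%:R :> R by [].
rewrite -subr_ge0.
rewrite (_ : _ - _ = (7 * k%:R + 9) * (s ^+ 2 * q t * X)); last by field.
by rewrite mulr_ge0// addr_ge0// mulr_ge0.
Qed.

End power_family.

Section family_products.
Context {R : realType}.
Implicit Types (a : nat -> R -> R) (l f : R -> R).

(** Coefficients of the product with an affine function [l] of slope [l1]. *)
Definition linmul l (l1 : R) a (n : nat) (t : R) : R :=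
  l t * a n t + l1 * (if n is n'.+1 then a n' t else 0).

Lemma taylor_linmul l (l1 : R) a : taylor_family a ->
  (forall t : R, 0 <= t <= 1 -> is_derive t (1 : R) l l1) -> taylor_family (linmul l l1 a).
Proof.
move=> Ha Hl n t tI; have D1 := is_derive_mul (Hl t tI) (Ha n t tI).
case: n D1 => [|n] D1.
  have -> : linmul l l1 a 0 = fun t => l t * a 0%N t.
    by apply/funext => u; rewrite /linmul mulr0 addr0.
  by apply: (is_derive_conv D1); rewrite /linmul; ring.
have D2 := is_derive_add D1 (is_derive_mulc1 l1 (Ha n t tI)).
apply: (is_derive_conv D2).
by rewrite /linmul -(natr1 n.+1); ring.
Qed.

(** Coefficients of a function with derivative c a_0; it serves for the logarithm, which is not a
    power. *)
Definition primitive f (c : R) a (n : nat) (t : R) : R :=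
  if n is n'.+1 then c * a n' t / n'.+1%:R else f t.

Lemma taylor_primitive f (c : R) a : taylor_family a ->
  (forall t : R, 0 <= t <= 1 -> is_derive t (1 : R) f (c * a 0%N t)) -> taylor_family (primitive f c a).
Proof.
move=> Ha Hf [|n] t tI.
  by rewrite mul1r /= divr1; exact: Hf.
have -> : primitive f c a n.+1 = fun t => (c / n.+1%:R) * a n t.
  by apply/funext => u; rewrite /primitive mulrAC.
apply: (is_derive_conv (is_derive_mulc1 (c / n.+1%:R) (Ha n t tI))).
have n0 (k : nat) : k.+1%:R != 0 :> R by rewrite pnatr_eq0.
by rewrite /primitive mulrA divfK// [RHS]mulrC divfK.
Qed.

Lemma taylor_scale (c : R) a : taylor_family a -> taylor_family (fun n t => c * a n t).
Proof.
move=> Ha n t tI; apply: (is_derive_conv (is_derive_mulc1 c (Ha n t tI))).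
by ring.
Qed.

End family_products.

Section pole_family.
Context {R : realType} {m : nat}.
Implicit Types (w e : 'rV[R]_m) (t : R).
Hypothesis m23 : m = 2%N \/ m = 3%N.
Local Notation kap := (@dG0_const R m).
Variables (w e : 'rV[R]_m) (del : R).
Hypothesis del_gt0 : 0 < del.
Hypothesis del_le : forall t : R, 0 <= t <= 1 -> del <= enorm (w - t *: e).
Hypothesis e_le : forall t : R, 0 <= t <= 1 -> enorm e <= 8^-1 * enorm (w - t *: e).

Let q t := dot (w - t *: e) (w - t *: e).
Let q' t := - 2 * dot (w - t *: e) e.
Let q2 := dot e e.
Let p t := rinv (w - t *: e).

Let enorm_pos t : 0 <= t <= 1 -> 0 < enorm (w - t *: e).
Proof. by move=> /del_le; exact: lt_le_trans. Qed.

Let q_enorm t : q t = enorm (w - t *: e) ^+ 2. Proof. by rewrite enorm_sqr. Qed.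

Let q_pos t : 0 <= t <= 1 -> 0 < q t.
Proof. by move=> /enorm_pos h; rewrite q_enorm exprn_gt0. Qed.

Let qE t : q t = dot w w - 2 * t * dot w e + t ^+ 2 * dot e e.
Proof.
rewrite /q /dot !mulr_sumr -sumrB -big_split; apply: eq_bigr => i _ /=.
by rewrite !mxE; ring.
Qed.

Let q'E t : q' t = - 2 * dot w e + t * (2 * dot e e).
Proof. by rewrite /q' dotBl dotZl; ring. Qed.

Let dq t : is_derive t (1 : R) q (q' t).
Proof.
rewrite (funext qE) q'E.
have D0 := is_derive_id t (1 : R).
have D1 := is_derive_mul D0 D0.
have D := is_derive_add (is_derive_add (is_derive_cst (dot w w) t (1 : R))
  (is_derive_mulc1 (- 2 * dot w e) D0)) (is_derive_mulc1 (dot e e) D1).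
rewrite (_ : (fun u => _) = (fun u => dot w w + - 2 * dot w e * u + dot e e * (u * u))); last first.
  by apply/funext => u; ring.
by apply: (is_derive_conv D); ring.
Qed.

Let dq' t : is_derive t (1 : R) q' (2 * q2).
Proof.
rewrite (funext q'E).
have D := is_derive_add (is_derive_cst (- 2 * dot w e) t (1 : R)) (is_derive_mulc1 (2 * dot e e) (is_derive_id t (1 : R))).
rewrite (_ : (fun u => _) = (fun u => - 2 * dot w e + 2 * dot e e * u)); last by apply/funext => u; ring.
by apply: (is_derive_conv D); rewrite /q2; ring.
Qed.

Let q2_le t : 0 <= t <= 1 -> q2 <= 8^-1 ^+ 2 * q t.
Proof.
move=> tI; rewrite q_enorm -exprMn /q2 -enorm_sqr.
by rewrite lerXn2r ?nnegrE ?mulr_ge0 ?invr_ge0 ?enorm_ge0 ?e_le.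
Qed.

Let q'_le t : 0 <= t <= 1 -> `|q' t| <= 2 * 8^-1 * q t.
Proof.
move=> tI; have h := q2_le tI; rewrite /q' normrM normrN normr_nat.
have A : 2 * `|dot (w - t *: e) e| <= 8^-1 * q t + 8 * q2.
  have k (a b : R) : 2 * `|a * b| <= 8^-1 * (a * a) + 8 * (b * b).
    rewrite -subr_ge0 (_ : _ - _ = 8^-1 * (`|a| - 8 * `|b|) ^+ 2).
      by rewrite mulr_ge0 ?invr_ge0 ?sqr_ge0.
    rewrite normrM -(ger0_norm (_ : 0 <= a * a)) -?expr2 ?sqr_ge0//.
    by rewrite -(ger0_norm (_ : 0 <= b ^+ 2)) ?sqr_ge0// !normrX; field.
  apply: le_trans (ler_wpM2l (ler0n R 2) (ler_norm_sum _ _ _)) _.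
  rewrite /q /q2 /dot !mulr_sumr -big_split; apply: ler_sum => i _; exact: k.
apply: (le_trans A); move: h; rewrite expr2.
by move: (q t) q2 => a b; lra.
Qed.

Let p_pos t : 0 <= t <= 1 -> 0 < p t.
Proof. by move=> /enorm_pos; rewrite invr_gt0. Qed.

Let p_le t : 0 <= t <= 1 -> p t <= del^-1.
Proof. by move=> tI; rewrite lef_pV2 ?posrE ?enorm_pos ?del_le. Qed.

Let dp t : 0 <= t <= 1 -> is_derive t (1 : R) p (- 2^-1 * q' t / q t * p t).
Proof.
move=> tI; have qt := q_pos tI; have et := enorm_pos tI.
have D1 := is_derive_comp1 (dq t) (is_derive1_sqrt qt).
have rn0 : Num.sqrt (q t) != 0 by rewrite gt_eqF.
have D2 := is_derive_inv (f := fun u => Num.sqrt (q u)) rn0 D1.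
apply: (is_derive_conv D2); rewrite /p /rinv -/(enorm (w - t *: e)) q_enorm.
by field; rewrite gt_eqF.
Qed.

Let dpX n t : 0 <= t <= 1 ->
  is_derive t (1 : R) (fun t => p t ^+ n) (- (n%:R / 2) * q' t / q t * p t ^+ n).
Proof.
move=> tI; elim: n => [|n IH].
  rewrite (_ : (fun t => _) = cst 1); last by apply/funext => u; rewrite expr0.
  by apply: (is_derive_conv (is_derive_cst (1 : R) t (1 : R))); rewrite !mul0r oppr0 !mul0r.
rewrite (_ : (fun t => _) = (fun t => p t * p t ^+ n)); last by apply/funext => u; rewrite exprS.
apply: (is_derive_conv (is_derive_mul (dp tI) IH)).
by rewrite exprS -natr1; field; rewrite gt_eqF ?q_pos.
Qed.

Definition pole_bound : R := kap * (del^-1 + 2 * del^-1 ^+ m.-1 + 1).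

(** With q(t) = |w - t e|^2, dimension 3 has the power q^(-1/2); dimension 2 has a logarithm whose
    derivative is a multiple of q' q^(-1). The factor 1/8 in [e_le] is s in [pcoef_bound], hence the
    decay 2^-n. Order 0 is left out because [del] does not bound the logarithm. *)
Lemma G0_family : exists2 F : nat -> R -> R, taylor_family F &
  (forall t, F 0%N t = G0 (w - t *: e)) /\
  forall n t, 0 <= t <= 1 -> `|F n.+1 t| <= pole_bound * 2^-1 ^+ n.+1.
Proof.
have k0 := @dG0_const_gt0 R m.
have s0 : 0 <= 8^-1 :> R by rewrite invr_ge0.
have bE : 4 * 8^-1 = 2^-1 :> R by field.
have dV : 0 <= del^-1 by rewrite invr_ge0 ltW.
have dVm : 0 <= del^-1 ^+ m.-1 by rewrite exprn_ge0.
case: m23 => m2.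
- have df : forall t : R, 0 <= t <= 1 -> is_derive t (1 : R) (fun t => p t ^+ 2) (- 1 * q' t / q t * p t ^+ 2).
    by move=> t tI; apply: (is_derive_conv (dpX 2 tI)); rewrite divff.
  have Tb := taylor_pcoef q_pos (fun t _ => dq t) (fun t _ => dq' t) df.
  pose b := pcoef q q' q2 1 (fun t => p t ^+ 2).
  pose c := linmul q' (2 * q2) b.
  have Tc : taylor_family c by apply: taylor_linmul => // t _; exact: dq'.
  exists (primitive (fun t => kap * ln (p t)) (- (kap / 2)) c).
    apply: taylor_primitive => // t tI.
    apply: (is_derive_conv (is_derive_mulc1 kap (is_derive_comp1 (dp tI) (is_derive1_ln (p_pos tI))))).
    rewrite /c /linmul mulr0 addr0 /b /pcoef /=.
    have -> : p t ^+ 2 = (q t)^-1 by rewrite q_enorm /p /rinv exprVn.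
    by field; rewrite !gt_eqF ?q_pos ?p_pos.
  split=> [t|n t tI]; first by rewrite /= /G0 /dG0_const (introT eqP m2).
  have pb k : `|b k t| <= (q t)^-1 * 2^-1 ^+ k.
    have a1 : 1 <= 3 / 2 :> R by lra.
    have := pcoef_bound (fun t => p t ^+ 2) q_pos ler01 a1 s0 (dot_ge0 e) q'_le q2_le k tI.
    rewrite bE => /le_trans; apply.
    rewrite ger0_norm ?exprn_ge0 ?(ltW (p_pos tI))//.
    have -> : p t ^+ 2 = (q t)^-1 by rewrite q_enorm /p /rinv exprVn.
    exact: lexx.
  have qt := q_pos tI.
  have cb : `|c n t| <= 2^-1 ^+ n.+1.
    apply: (le_trans (ler_normD _ _)).
    have h1 : `|q' t * b n t| <= 4^-1 * 2^-1 ^+ n.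
      rewrite normrM; apply: (le_trans (ler_pM _ _ (q'_le tI) (pb n))) => //.
      rewrite (_ : _ * q t * _ = 4^-1 * 2^-1 ^+ n); first exact: lexx.
      by move: (2^-1 ^+ n) => u; field; rewrite gt_eqF.
    have h2 : `|2 * q2 * (if n is n'.+1 then b n' t else 0)| <= 4^-1 * 2^-1 ^+ n.
      case: n {h1} => [|n]; first by rewrite mulr0 normr0 mulr_ge0 ?invr_ge0.
      rewrite !normrM normr_nat (ger0_norm (dot_ge0 e)) -mulrA.
      have := ler_pM (dot_ge0 e) (normr_ge0 _) (q2_le tI) (pb n).
      rewrite (_ : _ * q t * _ = 8^-1 ^+ 2 * 2^-1 ^+ n); last by move: (2^-1 ^+ n) => u; field; rewrite gt_eqF.
      have : 0 <= 2^-1 ^+ n :> R by rewrite exprn_ge0// invr_ge0.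
      by rewrite (exprS _ n) (expr2 8^-1); move: (2^-1 ^+ n) (dot e e * _) => u x; lra.
    move: h1 h2; rewrite (exprS _ n); move: (2^-1 ^+ n) `|_| `|_| => u x y; lra.
  rewrite /primitive !normrM normrN normrM normfV normr_nat normfV normr_nat (gtr0_norm k0).
  have B1 : kap <= pole_bound by rewrite /pole_bound ler_peMr ?(ltW k0)// lerDr addr_ge0// mulr_ge0.
  apply: (@le_trans _ _ (kap * 2^-1 ^+ n.+1)); last first.
    by rewrite ler_wpM2r// exprn_ge0// invr_ge0.
  rewrite -!mulrA ler_wpM2l ?(ltW k0)//.
  rewrite mulrCA -[leRHS]mulr1 ler_pM ?divr_ge0//.
  by rewrite -invfM invf_le1 ?mulr_gt0 ?ltr0n// -natrM ler1n.
- have df : forall t : R, 0 <= t <= 1 -> is_derive t (1 : R) (fun t => p t ^+ 1) (- 2^-1 * q' t / q t * p t ^+ 1).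
    by move=> t tI; apply: (is_derive_conv (dpX 1 tI)); rewrite div1r.
  have Tb := taylor_pcoef q_pos (fun t _ => dq t) (fun t _ => dq' t) df.
  pose b := pcoef q q' q2 2^-1 (fun t => p t ^+ 1).
  exists (fun n t => kap * b n t); first exact: taylor_scale.
  split=> [t|n t tI].
    by rewrite /b /pcoef /= expr1 /G0 /dG0_const (_ : (m == 2%N) = false) ?invfM// m2.
  have a0 : 0 <= 2^-1 :> R by rewrite invr_ge0.
  have a1 : 2^-1 <= 3 / 2 :> R by lra.
  have := pcoef_bound (fun t => p t ^+ 1) q_pos a0 a1 s0 (dot_ge0 e) q'_le q2_le n.+1 tI.
  rewrite bE => H; rewrite normrM (gtr0_norm k0) /pole_bound -!mulrA ler_wpM2l ?(ltW k0)//.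
  apply: (le_trans H).
  rewrite ler_wpM2r ?exprn_ge0 ?invr_ge0// ger0_norm ?expr1 ?(ltW (p_pos tI))//.
  by rewrite (le_trans (p_le tI))// -addrA lerDl addr_ge0// mulr_ge0.
Qed.

(** A coordinate of the gradient is an affine function of t times q^(-m/2). *)
Lemma dG0_family i : exists2 F : nat -> R -> R, taylor_family F &
  (forall t, F 0%N t = dG0 (w - t *: e) ord0 i) /\
  forall n t, 0 <= t <= 1 -> `|F n.+1 t| <= pole_bound * 2^-1 ^+ n.+1.
Proof.
have k0 := @dG0_const_gt0 R m.
have s0 : 0 <= 8^-1 :> R by rewrite invr_ge0.
have bE : 4 * 8^-1 = 2^-1 :> R by field.
have dV : 0 <= del^-1 by rewrite invr_ge0 ltW.
have dVm : 0 <= del^-1 ^+ m.-1 by rewrite exprn_ge0.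
have al0 : 0 <= m%:R / 2 :> R by rewrite divr_ge0.
have al3 : m%:R / 2 <= 3 / 2 :> R.
  by rewrite ler_pM2r ?invr_gt0// ler_nat; case: m23 => ->.
have m0 : (0 < m)%N by case: m23 => ->.
have Tb := taylor_pcoef q_pos (fun t _ => dq t) (fun t _ => dq' t) (dpX m).
pose b := pcoef q q' q2 (m%:R / 2) (fun t => p t ^+ m).
pose l t := w ord0 i - t * e ord0 i.
have dl t : 0 <= t <= 1 -> is_derive t (1 : R) l (- e ord0 i).
  move=> tI; have D := is_derive_add (is_derive_cst (w ord0 i) t (1 : R)) (is_derive_mulc1 (- e ord0 i) (is_derive_id t (1 : R))).
  rewrite (_ : l = (fun u => w ord0 i + - e ord0 i * u)); last by apply/funext => u; rewrite /l; ring.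
  by apply: (is_derive_conv D); rewrite add0r mulr1.
exists (fun n t => - kap * linmul l (- e ord0 i) b n t).
  by apply: taylor_scale; apply: taylor_linmul.
split=> [t|n t tI].
  rewrite /linmul mulr0 addr0 /b /pcoef /= !mxE /l /p; ring.
have pt := p_pos tI; have et := enorm_pos tI.
have pb k : `|b k t| <= p t ^+ m * 2^-1 ^+ k.
  have := pcoef_bound (fun t => p t ^+ m) q_pos al0 al3 s0 (dot_ge0 e) q'_le q2_le k tI.
  rewrite bE => /le_trans; apply.
  by rewrite ger0_norm ?exprn_ge0 ?(ltW pt).
have lb : `|l t| <= (p t)^-1.
  rewrite /p invrK (le_trans _ (norm_le_enorm _))//.
  by have := norm_coord (w - t *: e) i; rewrite !mxE.
have eb : `|- e ord0 i| <= 8^-1 * (p t)^-1.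
  rewrite normrN (le_trans (norm_coord e i))// (le_trans (norm_le_enorm e))//.
  by rewrite /p invrK e_le.
have pm : (p t)^-1 * p t ^+ m = p t ^+ m.-1.
  by rewrite -{1}(prednK m0) exprS mulKf// gt_eqF.
have pX0 : 0 <= p t ^+ m.-1 by rewrite exprn_ge0// ltW.
have h2n : 0 <= 2^-1 ^+ n :> R by rewrite exprn_ge0// invr_ge0.
have cb : `|linmul l (- e ord0 i) b n.+1 t| <= 2 * p t ^+ m.-1 * 2^-1 ^+ n.+1.
  apply: (le_trans (ler_normD _ _)); rewrite !normrM.
  have h1 := ler_pM (normr_ge0 _) (normr_ge0 _) lb (pb n.+1).
  have h2 := ler_pM (normr_ge0 _) (normr_ge0 _) eb (pb n).
  rewrite mulrA pm in h1; rewrite -mulrA [(p t)^-1 * _]mulrA pm in h2.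
  apply: (le_trans (lerD h1 h2)); rewrite exprS.
  have : 0 <= p t ^+ m.-1 * 2^-1 ^+ n by rewrite mulr_ge0.
  by move: (p t ^+ m.-1) (2^-1 ^+ n) => x y; lra.
rewrite normrM normrN (gtr0_norm k0) /pole_bound -mulrA ler_wpM2l ?(ltW k0)//.
apply: (le_trans cb); rewrite ler_wpM2r ?exprn_ge0 ?invr_ge0//.
have : p t ^+ m.-1 <= del^-1 ^+ m.-1 by rewrite lerXn2r ?nnegrE ?(ltW pt)// p_le.
by move: dV dVm; lra.
Qed.

End pole_family.

(** * Pushing poles along a needle *)

Section runge.
Context {R : realType} {m : nat}.
Implicit Types (U K E T : set 'rV[R]_m) (x y z c e : 'rV[R]_m) (u : 'rV[R]_m -> R)
  (F : 'rV[R]_m -> 'rV[R]_m) (s : seq (R * 'rV[R]_m)).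
Hypothesis m23 : m = 2%N \/ m = 3%N.

(** One list of sources serves for the function and for its gradient, since a needle sequence must
    approximate both at once. *)
Definition approximable K E u F := forall eps : R, 0 < eps ->
  exists s, (forall p, p \in s -> E p.2) /\
    forall y, K y -> `|u y - combo s y| <= eps /\ `|F y - dcombo s y| <= eps.

Lemma approximable_pole K E z : E z ->
  approximable K E (fun y => G0 (y - z)) (fun y => dG0 (y - z)).
Proof.
move=> Ez eps e0; exists [:: (1, z)]; split=> [p|y Ky].
  by rewrite inE => /eqP ->.
by rewrite /combo /dcombo !big_seq1 mul1r scale1r !subrr !normr0 ltW.
Qed.

Lemma approximable_lin K E u F u' F' (a b : R) : approximable K E u F -> approximable K E u' F' ->
  approximable K E (fun y => a * u y + b * u' y) (fun y => a *: F y + b *: F' y).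
Proof.
move=> H H' eps e0; pose M := `|a| + `|b| + 1.
have M0 : 0 < M by rewrite ltr_wpDl// addr_ge0.
have [s [Es Hs]] := H _ (divr_gt0 e0 M0); have [s' [Es' Hs']] := H' _ (divr_gt0 e0 M0).
exists ([seq (a * p.1, p.2) | p <- s] ++ [seq (b * p.1, p.2) | p <- s']); split=> [p|y Ky].
  by rewrite mem_cat => /orP[] /mapP[q qs ->] /=; [exact: Es|exact: Es'].
have sum_le (V : normedModType R) (f g f' g' : V) : `|f - g| <= eps / M -> `|f' - g'| <= eps / M ->
    `|a *: f + b *: f' - (a *: g + b *: g')| <= eps.
  move=> h h'; rewrite opprD addrACA -!scalerBr (le_trans (ler_normD _ _))// !normrZ.
  apply: (@le_trans _ _ ((`|a| + `|b|) * (eps / M))).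
    by rewrite mulrDl lerD// ler_wpM2l.
  by rewrite mulrA ler_pdivrMr// mulrC ler_pM2l// lerDl.
have [h1 h2] := Hs y Ky; have [h1' h2'] := Hs' y Ky.
have -> : combo ([seq (a * p.1, p.2) | p <- s] ++ [seq (b * p.1, p.2) | p <- s']) y =
    a * combo s y + b * combo s' y.
  rewrite /combo big_cat !big_map /= !mulr_sumr.
  by congr (_ + _); apply: eq_bigr => p _; rewrite mulrA.
have -> : dcombo ([seq (a * p.1, p.2) | p <- s] ++ [seq (b * p.1, p.2) | p <- s']) y =
    a *: dcombo s y + b *: dcombo s' y.
  rewrite /dcombo big_cat !big_map /= !scaler_sumr.
  by congr (_ + _); apply: eq_bigr => p _; rewrite scalerA.
by split; [exact: (sum_le R^o)|exact: sum_le].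
Qed.

Lemma approximable0 K E : approximable K E (fun=> 0) (fun=> 0).
Proof.
move=> eps e0; exists [::]; split=> // y _.
by rewrite /combo /dcombo !big_nil !subr0 !normr0 ltW.
Qed.

Lemma approximable_ext K E u F u' F' : (forall y, u y = u' y) -> (forall y, F y = F' y) ->
  approximable K E u F -> approximable K E u' F'.
Proof. by move=> /funext -> /funext ->. Qed.

Lemma approximable_sum K E N (a : nat -> R) (u : nat -> 'rV[R]_m -> R) (F : nat -> 'rV[R]_m -> 'rV[R]_m) :
  (forall k, (k < N)%N -> approximable K E (u k) (F k)) ->
  approximable K E (fun y => \sum_(k < N) a k * u k y) (fun y => \sum_(k < N) a k *: F k y).
Proof.
elim: N => [|N IH] H.
  apply: (approximable_ext _ _ (@approximable0 K E)) => y; by rewrite big_ord0.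
have HN : approximable K E (u N) (F N) by exact: H.
have HI := IH (fun k kN => H k (ltnW kN : (k < N.+1)%N)).
by apply: (approximable_ext _ _ (approximable_lin 1 (a N) HI HN)) => y;
  rewrite big_ord_recr ?mul1r ?scale1r.
Qed.

Lemma approximable_dl K E N (u : nat -> 'rV[R]_m -> R) (F : nat -> 'rV[R]_m -> 'rV[R]_m) k j :
  (forall i, (i < N)%N -> approximable K E (u i) (F i)) -> (j + k < N)%N ->
  approximable K E (fun y => iter k (@dl R) (fun i => u i y) j)
    (fun y => iter k (@dl _) (fun i => F i y) j).
Proof.
move=> H; elim: k j => [|k IH] j jN; first by apply: H; rewrite addn0 in jN.
have H1 := IH j.+1 ltac:(by rewrite addSnnS).
have H0 := IH j ltac:(by rewrite addnS in jN; exact: ltnW).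
by apply: (approximable_ext _ _ (approximable_lin 1 (-1) H1 H0)) => y;
  rewrite iterS /dl ?mul1r ?scale1r ?mulN1r ?scaleN1r.
Qed.

Lemma approximable_limit K E u F :
  (forall eps : R, 0 < eps -> exists u', exists2 F', approximable K E u' F' &
     forall y, K y -> `|u y - u' y| <= eps /\ `|F y - F' y| <= eps) ->
  approximable K E u F.
Proof.
move=> H eps e0; have e2 : 0 < eps / 2 by rewrite divr_gt0.
have [u' [F' A HA]] := H _ e2; have [s [Es Hs]] := A _ e2.
exists s; split=> // y Ky; have [h1 h2] := HA y Ky; have [h1' h2'] := Hs y Ky.
by split; rewrite [eps]splitr; [rewrite -(subrKA (u' y))|rewrite -(subrKA (F' y))];
  rewrite (le_trans (ler_normD _ _))// lerD.
Qed.

Lemma iter_dl_coord (g : nat -> 'rV[R]_m) k j i :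
  (iter k (@dl _) g j) ord0 i = iter k (@dl R) (fun n => g n ord0 i) j.
Proof. by elim: k j => [|k IH] j //; rewrite !iterS /dl !mxE !IH. Qed.

(* Newton extrapolation along the segment from c to c + e: the poles used are
   c + (j/M) e with j < N, which lie within eps0 of c once M is large. *)
Lemma approximable_step K E c e (eps0 del : R) : 0 < eps0 -> 0 < del ->
  (forall y, K y -> forall t : R, 0 <= t <= 1 -> del <= enorm (y - c - t *: e)) ->
  (forall y, K y -> forall t : R, 0 <= t <= 1 -> enorm e <= 8^-1 * enorm (y - c - t *: e)) ->
  (forall z, `|z - c| < eps0 -> approximable K E (fun y => G0 (y - z)) (fun y => dG0 (y - z))) ->
  approximable K E (fun y => G0 (y - (c + e))) (fun y => dG0 (y - (c + e))).
Proof.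
move=> e00 d0 Hd He HA; apply: approximable_limit => eps eps_0.
set B := @pole_bound R m del.
(* The accuracy fixes the order [N]; the mesh [M] is chosen afterwards, to bring the first [N] nodes
   within [eps0] of [c]. *)
have [N0 HN0] : exists N0, `|B| * 2^-1 ^+ N0.+1 <= eps.
  exists (Num.truncn (`|B| / eps)); have B0 := normr_ge0 B.
  rewrite exprVn ler_pdivrMr ?exprn_gt0// mulrC -ler_pdivrMr//.
  apply: ltW; apply: (lt_trans (truncnS_gt _)).
  by rewrite -natrX ltr_nat ltn_expl.
pose N := N0.+1.
pose M := (Num.truncn (N%:R * `|e| / eps0)).+1.
have M0 : 0 < M%:R :> R by rewrite ltr0n.
have MN : N%:R * `|e| / M%:R < eps0.
  by rewrite ltr_pdivrMr// [eps0 * _]mulrC -ltr_pdivrMr//; exact: truncnS_gt.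
pose pole (j : nat) : 'rV[R]_m := c + (j%:R * M%:R^-1) *: e.
pose uu j (y : 'rV[R]_m) := G0 (y - pole j) : R; pose FF j (y : 'rV[R]_m) := dG0 (y - pole j).
exists (fun y => \sum_(k < N) 'C(M, k)%:R * iter k (@dl R) (fun i => uu i y) 0%N).
exists (fun y => \sum_(k < N) 'C(M, k)%:R *: iter k (@dl _) (fun i => FF i y) 0%N).
  apply: (approximable_sum (u := fun k y => iter k (@dl R) (fun i => uu i y) 0%N)
    (F := fun k y => iter k (@dl _) (fun i => FF i y) 0%N) (fun k => 'C(M, k)%:R)) => k kN.
  apply: (@approximable_dl K E N) => // i iN; apply: HA.
  rewrite /pole addrC addKr normrZ ger0_norm ?mulr_ge0 ?invr_ge0//.
  apply: le_lt_trans MN; rewrite mulrAC.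
  by rewrite ler_wpM2r ?invr_ge0// ler_wpM2r// ler_nat ltnW.
move=> y Ky; have B2 : 0 <= `|B| * 2^-1 ^+ N by rewrite mulr_ge0// exprn_ge0// invr_ge0.
have shift t : y - (c + t *: e) = y - c - t *: e by rewrite opprD addrA.
have bB (f : R) : f <= B * 2^-1 ^+ N -> f <= `|B| * 2^-1 ^+ N.
  by move=> /le_trans; apply; rewrite ler_wpM2r ?exprn_ge0 ?invr_ge0// ler_norm.
have t1 : 0 <= (1 : R) <= 1 by rewrite ler01 lexx.
split; apply: le_trans HN0.
- have [f Tf [f0 fb]] := G0_family m23 d0 (Hd y Ky) (He y Ky).
  have := newton_extrapolation Tf (isT : (0 < M)%N) B2 (fun v vI => bB _ (fb N0 v vI)).
  rewrite f0 -shift scale1r => H; apply: le_trans H; rewrite le_eqVlt; apply/orP; left; apply/eqP.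
  have -> : (fun j => f 0%N (j%:R * M%:R^-1)) = (fun j => uu j y).
    by apply/funext => j; rewrite f0 /uu /pole shift.
  by [].
- apply: norm_le_coord => // i.
  have sub_coord (a b : 'rV[R]_m) : (a - b) ord0 i = a ord0 i - b ord0 i by rewrite !mxE.
  rewrite sub_coord.
  have [f Tf [f0 fb]] := dG0_family m23 d0 (Hd y Ky) (He y Ky) i.
  have := newton_extrapolation Tf (isT : (0 < M)%N) B2 (fun v vI => bB _ (fb N0 v vI)).
  rewrite f0 -shift scale1r => H; apply: le_trans H; rewrite le_eqVlt; apply/orP; left; apply/eqP.
  have -> : (fun j => f 0%N (j%:R * M%:R^-1)) = (fun j => FF j y ord0 i).
    by apply/funext => j; rewrite f0 /FF /pole shift.
  rewrite summxE (eq_bigr (fun k : 'I_N => 'C(M, k)%:R * iter k (@dl R) (fun j => FF j y ord0 i) 0%N))//.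
  by move=> k _; rewrite mxE iter_dl_coord.
Qed.

Let step_arith (del a b f g h : R) : 0 < del -> del <= a -> a <= b + f -> f <= g -> g <= h ->
  h <= del / 16 -> del / 2 <= b.
Proof. by lra. Qed.

Let step_arith' (del a b d : R) : d <= del / 16 -> a <= d -> del / 2 <= b -> a <= 8^-1 * b.
Proof. by lra. Qed.

(** A whole neighbourhood of poles instead of [c] alone: extrapolation draws on poles near [c], so
    this is the property that propagates. *)
Definition approximable_near K E c := exists2 eps0 : R, 0 < eps0 &
  forall z, `|z - c| < eps0 -> approximable K E (fun y => G0 (y - z)) (fun y => dG0 (y - z)).

(** A sup-norm step below del / (16 m) has Euclidean length at most del / 16, while the moving pole
    stays at distance at least del / 2 from K: the ratio 1/8 required by the extrapolation. *)
Lemma approximable_near_step K E c c' (del : R) : 0 < del -> (forall y, K y -> del <= `|y - c|) ->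
  `|c' - c| < del / (16 * m%:R) -> approximable_near K E c -> approximable_near K E c'.
Proof.
move=> d0 Hd cc [eps0 e0 HA].
have m0 : 0 < m%:R :> R by rewrite ltr0n; case: m23 => ->.
have m1 : 1 <= m%:R :> R by rewrite ler1n; case: m23 => ->.
exists (del / (16 * m%:R) - `|c' - c|); first by rewrite subr_gt0.
move=> z zc; have ze : `|z - c| < del / (16 * m%:R).
  rewrite -(subrKA c') (le_lt_trans (ler_normD _ _))//.
  by move: zc; rewrite ltrBrDr.
have mz : m%:R * `|z - c| <= del / 16.
  move: (ltW ze); rewrite ler_pdivlMr ?mulr_gt0// => h.
  by rewrite ler_pdivlMr// mulrC mulrA [X in X <= _]mulrC; exact: h.
have zz : `|z - c| <= m%:R * `|z - c| by rewrite ler_peMl.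
have lb y : K y -> forall t : R, 0 <= t <= 1 -> del / 2 <= enorm (y - c - t *: (z - c)).
  move=> Ky t /andP[t0 t1]; apply: le_trans (norm_le_enorm _).
  have h1 := ler_normB (y - c - t *: (z - c)) (- (t *: (z - c))).
  rewrite opprK subrK normrN normrZ (ger0_norm t0) in h1.
  have h2 : t * `|z - c| <= `|z - c| by rewrite ler_piMl.
  exact: step_arith d0 (Hd y Ky) h1 h2 zz mz.
have H := approximable_step (K := K) (E := E) (c := c) (e := z - c) e0 (divr_gt0 d0 (ltr0Sn _ 1)) lb.
rewrite (_ : c + (z - c) = z) in H; last by rewrite addrC subrK.
apply: H => // y Ky t tI.
exact: step_arith' mz (enorm_le_norm (z - c)) (lb y Ky t tI).
Qed.

(** Connectedness of the interval replaces the choice of a finite chain of poles along the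
    needle. *)
Lemma locally_constant_01 (P : R -> Prop) :
  (forall t, 0 <= t <= 1 -> exists2 r : R, 0 < r & forall v, 0 <= v <= 1 -> `|v - t| < r -> (P t <-> P v)) ->
  P 0 -> P 1.
Proof.
move=> H P0; pose A : set R := `[0, 1]%classic.
have AP t : A t <-> 0 <= t <= 1 by rewrite /A /= in_itv.
have ball_near (t : R) (r : R) : 0 < r -> nbhs t [set v | `|v - t| < r].
  move=> r0; apply/nbhs_ballP; exists r => // v; rewrite -ball_normE /= distrC; exact.
have cA : connected A by exact: segment_connected.
suff E : A `&` [set t | P t] = A.
  have : A 1 by apply/AP; rewrite ler01 lexx.
  by rewrite -E => -[].
apply: cA.
- by exists 0; split=> //; apply/AP; rewrite lexx ler01.
- exists (interior [set t | A t -> P t]); first exact: open_interior.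
  apply/seteqP; split=> t [At]; last by move=> /interior_subset /(_ At).
  move=> /= Pt; split=> //; have [r r0 Hr] := H t ((AP t).1 At).
  by apply: filterS (ball_near t r r0) => v /= vt /AP Av; exact/(Hr v Av vt).
- exists (closure (A `&` [set t | P t])); first exact: closed_closure.
  apply/seteqP; split=> t [At]; first by move=> Pt; split=> //; exact: subset_closure.
  move=> cl; split=> //=; have [r r0 Hr] := H t ((AP t).1 At).
  by have [v [[Av Pv] /= vt]] := cl _ (ball_near t r r0); apply/(Hr v ((AP v).1 Av) vt).
Qed.

Lemma within_continuous_ball (a b : R) (sigma : R -> 'rV[R]_m) t (eps : R) :
  {within `[a, b], continuous sigma} -> a <= t <= b -> 0 < eps ->
  exists2 r : R, 0 < r & forall v, a <= v <= b -> `|v - t| < r -> `|sigma v - sigma t| < eps.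
Proof.
move=> cs tI e0; have At : `[a, b]%classic t by rewrite /= in_itv.
have /subspace_continuousP/(_ t At) := cs.
move=> /(_ [set z | `|z - sigma t| < eps]) H.
have N : nbhs (sigma t) [set z | `|z - sigma t| < eps].
  by apply/nbhs_ballP; exists eps => // z; rewrite -ball_normE /= distrC.
have /nbhs_ballP[r /= r0 Hr] := H N; exists r => // v vI vt.
by apply: (Hr v) => /=; [rewrite -ball_normE /= distrC|rewrite in_itv].
Qed.

(** K has a positive distance from the needle, so one step length [eta] works along all of it. The
    property is then locally constant along the needle, and it holds at [sigma 0] because the outer
    cone provides poles off closure U within one step of it. *)
Lemma runge_needle U K x sigma : Lipschitz_boundary U -> needle U x sigma -> compact K ->
  K `<=` U `\` (sigma @` `[0, 1]) ->
  approximable K (~` closure U) (fun y => G0 (y - x)) (fun y => dG0 (y - x)).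
Proof.
move=> LU nd cK KU; have [_ _ _ [bp s1] _] := nd.
have cT := needle_compact nd (lexx 0) (lexx 1).
have oT : open (~` (sigma @` `[0, 1])).
  by apply: closed_openC; apply: compact_closed => //; exact: norm_hausdorff.
have [n Hn] := inner_cover oT cK (fun y Ky => (KU y Ky).2).
(* Half of the separation is held back for the starting pole [z0], which lies off the needle. *)
pose del : R := n.+1%:R^-1 / 2.
have d0 : 0 < del by rewrite divr_gt0// invr_gt0 ltr0n.
have dT y t : K y -> 0 <= t <= 1 -> 2 * del <= `|y - sigma t|.
  move=> Ky tI; rewrite /del mulrC divfK//; have [_] := Hn y Ky; apply.
  by apply; exists t => //=; rewrite in_itv.
have m0 : 0 < m%:R :> R by rewrite ltr0n; case: m23 => ->.
pose eta := del / (16 * m%:R); have eta0 : 0 < eta by rewrite divr_gt0// mulr_gt0.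
have eta_le : eta <= del.
  have m1 : 1 <= m%:R :> R by rewrite ler1n; case: m23 => ->.
  rewrite ler_pdivrMr ?mulr_gt0// ler_peMr ?(ltW d0)//; move: m1; move: (m%:R : R) => u; lra.
suff : approximable_near K (~` closure U) (sigma 1).
  by rewrite s1 => -[eps0 e0]; apply; rewrite subrr normr0.
apply: (locally_constant_01 (P := fun t => approximable_near K (~` closure U) (sigma t))).
  move=> t tI; have [[cs _] _ _ _ _] := nd.
  have [r r0 Hr] := within_continuous_ball cs tI eta0.
  exists r => // v vI vt; have h := Hr v vI vt.
  have dt y : K y -> del <= `|y - sigma t| by move=> Ky; apply: le_trans (dT y t Ky tI); lra.
  have dv y : K y -> del <= `|y - sigma v| by move=> Ky; apply: le_trans (dT y v Ky vI); lra.
  by split; [exact: approximable_near_step d0 dt h|apply: approximable_near_step d0 dv _; rewrite distrC].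
have [e [k [s0 [k0 s00 He]]]] := lipschitz_cone LU bp.
pose s := Num.min s0 (eta / (2 * (`|e| + 1))).
have e1 : 0 < `|e| + 1 by rewrite ltr_wpDl.
have s_0 : 0 < s by rewrite lt_min s00 divr_gt0// mulr_gt0.
have se : s * `|e| < eta.
  apply: (@le_lt_trans _ _ (eta / (2 * (`|e| + 1)) * (`|e| + 1))).
    by rewrite ler_pM ?(ltW s_0)// ?ge_min ?lexx ?orbT// lerDl.
  rewrite invfM mulrA divfK ?gt_eqF//; move: eta0; lra.
pose z0 := sigma 0 - s *: e.
have Nz0 : ~ closure U z0.
  have ss : s <= s0 by rewrite ge_min lexx.
  have ee : `|e - e| <= k by rewrite subrr normr0 ltW.
  by case: (He s e s_0 ss ee).
have z0d : `|sigma 0 - z0| < eta by rewrite /z0 opprB addrC subrK normrZ gtr0_norm.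
apply: (approximable_near_step d0 _ z0d).
  move=> y Ky; have := dT y 0 Ky _; rewrite lexx ler01 => /(_ isT) h.
  have : `|y - sigma 0| <= `|y - z0| + `|sigma 0 - z0|.
    by rewrite -(subrKA z0) (le_trans (ler_normD _ _))// [`|z0 - _|]distrC.
  by move: h z0d eta_le; move: `|_| `|_| `|_| => a b d; lra.
have oC : open (~` closure U) by apply: closed_openC; exact: closed_closure.
have [r r0 Hr] := open_cube oC Nz0.
by exists r => // z /ltW/Hr; exact: approximable_pole.
Qed.

(** The n-th member has accuracy 1/(n+1) on the n-th set of a compact exhaustion of U minus the
    needle. Every admissible compact set lies in one of these sets, where uniform bounds give L^2
    convergence. *)
Lemma needle_sequence_exists U x sigma : open U -> bounded_set U -> Lipschitz_boundary U ->
  needle U x sigma -> exists v, needle_sequence U x sigma v.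
Proof.
move=> oU bU LU nd; have cT := needle_compact nd (lexx 0) (lexx 1).
have mU := open_measurable_rV oU.
have oW : open (U `\` (sigma @` `[0, 1])).
  by apply: openI => //; apply: closed_openC; apply: compact_closed => //; exact: norm_hausdorff.
have [_ _ _ [_ s1] _] := nd.
have Tx : (sigma @` `[0, 1]) x by exists 1 => //=; rewrite in_itv /= lexx ler01.
pose KK n := inner (U `\` (sigma @` `[0, 1])) n.
have H n := runge_needle LU nd (@compact_inner _ _ (U `\` (sigma @` `[0, 1])) n) (@inner_sub _ _ _ n)
  (divr_gt0 ltr01 (ltr0Sn R n)).
have /choice[s Hs] := H.
have Ws n := combo_weak_solution m23 oU bU (fun p ps => (Hs n).1 p ps).
exists (fun n => combo (s n)); split=> [n|K cK KU]; first by case: (Ws n).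
have mK := compact_measurable_rV cK.
have Kx : ~ K x by move=> /KU[].
have KsU : K `<=` U by move=> y /KU[].
have yx y : K y -> y - x != 0 by move=> Ky; apply/eqP => /subr0_eq yx; apply: Kx; rewrite -yx.
have [n0 Hn0] := inner_cover oW cK KU.
have Lu n : L2 leb K (fun y => combo (s n) y - G0 (y - x)).
  apply: (L2B mK); last exact: G0_L2.
  have h := H1_L2 mU (Ws n).2.1; exact: L2_sub h.
have LG := dG0_L2v cK Kx.
have Lg n : L2v K (fun y => nabla U (combo (s n)) y - grad G0 (y - x)).
  have L : L2v K (fun y => nabla U (combo (s n)) y - dG0 (y - x)).
    apply: L2vB => //; exact: L2v_sub (nabla_L2v mU (Ws n).2.1).
  by apply: (L2v_ext mK _ L) => y /yx y0; rewrite grad_G0.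
apply/(H1norm_cvg0 mK Lu Lg).
have Koo := compact_leb_fin cK.
pose V := fine (leb K).
have small (f : 'rV[R]_m -> R) (C : R) : 0 <= C -> leb.-integrable K (EFin \o f) ->
    {ae leb, forall y, K y -> f y <= C} -> \int[leb]_(y in K) f y <= C * V.
  move=> C0 fi fC; rewrite /V -Rintegral_cst//; apply: ae_le_Rintegral => //.
  exact: (bounded_compact_integrable (M := `|C|) cK (measurable_cst _) (fun _ _ => lexx _)).
have hn n y : (n0 <= n)%N -> K y -> `|combo (s n) y - G0 (y - x)| <= n.+1%:R^-1 /\
    `|dcombo (s n) y - dG0 (y - x)| <= n.+1%:R^-1.
  move=> nn Ky; have := (Hs n).2 y (inner_le nn (Hn0 y Ky)).
  by rewrite div1r ![`|_ - combo _ _|]distrC ![`|_ - dcombo _ _|]distrC.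
have V0 : 0 <= V by exact: fine_ge0.
have n1 n : n.+1%:R^-1 ^+ 2 <= n.+1%:R^-1 :> R.
  by rewrite expr2 ger_pMr ?invr_gt0 ?ltr0n// invf_le1 ?ltr0n// ler1n.
have C0 (C : R) : n.+1%:R^-1 * C @[n --> \oo] --> 0.
  rewrite (_ : (fun n => _) = (fun n => C * harmonic n)); first exact: cvg0Z (@cvg_harmonic R).
  by apply/funext => n; rewrite mulrC.
split.
- have C0V := C0 V.
  apply: (squeeze_cvgr _ (cvg_cst 0) C0V).
  exists n0 => // n /= nn; apply/andP; split.
    by apply: Rintegral_ge0 => // y _; exact: sqr_ge0.
  apply: small => //; first exact: (Lu n).2.
  apply: aeW => y Ky; apply: le_trans (n1 n).
  have [h _] := hn n y nn Ky; rewrite -(ger0_norm (sqr_ge0 _)) normrX.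
  by rewrite lerXn2r ?nnegrE ?invr_ge0.
- have C0' := C0 (m%:R * V).
  apply: (squeeze_cvgr _ (cvg_cst 0) C0').
  exists n0 => // n /= nn; apply/andP; split; first exact: wip1_ge0.
  rewrite mulrA; apply: small => //; first exact: (wip_integrable mK (weight1 _) (Lg n) (Lg n)).
  have := nabla_ae oU (Ws n).2.1 (Ws n).1; apply: filterS => y Hy Ky.
  rewrite Hy ?grad_G0 ?mul1r ?yx//; last exact: KsU.
  have [_ h] := hn n y nn Ky.
  apply: le_trans (ler_norm _) _; apply: le_trans (dot_le _ _) _.
  rewrite mulrC ler_wpM2r//; apply: le_trans (n1 n).
  by rewrite expr2 ler_pM.
Qed.

End runge.

(** * Existence of needles *)

Section polygonal_paths.
Context {R : realType} {m : nat}.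
Implicit Types (sigma : R -> 'rV[R]_m) (a b c t : R) (s : seq R).

(** A recursive form of [piecewise_linear] with arbitrary end points, suited to cutting and
    appending; paths are rescaled to [0, 1] only at the end. *)
Fixpoint polygonal sigma a s : Prop :=
  match s with
  | [::] => True
  | c :: s' => [/\ a < c, exists p d : 'rV[R]_m, forall t, a <= t <= c -> sigma t = p + t *: d
      & polygonal sigma c s']
  end.

Lemma polygonal_path sigma a s : polygonal sigma a s -> path <%R a s.
Proof. by elim: s a => [|c s IH] a //= [-> _ /IH]. Qed.

Lemma polygonal_eq sigma sigma' a s : polygonal sigma a s ->
  (forall t, a <= t <= last a s -> sigma t = sigma' t) -> polygonal sigma' a s.
Proof.
elim: s a => [|c s IH] a //= [ac [p [d Hpd]] Hs] E; split=> //.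
  exists p, d => t /andP[t1 t2]; rewrite -E ?Hpd ?t1//=.
  by rewrite (le_trans t2)//; exact: path_last_ge (polygonal_path Hs).
by apply: IH => // t /andP[t1 t2]; apply: E; rewrite t2 (le_trans (ltW ac) t1).
Qed.

Lemma polygonal_rcons sigma a s b (p d : 'rV[R]_m) : polygonal sigma a s -> last a s < b ->
  (forall t, last a s <= t <= b -> sigma t = p + t *: d) -> polygonal sigma a (rcons s b).
Proof.
elim: s a => [|c s IH] a //=; first by move=> _ ab H; split=> //; exists p, d.
by move=> [ac Hc Hs] lb H; split=> //; exact: IH.
Qed.

Lemma polygonal_trunc sigma a s b : polygonal sigma a s -> a < b -> b <= last a s ->
  exists s', polygonal sigma a s' /\ last a s' = b.
Proof.
elim: s a => [|c s IH] a /=; first by move=> _ ab /(lt_le_trans ab); rewrite ltxx.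
move=> [ac [p [d Hpd]] Hs] ab bl; have [bc|cb] := leP b c.
  exists [:: b]; split=> //=; split=> //; exists p, d => t /andP[t1 t2].
  by apply: Hpd; rewrite t1 (le_trans t2).
have [s' [Hs' ls']] := IH c Hs cb bl.
by exists (c :: s'); split=> //=; split=> //; exists p, d.
Qed.

Lemma polygonal_scale sigma a s c : 0 < c -> polygonal sigma a s ->
  polygonal (fun t => sigma (t * c)) (a / c) [seq t / c | t <- s].
Proof.
move=> c0; elim: s a => [|b s IH] a //= [ab [p [d Hpd]] Hs]; split; last exact: IH.
  by rewrite ltr_pM2r// invr_gt0.
exists p, (c *: d) => t; rewrite ler_pdivrMr// ler_pdivlMr// => tI.
by rewrite (Hpd _ tI) scalerA.
Qed.

Lemma polygonal_continuous sigma a s : polygonal sigma a s ->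
  {within `[a, last a s], continuous sigma}.
Proof.
elim: s a => [|c s IH] a /=.
  move=> _; rewrite set_itv1; exact: continuous_subspace1.
move=> [ac [p [d Hpd]] Hs]; have cl := path_last_ge (polygonal_path Hs).
have -> : `[a, last c s]%classic = `[a, c]%classic `|` `[c, last c s]%classic.
  apply/seteqP; split=> t /=; rewrite !in_itv /=.
    by move=> /andP[h1 h2]; case: (leP t c) => h; [left|right]; rewrite ?h1 ?h ?h2 ?(ltW h).
  by move=> [/andP[h1 h2]|/andP[h1 h2]]; [rewrite h1 (le_trans h2)|rewrite h2 (le_trans (ltW ac))].
apply: withinU_continuous; [exact: itv_closed|exact: itv_closed| |exact: IH].
apply: (@subspace_eq_continuous _ _ _ (fun t => p + t *: d)).
  by move=> t; rewrite inE /= in_itv /= => tI; rewrite /from_subspace Hpd.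
apply: continuous_subspaceT => t.
apply: (@continuousD _ _ _ (cst p) (fun t : R => t *: d)); first exact: cst_continuous.
exact: scalel_continuous.
Qed.

Lemma polygonal_nth sigma a s i : polygonal sigma a s -> (i < size s)%N ->
  exists p d : 'rV[R]_m, {in `[nth 0 (a :: s) i, nth 0 (a :: s) i.+1], forall t, sigma t = p + t *: d}.
Proof.
elim: s a i => [|c s IH] a [|i] //= [ac [p [d Hpd]] Hs]; last exact: IH.
by move=> _; exists p, d => t; rewrite in_itv; exact: Hpd.
Qed.

End polygonal_paths.

Section needle_existence.
Context {R : realType} {m : nat}.
Implicit Types (sigma : R -> 'rV[R]_m) (s : seq R) (p x y z : 'rV[R]_m) (U D G : set 'rV[R]_m).

(** The path lies in G except at its start [p], which will be a boundary point of the domain. *)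
Definition reachable G p z := exists sigma s, [/\ polygonal sigma 0 s, 0 < last 0 s,
  sigma 0 = p /\ sigma (last 0 s) = z, forall t, 0 < t <= last 0 s -> G (sigma t) &
  forall t u, 0 <= t <= last 0 s -> 0 <= u <= last 0 s -> sigma t = sigma u -> t = u].

Let on_segment (tau mu : R) : 0 <= tau <= 1 -> 0 <= mu <= 1 -> 0 <= tau + mu * (1 - tau) <= 1.
Proof. by move=> /andP[a b] /andP[c d]; apply/andP; split; nra. Qed.

(* Follow the path up to its first meeting point with the segment [z, z'], then the segment. *)
Lemma reachable_segment G p z z' : ~ G p -> reachable G p z ->
  (forall tau : R, 0 <= tau <= 1 -> G (z + tau *: (z' - z))) -> reachable G p z'.
Proof.
move=> Gp [sigma [s [Ps L0 [s0 s1] sG inj]]] HG; set L := last 0 s in L0 s1 sG inj.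
have cs := polygonal_continuous Ps; rewrite -/L in cs.
pose Seg := [set z + tau *: (z' - z) | tau in `[0, 1]%classic].
have SegP y : Seg y <-> exists2 tau : R, 0 <= tau <= 1 & y = z + tau *: (z' - z).
  split; first by move=> [tau /= tI <-]; exists tau => //; move: tI; rewrite in_itv.
  by move=> [tau tI ->]; exists tau => //=; rewrite in_itv.
have oS : open (~` Seg).
  by apply: closed_openC; apply: compact_closed; [exact: norm_hausdorff|exact: compact_segment].
pose T := [set t | 0 <= t <= L /\ Seg (sigma t)].
have TL : T L.
  split; first by rewrite lexx ltW.
  by apply/SegP; exists 0; rewrite ?lexx ?ler01// scale0r addr0.
have infT : has_inf T by split; [exists L|exists 0 => t [/andP[]]].
pose ts := inf T.
have tsT t : T t -> ts <= t by apply: ge_inf; exact: infT.2.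
have ts0 : 0 <= ts by apply: lb_le_inf; [exists L|move=> t [/andP[]]].
have tsL : ts <= L by exact: tsT.
have tsI : 0 <= ts <= L by rewrite ts0 tsL.
have Tts : Seg (sigma ts).
  apply: contrapT => NS; have [r r0 Hr] := open_cube oS NS.
  have [r' r'0 Hr'] := within_continuous_ball cs tsI r0.
  have [t Tt tr] := inf_adherent r'0 infT.
  have [tI St] := Tt; apply: (Hr (sigma t)) => //; apply: ltW; apply: Hr' => //.
  by rewrite ger0_norm ?subr_ge0 ?tsT// ltrBlDl.
have tsp : 0 < ts.
  rewrite lt_neqAle ts0 andbT; apply/eqP => ts00; apply: Gp.
  by have /SegP[tau tI] := Tts; rewrite -ts00 s0 => ->; exact: HG.
have [tau tauI stau] := (SegP _).1 Tts.
have [s' [Ps' ls']] := polygonal_trunc Ps tsp tsL.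
pose d := z' - sigma ts.
have segd (mu : R) : 0 <= mu <= 1 -> Seg (sigma ts + mu *: d).
  move=> muI; apply/SegP; exists (tau + mu * (1 - tau)); first exact: on_segment.
  by rewrite /d stau; apply/rowP => i; rewrite !mxE; ring.
(* If the first meeting point is [z'] itself, nothing is appended: a constant piece would break
   injectivity. *)
have [d0|d0] := eqVneq d 0.
  exists sigma, s'; rewrite ls'; split=> //.
  - by split=> //; move/eqP : d0; rewrite subr_eq0 => /eqP.
  - by move=> t /andP[t0 tt]; apply: sG; rewrite t0 (le_trans tt).
  - move=> t u /andP[t0 tt] /andP[u0 uu]; apply: inj; first by rewrite t0 (le_trans tt).
    by rewrite u0 (le_trans uu).
pose sg t := if t <= ts then sigma t else sigma ts + (t - ts) *: d.
have sgE t : ts <= t -> sg t = sigma ts + (t - ts) *: d.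
  rewrite /sg le_eqVlt => /orP[/eqP <-|ht]; first by rewrite lexx subrr scale0r addr0.
  by rewrite leNgt ht.
have sgE' t : t <= ts -> sg t = sigma t by rewrite /sg => ->.
have lastE : last 0 (rcons s' (ts + 1)) = ts + 1 by rewrite last_rcons.
exists sg, (rcons s' (ts + 1)); rewrite lastE; split.
- apply: (polygonal_rcons (p := sigma ts - ts *: d) (d := d)).
  + by apply: polygonal_eq Ps' _ => t /andP[_]; rewrite ls' => /sgE'.
  + by rewrite ls' ltrDl.
  + by move=> t /andP[]; rewrite ls' => /sgE -> _; rewrite scalerBl addrA addrAC.
- by rewrite addr_gt0.
- rewrite sgE' ?(ltW tsp)// sgE ?lerDl// addrAC subrr add0r scale1r /d addrC subrK.
  by split.
- move=> t /andP[t0 tt]; case: (leP t ts) => ht.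
    by rewrite sgE'//; apply: sG; rewrite t0 (le_trans ht).
  rewrite sgE ?(ltW ht)//; have /SegP[w wI ->] : Seg (sigma ts + (t - ts) *: d).
    by apply: segd; rewrite subr_ge0 (ltW ht) lerBlDl.
  exact: HG.
(* The appended piece lies in [Seg], which the old path does not meet before [ts]; the point at [ts]
   is not hit again since d != 0. *)
have cross t u : 0 <= t <= ts + 1 -> 0 <= u <= ts + 1 -> t <= ts -> ts < u -> sg t <> sg u.
  move=> /andP[t0 _] /andP[_ u1] ht hu; rewrite sgE'// sgE ?(ltW hu)// => E.
  have muI : 0 <= u - ts <= 1 by rewrite subr_ge0 (ltW hu) lerBlDl.
  have Tt : T t by split; [rewrite t0 (le_trans ht)|rewrite E; exact: segd].
  have tts : t = ts by apply/eqP; rewrite eq_le ht tsT.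
  move: E; rewrite tts -[LHS]addr0 => /addrI/esym/eqP.
  by rewrite scaler_eq0 (negPf d0) orbF subr_eq0 gt_eqF.
move=> t u tI uI E; case: (leP t ts) => ht; case: (leP u ts) => hu.
- move/andP: tI => [t0 _]; move/andP: uI => [u0 _]; apply: inj.
  + by rewrite t0 (le_trans ht).
  + by rewrite u0 (le_trans hu).
  + by rewrite -!sgE'.
- by case: (cross t u tI uI ht hu).
- by case: (cross u t uI tI hu ht).
- move: E; rewrite !sgE ?(ltW ht) ?(ltW hu)// => /addrI/eqP.
  rewrite -subr_eq0 -scalerBl scaler_eq0 (negPf d0) orbF opprB addrA subrK subr_eq0.
  by move=> /eqP.
Qed.

Lemma ball_segment z z' w (r : R) (tau : R) : `|z - w| <= r -> `|z' - w| <= r -> 0 <= tau <= 1 ->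
  `|z + tau *: (z' - z) - w| <= r.
Proof.
move=> h h' /andP[t0 t1].
rewrite (_ : _ - w = (1 - tau) *: (z - w) + tau *: (z' - w)); last by apply/rowP => i; rewrite !mxE; ring.
apply: (le_trans (ler_normD _ _)); rewrite !normrZ (ger0_norm t0) (ger0_norm (_ : 0 <= 1 - tau)) ?subr_ge0//.
apply: (@le_trans _ _ ((1 - tau) * r + tau * r)).
  by rewrite lerD// ler_wpM2l// subr_ge0.
by rewrite -mulrDl subrK mul1r.
Qed.

(** Balls are convex, so by [reachable_segment] reachability spreads over any ball contained in G:
    the reachable points are open and closed in G. *)
Lemma reachable_connected G p q x : open G -> connected G -> ~ G p -> G q -> reachable G p q ->
  G x -> reachable G p x.
Proof.
move=> oG cG Gp Gq rq Gx.
suff E : G `&` [set z | reachable G p z] = G.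
  by have : (G `&` [set z | reachable G p z]) x; [rewrite E|case].
have near_reach z z' w (r : R) : 0 < r -> (forall y, `|y - w| <= r -> G y) -> `|z - w| <= r -> `|z' - w| <= r ->
    reachable G p z -> reachable G p z'.
  move=> r0 Hr h h' rz; apply: reachable_segment rz _ => // tau tI.
  by apply: Hr; exact: ball_segment.
have ball_near (w : 'rV[R]_m) (r : R) : 0 < r -> nbhs w [set v : 'rV[R]_m | `|v - w| < r].
  move=> r0; apply/nbhs_ballP; exists r => // v; rewrite -ball_normE /= distrC; exact.
apply: cG.
- by exists q.
- exists (interior [set z | G z -> reachable G p z]); first exact: open_interior.
  apply/seteqP; split=> z [Gz]; last by move=> /interior_subset /(_ Gz).
  move=> /= rz; split=> //; have [r r0 Hr] := open_cube oG Gz.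
  apply: filterS (ball_near z r r0) => z' /= zz' _.
  by apply: (near_reach z z' z r) => //; [rewrite subrr normr0 ltW|exact: ltW].
- exists (closure (G `&` [set z | reachable G p z])); first exact: closed_closure.
  apply/seteqP; split=> z [Gz]; first by move=> rz; split=> //; exact: subset_closure.
  move=> cl; split=> //=; have [r r0 Hr] := open_cube oG Gz.
  have [z' [[Gz' rz'] /= zz']] := cl _ (ball_near z r r0).
  by apply: (near_reach z' z z r) => //; [exact: ltW|rewrite subrr normr0 ltW].
Qed.

(** On a line through a point of U parallel to an axis, the supremum of the parameters of points in
    U gives a boundary point. *)
Lemma bounded_bdry_neq0 U (i0 : 'I_m) : U !=set0 -> open U -> bounded_set U -> bdry U !=set0.
Proof.
move=> [x Ux] oU [M [_ HM]]; pose d : 'rV[R]_m := delta_mx ord0 i0.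
pose A := [set t : R | U (x + t *: d)].
have bU y : U y -> `|y| <= `|M| + 1.
  by apply: HM; rewrite (le_lt_trans (ler_norm M))// ltrDl.
have supA : has_sup A.
  split; first by exists 0; rewrite /A /= scale0r addr0.
  exists (`|M| + 1 + `|x|) => t /bU h; have := norm_coord (t *: d) i0.
  rewrite !mxE !eqxx mulr1 => h'; apply: (le_trans (ler_norm t)); apply: (le_trans h').
  by rewrite -[t *: d](addKr x) addrC (le_trans (ler_normD _ _))// normrN lerD2r.
have dn : `|d| <= 1.
  by apply: norm_le_coord => // l; rewrite mxE eqxx /=; case: (l == i0); rewrite ?normr1 ?normr0.
exists (x + sup A *: d); split.
- move=> B /nbhs_ballP[r /= r0 Hr]; have [t At tr] := sup_adherent r0 supA.
  exists (x + t *: d); split=> //; apply: Hr; rewrite -ball_normE /=.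
  rewrite opprD addrACA subrr add0r -scalerBl normrZ.
  have tsup : t <= sup A by exact: sup_upper_bound.
  apply: (@le_lt_trans _ _ `|sup A - t|); first by rewrite ler_piMr.
  by rewrite ger0_norm ?subr_ge0// ltrBlDr -ltrBlDl.
- move=> /interior_subset Us; have [r r0 Hr] := open_cube oU Us.
  have : A (sup A + r).
    apply: Hr; rewrite opprD addrACA subrr add0r -scalerBl [sup A + r]addrC addrK normrZ (gtr0_norm r0).
    by apply: ler_piMr => //; exact: ltW.
  by move=> /(sup_upper_bound supA); rewrite leNgt ltrDl r0.
Qed.

Lemma needle_exists U D x : (0 < m)%N -> U !=set0 -> open U -> bounded_set U -> Lipschitz_boundary U ->
  closure D `<=` U -> connected (U `\` closure D) -> (U `\` closure D) x ->
  exists2 sigma, needle U x sigma & (sigma @` `]0, 1]) `&` closure D = set0.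
Proof.
move=> m0 U0 oU bU LU DU cG Gx; set G := U `\` closure D in cG Gx.
have [p bp] := bounded_bdry_neq0 (Ordinal m0) U0 oU bU.
have Up : ~ U p by move=> Up; case: bp => _; apply; rewrite (interior_id U).1.
have oC : open (~` closure D) by apply: closed_openC; exact: closed_closure.
have oG : open G by exact: openI.
have Gp : ~ G p by move=> [].
(* The axis of the inner cone at [p] gives the first segment of the needle; it is shortened so as to
   miss closure D. *)
have [e [k [s0 [k0 s00 He]]]] := lipschitz_cone LU bp.
have Ue (t : R) : 0 < t -> t <= s0 -> U (p + t *: e).
  by move=> h1 h2; have ee : `|e - e| <= k by [rewrite subrr normr0 ltW]; case: (He t e h1 h2 ee).
have [r r0 Hr] : exists2 r : R, 0 < r & forall y, `|y - p| <= r -> ~ closure D y.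
  by apply: open_cube oC _ => /DU.
pose L := Num.min s0 (r / (`|e| + 1)); have e1 : 0 < `|e| + 1 by rewrite ltr_wpDl.
have L0 : 0 < L by rewrite lt_min s00 divr_gt0.
have e0 : e != 0.
  by apply/eqP => e0; apply: Up; have := Ue s0 s00 (lexx _); rewrite e0 scaler0 addr0.
have GL t : 0 < t <= L -> G (p + t *: e).
  move=> /andP[t0 tL]; split; first by apply: Ue => //; rewrite (le_trans tL)// ge_min lexx.
  apply: Hr; rewrite addrC addKr normrZ gtr0_norm//.
  apply: (@le_trans _ _ (r / (`|e| + 1) * (`|e| + 1))); last by rewrite divfK// gt_eqF.
  by rewrite ler_pM ?(ltW t0)// ?lerDl// (le_trans tL)// ge_min lexx orbT.
have rq : reachable G p (p + L *: e).
  exists (fun t => p + t *: e), [:: L]; split=> //=.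
  - by split=> //; exists p, e.
  - by rewrite scale0r addr0.
  - move=> t u _ _ /addrI/eqP; rewrite -subr_eq0 -scalerBl scaler_eq0 (negPf e0) orbF subr_eq0.
    by move=> /eqP.
have GL1 : G (p + L *: e) by apply: GL; rewrite L0 lexx.
have [sigma [s [Ps l0 [sg0 sg1] sG inj]]] := reachable_connected oG cG Gp GL1 rq Gx.
set l := last 0 s in l0 sg1 sG inj.
pose sg t := sigma (t * l).
have Ps' : polygonal sg 0 [seq t / l | t <- s].
  by have := polygonal_scale l0 Ps; rewrite mul0r.
have l1 : last 0 [seq t / l | t <- s] = 1.
  by rewrite -[X in last X _](mul0r l^-1) (last_map (fun t => t / l)) divff ?gt_eqF.
have sgG t : 0 < t <= 1 -> G (sg t).
  by move=> /andP[t0 t1]; apply: sG; rewrite mulr_gt0// ler_piMl// ltW.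
exists sg; last first.
  apply/seteqP; split=> // y [[t /= tI <-] cD]; move: tI; rewrite in_itv /= => /sgG[_]; exact.
split.
- split; first by have := polygonal_continuous Ps'; rewrite l1.
  exists [seq t / l | t <- s]; split=> //; first exact: polygonal_path Ps'.
  by move=> i is_; exact: polygonal_nth Ps' is_.
- move=> t; rewrite in_itv /= => /andP[]; rewrite le_eqVlt => /orP[/eqP <- _|t0 t1].
    by rewrite /sg mul0r sg0; case: bp.
  by apply: subset_closure; case: (sgG t); rewrite ?t0.
- move=> t u; rewrite !in_itv /= => /andP[t0 t1] /andP[u0 u1] /inj E.
  apply: (mulIf (_ : l != 0)); first by rewrite gt_eqF.
  by apply: E; rewrite mulr_ge0 ?(ltW l0)//= ler_piMl// ltW.
- by rewrite /sg mul0r mul1r sg0 sg1.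
- by move=> t; rewrite in_itv /= => /andP[t0 t1]; case: (sgG t); rewrite ?t0 ?ltW.
Qed.

End needle_existence.

(** * Essentially bounded conductivities *)

Section essential_bounds.
Context {R : realType} {m : nat}.
Implicit Types (U D : set 'rV[R]_m) (g h v : 'rV[R]_m -> R).

Lemma wip_eq_weight U g g' F G : measurable U -> measurable_fun U g -> measurable_fun U g' ->
  L2v U F -> L2v U G -> {ae leb, forall x, U x -> g x = g' x} -> wip U g F G = wip U g' F G.
Proof.
move=> mU mg mg' LF LG E; apply: (Rintegral_ae_eq mU); [exact: wip_measurable..|].
by apply: filterS E => x E Ux; rewrite E.
Qed.

(** Both weights have the same weak solutions, so the two choices of a Dirichlet solution pick the
    same function. *)
Lemma Lambda_ae U g g' v (c : R) (i0 : 'I_m) : open U -> bounded_set U -> weight U g -> 0 < c ->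
  {ae leb, forall x, U x -> c <= g x} -> measurable_fun U g' ->
  {ae leb, forall x, U x -> g x = g' x} -> H1 U v ->
  Lambda U g' (trace U v) (trace U v) = Lambda U g (trace U v) (trace U v).
Proof.
move=> oU bU wg c0 cg mg' E Hv; have mU := open_measurable_rV oU; have mg := wg.1.
have W u : weak_solution U g' u <-> weak_solution U g u.
  split=> -[Hu O]; split=> // phi tp; rewrite -[RHS](O phi tp).
    exact: (wip_eq_weight mU mg mg' (nabla_L2v mU Hu) (test_grad_L2v mU tp) E).
  by symmetry; exact: (wip_eq_weight mU mg mg' (nabla_L2v mU Hu) (test_grad_L2v mU tp) E).
have S : Dirichlet_solution U g' (trace U v) = Dirichlet_solution U g (trace U v).
  rewrite /Dirichlet_solution; congr (xget _ _); apply/seteqP.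
  split=> u [h1 h2]; first exact: (conj ((W u).1 h1) h2).
  exact: (conj ((W u).2 h1) h2).
have [su _] := Dirichlet_solutionP i0 oU bU wg c0 cg Hv.
rewrite /Lambda S; set w := xget _ _; set u := Dirichlet_solution _ _ _ in su *.
have [Hw _] : H1 U w /\ trace U w = trace U v.
  by apply: (@xgetPex _ (fun=> 0) [set w | H1 U w /\ trace U w = trace U v]); exists v.
symmetry; exact: (wip_eq_weight mU mg mg' (nabla_L2v mU su.1) (nabla_L2v mU Hw) E).
Qed.

(** Selects the case in which the L^oo norm is an essential supremum. *)
Lemma leb_setT_gt0 : (0 < @lebesgue_rV R m setT)%E.
Proof.
apply: (@lt_le_trans _ _ (leb [set y : 'rV[R]_m | `|y - 0| <= 1])).
  by rewrite leb_ball// lte_fin exprn_gt0// pmulrn_lgt0.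
apply: le_measure; rewrite ?inE//; apply: compact_measurable_rV; exact: compact_norm_ball.
Qed.

Lemma memLoo_bound D h : measurable D -> memL +oo D h ->
  measurable_fun D h /\ exists2 M : R, 0 <= M & {ae leb, forall x, D x -> `|h x| <= M}.
Proof.
move=> mD Hh; move: (Hh); rewrite /memL inE => /andP[]; rewrite !inE /= => mh fh.
split; first exact/(measurable_restrictT h mD).
move: fh; rewrite /finite_norm unlock /= leb_setT_gt0.
set e := ess_sup _ _ => e_oo.
pose M : R := Num.max 0 (fine e); exists M; first by rewrite le_max lexx.
have eM : (e <= M%:E)%E.
  case: (e) e_oo @M => [r _|//|_] M; first by rewrite lee_fin le_max lexx orbT.
  by rewrite leNye.
have /ess_supP := eM; apply: filterS => x /=.
by rewrite lee_fin patchE => + Dx; rewrite mem_set.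
Qed.

Lemma ess_inf_gt0 D g : (0 < ess_inf_on D g)%E ->
  exists2 c : R, 0 < c & {ae leb, forall x, D x -> c <= g x}.
Proof.
rewrite /ess_inf_on; set e := ess_inf _ _ => e0.
have [c c0 ce] : exists2 c : R, 0 < c & (c%:E <= e)%E.
  case: (e) e0 => [r r0|_|//]; first by exists r.
  (* The essential infimum may be +oo, for instance when D is empty; any positive constant then
     serves. *)
  by exists 1; rewrite ?leey.
exists c => //; have /ess_infP := ce; apply: filterS => x /=.
by rewrite /patch => + Dx; rewrite mem_set//= lee_fin.
Qed.

(* The conductivity may be unbounded on a null set; clipping it there changes no Lambda. *)
Lemma clipped_conductivity U D h (i0 : 'I_m) : open U -> open D -> D `<=` U -> memL +oo D h ->
  (0 < ess_inf_on D (fun y => 1 + h y)%R)%E ->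
  exists g (c : R), [/\ weight U g, 0 < c, {ae leb, forall x, U x -> c <= g x},
    forall x, U x -> ~ D x -> g x = 1 &
    measurable_fun U (conductivity D h) /\
    {ae leb, forall x, U x -> g x = conductivity D h x}].
Proof.
move=> oU oD DU hLoo hinf; have mU := open_measurable_rV oU; have mD := open_measurable_rV oD.
have [mh [M M0 hM]] := memLoo_bound mD hLoo.
have [c c0 ch] := ess_inf_gt0 hinf.
have mhD : measurable_fun U (h \_ D) by apply: measurable_funTS; exact/(measurable_restrictT h mD).
have hD x : conductivity D h x = 1 + (h \_ D) x.
  by rewrite /conductivity /patch; case: ifP; rewrite // addr0.
pose g x := 1 + Num.max (- M) (Num.min M ((h \_ D) x)).
have mg : measurable_fun U g.
  apply: measurable_funD; first exact: measurable_cst.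
  apply: measurable_maxr; first exact: measurable_cst.
  by apply: measurable_minr => //; exact: measurable_cst.
have gh x : `|(h \_ D) x| <= M -> g x = conductivity D h x.
  by rewrite ler_norml => /andP[h1 h2]; rewrite hD /g (min_idPr h2) (max_idPr h1).
have ge : {ae leb, forall x, U x -> g x = conductivity D h x}.
  apply: filterS hM => x hx _; apply: gh; rewrite patchE; case: ifPn => [/set_mem/hx//|_].
  by rewrite normr0.
exists g, (Num.min c 1); split.
- split=> //; exists (1 + M) => x _; rewrite /g (le_trans (ler_normD _ _))// normr1 lerD2l.
  rewrite ler_norml ge_max le_max lexx /= ge_min lexx /= andbT.
  by rewrite (le_trans _ M0)// oppr_le0.
- by rewrite lt_min c0 ltr01.
- apply: filterS2 ge ch => x gx cx Ux; rewrite gx// hD patchE; case: ifPn => [/set_mem Dx|_].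
    by rewrite (le_trans _ (cx Dx))// ge_min lexx.
  by rewrite addr0 ge_min lexx orbT.
- move=> x _ Dx; rewrite gh ?hD ?patchE ?memNset ?addr0 ?normr0//.
- split=> //; rewrite (_ : conductivity D h = fun x => 1 + (h \_ D) x); last exact/funext.
  by apply: measurable_funD => //; exact: measurable_cst.
Qed.

End essential_bounds.

Lemma cvgn_bounded {R : realType} (u : nat -> R) : cvgn u -> exists M : R, forall n, `|u n| <= M.
Proof.
move=> /cvg_seq_bounded[M [_ HM]]; exists (`|M| + 1) => n.
by apply: HM => //; rewrite (le_lt_trans (ler_norm M))// ltrDl.
Qed.

Lemma ge_cvg_pinfty {R : realType} (a u : nat -> R) (k : R) : 0 < k ->
  (forall n, k * a n <= u n) -> a n @[n --> \oo] --> +oo -> u n @[n --> \oo] --> +oo.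
Proof.
move=> k0 H /cvgryPge Ha; apply/cvgryPge => A.
have := Ha (A / k); apply: filterS => n; rewrite ler_pdivrMr// mulrC => /le_trans; apply.
exact: H.
Qed.

Theorem theorem4p1 (R : realType) (m : nat) (m23 : m = 2%N \/ m = 3%N)
    (Omega D : set 'rV[R]_m)
    (Omega0 : Omega !=set0) (openOmega : open Omega)
    (connectedOmega : connected Omega) (boundedOmega : bounded_set Omega)
    (LipOmega : Lipschitz_boundary Omega)
    (openD : open D) (LipD : Lipschitz_boundary D)
    (DOmega : closure D `<=` Omega)
    (connectedOmegaD : connected (Omega `\` closure D))
    (h : 'rV[R]_m -> R) (hLoo : memL +oo D h)
    (h_essinf : (0 < ess_inf_on D (fun y => 1 + h y)%R)%E)
    (h_jump : exists2 C : R, 0 < C &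
       {ae leb, forall y, D y -> C <= h y} \/
       {ae leb, forall y, D y -> C <= - h y}) :
  let gamma := conductivity D h in
  (forall x, Omega x ->
     ((Omega `\` closure D) x <->
      exists sigma v, [/\ needle Omega x sigma,
        needle_sequence Omega x sigma v
        & exists M : R, forall n, `|indicator Omega gamma v n| <= M])) /\
  (forall x sigma, Omega x -> needle Omega x sigma ->
     [/\ (Omega `\` closure D) x ->
         (sigma @` `]0, 1]) `&` closure D = set0 ->
         forall v, needle_sequence Omega x sigma v ->
           cvgn (indicator Omega gamma v),
         (Omega `\` closure D) x ->
         (sigma @` `]0, 1]) `&` D !=set0 ->
         forall v, needle_sequence Omega x sigma v ->
           `|indicator Omega gamma v n| @[n --> \oo] --> +oo
       & closure D x ->
         forall v, needle_sequence Omega x sigma v ->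
           `|indicator Omega gamma v n| @[n --> \oo] --> +oo]).
Proof.
move=> gamma; have m0 : (0 < m)%N by case: m23 => ->.
pose i0 : 'I_m := Ordinal m0.
have DsO : D `<=` Omega by move=> y Dy; apply: DOmega; exact: subset_closure.
have mO := open_measurable_rV openOmega; have mD := open_measurable_rV openD.
(* [g] agrees with gamma almost everywhere and is bounded everywhere; the estimates are made for
   [g], and [indE] carries them over. *)
have [g [c [wg c0 cg g1 [mgam ggam]]]] := clipped_conductivity i0 openOmega openD DsO hLoo h_essinf.
have indE v n : weak_solution Omega (fun=> 1) (v n) -> indicator Omega gamma v n =
    Lambda Omega g (trace Omega (v n)) (trace Omega (v n)) -
    Lambda Omega (fun=> 1) (trace Omega (v n)) (trace Omega (v n)).
  move=> sv; have L := Lambda_ae i0 openOmega boundedOmega wg c0 cg mgam ggam (proj1 sv).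
  exact: (congr1 (fun t => t - Lambda Omega (fun=> 1) (trace Omega (v n)) (trace Omega (v n))) L).
have [C C0 hC] := h_jump.
have gD : {ae leb, forall y, D y -> g y - 1 = h y}.
  apply: filterS ggam => y gy Dy; rewrite gy; last exact: DsO.
  by rewrite /conductivity /patch mem_set// addrAC subrr add0r.
have jump : {ae leb, forall y, D y -> C <= g y - 1} \/ {ae leb, forall y, D y -> C <= - (g y - 1)}.
  by case: hC => hC; [left|right]; apply: filterS2 gD hC => y gy hy Dy; rewrite gy// hy.
have blow_up v : (forall n, weak_solution Omega (fun=> 1) (v n)) ->
    wip D (fun=> 1) (nabla Omega (v n)) (nabla Omega (v n)) @[n --> \oo] --> +oo ->
    `|indicator Omega gamma v n| @[n --> \oo] --> +oo.
  move=> sv; apply: (@ge_cvg_pinfty _ _ _ (Num.min C 1 / 2)).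
    by rewrite divr_gt0// lt_min C0 ltr01.
  move=> n; rewrite (indE v n (sv n)).
  exact: (energy_gap i0 openOmega boundedOmega openD DsO wg c0 cg g1 C0 jump (sv n)).
have part_i x sigma v : needle Omega x sigma -> (Omega `\` closure D) x ->
    (sigma @` `]0, 1]) `&` closure D = set0 -> needle_sequence Omega x sigma v ->
    cvgn (indicator Omega gamma v).
  move=> nd [Ox Dx] sD nv; have sv := nv.1.
  have [_ _ _ [bp s1] _] := nd.
  have Tx : (sigma @` `[0, 1]) x by exists 1 => //=; rewrite in_itv /= lexx ler01.
  have [_ Hv] := needle_sequence_sources m23 openOmega nv Tx.
  have cD : compact (closure D).
    apply: compact_closure_bounded; have [M [Mr HM]] := boundedOmega.
    by exists M; split=> // r rM y Dy; exact: (HM r rM y (DsO y Dy)).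
  have mcD := compact_measurable_rV cD.
  have DT : closure D `<=` Omega `\` (sigma @` `[0, 1]).
    move=> y Dy; split; first exact: DOmega.
    move=> [t /= tI ty]; have [t0|t0] := eqVneq t 0.
      case: bp => _; apply; rewrite (interior_id Omega).1// -t0 ty; exact: DOmega.
    suff : set0 y by [].
    rewrite -sD; split=> //; exists t => //=; move: tI; rewrite !in_itv /= => /andP[h1 ->].
    by rewrite lt_neqAle eq_sym t0 h1.
  have LG := dG0_L2v cD Dx; have LGD := L2v_sub mcD mD (@subset_closure _ D) LG.
  have sO : closure D `<=` Omega by exact: DOmega.
  have Ln n := L2v_sub mO mcD sO (nabla_L2v mO (sv n).1).
  have E : indicator Omega gamma v = fun n => Lambda Omega g (trace Omega (v n)) (trace Omega (v n)) -
      Lambda Omega (fun=> 1) (trace Omega (v n)) (trace Omega (v n)).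
    by apply/funext => n; exact: indE (sv n).
  rewrite E; apply: (energy_gap_cvg i0 openOmega boundedOmega openD DsO wg c0 cg g1 sv LGD).
  have H := Hv _ cD DT; apply: (squeeze_cvgr _ (cvg_cst 0) H); apply: nearW => n.
  rewrite wip1_ge0 /=; apply: (le_Rintegral_sub mcD mD (@subset_closure _ D)).
    have L := L2vB mcD (Ln n) LG; exact: (wip_integrable mcD (weight1 _) L L).
  by move=> y _; rewrite mul1r dot_ge0.
have part_iii x sigma v : needle Omega x sigma -> closure D x -> needle_sequence Omega x sigma v ->
    `|indicator Omega gamma v n| @[n --> \oo] --> +oo.
  move=> nd Dx nv; apply: (blow_up v nv.1).
  exact: (blow_up_closure m23 openOmega openD DsO LipD Dx nd nv).
split=> [x Ox|x sigma Ox nd].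
- split=> [Gx|[sigma [v [nd nv [M HM]]]]].
    have [sigma nd sD] := needle_exists m0 Omega0 openOmega boundedOmega LipOmega DOmega connectedOmegaD Gx.
    have [v nv] := needle_sequence_exists m23 openOmega boundedOmega LipOmega nd.
    exists sigma, v; split=> //; apply: cvgn_bounded; exact: (part_i x sigma v nd Gx sD nv).
  split=> // Dx; have /cvgryPge/(_ (M + 1))[N _ HN] := part_iii x sigma v nd Dx nv.
  have := le_trans (HN N (leqnn N)) (HM N).
  by rewrite -subr_ge0 opprD addrA subrr add0r oppr_ge0 ler10.
- split=> [Gx sD v nv|Gx sD v nv|Dx v nv].
  + exact: (part_i x sigma v nd Gx sD nv).
  + apply: (blow_up v nv.1).
    exact: (blow_up_through m23 openOmega boundedOmega openD DsO Ox nd nv sD).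
  + exact: (part_iii x sigma v nd Dx nv).
Qed.
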